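(* Let $\mathrm{rank}(\sigma) = n$ and suppose that $\ker A = V_1 \oplus V_2$ for orthogonal subspaces $V_1,V_2$ of $\mathbb{R}^n$ satisfying the following properties. (i) For any $x \in V_1 \cup V_2$, $B(x,x) = 0$. (ii) There is $C > 0$ so that $$\max_{j=1,2} \sup_{x \in V_j \cap \mathbb{S}^{n-1}}(\|P_{x,j}\| + \|P_{x,j}^{-1}\|) \le C,$$ where $P_{x,j}J^\perp_j P^{-1}_{x,j}$ denotes the Jordan canonical form decomposition of $\Pi_{V_j^\perp} L_x \Pi_{V_j^\perp}$. (iii) There is $\lambda_{\min} > 0$ such that for any $j \in \{1,2\}$ and $x \in V_j \cap \mathbb{S}^{n-1}$ there is an eigenvalue $\lambda$ of $\Pi_{V_j^\perp} L_x \Pi_{V_j^\perp}$ with $\mathrm{Re}(\lambda) \ge \lambda_{\min}$. (iv) There exists $c > 0$ so that for any $v_1 \in V_1$ and $v_2 \in V_2$ there holds $$\Pi_{\ker A} B(v_1,v_2) + \Pi_{\ker A} B(v_2,v_1) = 0$$ and $$|\Pi_{(\ker A)^\perp} B(v_1,v_2)+\Pi_{(\ker A)^\perp} B(v_2,v_1)| \ge c |v_1| |v_2|.$$ Then the SDE $dx_t = B(x_t,x_t)dt - Ax_t dt + \sigma dW_t$ has at least one stationary measure $\mu$, and $\langle x\rangle^p \in L^1(d\mu)$ for every $p < 2/3$.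
   Context: Consider the SDE in $\mathbb{R}^n$: $dx_t = B(x_t,x_t)dt - A x_t dt + \sigma dW_t$, $x_t|_{t=0}\in\mathbb{R}^n$, where $W_t$ is an $n$-dimensional standard Brownian motion, $A \in \mathbb{R}^{n\times n}$ is positive semi-definite, $\sigma \in \mathbb{R}^{n\times n}$, and $B:\mathbb{R}^n\times\mathbb{R}^n\to\mathbb{R}^n$ is bilinear with $x\cdot B(x,x)=0$ for all $x\in\mathbb{R}^n$. The SDE is globally well-posed. Let $\mathcal{P}_t f(x)=\mathbf{E}[f(x_t)\mid x_0=x]$ be its Markov semigroup and $\mathcal{P}_t^*$ the dual action on Borel probability measures. A stationary measure is a Borel probability measure $\mu$ with $\mathcal{P}_t^*\mu=\mu$ for all $t\ge 0$. For a subspace $S$, $S^\perp$ is its orthogonal complement in $\mathbb{R}^n$ and $\Pi_S$ the orthogonal projection onto $S$. $L_x v = B(x,v)+B(v,x)$. Jordan canonical forms are taken over $\mathbb{C}$. $\langle x\rangle=(1+|x|^2)^{1/2}$. *)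

(* Defs.v *)
From HB Require Import structures.
From mathcomp Require Import all_boot all_order all_algebra.
From mathcomp Require Import complex ring.
From mathcomp Require Import all_classical all_reals all_analysis.

Set Implicit Arguments.
Unset Strict Implicit.
Unset Printing Implicit Defensive.

Import Order.TTheory GRing.Theory Num.Theory.
Import numFieldNormedType.Exports.

Local Open Scope classical_set_scope.
Local Open Scope ring_scope.

(* The library norm on matrices is the sup norm, so the Euclidean structure is
   introduced here. The form instances give access to [orthov]. *)
Definition dotv (R : realType) (n : nat) (x y : 'cV[R]_n) : R :=
  \sum_(i < n) x i 0 * y i 0.

Fact dotv_is_bilinear (R : realType) (n : nat) :
  bilinear_for (GRing.Scale.Law.clone _ _ ( *%R ) _)
               (GRing.Scale.Law.clone _ _ (idfun \; *%R ) _) (@dotv R n).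
Proof.
split=> u a x y; rewrite /dotv /= mulr_sumr -big_split /=;
  by apply: eq_bigr => i _; rewrite !mxE; ring.
Qed.

HB.instance Definition _ (R : realType) (n : nat) :=
  bilinear_isBilinear.Build R _ _ _
    (GRing.Scale.Law.clone _ _ ( *%R ) _)
    (GRing.Scale.Law.clone _ _ (idfun \; *%R ) _)
    (@dotv R n) (@dotv_is_bilinear R n).

Fact dotv_sym (R : realType) (n : nat) (x y : 'cV[R]_n) :
  dotv x y = (-1) ^+ false * idfun (dotv y x).
Proof.
by rewrite expr0 mul1r /dotv /=; apply: eq_bigr => i _; rewrite mulrC.
Qed.

HB.instance Definition _ (R : realType) (n : nat) :=
  isHermitianSesquilinear.Build R _ false idfun (@dotv R n) (@dotv_sym R n).

Fact dotv_gt0 (R : realType) (n : nat) (x : 'cV[R]_n) : x != 0 -> 0 < dotv x x.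
Proof.
move=> x0; rewrite lt0r /dotv sumr_ge0 ?andbT; last first.
  by move=> i _; rewrite -expr2 sqr_ge0.
apply: contra x0; rewrite psumr_eq0 => [/allP h|i _]; last first.
  by rewrite -expr2 sqr_ge0.
apply/eqP/colP => i; rewrite mxE.
by have := h i (mem_index_enum i); rewrite /= mulf_eq0 orbb => /eqP.
Qed.

HB.instance Definition _ (R : realType) (n : nat) :=
  isDotProduct.Build R _ (@dotv R n) (@dotv_gt0 R n).

Definition enorm (R : realType) (n : nat) (x : 'cV[R]_n) : R :=
  Num.sqrt (dotv x x).

Definition japanese (R : realType) (n : nat) (x : 'cV[R]_n) : R :=
  Num.sqrt (1 + enorm x ^+ 2).

Definition unit_sphere (R : realType) (n : nat) : set 'cV[R]_n :=
  [set x | enorm x = 1].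

Definition orth (R : realType) (n : nat) (S : {vspace 'cV[R]_n}) :
  {vspace 'cV[R]_n} := orthov (@dotv R n) S.

Definition orth_proj (R : realType) (n : nat) (S : {vspace 'cV[R]_n}) :
  'cV[R]_n -> 'cV[R]_n := daddv_pi S (orth S).

(* Unlike [lin1_mx], this acts on column vectors: [mx_of f *m x = f x] for
   linear [f]. *)
Definition mx_of (R : realType) (n : nat) (f : 'cV[R]_n -> 'cV[R]_n) :
  'M[R]_n := \matrix_(i, j) f (delta_mx j 0) i 0.

Definition kerv (R : realType) (n : nat) (A : 'M[R]_n) : {vspace 'cV[R]_n} :=
  lker (linfun (mulmx A : 'cV[R]_n -> 'cV[R]_n)).

Definition psd (R : realType) (n : nat) (A : 'M[R]_n) : Prop :=
  A^T = A /\ forall x : 'cV[R]_n, 0 <= dotv x (A *m x).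

Definition cenorm (R : realType) (n : nat) (v : 'cV[R[i]]_n) : R :=
  Num.sqrt (\sum_(k < n) Normc.normc (v k 0) ^+ 2).

Definition opnorm (R : realType) (n : nat) (M : 'M[R[i]]_n) : R :=
  sup [set cenorm (M *m v) | v in [set v : 'cV[R[i]]_n | cenorm v = 1]].

Definition jordan_block (F : fieldType) (m : nat) (a : F) : 'M[F]_m :=
  \matrix_(i, j) (a *+ (i == j) + (i.+1 == j :> nat)%:R).

Definition is_jordan (F : fieldType) (n : nat) (J : 'M[F]_n) : Prop :=
  exists (k : nat) (m : 'I_k -> nat) (a : 'I_k -> F)
    (e : (\sum_(i < k) m i)%N = n),
    (forall i, (0 < m i)%N) /\
    J = castmx (e, e) (\mxdiag_(i < k) jordan_block (m i) (a i)).

Definition jordan_decomposition (F : fieldType) (n : nat) (M P J : 'M[F]_n) :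
  Prop := [/\ P \in unitmx, is_jordan J & M = P *m J *m invmx P].

Section Drift.
Variables (R : realType) (n : nat).
Variable B : {bilinear 'cV[R]_n -> 'cV[R]_n -> 'cV[R]_n}.

Definition linearization (x v : 'cV[R]_n) : 'cV[R]_n := B x v + B v x.

Definition transverse_mx (V : {vspace 'cV[R]_n}) (x : 'cV[R]_n) : 'M[R[i]]_n :=
  map_mx (real_complex R)
    (mx_of (fun v => orth_proj (orth V)
                       (linearization x (orth_proj (orth V) v)))).

End Drift.

Section SDE.
Variables (R : realType) (n : nat).

Definition borelV := g_sigma_algebraType (@open 'cV[R]_n).

Section Probability.
Context (d : measure_display) (T : measurableType d) (P : probability T R).

Definition mutually_independent (I : finType) (X : I -> T -> R) : Prop :=
  forall E : I -> set R, (forall i, measurable (E i)) ->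
    P (\bigcap_i (X i @^-1` E i)) = (\prod_i P (X i @^-1` E i))%E.

Record brownian_motion (W : R -> T -> 'cV[R]_n) : Prop := BrownianMotion {
  bm_measurable : forall t, 0 <= t ->
    measurable_fun setT (W t : T -> borelV) ;
  bm_start : {ae P, forall w, W 0 w = 0} ;
  (* the coordinates of the increments are jointly independent *)
  bm_independent : forall t : nat -> R, 0 <= t 0%N -> nondecreasing_seq t ->
    forall k : nat, mutually_independent
      (fun (ij : 'I_k * 'I_n) w => (W (t ij.1.+1) w - W (t ij.1) w) ij.2 0) ;
  (* the second argument of [normal_prob] is the standard deviation *)
  bm_normal : forall s t, 0 <= s -> s < t ->
    forall (i : 'I_n) (E : set R), measurable E ->
      P [set w | E ((W t w - W s w) i 0)] = normal_prob 0 (Num.sqrt (t - s)) E ;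
  bm_continuous :
    {ae P, forall w, {within `[0, +oo[, continuous (fun t => W t w)}}
}.

Variables (B : {bilinear 'cV[R]_n -> 'cV[R]_n -> 'cV[R]_n}) (A sigma : 'M[R]_n).

Definition drift (x : 'cV[R]_n) : 'cV[R]_n := B x x - A *m x.

(* Since the noise is additive, the stochastic integral of [sigma] is
   [sigma *m W t] and the SDE is a pathwise integral equation. *)
Definition sde_solution (W : R -> T -> 'cV[R]_n) (x0 : 'cV[R]_n)
    (X : R -> T -> 'cV[R]_n) : Prop :=
  (forall t, 0 <= t -> measurable_fun setT (X t : T -> borelV)) /\
  {ae P, forall w, {within `[0, +oo[, continuous (fun t => X t w)} /\
    forall t, 0 <= t ->
      X t w = x0
        + (\col_i \int[lebesgue_measure]_(s in `[0, t]) drift (X s w) i 0)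
        + sigma *m W t w}.

(* [X x] is the solution started at [x]. *)
Variable X : 'cV[R]_n -> R -> T -> 'cV[R]_n.

Definition semigroup (t : R) (f : borelV -> R) (x : borelV) : \bar R :=
  'E_P[fun w => f (X x t w)].

Definition dual_semigroup (t : R) (mu : probability borelV R)
    (E : set borelV) : \bar R :=
  (\int[mu]_x semigroup t \1_E x)%E.

Definition stationary (mu : probability borelV R) : Prop :=
  forall t, 0 <= t -> forall E : set borelV, measurable E ->
    dual_semigroup t mu E = mu E.

End Probability.
End SDE.

(* Main.v *)
(* Let [Pw] be the projection onto the complement of [ker A].  By the energy
   balance, time averages of [|Pw x| ^ 2] stay bounded.  At distance [R = 4 ^ k]
   from the origin a path cannot keep [Pw x] small for long: by (iv) the
   interaction of the components in [V1] and [V2] feeds [Pw x] unless one of them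
   is small, and near [V_j] the linearization is unstable at a rate of order [R] by
   (iii), so that among two paths driven by noises of opposite signs at least one
   leaves the neighbourhood of [ker A] within a time of order [k / R], carried by a
   deviation that grows from size [R ^ (- 1 / 2)] to size [R ^ (1 / 2)].  After
   that [|Pw x| ^ 2] is of order [R] during a time of order [1 / R].  Hence a
   bounded amount of dissipation is produced in every time [k / R] spent at
   distance [R], and the fraction of time spent there is [O (k / R)].  Limits of the
   time averages started at the origin are therefore tight, with moments of every
   order below [1]; they are stationary by the Markov and Feller properties. *)

From HB Require Import structures.
Require Import Defs.
From mathcomp Require Import all_boot all_order all_algebra.
From mathcomp Require Import complex spectral.
From mathcomp Require Import all_classical all_reals all_analysis.
From mathcomp Require Import measurable_realfun zify ring lra.

Import Order.TTheory GRing.Theory Num.Theory.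
Import numFieldNormedType.Exports.

Local Open Scope classical_set_scope.
Local Open Scope ring_scope.

Set Implicit Arguments.
Unset Strict Implicit.
Unset Printing Implicit Defensive.

(** Why pairs of paths: since [B] is bilinear, the difference of two solutions with the same noise
    obeys an exactly linear equation, whose coefficient is the linearization at their midpoint; no
    nonlinear remainder has to be controlled. What remains is the motion of the midpoint: during a
    quiet period of length K k / 4 ^ k it moves by order k 2 ^ k, so the coefficient, of size 4 ^ k,
    varies by a relative amount k 2 ^ - k. The growth estimate tolerates this only if its constants
    are uniform over directions and its loss in the exponent is small: over the whole period the
    loss must cost less than 2 ^ k, here (3 / 2) ^ k. The solutions are given one starting point at
    a time, each up to its own null set. The Markov property is therefore extracted from the
    independence of the increments, through Euler schemes whose noise takes finitely many values,
    and continuity in the starting point is proved along sequences. Ito's formula is replaced by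
    one-step inequalities, and time integrals by sums over grids of mesh 4 ^ - m. *)

Lemma cvg_bigsum (R : realType) (T : Type) (F : set_system T) {FF : Filter F}
    (I : Type) (r : seq I) (f : I -> T -> R) (l : I -> R) :
  (forall i, f i t @[t --> F] --> l i) ->
  \sum_(i <- r) f i t @[t --> F] --> \sum_(i <- r) l i.
Proof.
move=> h; elim: r => [|i r ih].
  rewrite big_nil (_ : (fun _ => _) = cst 0); first exact: cvg_cst.
  by apply/funext => t; rewrite big_nil.
rewrite big_cons (_ : (fun _ => _) = (fun t => f i t + \sum_(j <- r) f j t)).
  exact: cvgD.
by apply/funext => t; rewrite big_cons.
Qed.

(** * Euclidean geometry *)

Section Euclid.
Context {R : realType} {n : nat}.
Implicit Types (x y z : 'cV[R]_n) (M : 'M[R]_n).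

Lemma dotvC x y : dotv x y = dotv y x.
Proof. by rewrite /dotv; apply: eq_bigr => i _; rewrite mulrC. Qed.

Lemma dotvDl x y z : dotv (x + y) z = dotv x z + dotv y z.
Proof. by rewrite /dotv -big_split; apply: eq_bigr => i _; rewrite !mxE mulrDl. Qed.

Lemma dotvZl a x y : dotv (a *: x) y = a * dotv x y.
Proof. by rewrite /dotv mulr_sumr; apply: eq_bigr => i _; rewrite !mxE mulrA. Qed.

Lemma dotvDr x y z : dotv x (y + z) = dotv x y + dotv x z.
Proof. by rewrite dotvC dotvDl !(dotvC x). Qed.

Lemma dotvZr a x y : dotv x (a *: y) = a * dotv x y.
Proof. by rewrite dotvC dotvZl dotvC. Qed.

Lemma dotvNl x y : dotv (- x) y = - dotv x y.
Proof. by rewrite -scaleN1r dotvZl mulN1r. Qed.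

Lemma dotvNr x y : dotv x (- y) = - dotv x y.
Proof. by rewrite -scaleN1r dotvZr mulN1r. Qed.

Lemma dotv0l y : dotv 0 y = 0 :> R.
Proof. by rewrite -(scale0r (0 : 'cV[R]_n)) dotvZl mul0r. Qed.

Lemma dotv0r y : dotv y 0 = 0 :> R.
Proof. by rewrite dotvC dotv0l. Qed.

Lemma dotvv_ge0 x : 0 <= dotv x x.
Proof. by apply: sumr_ge0 => i _; rewrite -expr2 sqr_ge0. Qed.

Lemma dotv_tr M x y : dotv x (M *m y) = dotv (M^T *m x) y.
Proof.
rewrite /dotv.
under eq_bigr do rewrite !mxE mulr_sumr.
rewrite exchange_big /=; apply: eq_bigr => j _; rewrite !mxE mulr_suml.
by apply: eq_bigr => i _; rewrite !mxE; ring.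
Qed.

Lemma enorm_ge0 x : 0 <= enorm x.
Proof. exact: sqrtr_ge0. Qed.

Lemma enorm_sqr x : enorm x ^+ 2 = dotv x x.
Proof. by rewrite /enorm sqr_sqrtr // dotvv_ge0. Qed.

Lemma enorm0 : enorm (0 : 'cV[R]_n) = 0.
Proof. by rewrite /enorm dotv0l sqrtr0. Qed.

Lemma enorm_eq0 x : enorm x = 0 -> x = 0.
Proof.
move=> x0; apply/eqP; apply/negPn/negP => /dotv_gt0.
by rewrite -enorm_sqr x0 expr0n ltxx.
Qed.

Lemma enorm_gt0 x : x != 0 -> 0 < enorm x.
Proof. by move=> x0; rewrite /enorm sqrtr_gt0 dotv_gt0. Qed.

Lemma enormZ a x : enorm (a *: x) = `|a| * enorm x.
Proof.
by rewrite /enorm dotvZl dotvZr mulrA -expr2 sqrtrM ?sqr_ge0 // sqrtr_sqr.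
Qed.

Lemma enormN x : enorm (- x) = enorm x.
Proof. by rewrite -scaleN1r enormZ normrN1 mul1r. Qed.

Lemma enormBC x y : enorm (x - y) = enorm (y - x).
Proof. by rewrite -enormN opprB. Qed.

Lemma dotv_le x y : dotv x y <= enorm x * enorm y.
Proof.
have [->|x0] := eqVneq x 0; first by rewrite dotv0l enorm0 mul0r.
have [->|y0] := eqVneq y 0; first by rewrite dotv0r enorm0 mulr0.
have xp := enorm_gt0 x0; have yp := enorm_gt0 y0.
have := dotvv_ge0 (enorm y *: x - enorm x *: y).
rewrite dotvDl !dotvDr !dotvNl !dotvNr !dotvZl !dotvZr -!enorm_sqr (dotvC y x).
set a := enorm x in xp *; set b := enorm y in yp *; set c := dotv x y => h.
have : 0 <= (a * b) * (2 * (a * b - c)) by move: h; congr (_ <= _); ring.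
by rewrite pmulr_rge0 ?mulr_gt0 // pmulr_rge0 // subr_ge0.
Qed.

Lemma dotv_abs x y : `|dotv x y| <= enorm x * enorm y.
Proof.
rewrite ler_norml dotv_le andbT lerNl -dotvNl.
by rewrite (le_trans (dotv_le _ _)) // enormN.
Qed.

Lemma enormD x y : enorm (x + y) <= enorm x + enorm y.
Proof.
rewrite -(ler_pXn2r (n:=2)) ?nnegrE ?addr_ge0 ?enorm_ge0 //.
rewrite enorm_sqr dotvDl !dotvDr -!enorm_sqr (dotvC y x) sqrrD.
by have := dotv_le x y; lra.
Qed.

Lemma enormB x y : enorm (x - y) <= enorm x + enorm y.
Proof. by rewrite -(enormN y) enormD. Qed.

Lemma enorm_lerB x y : enorm x - enorm y <= enorm (x - y).
Proof. by rewrite lerBlDr (le_trans _ (enormD _ _)) // subrK. Qed.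

Lemma enorm_sum I (r : seq I) (P : pred I) (F : I -> 'cV[R]_n) :
  enorm (\sum_(i <- r | P i) F i) <= \sum_(i <- r | P i) enorm (F i).
Proof.
elim/big_ind2 : _ => //; first by rewrite enorm0.
by move=> a b c d ab cd; rewrite (le_trans (enormD _ _)) // lerD.
Qed.

Lemma coord_le_enorm x i : `|x i 0| <= enorm x.
Proof.
rewrite -(ler_pXn2r (n:=2)) ?nnegrE ?enorm_ge0 // enorm_sqr /dotv (bigD1 i) //=.
rewrite real_normK ?num_real // expr2 lerDl; apply: sumr_ge0 => j _.
by rewrite -expr2 sqr_ge0.
Qed.

Lemma col_sum_delta x : x = \sum_i x i 0 *: delta_mx i 0.
Proof.
by rewrite {1}(matrix_sum_delta x); apply: eq_bigr => i _; rewrite big_ord1.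
Qed.

Lemma enorm_le_sum x : enorm x <= \sum_i `|x i 0|.
Proof.
rewrite {1}(col_sum_delta x); apply: le_trans (enorm_sum _ _ _) _.
apply: ler_sum => i _; rewrite enormZ ler_piMr //.
rewrite /enorm /dotv (bigD1 i) //= big1 ?addr0 => [|j ji].
  by rewrite !mxE !eqxx mulr1 sqrtr1.
by rewrite !mxE (negbTE ji) mul0r.
Qed.

Lemma coord_le_norm x i : `|x i 0| <= `|x|.
Proof.
rewrite [leRHS]/Num.Def.normr /= mx_normrE; apply/bigmax_geP; right => /=.
by exists (i, 0).
Qed.

Lemma norm_le_enorm x : `|x| <= enorm x.
Proof.
rewrite [leLHS]/Num.Def.normr /= mx_normrE; apply/bigmax_leP; split.
  exact: enorm_ge0.
by move=> [i j] _ /=; rewrite ord1 coord_le_enorm.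
Qed.

Lemma enorm_le_norm x : enorm x <= n%:R * `|x|.
Proof.
apply: le_trans (enorm_le_sum _) _.
apply: le_trans (ler_sum _ (fun i _ => coord_le_norm x i)) _.
by rewrite sumr_const card_ord mulr_natl.
Qed.

Lemma mulmx_bounded M : exists2 C : R, 0 < C & forall x, enorm (M *m x) <= C * enorm x.
Proof.
exists (1 + \sum_i \sum_j `|M i j|).
  by rewrite ltr_wpDr //; do 2 (apply: sumr_ge0 => ? _).
move=> x; apply: le_trans (enorm_le_sum _) _.
rewrite mulrDl mul1r mulr_suml ler_wpDl ?enorm_ge0 //; apply: ler_sum => i _.
rewrite mxE mulr_suml; apply: le_trans (ler_norm_sum _ _ _) _.
by apply: ler_sum => j _; rewrite normrM ler_wpM2l // coord_le_enorm.
Qed.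

Lemma bilinear_bounded (B : {bilinear 'cV[R]_n -> 'cV[R]_n -> 'cV[R]_n}) :
  exists2 C : R, 0 < C & forall x y, enorm (B x y) <= C * enorm x * enorm y.
Proof.
exists (1 + \sum_i \sum_j enorm (B (delta_mx i 0) (delta_mx j 0))).
  by rewrite ltr_wpDr //; do 2 (apply: sumr_ge0 => ? _); exact: enorm_ge0.
move=> x y.
rewrite {1}(col_sum_delta x) {1}(col_sum_delta y) linear_sumlz.
apply: le_trans (enorm_sum _ _ _) _.
rewrite 2!mulrDl mul1r ler_wpDl ?mulr_ge0 ?enorm_ge0 //.
rewrite !mulr_suml; apply: ler_sum => i _.
rewrite linear_sumr; apply: le_trans (enorm_sum _ _ _) _.
rewrite !mulr_suml; apply: ler_sum => j _.
rewrite linearZl_LR linearZr_LR /= !enormZ mulrA mulrC -mulrA.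
by rewrite ler_wpM2l ?enorm_ge0 // ler_pM // coord_le_enorm.
Qed.

Lemma cvg_enormP (T : Type) (F : set_system T) {FF : Filter F} (f : T -> 'cV[R]_n) (l : 'cV[R]_n) :
  f @ F --> l <-> (forall e : R, 0 < e -> \forall t \near F, enorm (f t - l) < e).
Proof.
split.
  move=> fl e e0; have ep : 0 < e / (n%:R + 1) by rewrite divr_gt0 // ltr_wpDl.
  have /cvgrPdist_lt /(_ _ ep) := fl; apply: filterS => t h.
  apply: le_lt_trans (enorm_le_norm _) _; rewrite -normrN opprB.
  apply: (@le_lt_trans _ _ ((n%:R + 1) * `|l - f t|)).
    by rewrite ler_wpM2r // lerDl.
  by rewrite mulrC -ltr_pdivlMr // ltr_wpDl.
move=> h; apply/cvgrPdist_lt => e e0; apply: filterS (h e e0) => t.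
by apply: le_lt_trans; rewrite enormBC norm_le_enorm.
Qed.

Lemma lipschitz_near_continuous (F : 'cV[R]_n -> 'cV[R]_n) :
  (forall x, exists C, forall y, enorm (y - x) <= 1 ->
     enorm (F y - F x) <= C * enorm (y - x)) -> continuous F.
Proof.
move=> H x; have [C hC] := H x.
apply/(@cvg_enormP _ _ (nbhs_filter x)) => e e0.
have d0 : 0 < Num.min 1 (e / (`|C| + 1)).
  by rewrite lt_min ltr01 divr_gt0 // ltr_wpDl.
have idx : id y @[y --> x] --> x by exact: cvg_id.
have /(@cvg_enormP _ _ (nbhs_filter x)) /(_ _ d0) := idx.
apply: filterS => y; rewrite lt_min => /andP[h1 h2].
apply: le_lt_trans (hC y (ltW h1)) _.
apply: (@le_lt_trans _ _ ((`|C| + 1) * enorm (y - x))).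
  by rewrite ler_wpM2r ?enorm_ge0 // (le_trans (ler_norm C)) // lerDl.
by rewrite mulrC -ltr_pdivlMr // ltr_wpDl.
Qed.

Lemma cvg_enorm (T : Type) (F : set_system T) {FF : Filter F} (f : T -> 'cV[R]_n) (l : 'cV[R]_n) :
  f @ F --> l -> enorm (f t) @[t --> F] --> enorm l.
Proof.
move=> /cvg_enormP h; apply/cvgrPdist_lt => e e0; apply: filterS (h e e0) => t ht.
rewrite ltr_norml; have := enorm_lerB (f t) l; have := enorm_lerB l (f t).
by rewrite (enormBC l); lra.
Qed.

Lemma cvg_coord (T : Type) (F : set_system T) {FF : Filter F} (f : T -> 'cV[R]_n) (l : 'cV[R]_n) i :
  f @ F --> l -> f t i 0 @[t --> F] --> l i 0.
Proof.
move=> /cvg_enormP h; apply/cvgrPdist_lt => e e0; apply: filterS (h e e0) => t.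
apply: le_lt_trans; rewrite distrC.
by have := coord_le_enorm (f t - l) i; rewrite !mxE.
Qed.

Lemma cvg_colP (T : Type) (F : set_system T) {FF : Filter F} (f : T -> 'cV[R]_n) (l : 'cV[R]_n) :
  (forall i, f t i 0 @[t --> F] --> l i 0) -> f @ F --> l.
Proof.
move=> h; apply/cvg_enormP => e e0.
have : \sum_i `|f t i 0 - l i 0| @[t --> F] --> \sum_(i < n) (0 : R).
  apply: cvg_bigsum => i; apply/norm_cvg0P; rewrite -(subrr (l i 0)).
  by apply: cvgB => //; exact: cvg_cst.
rewrite big1 // => /cvgr0Pnorm_lt /(_ _ e0); apply: filterS => t.
apply: le_lt_trans; apply: le_trans (enorm_le_sum _) _.
apply: le_trans _ (ler_norm _); apply: ler_sum => i _.
by rewrite !mxE.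
Qed.

Lemma mulmx_continuous M : continuous (mulmx M : 'cV[R]_n -> 'cV[R]_n).
Proof.
apply: lipschitz_near_continuous => x; have [C _ hC] := mulmx_bounded M.
by exists C => y _; rewrite -mulmxBr.
Qed.

Lemma enorm_continuous : continuous (@enorm R n).
Proof. by move=> x; apply: (@cvg_enorm _ _ (nbhs_filter x)); exact: cvg_id. Qed.

End Euclid.

(** * One-variable calculus *)

Section RealFunctions.
Context {R : realType}.

Lemma is_derive_mul (f g : R -> R) (t a b : R) : is_derive t 1 f a ->
  is_derive t 1 g b -> is_derive t 1 (fun s => f s * g s) (f t * b + a * g t).
Proof.
move=> h1 h2; apply: is_derive_eq.
change (f t * b + g t * a = f t * b + a * g t); ring.
Qed.

Lemma is_derive_bigsum m (f : 'I_m -> R -> R) (t : R) (a : 'I_m -> R) :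
  (forall i, is_derive t 1 (f i) (a i)) ->
  is_derive t 1 (fun s => \sum_i f i s) (\sum_i a i).
Proof.
move=> h.
have -> : (fun s => \sum_i f i s) = \sum_i f i by apply/funext => s; rewrite fct_sumE.
exact: is_derive_sum.
Qed.

Lemma MVT_continuous (f df : R -> R) (a b : R) : a <= b -> continuous f ->
  (forall r : R, a < r -> r < b -> is_derive r 1 f (df r)) ->
  exists2 c, a <= c <= b & f b - f a = df c * (b - a).
Proof.
move=> ab cf hf; have [||c cab ->] := @MVT_segment R f df a b ab.
- by move=> r; rewrite in_itv /= => /andP[? ?]; exact: hf.
- exact: continuous_subspaceT.
by exists c => //; move: cab; rewrite in_itv.
Qed.

Lemma derive_le0_le (f df : R -> R) (a b : R) : a <= b -> continuous f ->
  (forall r : R, a < r -> r < b -> is_derive r 1 f (df r)) ->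
  (forall r : R, a <= r -> r <= b -> df r <= 0) -> f b <= f a.
Proof.
move=> ab cf hf h; have [c /andP[ac cb] e] := MVT_continuous ab cf hf.
by rewrite -subr_le0 e mulr_le0_ge0 ?h // subr_ge0.
Qed.

(** At the first time [m] where [f] reaches [c], continuity gives [f <= c] up to [m], so the
    hypothesis yields [f m < c], and [f] stays below [c] a little longer: a contradiction. *)
Lemma continuous_bootstrap (f : R -> R) (t c : R) : 0 <= t -> continuous f -> f 0 < c ->
  (forall s : R, 0 <= s -> s <= t -> (forall r : R, 0 <= r -> r <= s -> f r <= c) -> f s < c) ->
  forall s : R, 0 <= s -> s <= t -> f s < c.
Proof.
move=> t0 cf f0 H s s0 st; rewrite ltNge; apply/negP => fs.
pose E := [set r : R | 0 <= r <= t /\ c <= f r].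
have Es : E s by split; rewrite ?s0.
have hE : has_inf E by split; [exists s | exists 0 => r [/andP[]]].
pose m := inf E.
have m0 : 0 <= m by apply: lb_le_inf; [exists s | move=> r [/andP[]]].
have mt : m <= t by apply: le_trans (ge_inf hE.2 Es) st.
have below (r : R) : 0 <= r -> r < m -> f r < c.
  move=> r0 rm; rewrite ltNge; apply/negP => fr.
  have : E r by split=> //; rewrite r0 /= (le_trans (ltW rm)).
  by move/(ge_inf hE.2); rewrite leNgt rm.
have fm : f m <= c.
  rewrite leNgt; apply/negP => cfm.
  have [m00|mp] := eqVneq m 0; first by move: cfm; rewrite m00 ltNge (ltW f0).
  have {}mp : 0 < m by rewrite lt0r mp.
  have := cf m; move/cvgrPdist_lt => /(_ (f m - c)); rewrite subr_gt0 => /(_ cfm).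
  move=> /nbhs_ballP[d /= d0 hd].
  pose r := m - Num.min (d / 2) (m / 2).
  have mn : 0 < Num.min (d / 2) (m / 2) by rewrite lt_min !divr_gt0.
  have rd : ball m d r.
    rewrite /ball /= /r opprB addrC subrK gtr0_norm // gt_min.
    by rewrite ltr_pdivrMr // ltr_pMr // ltr1n.
  have r0 : 0 <= r.
    rewrite /r subr_ge0 ge_min; apply/orP; right.
    by rewrite ler_pdivrMr // ler_pMr // ler1n.
  have := below r r0; rewrite /r ltrBlDr ltrDl mn => /(_ isT).
  by have := hd _ rd; rewrite -/r ltr_norml => /andP[_]; lra.
have fmc : f m < c.
  apply: H => // r r0; rewrite le_eqVlt => /predU1P[->//|rm].
  exact/ltW/below.
have := cf m; move/cvgrPdist_lt => /(_ (c - f m)); rewrite subr_gt0 => /(_ fmc).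
move=> /nbhs_ballP[d /= d0 hd].
have [r Er rm] := inf_adherent d0 hE.
have mr : m <= r by exact: (ge_inf hE.2 Er).
have : ball m d r.
  by rewrite /ball /= distrC ger0_norm ?subr_ge0 //; rewrite -/m in rm; lra.
move/hd; rewrite ltr_norml => /andP[h _].
by case: Er => _; lra.
Qed.

(** Compactness in its covering form. Only [r] is confined to [[0, T]]; [s] may leave the segment,
    which spares a case distinction at the last grid point. *)
Lemma segment_uniform (V : normedModType R) (f : R -> V) (T e : R) : continuous f -> 0 < e ->
  exists2 h : R, 0 < h & forall r s : R, 0 <= r -> r <= T -> `|s - r| <= h -> `|f s - f r| <= e.
Proof.
move=> cf e0.
have /compact_near_coveringP : compact `[0, T] by exact: segment_compact.
move=> /(_ R (0^'+) (fun h r => forall s, `|s - r| <= h -> `|f s - f r| <= e)).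
case=> [r _|].
  have e2 : 0 < e / 2 by rewrite divr_gt0.
  have /cvgrPdist_lt /(_ _ e2) /nbhs_ballP[d /= d0 hd] := cf r.
  have d2 : 0 < d / 2 by rewrite divr_gt0.
  exists (ball r (d / 2), [set h | h < d / 2]) => /=.
    split; first by apply/nbhs_ballP; exists (d / 2).
    exact: nbhs_right_lt.
  move=> [r' h] /= [br hh] s sr.
  have h1 : ball r d r' by apply: le_ball br; rewrite ler_pdivrMr // ler_pMr // ler1n.
  have h2 : ball r d s.
    rewrite /ball /=; move: br; rewrite /ball /= => br.
    rewrite -(subrK r' r) -addrA; apply: le_lt_trans (ler_normD _ _) _.
    by rewrite (distrC r' s); move: sr hh br; lra.
  have := hd _ h1; have := hd _ h2; move=> /= k1 k2.
  rewrite -(subrK (f r) (f s)) -addrA; apply: le_trans (ler_normD _ _) _.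
  by rewrite (distrC (f s)); lra.
move=> d /= d0 hd; exists (d / 2); first by rewrite divr_gt0.
move=> r s r0 rT; apply: (hd (d/2)) => /=.
- by rewrite sub0r normrN gtr0_norm ?divr_gt0 // ltr_pdivrMr // ltr_pMr // ltr1n.
- by rewrite divr_gt0.
- by rewrite in_itv /= r0.
Qed.

Lemma is_derive_expRM (a r : R) :
  is_derive r 1 (fun s : R => expR (a * s)) (a * expR (a * r)).
Proof.
have h := is_derive_mul (@is_derive_cst _ R R a r 1) (is_derive_id r 1).
have := is_derive1_comp (is_derive_expR _) h.
move=> h'; apply: is_derive_eq h' _.
by rewrite mul0r addr0 mulr1 mulrC.
Qed.

Lemma continuous_expRM (a : R) : continuous (fun s : R => expR (a * s)).
Proof.
move=> s; apply: (@continuous_comp _ _ _ (fun s => a * s) expR).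
  by apply: cvgM; [exact: cvg_cst|exact: cvg_id].
exact: continuous_expR.
Qed.

End RealFunctions.

(** * Paths driven by additive noise *)

Section Paths.
Context {R : realType} {n : nat}.
Implicit Types (b : 'cV[R]_n -> 'cV[R]_n) (x g : R -> 'cV[R]_n) (M : 'M[R]_n).

(* [x] solves [dx = b x dt + dg], phrased through the absolutely continuous part
   [x - g], which is differentiable. *)
Definition path_sol b g x : Prop :=
  [/\ continuous x, continuous g, g 0 = 0 &
      forall t : R, 0 < t -> forall i,
        is_derive t 1 (fun s => (x s - g s) i 0) (b (x t) i 0)].

Definition coord_derive (y : R -> 'cV[R]_n) (t : R) (v : 'cV[R]_n) : Prop :=
  forall i, is_derive t 1 (fun s => y s i 0) (v i 0).

Lemma coord_derive_dot y z (t : R) u v : coord_derive y t u -> coord_derive z t v ->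
  is_derive t 1 (fun s => dotv (y s) (z s)) (dotv (y t) v + dotv u (z t)).
Proof.
move=> hy hz; rewrite /dotv -big_split /=.
by apply: is_derive_bigsum => i; exact: is_derive_mul.
Qed.

Lemma coord_derive_mulmx M y (t : R) u : coord_derive y t u ->
  coord_derive (fun s => M *m y s) t (M *m u).
Proof.
move=> hy i; rewrite mxE.
rewrite (_ : (fun _ => _) = (fun s => \sum_j M i j * y s j 0)); last first.
  by apply/funext => s; rewrite mxE.
apply: is_derive_bigsum => j.
have := is_derive_mul (@is_derive_cst _ R R (M i j) t 1) (hy j).
by rewrite mul0r addr0.
Qed.

Lemma coord_derive_cst (v : 'cV[R]_n) (t : R) : coord_derive (fun=> v) t 0.
Proof. by move=> i; rewrite mxE; exact: is_derive_cst. Qed.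

Lemma coord_derive_quad M y (t : R) u : M^T = M -> coord_derive y t u ->
  is_derive t 1 (fun s => dotv (y s) (M *m y s)) (2 * dotv (y t) (M *m u)).
Proof.
move=> sM hy; have := coord_derive_dot hy (coord_derive_mulmx M hy).
have -> : dotv u (M *m y t) = dotv (y t) (M *m u) by rewrite dotv_tr sM dotvC.
by rewrite mulr_natl mulr2n.
Qed.

Lemma continuous_dotv (y z : R -> 'cV[R]_n) : continuous y -> continuous z ->
  continuous (fun s => dotv (y s) (z s)).
Proof.
move=> cy cz t; apply: cvg_bigsum => i.
by apply: cvgM; apply: cvg_coord; [exact: cy|exact: cz].
Qed.

Lemma continuous_mulmx_path M (y : R -> 'cV[R]_n) : continuous y -> continuous (fun s : R => M *m y s).
Proof.
move=> cy t; apply: (@continuous_comp _ _ _ y (mulmx M)); first exact: cy.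
exact: mulmx_continuous.
Qed.

Lemma continuous_enorm_path (y : R -> 'cV[R]_n) : continuous y -> continuous (fun s : R => enorm (y s)).
Proof. by move=> cy t; apply: cvg_enorm; exact: cy. Qed.

Lemma continuous_subv (y z : R -> 'cV[R]_n) : continuous y -> continuous z ->
  continuous (fun s => y s - z s).
Proof. by move=> cy cz t; apply: cvgB; [exact: cy|exact: cz]. Qed.

Lemma path_sol_derive b g x (t : R) : path_sol b g x -> 0 < t ->
  coord_derive (fun s => x s - g s) t (b (x t)).
Proof. by case=> _ _ _ h t0 i; exact: h. Qed.

Lemma path_sol_sub_derive b g x x' (t : R) : path_sol b g x -> path_sol b g x' -> 0 < t ->
  coord_derive (fun s => x s - x' s) t (b (x t) - b (x' t)).
Proof.
move=> hx hx' t0 i.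
have := is_deriveB (path_sol_derive hx t0 i) (path_sol_derive hx' t0 i).
rewrite !mxE (_ : (fun _ => _) - _ = (fun s => (x s - x' s) i 0)) //.
by apply/funext => s; rewrite !fctE !mxE; ring.
Qed.

(** Vector form of the mean value inequality: the scalar mean value theorem is applied to the
    component along the error vector [u] itself. Inserting [M] allows one projection of the drift to
    be estimated when the full drift is too large. *)
Lemma path_sol_increment b g x M (q : 'cV[R]_n) (s t c : R) : path_sol b g x ->
  0 <= s -> s <= t ->
  (forall r : R, s <= r -> r <= t -> enorm (M *m b (x r) - q) <= c) ->
  enorm (M *m ((x t - g t) - (x s - g s)) - (t - s) *: q) <= (t - s) * c.
Proof.
move=> hx s0 st H.
set u := (X in enorm X).
have [u0|u0] := eqVneq (enorm u) 0.
  by rewrite u0 mulr_ge0 ?subr_ge0 // (le_trans (enorm_ge0 _) (H s _ _)).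
have up : 0 < enorm u by rewrite lt0r u0 enorm_ge0.
have [cx cg _ _] := hx.
pose f r := dotv u (M *m (x r - g r)) - r * dotv u q.
have cf : continuous f.
  move=> r; apply: cvgB.
    apply: continuous_dotv => [r'|]; first exact: cvg_cst.
    exact/continuous_mulmx_path/continuous_subv.
  by apply: cvgM; [exact: cvg_id | exact: cvg_cst].
have df (r : R) : s < r -> r < t -> is_derive r 1 f (dotv u (M *m b (x r) - q)).
  move=> sr _; have r0 : 0 < r by exact: le_lt_trans sr.
  have h1 := coord_derive_dot (coord_derive_cst u r)
    (coord_derive_mulmx M (path_sol_derive hx r0)).
  have h2 := is_derive_mul (is_derive_id r 1) (@is_derive_cst _ R R (dotv u q) r 1).
  have := is_deriveB h1 h2.
  by rewrite dotv0l addr0 mulr0 add0r mul1r dotvDr dotvNr.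
have [r /andP[sr rt] e] := MVT_continuous st cf df.
have : enorm u ^+ 2 <= (t - s) * (enorm u * c).
  rewrite enorm_sqr.
  have -> : dotv u u = f t - f s.
    by rewrite {2}/u /f mulmxBr !(dotvDr, dotvNr) dotvZr; ring.
  rewrite e mulrC ler_wpM2l ?subr_ge0 //.
  by apply: le_trans (dotv_le _ _) _; rewrite ler_wpM2l ?enorm_ge0 ?H.
by rewrite expr2 mulrCA ler_pM2l.
Qed.

Lemma path_sol_increment1 b g x (q : 'cV[R]_n) (s t c : R) : path_sol b g x ->
  0 <= s -> s <= t ->
  (forall r : R, s <= r -> r <= t -> enorm (b (x r) - q) <= c) ->
  enorm ((x t - g t) - (x s - g s) - (t - s) *: q) <= (t - s) * c.
Proof.
move=> hx s0 st H; have := @path_sol_increment b g x 1%:M q s t c hx s0 st.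
by rewrite mul1mx; apply => r sr rt; rewrite mul1mx H.
Qed.

Definition locally_lipschitz b : Prop := forall M : R, exists2 L : R, 0 < L &
  forall y z, enorm y <= M -> enorm z <= M -> enorm (b y - b z) <= L * enorm (y - z).

Lemma locally_lipschitz_continuous b : locally_lipschitz b -> continuous b.
Proof.
move=> hb; apply: lipschitz_near_continuous => x.
have [L L0 hL] := hb (enorm x + 1).
exists L => y yx; apply: hL; last by rewrite lerDl.
by rewrite -(subrK x y) addrC; apply: le_trans (enormD _ _) _; rewrite lerD2l.
Qed.

(** The common noise cancels in the difference, so [expR (- 2 L t) |x - x'| ^ 2] is differentiable,
    and it is nonincreasing. *)
Lemma path_sol_gronwall b g x x' (t M L : R) : path_sol b g x -> path_sol b g x' ->
  0 <= t -> 
  (forall y z, enorm y <= M -> enorm z <= M -> enorm (b y - b z) <= L * enorm (y - z)) ->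
  (forall s : R, 0 <= s -> s <= t -> enorm (x s) <= M /\ enorm (x' s) <= M) ->
  enorm (x t - x' t) <= expR (L * t) * enorm (x 0 - x' 0).
Proof.
move=> hx hx' t0 hL hM.
have [cx _ _ _] := hx; have [cx' _ _ _] := hx'.
pose f (s : R) : R := expR (- (2 * L) * s) * dotv (x s - x' s) (1%:M *m (x s - x' s)).
have cd := continuous_subv cx cx'.
have cf : continuous f.
  move=> s; apply: cvgM; first exact: continuous_expRM.
  have h := continuous_dotv cd (@continuous_mulmx_path 1%:M _ cd); exact: h.
have df (r : R) : 0 < r -> r < t -> is_derive r 1 f
  (expR (- (2 * L) * r) * (2 * dotv (x r - x' r) (1%:M *m (b (x r) - b (x' r))))
   + (- (2 * L) * expR (- (2 * L) * r)) * dotv (x r - x' r) (1%:M *m (x r - x' r))).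
  move=> r0 rt.
  have h2 := coord_derive_quad (trmx1 _ _) (path_sol_sub_derive hx hx' r0).
  exact: (is_derive_mul (is_derive_expRM _ r) h2).
have := derive_le0_le t0 cf df.
rewrite /f mulr0 expR0 mul1r !mul1mx -!enorm_sqr => H.
have {H} : expR (- (2 * L) * t) * enorm (x t - x' t) ^+ 2 <= enorm (x 0 - x' 0) ^+ 2.
  apply: H => r r0 rt; rewrite !mul1mx.
  have [Mx Mx'] := hM r r0 rt.
  have k1 := hL _ _ Mx Mx'.
  have k2 := dotv_le (x r - x' r) (b (x r) - b (x' r)).
  have k3 : dotv (x r - x' r) (b (x r) - b (x' r)) <= L * dotv (x r - x' r) (x r - x' r).
    rewrite -enorm_sqr expr2 mulrCA; apply: le_trans k2 _.
    by rewrite ler_wpM2l ?enorm_ge0.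
  rewrite [X in X <= _](_ : _ = expR (- (2 * L) * r) * (2 * (dotv (x r - x' r) (b (x r) - b (x' r)) - L * dotv (x r - x' r) (x r - x' r)))); last by ring.
  by rewrite pmulr_rle0 ?expR_gt0 // pmulr_rle0 // subr_le0.
rewrite mulNr expRN mulrC ler_pdivrMr ?expR_gt0 // => h.
rewrite -(ler_pXn2r (n:=2)) ?nnegrE ?mulr_ge0 ?enorm_ge0 ?expR_ge0 //.
by rewrite exprMn -expRM_natl mulrC (mulrA 2%:R).
Qed.

(** The Lipschitz constant is taken on a ball one unit larger than the range of [x]; a bootstrap
    shows that [x'] never leaves it, so the Gronwall bound applies on all of [[0, t]]. *)
Lemma path_sol_stable b g x (t : R) : locally_lipschitz b -> path_sol b g x -> 0 <= t ->
  exists2 C : R, 0 < C & forall x', path_sol b g x' -> C * enorm (x' 0 - x 0) < 1 ->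
   enorm (x' t - x t) <= C * enorm (x' 0 - x 0).
Proof.
move=> hb hx t0; have [cx _ _ _] := hx.
have [m _ hm] := @EVT_max R (fun s => enorm (x s)) 0 t t0
  (continuous_subspaceT (continuous_enorm_path cx)).
have {}hm (s : R) : 0 <= s -> s <= t -> enorm (x s) <= enorm (x m).
  by move=> s0 st; apply: hm; rewrite in_itv /= s0.
have [L L0 hL] := hb (enorm (x m) + 1).
exists (expR (L * t)); first exact: expR_gt0.
move=> x' hx' small; have [cx' _ _ _] := hx'.
have e1 : 1 <= expR (L * t) by rewrite -expR0 ler_expR mulr_ge0 // ltW.
have bound : forall s : R, 0 <= s -> s <= t -> enorm (x' s - x s) < 1.
  apply: continuous_bootstrap => //.
  - exact/continuous_enorm_path/continuous_subv.
  - by apply: le_lt_trans small; rewrite ler_peMl ?enorm_ge0.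
  - move=> s s0 st h; apply: le_lt_trans small.
    apply: (@le_trans _ _ (expR (L * s) * enorm (x' 0 - x 0))).
      apply: (path_sol_gronwall hx' hx s0 hL) => r r0 rs.
      split; last by apply: le_trans (hm r r0 (le_trans rs st)) _; rewrite lerDl.
      rewrite -(subrK (x r) (x' r)); apply: le_trans (enormD _ _) _.
      by rewrite addrC lerD ?h // hm // (le_trans rs st).
    by rewrite ler_wpM2r ?enorm_ge0 // ler_expR ler_wpM2l // ltW.
apply: (path_sol_gronwall hx' hx t0 hL) => r r0 rt.
split; last by apply: le_trans (hm r r0 rt) _; rewrite lerDl.
rewrite -(subrK (x r) (x' r)); apply: le_trans (enormD _ _) _.
by rewrite addrC lerD ?hm // ltW ?bound.
Qed.

Fixpoint euler b (h : R) (d : nat -> 'cV[R]_n) (x0 : 'cV[R]_n) (k : nat) : 'cV[R]_n :=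
  if k is k'.+1 then
    let y := euler b h d x0 k' in y + h *: b y + d k'
  else x0.

(** Discrete Gronwall argument. The scheme receives the exact increments of [g], so its local error
    comes from the drift alone, through the modulus of continuity of [b (x s)]. *)
Lemma euler_near b g x (T e : R) : locally_lipschitz b -> path_sol b g x -> 0 <= T ->
  0 < e -> exists h0 d0 : R, [/\ 0 < h0, 0 < d0 &
  forall (h : R) (k : nat) (x0 : 'cV[R]_n), 0 <= h -> h <= h0 -> h * k%:R <= T ->
    enorm (x0 - x 0) <= d0 ->
    enorm (euler b h (fun j => g (h * j.+1%:R) - g (h * j%:R)) x0 k - x (h * k%:R)) <= e].
Proof.
move=> hb hx T0 e0; have [cx _ _ _] := hx.
have [m _ hm] := @EVT_max R (fun s => enorm (x s)) 0 T T0
  (continuous_subspaceT (continuous_enorm_path cx)).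
have {}hm (s : R) : 0 <= s -> s <= T -> enorm (x s) <= enorm (x m).
  by move=> s0 st; apply: hm; rewrite in_itv /= s0.
have [L L0 hL] := hb (enorm (x m) + 1).
pose K := expR (L * T); have K0 : 0 < K by exact: expR_gt0.
pose eta := Num.min 1 e; have eta0 : 0 < eta by rewrite lt_min ltr01.
have T1 : 0 < T + 1 by rewrite ltr_wpDl.
(* Half of the tolerance [eta] goes to the initial error and half to the accumulated local errors,
   both amplified by at most [K]. The bound [eta <= 1] keeps the scheme in the ball where [L] is
   valid. *)
pose d0 := eta / (2 * K); pose c := eta / (2 * K * (T + 1)).
have c0 : 0 < c by rewrite divr_gt0 // !mulr_gt0.
have d00 : 0 < d0 by rewrite divr_gt0 // !mulr_gt0.
have Kdc : K * (d0 + T * c) <= eta.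
  have -> : K * (d0 + T * c) = eta / 2 * (1 + T / (T + 1)).
    by rewrite /d0 /c; field; rewrite !gt_eqF.
  have : T / (T + 1) <= 1 by rewrite ler_pdivrMr // mul1r lerDl.
  by move: eta0; set w := T / _; nra.
have cbx : continuous (fun s => b (x s)).
  move=> s; apply: (@continuous_comp _ _ _ x b); first exact: cx.
  exact: locally_lipschitz_continuous.
have c'0 : 0 < c / (n%:R + 1) by rewrite divr_gt0 // ltr_wpDl.
have [h0 h00 hh] := segment_uniform T cbx c'0.
exists h0, d0; split=> // h k x0 hge hle hk hx0.
pose d j := g (h * j.+1%:R) - g (h * j%:R).
suff H : forall j : nat, (j <= k)%N ->
    enorm (euler b h d x0 j - x (h * j%:R)) <= (1 + h * L) ^+ j * (d0 + j%:R * h * c)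
    /\ (1 + h * L) ^+ j * (d0 + j%:R * h * c) <= eta.
  have [h1 h2] := H k (leqnn k).
  by apply: le_trans h1 (le_trans h2 _); rewrite ge_min lexx orbT.
have hL1 : 1 <= 1 + h * L by rewrite lerDl mulr_ge0 // ltW.
have second (j : nat) : (j <= k)%N -> (1 + h * L) ^+ j * (d0 + j%:R * h * c) <= eta.
  move=> jk; apply: le_trans Kdc.
  have jT : j%:R * h <= T.
    by apply: le_trans hk; rewrite mulrC ler_wpM2l // ler_nat.
  apply: ler_pM.
  - by rewrite exprn_ge0 // (le_trans _ hL1).
  - by rewrite addr_ge0 ?(ltW d00) // mulr_ge0 ?(ltW c0) // mulr_ge0.
  - apply: (@le_trans _ _ (expR (h * L) ^+ j)).
      by rewrite lerXn2r ?nnegrE ?expR_ge0 ?expR_ge1Dx // (le_trans _ hL1).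
    by rewrite -expRM_natl ler_expR mulrA mulrC ler_wpM2l // ltW.
  - by rewrite lerD2l ler_wpM2r // ltW.
elim=> [|j IH] jk; split; rewrite ?second //.
  by rewrite expr0 mul1r mul0r mul0r addr0 mulr0.
have [h1 h2] := IH (ltnW jk).
have jh0 : 0 <= h * j%:R by rewrite mulr_ge0.
have jS : h * j.+1%:R = h * j%:R + h by rewrite -natr1 mulrDr mulr1.
have jST : h * j.+1%:R <= T by apply: le_trans hk; rewrite ler_wpM2l // ler_nat.
have jT : h * j%:R <= T by apply: le_trans jST; rewrite ler_wpM2l // ler_nat.
have jj : h * j%:R <= h * j.+1%:R by rewrite jS lerDl.
set y := euler b h d x0 j in h1 *; set z := x (h * j%:R) in h1.
have yz : enorm (y - z) <= 1 by apply: le_trans h1 (le_trans h2 _); rewrite ge_min lexx.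
have zM : enorm z <= enorm (x m) + 1 by apply: le_trans (hm _ jh0 jT) _; rewrite lerDl.
have yM : enorm y <= enorm (x m) + 1.
  rewrite -(subrK z y); apply: le_trans (enormD _ _) _.
  by rewrite addrC lerD // hm.
have loc := @path_sol_increment1 b g x (b z) _ _ c hx jh0 jj.
have {}loc := loc _.
have hloc : forall r : R, h * j%:R <= r -> r <= h * j.+1%:R -> enorm (b (x r) - b z) <= c.
  move=> r r1 r2; apply: le_trans (enorm_le_norm _) _.
  have := hh (h * j%:R) r jh0 jT; rewrite ger0_norm ?subr_ge0 // => /(_ _).
  have rh : r - h * j%:R <= h0 by rewrite lerBlDl (le_trans r2) // jS lerD2l.
  move=> /(_ rh) hr; apply: (@le_trans _ _ ((n%:R + 1) * (c / (n%:R + 1)))).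
    by apply: ler_pM => //; rewrite lerDl.
  by rewrite mulrC divfK // gt_eqF // ltr_wpDl.
have {hloc}loc := loc hloc.
have -> : euler b h d x0 j.+1 - x (h * j.+1%:R) =
   ((y - z) + h *: (b y - b z)) -
   ((x (h * j.+1%:R) - g (h * j.+1%:R)) - (z - g (h * j%:R)) - h *: b z).
  rewrite /= -/y /d scalerBr; apply/colP => i; rewrite !mxE; ring.
apply: le_trans (enormB _ _) _.
have e1 : h * j.+1%:R - h * j%:R = h by rewrite jS addrC addKr.
rewrite e1 in loc.
apply: (@le_trans _ _ ((1 + h * L) * enorm (y - z) + h * c)).
  apply: lerD => //; apply: le_trans (enormD _ _) _.
  rewrite mulrDl mul1r lerD2l enormZ ger0_norm // -mulrA ler_wpM2l //.
  exact: hL.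
rewrite exprS -mulrA -natr1.
set a := (1 + h * L) in hL1 h1 *; set q := a ^+ j in h1 *.
have q1 : 1 <= q by rewrite exprn_ege1.
have aq : 1 <= a * q by rewrite mulr_ege1.
have hc : 0 <= h * c by rewrite mulr_ge0 // ltW.
apply: (@le_trans _ _ (a * (q * (d0 + j%:R * h * c)) + a * q * (h * c))).
  apply: lerD; first by rewrite ler_wpM2l // (le_trans _ hL1).
  by rewrite ler_peMl.
by rewrite le_eqVlt; apply/orP; left; apply/eqP; ring.
Qed.

End Paths.

(** * From the integral equation to differentiable paths *)

Section SolutionPaths.
Context {R : realType} {n : nat}.

(** Solutions and noise are continuous on [[0, +oo[] only. Freezing them at negative times makes
    them continuous on the whole line, the form used in [path_sol]. *)
Lemma continuous_max0 (V : topologicalType) (f : R -> V) :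
  {within `[0, +oo[, continuous f} -> continuous (fun t : R => f (Num.max 0 t)).
Proof.
move=> /subspace_continuousP cf t.
have m0 : `[0, +oo[%classic (Num.max 0 t) by rewrite /= in_itv /= le_max lexx.
have := cf _ m0.
move=> h; apply: cvg_trans h.
have cm : Num.max 0 s @[s --> t] --> Num.max 0 t.
  by apply: continuous_max; [exact: cvg_cst|exact: cvg_id].
move=> U /= hU.
have := cm _ hU; rewrite /= => hm.
rewrite nbhs_simpl /=.
apply: (@filterS _ (nbhs t) (nbhs_filter t) _ _ _ hm) => s /=; apply.
by rewrite /= in_itv /= le_max lexx.
Qed.

Lemma continuous_path_comp (b : 'cV[R]_n -> 'cV[R]_n) (x : R -> 'cV[R]_n) :
  continuous b -> continuous x -> continuous (fun s => b (x s)).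
Proof.
by move=> cb cx s; apply: (@continuous_comp _ _ _ x b); [exact: cx|exact: cb].
Qed.

Lemma drift_lipschitz (B : {bilinear 'cV[R]_n -> 'cV[R]_n -> 'cV[R]_n}) (A : 'M[R]_n) :
  locally_lipschitz (drift B A).
Proof.
move=> M; have [C C0 hC] := bilinear_bounded B; have [D D0 hD] := mulmx_bounded A.
exists (C * `|M| + C * `|M| + D); first by rewrite ltr_wpDl // addr_ge0 // mulr_ge0 // ltW.
move=> x y Mx My.
have -> : drift B A x - drift B A y = B (x - y) x + B y (x - y) - A *m (x - y).
  rewrite /drift mulmxBr linearBl linearBr /=.
  by apply/colP => i; rewrite !mxE; ring.
apply: le_trans (enormB _ _) _; rewrite mulrDl; apply: lerD => //.
apply: le_trans (enormD _ _) _; rewrite mulrDl; apply: lerD.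
  apply: le_trans (hC _ _) _; rewrite mulrAC ler_wpM2r ?enorm_ge0 // ler_wpM2l ?(ltW C0) //.
  exact: le_trans Mx (ler_norm _).
apply: le_trans (hC _ _) _; rewrite ler_wpM2r ?enorm_ge0 // ler_wpM2l ?(ltW C0) //.
exact: le_trans My (ler_norm _).
Qed.

Lemma is_derive_Rintegral (f : R -> R) (t : R) : continuous f -> 0 < t ->
  is_derive t 1 (fun s => \int[lebesgue_measure]_(r in `[0, s]) f r) (f t).
Proof.
move=> cf t0.
have tt : t < t + 1 by rewrite ltrDl.
have fi : lebesgue_measure.-integrable `[0, t + 1] (EFin \o f).
  by apply: continuous_compact_integrable; [exact: segment_compact|exact: continuous_subspaceT].
have [d e] := @continuous_FTC1_closed R f 0 t (t + 1) tt fi t0 (cf t).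
by apply: DeriveDef; [exact: d|rewrite -derive1E; exact: e].
Qed.

Lemma sde_path_sol (B : {bilinear 'cV[R]_n -> 'cV[R]_n -> 'cV[R]_n}) (A sigma : 'M[R]_n)
    (w x : R -> 'cV[R]_n) (x0 : 'cV[R]_n) :
  {within `[0, +oo[, continuous w} -> w 0 = 0 ->
  {within `[0, +oo[, continuous x} ->
  (forall t : R, 0 <= t -> x t = x0
     + (\col_i \int[lebesgue_measure]_(s in `[0, t]) drift B A (x s) i 0) + sigma *m w t) ->
  path_sol (drift B A) (fun t => sigma *m w (Num.max 0 t)) (fun t => x (Num.max 0 t))
  /\ x 0 = x0.
Proof.
move=> cw w0 cx hx; have cw' := continuous_max0 cw; have cx' := continuous_max0 cx.
split; last first.
  rewrite hx // w0 mulmx0 addr0 set_itv1.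
  by apply/colP => i; rewrite !mxE Rintegral_set1 addr0.
split=> //.
- exact: continuous_mulmx_path.
- by rewrite maxxx w0 mulmx0.
move=> t t0 i; rewrite (max_idPr (ltW t0)).
pose f (s : R) : R := drift B A (x (Num.max 0 s)) i 0.
have cf : continuous f.
  move=> s; apply: cvg_coord.
  exact: (continuous_path_comp (locally_lipschitz_continuous (drift_lipschitz B A)) cx').
have := is_derive_Rintegral cf t0.
rewrite {2}/f (max_idPr (ltW t0)) => h.
have h2 := is_deriveD (@is_derive_cst _ R R (x0 i 0) t 1) h.
rewrite add0r in h2.
apply: near_eq_is_derive h2.
near=> s.
have s0 : 0 < s by near: s; exact: lt_nbhsr.
rewrite (max_idPr (ltW s0)) hx ?ltW // !mxE addrK /cst /=.
apply: (congr1 (fun z => x0 i 0 + z)); apply: eq_Rintegral => r; rewrite inE /= in_itv /= => /andP[r0 _].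
by rewrite /f (max_idPr r0).
Unshelve. all: by end_near. Qed.

End SolutionPaths.

(** * Gaussian tails and expectations *)

Section Normal.
Context {R : realType}.

(** The exponential is split into four equal factors, each estimated by [1 + z <= expR z]. *)
Lemma sqr_expR_bound (y : R) : 0 <= y -> y ^+ 2 * expR (- (3 / 8 * y)) <= 15.
Proof.
move=> y0.
have e4 : 1 + 3 / 32 * y <= expR (3 / 32 * y) by exact: expR_ge1Dx.
have -> : expR (- (3 / 8 * y)) = (expR (3 / 32 * y) ^+ 4)^-1.
  by rewrite expRN -expRM_natl; congr (expR _)^-1; field.
rewrite ler_pdivrMr ?exprn_gt0 ?expR_gt0 //.
set e := expR _ in e4 *.
have : (1 + 3 / 32 * y) ^+ 4 <= e ^+ 4 by rewrite lerXn2r ?nnegrE ?expR_ge0 //; nra.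
nra.
Qed.

(** Passing from standard deviation [s] to [2 s] frees a factor [expR (- 3 y / 8)] with
    [y = (x / s) ^ 2]; it beats [y ^ 2], and [y] is at least [(u / s) ^ 2]. *)
Lemma normal_pdf_compare (s u x : R) : 0 < s -> 0 < u -> u <= `|x| ->
  normal_pdf 0 s x <= 30 * (s / u) ^+ 4 * normal_pdf 0 (2 * s) x.
Proof.
move=> s0 u0 ux; rewrite !normal_pdfE ?gt_eqF ?mulr_gt0 //.
rewrite /normal_fun !subr0.
have pk : normal_peak s = 2 * normal_peak (2 * s).
  rewrite /normal_peak.
  have -> : (2 * s) ^+ 2 * pi *+ 2 = 2 ^+ 2 * (s ^+ 2 * pi *+ 2) by ring.
  by rewrite sqrtrM ?sqr_ge0 // sqrtr_sqr ger0_norm // invfM mulrA mulfV ?mul1r // pnatr_eq0.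
rewrite pk; set p := normal_peak (2 * s).
have p0 : 0 <= p by exact: normal_peak_ge0.
pose y := (x / s) ^+ 2.
have y0 : 0 <= y by exact: sqr_ge0.
have -> : expR (- x ^+ 2 / (s ^+ 2 *+ 2)) = expR (- (3 / 8 * y)) * expR (- x ^+ 2 / ((2 * s) ^+ 2 *+ 2)).
  rewrite -expRD; congr expR; rewrite /y; field.
  by rewrite gt_eqF.
set e1 := expR (- (3 / 8 * y)); set e2 := expR _.
have ys : 1 <= (s / u) ^+ 4 * y ^+ 2.
  have -> : (s / u) ^+ 4 * y ^+ 2 = (`|x| / u) ^+ 4.
    rewrite /y (_ : `|x| / u = `|x / u|); last by rewrite normf_div (gtr0_norm u0).
    have -> : `|x / u| ^+ 4 = ((x / u) ^+ 2) ^+ 2.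
      by rewrite -[4%N]/(2 * 2)%N exprM real_normK ?num_real.
    by field; rewrite !gt_eqF.
  by rewrite exprn_ege1 // ler_pdivlMr // mul1r.
have h := sqr_expR_bound y0; rewrite -/e1 in h.
have e10 : 0 <= e1 by exact: expR_ge0.
have e20 : 0 <= e2 by exact: expR_ge0.
have k : e1 <= 15 * (s / u) ^+ 4.
  apply: (@le_trans _ _ ((s / u) ^+ 4 * y ^+ 2 * e1)); first by rewrite ler_peMl.
  by rewrite -mulrA mulrC ler_wpM2r // exprn_ge0 // divr_ge0 // ltW.
have : 2 * p * (e1 * e2) <= 2 * p * (15 * (s / u) ^+ 4 * e2).
  by rewrite ler_wpM2l ?mulr_ge0 // ler_wpM2r.
move=> /le_trans; apply; rewrite le_eqVlt; apply/orP; left; apply/eqP; ring.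
Qed.

(** The fourth power matters: for an increment over time [h] it yields a probability of order
    [h ^ 2], summable over dyadic refinements and negligible per unit of time. *)
Lemma normal_tail (s u : R) : 0 < s -> 0 < u ->
  (normal_prob 0 s [set x : R | (u <= `|x|)%R] <= (30 * (s / u) ^+ 4)%:E)%E.
Proof.
move=> s0 u0.
have mA : measurable [set x : R | u <= `|x|].
  rewrite (_ : [set x : R | _] = Num.Def.normr @^-1` `[u, +oo[); last first.
    by apply/seteqP; split => x /=; rewrite in_itv /= andbT.
  rewrite -[X in measurable X]setTI.
  by apply: (@normr_measurable R setT).
have c0 : 0 <= 30 * (s / u) ^+ 4 by rewrite mulr_ge0 // exprn_ge0 // divr_ge0 // ltW.
rewrite /normal_prob.
apply: (@le_trans _ _ (\int[lebesgue_measure]_(x in [set x : R | (u <= `|x|)%R]) ((30 * (s / u) ^+ 4)%:E * (normal_pdf 0 (2 * s) x)%:E))%E).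
  apply: ge0_le_integral => //.
  - by move=> x _; rewrite lee_fin normal_pdf_ge0.
  - by apply/measurable_funTS/measurable_EFinP; exact: measurable_normal_pdf.
  - apply: (measurable_funS measurableT (subsetT _)).
    apply/measurable_EFinP; apply: measurable_funM => //.
    exact: measurable_normal_pdf.
  - by move=> x ux; rewrite -EFinM lee_fin normal_pdf_compare.
rewrite ge0_integralZl //; last 2 first.
- by apply/measurable_funTS/measurable_EFinP; exact: measurable_normal_pdf.
- by move=> x _; rewrite lee_fin normal_pdf_ge0.
rewrite -[leRHS]mule1; apply: lee_wpmul2l; first by rewrite lee_fin.
exact: (@probability_le1 _ _ _ (normal_prob 0 (2 * s))).
Qed.

(** The standard normal density at two standard deviations, hence a lower bound for the mass of any
    interval of length [s] inside [[- 2 s, 2 s]]. *)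
Definition normal_const : R := expR (- 2) * (Num.sqrt (pi *+ 2))^-1.

Lemma normal_const_gt0 : 0 < normal_const.
Proof. by rewrite mulr_gt0 ?expR_gt0 // invr_gt0 sqrtr_gt0 mulrn_wgt0 // pi_gt0. Qed.

Lemma normal_lower (s a : R) : 0 < s -> (forall x : R, a <= x -> x <= a + s -> `|x| <= 2 * s) ->
  (normal_const%:E <= normal_prob 0 s `[a, (a + s)%R])%E.
Proof.
move=> s0 ha; rewrite /normal_prob.
have pk : normal_peak s * s = (Num.sqrt (pi *+ 2))^-1.
  rewrite /normal_peak -mulrnAr sqrtrM ?sqr_ge0 // sqrtr_sqr (gtr0_norm s0) invfM.
  by rewrite mulrAC mulVf ?mul1r // gt_eqF.
apply: (@le_trans _ _ (\int[lebesgue_measure]_(x in `[a, (a + s)%R]) (normal_peak s * expR (- 2))%:E)%E).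
  rewrite integral_cst //= lebesgue_measure_itv /= lte_fin ltrDl s0 -EFinB -EFinM lee_fin.
  by rewrite /normal_const -pk addrAC subrr add0r le_eqVlt; apply/orP; left; apply/eqP; ring.
apply: ge0_le_integral => //.
- by move=> x _; rewrite lee_fin mulr_ge0 ?normal_peak_ge0 ?expR_ge0.
- apply: (measurable_funS measurableT (subsetT _)).
  by apply/measurable_EFinP; exact: measurable_normal_pdf.
move=> x /=; rewrite in_itv /= => /andP[ax xa]; rewrite lee_fin normal_pdfE ?gt_eqF //.
rewrite /normal_fun subr0 ler_wpM2l ?normal_peak_ge0 // ler_expR.
rewrite mulNr lerN2 ler_pdivrMr; last by rewrite mulrn_wgt0 // exprn_gt0.
have := ha x ax xa => h.
have : `|x| ^+ 2 <= (2 * s) ^+ 2 by rewrite lerXn2r ?nnegrE ?mulr_ge0 // ltW.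
rewrite real_normK ?num_real // => /le_trans; apply.
by rewrite le_eqVlt; apply/orP; left; apply/eqP; rewrite -mulr_natr; ring.
Qed.

Lemma normal_lower_pos (s : R) : 0 < s ->
  (normal_const%:E <= normal_prob 0 s `[s, +oo[)%E.
Proof.
move=> s0; apply: (le_trans (@normal_lower s s s0 _)).
  by move=> x sx xs; rewrite ger0_norm; lra.
apply: (@le_measure _ _ _ (normal_prob 0 s)); rewrite ?inE //.
by move=> x /=; rewrite !in_itv /= andbT => /andP[].
Qed.

Lemma normal_lower_neg (s : R) : 0 < s ->
  (normal_const%:E <= normal_prob 0 s `]-oo, (- s)%R])%E.
Proof.
move=> s0; apply: (le_trans (@normal_lower s (- (2 * s)) s0 _)).
  by move=> x sx xs; rewrite ler0_norm; lra.
apply: (@le_measure _ _ _ (normal_prob 0 s)); rewrite ?inE //.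
by move=> x /=; rewrite !in_itv /= => /andP[_]; lra.
Qed.

End Normal.

(** * Real-valued expectations and probabilities *)

Section Expectation.
Context d {T : measurableType d} {R : realType} (P : probability T R).
Implicit Types (f g : T -> R) (A : set T).

Definition Ex f : R := fine (\int[P]_w (f w)%:E)%E.

Definition Pr A : R := fine (P A).

Definition bmeas f : Prop := measurable_fun setT f /\ exists M : R, forall w, `|f w| <= M.

Lemma ae_full_set (Q : T -> Prop) : {ae P, forall w, Q w} ->
  exists O : set T, [/\ measurable O, P O = 1%E & forall w, O w -> Q w].
Proof.
case=> N [mN PN hN]; exists (~` N); split; first exact: measurableC.
  by rewrite probability_setC // PN sube0.
by move=> w Nw; apply: contrapT => nQ; apply: Nw; exact: hN.
Qed.

Lemma bmeas_integrable f : bmeas f -> P.-integrable setT (EFin \o f).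
Proof.
move=> [mf [M hM]]; apply: measurable_bounded_integrable => //.
  by apply: (le_lt_trans (@probability_le1 _ _ _ P _ measurableT)); rewrite ltry.
exists M; split; first by rewrite num_real.
by move=> M' MM' w _; apply: le_trans (hM w) (ltW MM').
Qed.

Lemma ExE f : P.-integrable setT (EFin \o f) -> (\int[P]_w (f w)%:E)%E = (Ex f)%:E.
Proof. by move=> fi; rewrite /Ex fineK //; exact: integrable_fin_num. Qed.

Lemma ExD f g : P.-integrable setT (EFin \o f) -> P.-integrable setT (EFin \o g) ->
  Ex (fun w => f w + g w) = Ex f + Ex g.
Proof.
move=> fi gi; apply: EFin_inj; rewrite EFinD -!ExE //.
  by under eq_integral do rewrite EFinD; rewrite integralD.
exact: (integrableD measurableT fi gi).
Qed.

Lemma ExZ f (a : R) : P.-integrable setT (EFin \o f) -> Ex (fun w => a * f w) = a * Ex f.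
Proof.
move=> fi; apply: EFin_inj; rewrite EFinM -!ExE //.
  by under eq_integral do rewrite EFinM; rewrite integralZl.
exact: (integrableZl measurableT a fi).
Qed.

Lemma ExB f g : P.-integrable setT (EFin \o f) -> P.-integrable setT (EFin \o g) ->
  Ex (fun w => f w - g w) = Ex f - Ex g.
Proof.
move=> fi gi; rewrite -[- Ex g]mulN1r -ExZ // -ExD //.
  by congr Ex; apply/funext => w; rewrite mulN1r.
exact: (integrableZl measurableT (-1) gi).
Qed.

Lemma Ex_cst (a : R) : Ex (fun=> a) = a.
Proof.
by rewrite /Ex integral_cst //= -[X in (_ * X)%E]/(P [set: T]) probability_setT mule1.
Qed.

Lemma Ex_ge0_ae f : P.-integrable setT (EFin \o f) -> {ae P, forall w, 0 <= f w} -> 0 <= Ex f.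
Proof.
move=> fi f0; have mf : measurable_fun setT f.
  by have /integrableP[/measurable_EFinP] := fi.
apply: fine_ge0; rewrite (ae_eq_integral (fun w => (Num.max (f w) 0)%:E)) //.
- by apply: integral_ge0 => w _; rewrite lee_fin le_max lexx orbT.
- exact/measurable_EFinP.
- by apply/measurable_EFinP; apply: measurable_maxr.
- by apply: filterS f0 => w h _; rewrite (max_idPl h).
Qed.

Lemma Ex_le f g : P.-integrable setT (EFin \o f) -> P.-integrable setT (EFin \o g) ->
  {ae P, forall w, f w <= g w} -> Ex f <= Ex g.
Proof.
move=> fi gi h; rewrite -subr_ge0 -ExB //; apply: Ex_ge0_ae.
  exact: (integrableB measurableT gi fi).
by apply: filterS h => w; rewrite subr_ge0.
Qed.

Lemma Ex_ge0 f : (forall w, 0 <= f w) -> 0 <= Ex f.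
Proof. by move=> f0; apply: fine_ge0; apply: integral_ge0 => w _; rewrite lee_fin. Qed.

Lemma Ex_indic A : measurable A -> Ex (\1_A) = Pr A.
Proof. by move=> mA; rewrite /Ex integral_indic // setIT. Qed.

Lemma Pr_ge0 A : 0 <= Pr A.
Proof. exact: fine_ge0. Qed.

Lemma PrE A : measurable A -> P A = (Pr A)%:E.
Proof. by move=> mA; rewrite /Pr fineK // fin_num_measure. Qed.

Lemma bmeas_indic A : measurable A -> bmeas (\1_A).
Proof.
move=> mA; split; first exact: measurable_indic.
by exists 1 => w; rewrite indicE; case: (_ \in _); rewrite ?normr1 ?normr0.
Qed.

Lemma bmeasD f g : bmeas f -> bmeas g -> bmeas (fun w => f w + g w).
Proof.
move=> [mf [M hM]] [mg [N hN]]; split; first exact: measurable_funD.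
by exists (M + N) => w; rewrite (le_trans (ler_normD _ _)) // lerD.
Qed.

Lemma bmeasM f g : bmeas f -> bmeas g -> bmeas (fun w => f w * g w).
Proof.
move=> [mf [M hM]] [mg [N hN]]; split; first exact: measurable_funM.
by exists (M * N) => w; rewrite normrM ler_pM.
Qed.

Lemma bmeas_cst (a : R) : bmeas (fun=> a).
Proof. by split; [exact: measurable_cst|exists `|a|]. Qed.

Lemma bmeas_sum (I : Type) (r : seq I) (F : I -> T -> R) :
  (forall i, bmeas (F i)) -> bmeas (fun w => \sum_(i <- r) F i w).
Proof.
move=> h; elim: r => [|i r ih].
  by under eq_fun do rewrite big_nil; exact: bmeas_cst.
by under eq_fun do rewrite big_cons; exact: bmeasD.
Qed.

Lemma Ex_sum (I : Type) (r : seq I) (F : I -> T -> R) :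
  (forall i, P.-integrable setT (EFin \o F i)) ->
  Ex (fun w => \sum_(i <- r) F i w) = \sum_(i <- r) Ex (F i).
Proof.
move=> h.
suff [] : Ex (fun w => \sum_(i <- r) F i w) = \sum_(i <- r) Ex (F i) /\
  P.-integrable setT (EFin \o (fun w => \sum_(i <- r) F i w)) by [].
elim: r => [|i r [ih1 ih2]].
  under eq_fun do rewrite big_nil; rewrite Ex_cst big_nil; split=> //.
  by apply: bmeas_integrable; exact: bmeas_cst.
split; last first.
  under eq_fun do rewrite big_cons.
  exact: (integrableD measurableT (h i) ih2).
by under eq_fun do rewrite big_cons; rewrite ExD // ih1 big_cons.
Qed.

Lemma Ex_cvg (F : nat -> T -> R) f (M : R) :
  (forall k, measurable_fun setT (F k)) -> measurable_fun setT f ->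
  (forall k w, `|F k w| <= M) ->
  {ae P, forall w, F k w @[k --> \oo] --> f w} ->
  Ex (F k) @[k --> \oo] --> Ex f.
Proof.
move=> mF mf hM hcv.
have mF' k : measurable_fun setT (fun w => (F k w)%:E) by exact/measurable_EFinP.
have mf' : measurable_fun setT (fun w => (f w)%:E) by exact/measurable_EFinP.
have cv : {ae P, forall w, setT w -> (F k w)%:E @[k --> \oo] --> (f w)%:E}.
  by apply: filterS hcv => w h _; apply/fine_cvgP; split => //; exact: nearW.
have iM : P.-integrable setT (fun=> M%:E) by exact: (bmeas_integrable (bmeas_cst M)).
have dm : {ae P, forall (w : T) (k : nat), setT w -> (`|(F k w)%:E| <= M%:E)%E}.
  by apply: aeW => w k _; rewrite lee_fin.
have [fi _ h] := dominated_convergence measurableT mF' mf' cv iM dm.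
by rewrite ExE // in h; move/fine_cvgP : h => [].
Qed.

Lemma measurable_ge f (a : R) : measurable_fun setT f -> measurable [set w | a <= f w].
Proof.
move=> mf; rewrite (_ : [set w | _] = f @^-1` `[a, +oo[); last first.
  by apply/seteqP; split => w /=; rewrite in_itv /= andbT.
by rewrite -[X in measurable X]setTI; exact: mf.
Qed.

Lemma Pr_setC A : measurable A -> Pr (~` A) = 1 - Pr A.
Proof.
move=> mA; apply: EFin_inj; rewrite EFinB -!PrE //; last exact: measurableC.
exact: probability_setC.
Qed.

Lemma Pr_setU A B : measurable A -> measurable B -> Pr (A `|` B) <= Pr A + Pr B.
Proof.
move=> mA mB; rewrite -lee_fin EFinD -!PrE //; last exact: measurableU.
exact: measureU2.
Qed.

(** Solution properties hold almost surely for one starting point at a time. This shrinks an event,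
    at no cost in probability, to outcomes where the required ones hold. *)
Lemma Pr_ae A (Q : T -> Prop) : {ae P, forall w, Q w} -> measurable A ->
  exists O, [/\ measurable O, O `<=` A, Pr O = Pr A & forall w, O w -> Q w].
Proof.
move=> /ae_full_set => -[U [mU PU hU]] mA; exists (A `&` U); split=> //.
- exact: measurableI.
- apply: EFin_inj; rewrite -!PrE //; last exact: measurableI.
  apply/eqP; rewrite eq_le; apply/andP; split.
    by apply: le_measure; rewrite ?inE //; exact: measurableI.
  have -> : P A = (P (A `&` U) + P (A `\` U))%E.
    by rewrite addeC -measureDI.
  rewrite [X in (_ + X)%E](_ : _ = 0%E) ?adde0 //.
  apply/eqP; rewrite eq_le measure_ge0 andbT.
  apply: (@le_trans _ _ (P (~` U))).
    by apply: le_measure; rewrite ?inE //; [exact: measurableD|exact: measurableC].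
  by rewrite probability_setC // PU subee.
- by move=> w [_ /hU].
Qed.

End Expectation.

(** * Quadratic forms adapted to an unstable matrix *)

Section GramForm.
Local Open Scope sesquilinear_scope.
Context {R : realType} {n : nat}.

Definition gram (k : nat) (s : 'I_k -> R) (a : 'I_k -> 'cV[R]_n) : 'M[R]_n :=
  \sum_i s i *: (a i *m (a i)^T).

Lemma dotvE (x y : 'cV[R]_n) : dotv x y = (x^T *m y) 0 0.
Proof. by rewrite mxE; apply: eq_bigr => i _; rewrite mxE. Qed.

Lemma gram_sym k s (a : 'I_k -> 'cV[R]_n) : (gram s a)^T = gram s a.
Proof.
rewrite /gram linear_sum; apply: eq_bigr => i _.
by rewrite linearZ /= trmx_mul trmxK.
Qed.

Lemma dotv_gram k s (a : 'I_k -> 'cV[R]_n) x y :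
  dotv x (gram s a *m y) = \sum_i s i * (dotv (a i) x * dotv (a i) y).
Proof.
rewrite dotvE /gram mulmx_suml mulmx_sumr summxE; apply: eq_bigr => i _.
rewrite -scalemxAl -scalemxAr mxE; congr (_ * _).
rewrite -(mulmxA (a i)) (mulmxA x^T) mxE big_ord1 -!dotvE.
by rewrite (dotvC x).
Qed.

End GramForm.

Section Schur.
Local Open Scope sesquilinear_scope.
Context {R : realType} {n : nat}.
Local Notation C := (R[i]).
Local Notation Re := complex.Re.
Local Notation Im := complex.Im.
Local Notation toC := (map_mx (real_complex R)).
Implicit Types (z t y : C).

Definition nrm2 z : R := Re z ^+ 2 + Im z ^+ 2.

(** The real part of the conjugate of [z] times [t * y]. *)
Definition cross z t y : R := Re z * Re (t * y) + Im z * Im (t * y).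

Lemma ReM z t : Re (z * t) = Re z * Re t - Im z * Im t.
Proof. by case: z t => [a b] [c e]. Qed.

Lemma ImM z t : Im (z * t) = Re z * Im t + Im z * Re t.
Proof. by case: z t => [a b] [c e]. Qed.

Lemma cross_diag z t : cross z t z = Re t * nrm2 z.
Proof. by rewrite /cross /nrm2 ReM ImM; ring. Qed.

Lemma cross_scale (a b : R) z t y :
  cross (a%:C%C * z) t (b%:C%C * y) = a * b * cross z t y.
Proof. by case: z t y => [? ?] [? ?] [? ?]; rewrite /cross /=; ring. Qed.

Lemma nrm2_scale (a : R) z : nrm2 (a%:C%C * z) = a ^+ 2 * nrm2 z.
Proof. by case: z => [? ?]; rewrite /nrm2 /=; ring. Qed.

Lemma nrm2_ge0 z : 0 <= nrm2 z.
Proof. by rewrite addr_ge0 // sqr_ge0. Qed.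

Lemma cross_bound z t y (tau : R) : `|Re t| <= tau -> `|Im t| <= tau ->
  cross z t y <= tau * (nrm2 z + nrm2 y).
Proof.
rewrite !ler_norml => /andP[a1 a2] /andP[b1 b2]; rewrite /cross /nrm2 ReM ImM.
set x1 := Re z; set x2 := Im z; set y1 := Re y; set y2 := Im y.
set t1 := Re t in a1 a2 *; set t2 := Im t in b1 b2 *.
have tau0 : 0 <= tau by lra.
have key (u v w : R) : - tau <= u -> u <= tau -> u * (v * w) <= tau / 2 * (v ^+ 2 + w ^+ 2).
  move=> u1 u2; have := sqr_ge0 (v + w); have := sqr_ge0 (v - w) => h1 h2; nra.
have := key t1 x1 y1 a1 a2; have := key t1 x2 y2 a1 a2.
have := key (- t2) x1 y2 _ _; have := key t2 x2 y1 b1 b2.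
move=> k1 /(_ _ _)k2 k3 k4.
have {}k2 : - t2 * (x1 * y2) <= tau / 2 * (x1 ^+ 2 + y2 ^+ 2) by apply: k2; lra.
lra.
Qed.

Lemma Re_sum I (r : seq I) (F : I -> C) : Re (\sum_(i <- r) F i) = \sum_(i <- r) Re (F i).
Proof. by elim/big_rec2 : _ => // i a b _ <-; case: (F i); case: b. Qed.

Lemma Im_sum I (r : seq I) (F : I -> C) : Im (\sum_(i <- r) F i) = \sum_(i <- r) Im (F i).
Proof. by elim/big_rec2 : _ => // i a b _ <-; case: (F i); case: b. Qed.

Lemma Re_row (l : 'rV[C]_n) (x : 'cV[R]_n) :
  Re ((l *m toC x) 0 0) = dotv (\col_j Re (l 0 j)) x.
Proof.
rewrite mxE Re_sum; apply: eq_bigr => j _; rewrite !mxE ReM /=; ring.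
Qed.

Lemma Im_row (l : 'rV[C]_n) (x : 'cV[R]_n) :
  Im ((l *m toC x) 0 0) = dotv (\col_j Im (l 0 j)) x.
Proof.
rewrite mxE Im_sum; apply: eq_bigr => j _; rewrite !mxE ImM /=; ring.
Qed.

Lemma nrm2C z : (nrm2 z)%:C%C = z^* * z.
Proof. by case: z => a b; rewrite /nrm2 /=; apply/eqP; rewrite eq_complex /=; apply/andP; split; apply/eqP; ring. Qed.

Lemma norm_Re z (tau : R) : `|z| <= tau%:C%C -> `|Re z| <= tau.
Proof. by move=> h; rewrite -lecR; apply: le_trans (normc_ge_Re z) h. Qed.

Lemma norm_Im z (tau : R) : `|z| <= tau%:C%C -> `|Im z| <= tau.
Proof.
move=> h; rewrite -normrN -ReiNIm; apply: norm_Re.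
by rewrite normrM normCi mulr1.
Qed.

Lemma nrm2_unitary (U : 'M[C]_n) (v : 'cV[C]_n) : U \is unitarymx ->
  \sum_i nrm2 ((U *m v) i 0) = \sum_i nrm2 (v i 0).
Proof.
move=> hU.
have key (u : 'cV[C]_n) : (\sum_i nrm2 (u i 0))%:C%C = (u ^t* *m u) 0 0.
  rewrite mxE rmorph_sum; apply: eq_bigr => i _.
  by rewrite /= nrm2C !mxE.
have e : (\sum_i nrm2 ((U *m v) i 0))%:C%C = (\sum_i nrm2 (v i 0))%:C%C; last by case: e.
rewrite !key trmx_mul map_mxM mulmxA -(mulmxA (v^t*)).
by rewrite (mulmx1C (unitarymxP hU)) mulmx1.
Qed.

Lemma unitary_entry (U : 'M[C]_n) i j : U \is unitarymx -> `|U i j| <= 1.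
Proof.
move=> /unitarymxP /matrixP /(_ i i); rewrite !mxE eqxx /= => h.
rewrite -(ler_pXn2r (n:=2)) ?nnegrE // expr1n.
apply: (@le_trans _ _ (\sum_j U i j * (U ^t*) j i)); last by rewrite h.
rewrite (bigD1 j) //= !mxE -normCK.
by rewrite lerDl sumr_ge0 // => k _; rewrite !mxE -normCK exprn_ge0.
Qed.

(** Schur triangularization, by a unitary matrix and hence with uniform bounds. In the triangular
    coordinates the weights [ka ^ (2 i)] make the off-diagonal part as small as [ep], so [Q] grows
    at a rate at most [La + ep], where [La] is the largest real part of an eigenvalue. The vectors
    [p] and [q] are the real and imaginary parts of a left eigenvector for it. The constant [c0]
    depends on [ep], [C0] and [n] only, which makes the estimate uniform over directions. *)
Lemma unstable_forms (ep C0 : R) : 0 < ep -> 0 < C0 -> exists2 c0 : R, 0 < c0 &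
  forall (m : 'M[R]_n) (l0 : R), (forall i j, `|m i j| <= C0) ->
  (exists2 la : C, eigenvalue (toC m) la & l0 <= Re la) ->
  exists (La : R) (p q : 'cV[R]_n) (Q : 'M[R]_n),
  [/\ l0 <= La, dotv p p + dotv q q = 1,
      forall x, dotv p x * dotv p (m *m x) + dotv q x * dotv q (m *m x)
                = La * (dotv p x ^+ 2 + dotv q x ^+ 2),
      Q^T = Q &
      forall x, [/\ dotv x (Q *m (m *m x)) <= (La + ep) * dotv x (Q *m x),
                    c0 * dotv x x <= dotv x (Q *m x) & dotv x (Q *m x) <= dotv x x]].
Proof.
move=> ep0 C00.
(* Bound for the entries of the triangular matrix: conjugation by a unitary matrix sums [n ^ 2]
   entries of [m] with coefficients of modulus at most [1]. *)
pose tau := n%:R * n%:R * C0.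
have tau0 : 0 <= tau by rewrite !mulr_ge0 // ltW.
(* The off-diagonal terms contribute at most [2 n tau ka] in total, which this choice keeps below
   [ep]. *)
pose ka := Num.min 1 (ep / (2 * n%:R * tau + 1)).
have nn0 : 0 <= 2 * n%:R :> R by rewrite mulr_ge0.
have den0 : 0 < 2 * n%:R * tau + 1 by rewrite ltr_wpDl // mulr_ge0.
have ka0 : 0 < ka by rewrite lt_min ltr01 divr_gt0.
have ka1 : ka <= 1 by rewrite ge_min lexx.
have kaep : 2 * n%:R * tau * ka <= ep.
  have : ka * (2 * n%:R * tau + 1) <= ep by rewrite -ler_pdivlMr // ge_min lexx orbT.
  by apply: le_trans; rewrite mulrC ler_wpM2l ?lerDl // ltW.
exists (ka ^+ (2 * n)); first exact: exprn_gt0.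
move=> m l0 mC [la ela hla].
have n0 : (0 < n)%N.
  case: (posnP n) => // n0; exfalso.
  have [v _] := eigenvalueP ela.
  by rewrite (_ : v = 0) ?eqxx //; apply/rowP => j; exfalso; have := ltn_ord j; rewrite [X in (_ < X)%N]n0.
have [U hU hT] := Schur (toC m) n0.
set t := conjmx U (toC m) in hT.
have tE : t = U *m toC m *m U^t* by exact: conjymx.
have UU : U^t* *m U = 1%:M by exact: (mulmx1C (unitarymxP hU)).
have Um : U *m toC m = t *m U by rewrite tE -(mulmxA _ _ U) UU mulmx1.
have hcp : char_poly t = \prod_(i < n) ('X - (t i i)%:P) by exact: char_poly_trig.
have eigE a : eigenvalue t a = (a \in [seq t i i | i <- index_enum 'I_n]).
  rewrite eigenvalue_root_char hcp.
  by rewrite -(big_map (fun i => t i i) predT (fun x => 'X - x%:P)) root_prod_XsubC.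
have eig i : eigenvalue t (t i i).
  by rewrite eigE; apply/mapP; exists i; rewrite ?mem_index_enum.
have elat : eigenvalue t la.
  have [v vm v0] := eigenvalueP ela.
  apply/eigenvalueP; exists (v *m U^t*).
    rewrite tE !mulmxA -(mulmxA v) UU mulmx1 vm.
    by rewrite -scalemxAl.
  apply: contra_neq v0 => h; rewrite -[v]mulmx1 -UU mulmxA h.
  by rewrite mul0mx.
have [j0 j0la] : exists j, la = t j j.
  by move: elat; rewrite eigE => /mapP[j _ ->]; exists j.
(* The most unstable eigenvalue is taken rather than [la]: only then does the upper growth rate of
   [Q] match the rate along [p] and [q] up to [ep]. *)
pose jm := [arg max_(j > j0) Re (t j j)]%O.
have jmax j : Re (t j j) <= Re (t jm jm).
  by rewrite /jm; case: arg_maxP => // i _; apply.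
pose La := Re (t jm jm).
have [v vt v0] := eigenvalueP (eig jm).
pose l := v *m U.
have lm : l *m toC m = t jm jm *: l.
  by rewrite /l -mulmxA Um mulmxA vt -scalemxAl.
have l_neq0 : l != 0.
  apply: contra_neq v0 => h; rewrite -[v]mulmx1.
  by rewrite -(unitarymxP hU) mulmxA -/l h mul0mx.
pose p0 : 'cV[R]_n := \col_j Re (l 0 j); pose q0 : 'cV[R]_n := \col_j Im (l 0 j).
pose w := Num.sqrt (dotv p0 p0 + dotv q0 q0).
have pq0 : 0 < dotv p0 p0 + dotv q0 q0.
  rewrite lt0r addr_ge0 ?dotvv_ge0 // andbT; apply: contra_neq l_neq0 => h.
  have [h1 h2] : p0 = 0 /\ q0 = 0.
    have a1 := dotvv_ge0 p0; have a2 := dotvv_ge0 q0.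
    move/eqP: h; rewrite paddr_eq0 // => /andP[/eqP h1 /eqP h2].
    by split; apply: enorm_eq0; rewrite /enorm ?h1 ?h2 sqrtr0.
  apply/rowP => j; rewrite mxE; apply/eqP; rewrite eq_complex /=.
  move/colP/(_ j): h1; rewrite !mxE => ->; move/colP/(_ j): h2; rewrite !mxE => ->.
  by rewrite !eqxx.
have w0 : 0 < w by rewrite sqrtr_gt0.
have ww : w ^+ 2 = dotv p0 p0 + dotv q0 q0 by rewrite sqr_sqrtr // ltW.
pose a i : 'cV[R]_n := \col_j Re (U i j); pose b i : 'cV[R]_n := \col_j Im (U i j).
pose s (i : 'I_n) := ka ^+ (2 * i).
pose Q := gram s a + gram s b.
have etaE (x : 'cV[R]_n) i : (U *m toC x) i 0 = (row i U *m toC x) 0 0.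
  by rewrite !mxE; apply: eq_bigr => j _; rewrite !mxE.
have ReE x i : Re ((U *m toC x) i 0) = dotv (a i) x.
  by rewrite etaE Re_row; congr dotv; apply/colP => j; rewrite !mxE.
have ImE x i : Im ((U *m toC x) i 0) = dotv (b i) x.
  by rewrite etaE Im_row; congr dotv; apply/colP => j; rewrite !mxE.
have QE (x x' : 'cV[R]_n) : dotv x (Q *m x') = \sum_i s i *
    (Re ((U *m toC x) i 0) * Re ((U *m toC x') i 0) + Im ((U *m toC x) i 0) * Im ((U *m toC x') i 0)).
  rewrite mulmxDl dotvDr !dotv_gram -big_split /=; apply: eq_bigr => i _.
  by rewrite (ReE x) (ReE x') (ImE x) (ImE x') -mulrDr.
have QQ (x : 'cV[R]_n) : dotv x (Q *m x) = \sum_i s i * nrm2 ((U *m toC x) i 0).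
  by rewrite QE; apply: eq_bigr => i _; rewrite /nrm2 !expr2.
have nx (x : 'cV[R]_n) : \sum_i nrm2 ((U *m toC x) i 0) = dotv x x.
  rewrite nrm2_unitary //; apply: eq_bigr => i _.
  by rewrite mxE /nrm2 /= expr0n addr0 expr2.
exists La, (w^-1 *: p0), (w^-1 *: q0), Q; split.
- by apply: le_trans (jmax j0); rewrite -j0la.
- by rewrite !dotvZl !dotvZr -!mulrDr -ww; field; rewrite gt_eqF.
- move=> x.
  have e1 : (l *m toC (m *m x)) 0 0 = t jm jm * (l *m toC x) 0 0.
    by rewrite map_mxM mulmxA lm -scalemxAl mxE.
  have e2 : Re ((l *m toC (m *m x)) 0 0) = Re (t jm jm * (l *m toC x) 0 0) by rewrite e1.
  have e3 : Im ((l *m toC (m *m x)) 0 0) = Im (t jm jm * (l *m toC x) 0 0) by rewrite e1.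
  rewrite ReM !Re_row !Im_row -/p0 -/q0 in e2.
  rewrite ImM !Re_row !Im_row -/p0 -/q0 in e3.
  rewrite !dotvZl e2 e3 -/La; ring.
- by rewrite linearD /= !gram_sym.
move=> x; split.
- rewrite QE QQ.
  pose z i := (U *m toC x) i 0.
  have tz i : (U *m toC (m *m x)) i 0 = \sum_j t i j * z j.
    by rewrite map_mxM mulmxA Um -mulmxA mxE.
  pose N i := s i * nrm2 (z i).
  have N0 i : 0 <= N i by rewrite mulr_ge0 ?nrm2_ge0 // exprn_ge0 // ltW.
  have tb i j : `|t i j| <= tau%:C%C.
    rewrite tE mxE; apply: le_trans (ler_norm_sum _ _ _) _.
    rewrite /tau -mulrA rmorphM /= rmorph_nat.
    apply: (@le_trans _ _ (\sum_(k < n) (n%:R * C0)%:C%C)); last first.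
      by rewrite sumr_const card_ord -[leLHS]mulr_natl.
    apply: ler_sum => k _; rewrite normrM !mxE norm_conjC.
    apply: (@le_trans _ _ ((n%:R * C0)%:C%C * 1)); last by rewrite mulr1.
    apply: ler_pM => //; last exact: unitary_entry.
    apply: le_trans (ler_norm_sum _ _ _) _.
    apply: (@le_trans _ _ (\sum_(k < n) (C0)%:C%C)); last first.
      by rewrite sumr_const card_ord rmorphM /= rmorph_nat -[leLHS]mulr_natl.
    apply: ler_sum => k' _; rewrite normrM !mxE.
    apply: (@le_trans _ _ (1 * C0%:C%C)); last by rewrite mul1r.
    apply: ler_pM => //; first exact: unitary_entry.
    by rewrite normc_def /= expr0n addr0 sqrtr_sqr lecR.
  (* For [j < i] the weight splits as [ka ^ (i - j)] times [ka ^ i * ka ^ j]: the last two factors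
     rescale [z i] and [z j] to their weighted sizes, and the first one is at most [ka]. *)
  have term i j : s i * cross (z i) (t i j) (z j) <=
      (if j == i then La * N i else 0) + tau * ka * (N i + N j).
    have [ij|ij|ij] := ltngtP (i : nat) j.
    + have -> : t i j = 0 by move/is_trig_mxP : hT; apply.
      rewrite /cross mul0r !mulr0 addr0 mulr0.
      by case: eqP => [e|_]; [rewrite e ltnn in ij|rewrite add0r !mulr_ge0 ?addr_ge0 // ltW].
    + have -> : (j == i) = false by apply/negP => /eqP e; rewrite e ltnn in ij.
      rewrite add0r /s.
      have -> : ka ^+ (2 * i) = ka ^+ (i - j) * (ka ^+ i * ka ^+ j).
        by rewrite -!exprD addnCA subnK ?(ltnW ij) // mul2n -addnn.
      have -> : ka ^+ (i - j) * (ka ^+ i * ka ^+ j) * cross (z i) (t i j) (z j)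
         = ka ^+ (i - j) * cross ((ka ^+ i)%:C%C * z i) (t i j) ((ka ^+ j)%:C%C * z j).
        by rewrite cross_scale; ring.
      have cb := cross_bound ((ka ^+ i)%:C%C * z i) ((ka ^+ j)%:C%C * z j) (norm_Re (tb i j)) (norm_Im (tb i j)).
      have nn (k : 'I_n) : nrm2 ((ka ^+ k)%:C%C * z k) = N k.
        by rewrite nrm2_scale /N /s mulnC exprM.
      rewrite !nn in cb.
      have k1 : ka ^+ (i - j) <= ka.
        rewrite -{2}(expr1 ka); apply: ler_wiXn2l => //; first exact: ltW.
        by rewrite subn_gt0.
      have k0 : 0 <= ka ^+ (i - j) by rewrite exprn_ge0 // ltW.
      have N2 : 0 <= tau * (N i + N j) by rewrite mulr_ge0 ?addr_ge0.
      apply: le_trans (ler_wpM2l k0 cb) _.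
      by rewrite [leRHS]mulrAC [leRHS]mulrC ler_wpM2r.
    + have -> : j = i by apply/val_inj.
      rewrite eqxx cross_diag mulrCA -/(N i) ler_wpDr //.
        by rewrite !mulr_ge0 ?addr_ge0 // ltW.
      by rewrite ler_wpM2r.
  apply: (@le_trans _ _ (\sum_i \sum_j s i * cross (z i) (t i j) (z j))).
    rewrite le_eqVlt; apply/orP; left; apply/eqP; apply: eq_bigr => i _.
    rewrite tz Re_sum Im_sum !mulr_sumr -big_split mulr_sumr; apply: eq_bigr => j _.
    by rewrite /cross.
  apply: (@le_trans _ _ (\sum_i \sum_j ((if j == i then La * N i else 0) + tau * ka * (N i + N j)))).
    by apply: ler_sum => i _; apply: ler_sum => j _; exact: term.
  have -> : \sum_i \sum_j ((if j == i then La * N i else 0) + tau * ka * (N i + N j))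
     = (La + 2 * n%:R * tau * ka) * \sum_i N i.
    transitivity (\sum_i (La * N i + tau * ka * (n%:R * N i + \sum_j N j))).
      apply: eq_bigr => i _; rewrite big_split /= -big_mkcond /= big_pred1_eq.
      by rewrite -mulr_sumr big_split /= sumr_const card_ord -(mulr_natl (N i)).
    rewrite big_split /= -!mulr_sumr big_split /= -mulr_sumr sumr_const card_ord.
    by rewrite -(mulr_natl (\sum_j N j)); ring.
  by rewrite ler_wpM2r ?lerD2l // sumr_ge0.
- rewrite QQ -nx mulr_sumr; apply: ler_sum => i _; rewrite ler_wpM2r ?nrm2_ge0 //.
  by apply: ler_wiXn2l; rewrite ?(ltW ka0) // leq_mul2l ltnW.
- rewrite QQ -nx; apply: ler_sum => i _; rewrite ler_piMl ?nrm2_ge0 //.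
  by apply: exprn_ile1 => //; exact: ltW.
Qed.

End Schur.

(** * The splitting of the state space *)

Section OrthogonalProjection.
Context {R : realType} {n : nat}.
Implicit Types (S V : {vspace 'cV[R]_n}) (x y : 'cV[R]_n).

(** Each linear form lowers the dimension by at most one. An orthogonal complement is an
    intersection of [\dim S] such kernels, so this is the dimension count behind [orth_add]. *)
Lemma dim_bigcap_lker (k : nat) (f : 'I_k -> 'Hom('cV[R]_n, R^o)) :
  (\dim {:'cV[R]_n} <= k + \dim (\bigcap_(i < k) lker (f i)))%N.
Proof.
elim: k f => [|k IH] f; first by rewrite big_ord0.
rewrite big_ord_recr /=; set U := (\bigcap_(i < k) _)%VS; set W := lker _.
have := IH (fun i => f (widen_ord (leqnSn k) i)); rewrite -/U => h.
have h1 : (\dim {:'cV[R]_n} <= \dim W + 1)%N.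
  have := limg_ker_dim (f ord_max) fullv; rewrite capfv -/W => <-.
  by rewrite leq_add2l; apply: leq_trans (dimvS (subvf _)) _; rewrite dimvf.
have h2 := dimv_sum_cap U W.
have h3 : (\dim (U + W) <= \dim {:'cV[R]_n})%N by apply: dimvS; exact: subvf.
lia.
Qed.

Lemma orth_cap S : (S :&: orth S = 0)%VS.
Proof.
apply/eqP; rewrite -subv0; apply/subvP => x; rewrite memv_cap => /andP[xS].
move=> /mem_orthovP /(_ x xS) /= h; rewrite memv0; apply/eqP; apply: enorm_eq0.
by rewrite /enorm h sqrtr0.
Qed.

Lemma orth_add S : (S + orth S = fullv)%VS.
Proof.
apply/eqP; rewrite eqEdim subvf /= dimv_disjoint_sum ?orth_cap //.
rewrite /orth /orthov; exact: dim_bigcap_lker.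
Qed.

Lemma memv_orth S x : reflect (forall y, y \in S -> dotv x y = 0) (x \in orth S).
Proof. by apply: (iffP mem_orthovP). Qed.

Lemma sub_orth_orth S : (S <= orth (orth S))%VS.
Proof.
apply/subvP => x xS; apply/memv_orth => y /memv_orth /(_ x xS).
by rewrite dotvC.
Qed.

Lemma orth_proj_mem S x : orth_proj S x \in S.
Proof. exact: memv_pi. Qed.

Lemma orth_proj_sub S x : x - orth_proj S x \in orth S.
Proof.
have := daddv_pi_add (orth_cap S) (w := x); rewrite orth_add memvf => /(_ isT) e.
by rewrite -{1}e /orth_proj addrC addKr; exact: memv_pi.
Qed.

Lemma orth_projP S x y : y \in S -> x - y \in orth S -> orth_proj S x = y.
Proof.
move=> yS xy; apply/eqP; rewrite -subr_eq0 -memv0 -(orth_cap S) memv_cap.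
apply/andP; split; first by rewrite rpredB // orth_proj_mem.
have -> : orth_proj S x - y = (x - y) - (x - orth_proj S x).
  by rewrite opprB [RHS]addrC addrA subrK.
by rewrite rpredB // orth_proj_sub.
Qed.

Lemma mx_of_mul (f : {linear 'cV[R]_n -> 'cV[R]_n}) x : mx_of f *m x = f x.
Proof.
rewrite {2}(col_sum_delta x) linear_sum /=; apply/colP => i.
rewrite mxE summxE; apply: eq_bigr => j _.
by rewrite linearZ /= !mxE mulrC.
Qed.

Definition proj_mx_of S : 'M[R]_n := mx_of (orth_proj S).

Lemma proj_mx_ofE S x : proj_mx_of S *m x = orth_proj S x.
Proof. exact: (mx_of_mul (daddv_pi S (orth S))). Qed.

Lemma orth_proj_id S x : x \in S -> orth_proj S x = x.
Proof. by move=> xS; apply: orth_projP => //; rewrite subrr rpred0. Qed.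

Lemma orth_proj_orth S x : orth_proj (orth S) x = x - orth_proj S x.
Proof.
apply: orth_projP; first exact: orth_proj_sub.
rewrite opprB addrC subrK; apply: (subvP (sub_orth_orth S)).
exact: orth_proj_mem.
Qed.

Lemma orth_proj_dot S x y : x \in S -> dotv x (orth_proj S y) = dotv x y.
Proof.
move=> xS; apply/eqP; rewrite eq_sym -subr_eq0 -dotvNr -dotvDr dotvC.
by have /memv_orth /(_ x xS) -> := orth_proj_sub S y.
Qed.

Lemma orth_proj_add (V1 V2 : {vspace 'cV[R]_n}) x : (V1 <= orth V2)%VS ->
  orth_proj (V1 + V2)%VS x = orth_proj V1 x + orth_proj V2 x.
Proof.
move=> V12; apply: orth_projP; first by rewrite memv_add ?orth_proj_mem.
apply/memv_orth => y /memv_addP[y1 y1V [y2 y2V ->]].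
have o1 : dotv (orth_proj V2 x) y1 = 0.
  by rewrite dotvC; have /memv_orth -> := subvP V12 _ y1V; rewrite ?orth_proj_mem.
have o2 : dotv (orth_proj V1 x) y2 = 0.
  by have /memv_orth -> := subvP V12 _ (orth_proj_mem V1 x).
have e1 := orth_proj_dot x y1V; have e2 := orth_proj_dot x y2V.
by rewrite dotvDl dotvNl !(dotvDr, dotvDl) o1 o2 !(dotvC (orth_proj _ _)) e1 e2 !(dotvC _ x); ring.
Qed.

End OrthogonalProjection.

Lemma mulmx_entry (K : comRingType) m p q (M : 'M[K]_(m, p)) (N : 'M[K]_(p, q)) i j :
  (M *m N) i j = (M *m col j N) i (0 : 'I_1).
Proof. by rewrite !mxE; apply: eq_bigr => k _; rewrite mxE. Qed.

Lemma mx_entry_delta (K : comRingType) m p (M : 'M[K]_(m, p)) i j :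
  M i j = (M *m delta_mx j 0) i (0 : 'I_1).
Proof. by rewrite -colE mxE. Qed.

Section Splitting.
Context {R : realType} {n : nat}.
Variables (B : {bilinear 'cV[R]_n -> 'cV[R]_n -> 'cV[R]_n}) (A : 'M[R]_n).
Implicit Types x y : 'cV[R]_n.

Definition lin_mx_of (x : 'cV[R]_n) : 'M[R]_n := mx_of (linearization B x).

Lemma lin_mx_ofE x y : lin_mx_of x *m y = linearization B x y.
Proof.
rewrite {2}(col_sum_delta y) /linearization linear_sumr linear_sumlz -big_split /=.
apply/colP => i; rewrite mxE summxE; apply: eq_bigr => j _.
by rewrite linearZr_LR linearZl_LR -scalerDr !mxE mulrC.
Qed.

(* [P1], [P2] and [Pw] are the orthogonal projections onto [V1], [V2] and the
   orthogonal complement of [ker A]. *)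
Record splitting (P1 P2 Pw : 'M[R]_n) : Prop := Splitting {
  sp_add : forall x, P1 *m x + P2 *m x + Pw *m x = x ;
  sp_pyth : forall x, enorm x ^+ 2 =
    enorm (P1 *m x) ^+ 2 + enorm (P2 *m x) ^+ 2 + enorm (Pw *m x) ^+ 2 ;
  sp_11 : forall x, P1 *m (P1 *m x) = P1 *m x ;
  sp_22 : forall x, P2 *m (P2 *m x) = P2 *m x ;
  sp_B1 : forall x, B (P1 *m x) (P1 *m x) = 0 ;
  sp_B2 : forall x, B (P2 *m x) (P2 *m x) = 0 ;
  sp_cross1 : forall x y, P1 *m linearization B (P1 *m x) (P2 *m y) = 0 ;
  sp_cross2 : forall x y, P2 *m linearization B (P1 *m x) (P2 *m y) = 0 ;
  sp_cross : exists2 c : R, 0 < c & forall x y,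
    c * enorm (P1 *m x) * enorm (P2 *m y) <= enorm (linearization B (P1 *m x) (P2 *m y)) ;
  sp_A1 : forall x, A *m (P1 *m x) = 0 ;
  sp_A2 : forall x, A *m (P2 *m x) = 0 ;
  sp_diss : exists2 a : R, 0 < a & forall x, a * enorm (Pw *m x) ^+ 2 <= dotv x (A *m x) ;
  sp_eig1 : exists2 lmin : R, 0 < lmin & forall x, enorm (P1 *m x) = 1 ->
    exists2 la : R[i], eigenvalue (map_mx (real_complex R) (lin_mx_of (P1 *m x))) la &
      lmin <= complex.Re la ;
  sp_eig2 : exists2 lmin : R, 0 < lmin & forall x, enorm (P2 *m x) = 1 ->
    exists2 la : R[i], eigenvalue (map_mx (real_complex R) (lin_mx_of (P2 *m x))) la &
      lmin <= complex.Re la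
}.

Lemma linearizationC x y : linearization B x y = linearization B y x.
Proof. by rewrite /linearization addrC. Qed.

Lemma splitting_swap P1 P2 Pw : splitting P1 P2 Pw -> splitting P2 P1 Pw.
Proof.
case=> a b c d e f g h [k k0 hk] l m o p q; split=> //.
- by move=> x; rewrite (addrC (P2 *m x)).
- by move=> x; rewrite b (addrC (enorm (P1 *m x) ^+ 2)).
- by move=> x y; rewrite linearizationC.
- by move=> x y; rewrite linearizationC.
- by exists k => // x y; rewrite linearizationC mulrAC.
Qed.

(* Since [L_x] vanishes on [V] for [x] in [V], a left eigenvector of the
   transverse part of [L_x] is a left eigenvector of [L_x] itself. *)
Lemma transverse_eigenvalue (V : {vspace 'cV[R]_n}) x (la : R[i]) :
  (forall y, y \in V -> B y y = 0) -> x \in V -> 0 < complex.Re la ->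
  eigenvalue (transverse_mx B V x) la ->
  eigenvalue (map_mx (real_complex R) (lin_mx_of x)) la.
Proof.
move=> BV xV la0 /eigenvalueP[l el l0].
have la_neq0 : la != 0 by apply: contraTneq la0 => ->; rewrite ltxx.
pose Op := proj_mx_of (orth V); pose L := lin_mx_of x.
have OpOp : Op *m Op = Op.
  apply/matrixP => i j.
  have e (M : 'M[R]_n) : M i j = (M *m delta_mx j 0) i (0 : 'I_1) by rewrite -colE mxE.
  by rewrite !e -mulmxA !proj_mx_ofE (orth_proj_id (orth_proj_mem _ _)).
have ext (M N : 'M[R]_n) : (forall y : 'cV[R]_n, M *m y = N *m y) -> M = N.
  by move=> h; apply/matrixP => i j; have /colP/(_ i) := h (delta_mx j 0); rewrite -!colE !mxE.
(* Polarization: [B] vanishes on the diagonal at [x], at [y] and at [x + y]. *)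
have LV y : y \in V -> L *m y = 0.
  move=> yV; rewrite lin_mx_ofE /linearization.
  have := BV _ (rpredD xV yV); rewrite linearDl !linearDr /= (BV _ xV) (BV _ yV).
  by rewrite add0r addr0.
have LO : L *m Op = L.
  apply: ext => y; rewrite -mulmxA proj_mx_ofE orth_proj_orth mulmxBr (LV (orth_proj _ _)) ?subr0 //.
  exact: orth_proj_mem.
have tE : transverse_mx B V x = map_mx (real_complex R) (Op *m L).
  rewrite -[in RHS]LO; congr (map_mx _ _); apply/matrixP => i j.
  rewrite [RHS]mx_entry_delta.
  by rewrite mxE -!mulmxA proj_mx_ofE lin_mx_ofE proj_mx_ofE.
rewrite tE in el.
have lO : l *m map_mx (real_complex R) Op = l.
  apply: (scalerI la_neq0); rewrite scalemxAl -el -mulmxA -map_mxM -mulmxA LO.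
  done.
apply/eigenvalueP; exists l => //.
by rewrite -{1}lO -mulmxA -map_mxM.
Qed.

Hypothesis A_psd : psd A.

(** Positivity of the form at [C x - A x], where [C] bounds the norm of [A], gives the estimate
    without diagonalizing [A]. *)
Lemma psd_image_bound : exists2 C : R, 0 < C & forall x, enorm (A *m x) ^+ 2 <= C * dotv x (A *m x).
Proof.
have [sA pA] := A_psd; have [C C0 hC] := mulmx_bounded A.
exists C => // x; have := pA (C *: x - A *m x).
rewrite mulmxBr -scalemxAr !(dotvDl, dotvDr, dotvNl, dotvNr, dotvZl, dotvZr).
have -> : dotv (A *m x) (A *m x) = enorm (A *m x) ^+ 2 by rewrite enorm_sqr.
have -> : dotv x (A *m (A *m x)) = enorm (A *m x) ^+ 2.
  by rewrite dotv_tr sA enorm_sqr.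
have := dotv_le (A *m x) (A *m (A *m x)).
have := hC (A *m x); have := enorm_ge0 (A *m x).
set e := enorm (A *m x); set f := enorm _; set g := dotv _ _; set h := dotv _ _ => e0 h1 h2 h3.
have h4 : g <= C * e ^+ 2 by apply: le_trans h2 _; rewrite expr2 mulrCA ler_wpM2l.
have : 0 <= C * (C * h - e ^+ 2) by nra.
by rewrite pmulr_rge0 // subr_ge0.
Qed.

Lemma kervE x : (x \in kerv A) = (A *m x == 0).
Proof. by rewrite /kerv memv_ker lfunE. Qed.

(** The projection vanishes on [ker A], so it factors as [D *m A]. With [psd_image_bound] this shows
    that the dissipation controls the component off the kernel. *)
Lemma proj_orth_ker_bound : exists2 C : R, 0 < C & forall x,
  enorm (orth_proj (orth (kerv A)) x) <= C * enorm (A *m x).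
Proof.
have : (proj_mx_of (orth (kerv A)) <= A)%MS.
  rewrite submxE; apply/eqP/matrixP => i j; rewrite [RHS]mxE.
  rewrite mulmx_entry proj_mx_ofE orth_proj_orth orth_proj_id ?subrr ?mxE //.
  by rewrite kervE colE mulmxA mulmx_coker mul0mx.
move=> /submxP[D eD]; have [C C0 hC] := mulmx_bounded D.
by exists C => // x; rewrite -proj_mx_ofE eD -mulmxA.
Qed.

Lemma enorm_sqr_add3 (u v w : 'cV[R]_n) : dotv u v = 0 -> dotv u w = 0 -> dotv v w = 0 ->
  enorm (u + v + w) ^+ 2 = enorm u ^+ 2 + enorm v ^+ 2 + enorm w ^+ 2.
Proof.
move=> uv uw vw; rewrite !enorm_sqr !dotvDl !dotvDr (dotvC v u) (dotvC w u) (dotvC w v) uv uw vw.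
by ring.
Qed.

Lemma splitting_exists (V1 V2 : {vspace 'cV[R]_n}) :
  kerv A = (V1 + V2)%VS -> (V1 <= orth V2)%VS ->
  (forall x, x \in V1 \/ x \in V2 -> B x x = 0) ->
  (exists2 lambda_min : R, 0 < lambda_min &
     forall V, V = V1 \/ V = V2 ->
     forall x, x \in V -> unit_sphere x ->
     exists2 lambda : R[i], eigenvalue (transverse_mx B V x) lambda &
       lambda_min <= complex.Re lambda) ->
  (exists2 c : R, 0 < c &
     forall v1 v2, v1 \in V1 -> v2 \in V2 ->
       orth_proj (kerv A) (B v1 v2) + orth_proj (kerv A) (B v2 v1) = 0 /\
       c * enorm v1 * enorm v2 <=
         enorm (orth_proj (orth (kerv A)) (B v1 v2)
                + orth_proj (orth (kerv A)) (B v2 v1))) ->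
  splitting (proj_mx_of V1) (proj_mx_of V2) (proj_mx_of (orth (kerv A))).
Proof.
move=> kA V12 hB [lm lm0 hl] [c c0 hc].
have m1 x : proj_mx_of V1 *m x \in V1 by rewrite proj_mx_ofE orth_proj_mem.
have m2 x : proj_mx_of V2 *m x \in V2 by rewrite proj_mx_ofE orth_proj_mem.
have o12 u v : u \in V1 -> v \in V2 -> dotv u v = 0.
  by move=> uV; exact: (memv_orth _ _ (subvP V12 _ uV)).
have ow u v : u \in orth (kerv A) -> v \in kerv A -> dotv u v = 0.
  by move=> uV; exact: (memv_orth _ _ uV).
have k1 x : proj_mx_of V1 *m x \in kerv A by rewrite kA; apply: (subvP (addvSl _ _)).
have k2 x : proj_mx_of V2 *m x \in kerv A by rewrite kA; apply: (subvP (addvSr _ _)).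
have mw x : proj_mx_of (orth (kerv A)) *m x \in orth (kerv A) by rewrite proj_mx_ofE orth_proj_mem.
have add x : proj_mx_of V1 *m x + proj_mx_of V2 *m x + proj_mx_of (orth (kerv A)) *m x = x.
  by rewrite !proj_mx_ofE orth_proj_orth kA orth_proj_add // addrC subrK.
have Lk x y : orth_proj (kerv A) (linearization B (proj_mx_of V1 *m x) (proj_mx_of V2 *m y)) = 0.
  by have [e _] := hc _ _ (m1 x) (m2 y); rewrite /orth_proj linearD; exact: e.
(* The projections onto [V1] and [V2] add up to zero and are orthogonal to each other, so each of
   them vanishes. *)
have Lk12 x y : orth_proj V1 (linearization B (proj_mx_of V1 *m x) (proj_mx_of V2 *m y)) = 0 /\
   orth_proj V2 (linearization B (proj_mx_of V1 *m x) (proj_mx_of V2 *m y)) = 0.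
  have := Lk x y; rewrite kA orth_proj_add // => /eqP; rewrite addr_eq0 => /eqP e.
  set l := linearization _ _ _ in e *.
  have z : orth_proj V1 l = 0.
    apply: enorm_eq0; apply/eqP; rewrite -sqrf_eq0 enorm_sqr {2}e dotvNr o12 ?oppr0 //; exact: orth_proj_mem.
  by split=> //; apply/eqP; rewrite -oppr_eq0 -e z.
split=> //.
- move=> x; rewrite -{1}(add x); apply: enorm_sqr_add3.
  + by apply: o12; [exact: m1|exact: m2].
  + by rewrite dotvC; apply: ow; [exact: mw|exact: k1].
  by rewrite dotvC; apply: ow; [exact: mw|exact: k2].
- by move=> x; rewrite 2!proj_mx_ofE orth_proj_id ?orth_proj_mem.
- by move=> x; rewrite 2!proj_mx_ofE orth_proj_id ?orth_proj_mem.
- by move=> x; apply: hB; left.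
- by move=> x; apply: hB; right.
- by move=> x y; rewrite proj_mx_ofE; case: (Lk12 x y).
- by move=> x y; rewrite proj_mx_ofE; case: (Lk12 x y).
- exists c => // x y; have [_ h] := hc _ _ (m1 x) (m2 y); apply: le_trans h _.
  rewrite -linearD /= -[daddv_pi _ _ _]/(orth_proj (orth (kerv A)) (linearization B (proj_mx_of V1 *m x) (proj_mx_of V2 *m y))).
  by rewrite orth_proj_orth Lk subr0.
- by move=> x; apply/eqP; rewrite -kervE.
- by move=> x; apply/eqP; rewrite -kervE.
- have [C C0 hC] := psd_image_bound; have [D D0 hD] := proj_orth_ker_bound.
  have DC : 0 < D ^+ 2 * C by rewrite mulr_gt0 // exprn_gt0.
  exists (D ^+ 2 * C)^-1; first by rewrite invr_gt0.
  move=> x; rewrite mulrC ler_pdivrMr // proj_mx_ofE.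
  apply: (@le_trans _ _ ((D * enorm (A *m x)) ^+ 2)).
    by rewrite lerXn2r ?nnegrE ?mulr_ge0 ?enorm_ge0 // ltW.
  rewrite exprMn mulrC [leRHS]mulrCA [leRHS]mulrC ler_wpM2r ?exprn_ge0 ?(ltW D0) //.
  by rewrite [leRHS]mulrC.
- exists lm => // x x1; have [la h1 h2] := hl V1 (or_introl erefl) _ (m1 x) x1.
  exists la; last exact: h2.
  apply: (@transverse_eigenvalue V1 (proj_mx_of V1 *m x) la _ (m1 x) _ h1).
    by move=> y yV; apply: hB; left.
  exact: lt_le_trans lm0 h2.
- exists lm => // x x1; have [la h1 h2] := hl V2 (or_intror erefl) _ (m2 x) x1.
  exists la; last exact: h2.
  apply: (@transverse_eigenvalue V2 (proj_mx_of V2 *m x) la _ (m2 x) _ h1).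
    by move=> y yV; apply: hB; right.
  exact: lt_le_trans lm0 h2.
Qed.

End Splitting.

(** * Dynamics near the kernel of [A] *)

Section PathLipschitz.
Context {R : realType} {n : nat}.

Lemma path_sol_lipschitz (b : 'cV[R]_n -> 'cV[R]_n) g x (M : 'M[R]_n) (T c : R) :
  path_sol b g x -> (forall r : R, 0 <= r -> r <= T -> enorm (M *m b (x r)) <= c) ->
  forall s t : R, 0 <= s -> s <= T -> 0 <= t -> t <= T ->
  enorm (M *m ((x t - g t) - (x s - g s))) <= `|t - s| * c.
Proof.
move=> hx hc.
have key (s t : R) : 0 <= s -> s <= t -> t <= T ->
    enorm (M *m ((x t - g t) - (x s - g s))) <= (t - s) * c.
  move=> s0 st tT.
  have := @path_sol_increment R n b g x M 0 s t c hx s0 st.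
  rewrite scaler0 subr0; apply => r sr rt; rewrite subr0; apply: hc.
    exact: le_trans sr.
  exact: le_trans tT.
move=> s t s0 sT t0 tT; have [st|ts] := leP s t.
  by rewrite ger0_norm ?subr_ge0 // key.
rewrite distrC ger0_norm ?subr_ge0 ?(ltW ts) //.
by rewrite -enormN -mulmxN opprB key // ltW.
Qed.

(** At least [d / h - 2] grid points fall into the interval, and [4 * h <= d] makes this at least
    half of [d / h]. Thus a stay of [f] above [m] is still seen by the sum over the grid. *)
Lemma riemann_lower (f : R -> R) (h l d m : R) (J : nat) : 0 < h -> 0 <= l ->
  4 * h <= d -> l + d < h * J%:R -> (forall r, 0 <= f r) -> 0 <= m ->
  (forall r : R, l <= r -> r <= l + d -> m <= f r) ->
  d / 2 * m <= h * \sum_(j < J) f (h * j%:R).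
Proof.
move=> h0 l0 hd lJ f0 m0 fm.
pose j0 := (Num.trunc (l / h)).+1; pose N := Num.trunc (d / h - 1).
have lh0 : 0 <= l / h by rewrite divr_ge0 // ltW.
have dh1 : 0 <= d / h - 1.
  by rewrite subr_ge0 ler_pdivlMr // mul1r; lra.
have /andP[a1 a2] := truncn_itv lh0; have /andP[b1 b2] := truncn_itv dh1.
rewrite -/N in b1 b2.
have c1 : l <= h * j0%:R.
  by rewrite mulrC -ler_pdivrMr // ltW.
have c2 : h * j0%:R <= l + h.
  rewrite /j0 -natr1 mulrDr mulr1 lerD2r mulrC -ler_pdivlMr //.
have c3 : h * N%:R <= d - h.
  by move: b1; rewrite lerBrDr ler_pdivlMr // mulrC mulrDr mulr1; lra.
have c4 : d - h <= h * N%:R + h.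
  move: b2; rewrite ltrBlDr ltr_pdivrMr // mulrC -natr1 => /ltW.
  by rewrite !mulrDr !mulr1; lra.
have jN (i : nat) : (i < N)%N -> l <= h * (j0 + i)%:R /\ h * (j0 + i)%:R <= l + d.
  move=> iN; have : h * i%:R <= h * N%:R by rewrite ler_wpM2l ?(ltW h0) // ler_nat ltnW.
  have : 0 <= h * i%:R by rewrite mulr_ge0 // ltW.
  by rewrite natrD mulrDr; split; lra.
have N0 : (0 < N)%N.
  have : 1 < N.+1%:R :> R.
    by apply: le_lt_trans b2; rewrite lerBrDr ler_pdivlMr //; lra.
  by rewrite ltr1n.
have jNJ : (j0 + N <= J)%N.
  have /jN[_ h1] : (N.-1 < N)%N by rewrite prednK.
  have h2 : h * (j0 + N.-1)%:R < h * J%:R := le_lt_trans h1 lJ.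
  by move: h2; rewrite (ltr_pM2l h0) ltr_nat -{2}(prednK N0) addnS.
have e : \sum_(j < J) f (h * j%:R) = \sum_(0 <= j < J) f (h * j%:R) by rewrite big_mkord.
rewrite e (@big_cat_nat _ _ _ (j0 + N)) //= (@big_cat_nat _ _ _ j0 0) ?leq_addr //=.
have s1 : 0 <= \sum_(0 <= j < j0) f (h * j%:R) by apply: sumr_ge0.
have s2 : 0 <= \sum_(j0 + N <= j < J) f (h * j%:R) by apply: sumr_ge0.
have s3 : N%:R * m <= \sum_(j0 <= j < j0 + N) f (h * j%:R).
  rewrite -{1}[j0]add0n big_addn addKn big_mkord.
  rewrite -[N in N%:R]card_ord mulr_natl -sumr_const; apply: ler_sum => i _.
  by have [k1 k2] := jN i (ltn_ord i); rewrite addnC; exact: fm.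
apply: (@le_trans _ _ (h * (N%:R * m))); last by rewrite ler_pM2l //; lra.
by rewrite mulrA ler_wpM2r //; lra.
Qed.

Lemma exp_monotone (f df : R -> R) (a t : R) : 0 <= t -> continuous f ->
  (forall r : R, 0 < r -> r < t -> is_derive r 1 f (df r)) ->
  (forall r : R, 0 <= r -> r <= t -> df r + a * f r <= 0) ->
  expR (a * t) * f t <= f 0.
Proof.
move=> t0 cf hf h.
have := @derive_le0_le R (fun s => expR (a * s) * f s)
  (fun s => expR (a * s) * df s + (a * expR (a * s)) * f s) 0 t t0.
rewrite mulr0 expR0 mul1r; apply.
- by move=> s; apply: cvgM; [exact: continuous_expRM|exact: cf].
- by move=> r r0 rt; apply: is_derive_mul; [exact: is_derive_expRM|exact: hf].
move=> r r0 rt; have -> : expR (a * r) * df r + a * expR (a * r) * f r =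
  expR (a * r) * (df r + a * f r) by ring.
by rewrite pmulr_rle0 ?expR_gt0 // h.
Qed.

End PathLipschitz.

Section Dynamics.
Context {R : realType} {n : nat}.
Variables (B : {bilinear 'cV[R]_n -> 'cV[R]_n -> 'cV[R]_n}) (A P1 P2 Pw : 'M[R]_n).
Hypothesis B_energy : forall x, dotv x (B x x) = 0.
Hypothesis sp : splitting B A P1 P2 Pw.
Implicit Types (x y : 'cV[R]_n).
Local Notation b := (drift B A).
Local Notation L x y := (linearization B x y).

Lemma proj1_le x : enorm (P1 *m x) <= enorm x.
Proof.
rewrite -(ler_pXn2r (n:=2)) ?nnegrE ?enorm_ge0 // (sp_pyth sp x).
by rewrite -addrA lerDl addr_ge0 // sqr_ge0.
Qed.

Lemma proj2_le x : enorm (P2 *m x) <= enorm x.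
Proof.
rewrite -(ler_pXn2r (n:=2)) ?nnegrE ?enorm_ge0 // (sp_pyth sp x) addrAC lerDr.
by rewrite addr_ge0 // sqr_ge0.
Qed.

Lemma projw_le x : enorm (Pw *m x) <= enorm x.
Proof.
rewrite -(ler_pXn2r (n:=2)) ?nnegrE ?enorm_ge0 // (sp_pyth sp x) lerDr.
by rewrite addr_ge0 // sqr_ge0.
Qed.

Lemma projw_cross x y : Pw *m L (P1 *m x) (P2 *m y) = L (P1 *m x) (P2 *m y).
Proof. by rewrite -[RHS](sp_add sp) (sp_cross1 sp) (sp_cross2 sp) !add0r. Qed.

Lemma linearization_bounded : exists2 C : R, 0 < C & forall x y, enorm (L x y) <= C * enorm x * enorm y.
Proof.
have [C C0 hC] := bilinear_bounded B; exists (2 * C); first by rewrite mulr_gt0.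
move=> x y; apply: le_trans (enormD _ _) _.
have h1 := hC x y; have h2 := hC y x.
by rewrite -!mulrA in h1 h2 *; rewrite (mulrC (enorm y)) in h2; lra.
Qed.

Lemma linearizationDl x y z : L (x + y) z = L x z + L y z.
Proof. by rewrite /linearization linearDl linearDr /= addrACA. Qed.

Lemma linearizationZl (a : R) x y : L (a *: x) y = a *: L x y.
Proof. by rewrite /linearization linearZl_LR linearZr_LR scalerDr. Qed.

Lemma linearizationBl x y z : L (x - y) z = L x z - L y z.
Proof. by rewrite -scaleN1r linearizationDl linearizationZl scaleN1r. Qed.

Lemma linearizationBr x y z : L x (y - z) = L x y - L x z.
Proof. by rewrite !(linearizationC B x) linearizationBl. Qed.

(** Since [B] vanishes on the diagonals of [V1] and [V2] and [A] vanishes on both, the interaction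
    of the two kernel components is the only term of the drift without a factor [Pw *m x]. *)
Lemma drift_split : exists2 C : R, 0 < C & forall x,
  enorm (b x - L (P1 *m x) (P2 *m x)) <= C * (enorm x + 1) * enorm (Pw *m x).
Proof.
have [C C0 hC] := bilinear_bounded B; have [D D0 hD] := mulmx_bounded A.
exists (4 * C + D); first by rewrite addr_gt0 // mulr_gt0.
move=> x; set v1 := P1 *m x; set v2 := P2 *m x; set w := Pw *m x.
have xE : x = v1 + v2 + w by rewrite (sp_add sp).
have -> : b x - L v1 v2 = B (v1 + v2) w + B w x - A *m w.
  have eA : A *m x = A *m w by rewrite {1}xE !mulmxDr (sp_A1 sp) (sp_A2 sp) !add0r.
  have eB : B x x = B (v1 + v2) (v1 + v2) + B (v1 + v2) w + B w x.
    by rewrite {1}xE linearDl /= {1}xE linearDr.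
  have eK : B (v1 + v2) (v1 + v2) = L v1 v2.
    by rewrite linearDl !linearDr /= (sp_B1 sp) (sp_B2 sp) add0r addr0.
  by rewrite /drift eA eB eK; apply/colP => i; rewrite !mxE; ring.
have k1 : enorm (v1 + v2) <= 2 * enorm x.
  apply: le_trans (enormD _ _) _; have := proj1_le x; have := proj2_le x.
  by rewrite -/v1 -/v2; lra.
have w0 : 0 <= enorm w by exact: enorm_ge0.
have x0 : 0 <= enorm x by exact: enorm_ge0.
have h1 : enorm (B (v1 + v2) w) <= 2 * C * enorm x * enorm w.
  by apply: le_trans (hC _ _) _; rewrite ler_wpM2r // (mulrC 2) -(mulrA C) ler_wpM2l // ltW.
have h2 : enorm (B w x) <= C * enorm x * enorm w.
  by apply: le_trans (hC _ _) _; rewrite mulrAC.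
have h3 := hD w.
apply: le_trans (enormB _ _) _; apply: le_trans (lerD (enormD _ _) (lexx _)) _.
have p1 : 0 <= C * enorm x * enorm w by rewrite !mulr_ge0 // ltW.
have p2 : 0 <= C * enorm w by rewrite !mulr_ge0 // ltW.
have p3 : 0 <= D * enorm x * enorm w by rewrite !mulr_ge0 // ltW.
lra.
Qed.

(** The energy is computed for [x - g], which is differentiable, and is controlled in both
    directions so that norms can neither grow nor shrink much. *)
Lemma path_energy : exists2 C : R, 0 < C & forall (g x : R -> 'cV[R]_n) (t : R), path_sol b g x -> 0 <= t ->
  (forall s : R, 0 <= s -> s <= t -> enorm (g s) <= 1) ->
  1 + enorm (x t - g t) ^+ 2 <= expR (C * t) * (1 + enorm (x 0) ^+ 2) /\
  1 + enorm (x 0) ^+ 2 <= expR (C * t) * (1 + enorm (x t - g t) ^+ 2).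
Proof.
have [C C0 hC] := bilinear_bounded B; have [D D0 hD] := mulmx_bounded A.
pose E := 6 * (2 * D + C).
exists E; first by rewrite !mulr_gt0 // addr_gt0 // mulr_gt0.
move=> g x t hx t0 hg; have [cx cg g0 _] := hx.
pose y s := x s - g s.
have cy : continuous y by exact: continuous_subv.
pose f s := 1 + dotv (y s) (1%:M *m y s).
pose df s := 0 + 2 * dotv (y s) (1%:M *m b (x s)).
have cf : continuous f.
  move=> s; apply: cvgD; first exact: cvg_cst.
  have h := @continuous_dotv R n _ _ cy (@continuous_mulmx_path R n 1%:M _ cy); exact: h.
have hf (r : R) : 0 < r -> r < t -> is_derive r 1 f (df r).
  move=> r0 rt; have h1 := coord_derive_quad (trmx1 _ _) (path_sol_derive hx r0).
  exact: (is_deriveD (@is_derive_cst _ R R 1 r 1) h1).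
have bound (r : R) : 0 <= r -> r <= t -> `|df r| <= E * f r.
  move=> r0 rt; rewrite /df /f add0r !mul1mx normrM (ger0_norm (ler0n _ 2)).
  have gr := hg r r0 rt.
  (* The cubic term [x . B(x, x)] vanishes; what is left of [B] is paired with [g], of norm at most
     [1], so the derivative of the energy is at most quadratic. *)
  have -> : dotv (y r) (b (x r)) = - dotv (x r) (A *m x r) - dotv (g r) (B (x r) (x r)) + dotv (g r) (A *m x r).
    by rewrite /y /drift dotvDl !dotvDr !dotvNl !dotvNr B_energy; ring.
  set X := enorm (x r); have X0 : 0 <= X by exact: enorm_ge0.
  have k1 : `|dotv (x r) (A *m x r)| <= D * X ^+ 2.
    by apply: le_trans (dotv_abs _ _) _; rewrite expr2 mulrCA ler_wpM2l.
  have G0 : 0 <= enorm (g r) by exact: enorm_ge0.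
  have k2 : `|dotv (g r) (B (x r) (x r))| <= C * X ^+ 2.
    apply: le_trans (dotv_abs _ _) _; rewrite -[leRHS]mul1r; apply: ler_pM => //; rewrite ?enorm_ge0 //.
    by rewrite expr2 mulrA.
  have k3 : `|dotv (g r) (A *m x r)| <= D * X.
    by apply: le_trans (dotv_abs _ _) _; rewrite -[leRHS]mul1r; apply: ler_pM => //; rewrite ?enorm_ge0.
  have k4 : X <= enorm (y r) + 1.
    rewrite /X -{1}(subrK (g r) (x r)); apply: le_trans (enormD _ _) _.
    by rewrite lerD2l.
  have Y0 : 0 <= enorm (y r) by exact: enorm_ge0.
  rewrite -enorm_sqr; set Y := enorm (y r) in k4 Y0 *.
  have k5 : X ^+ 2 <= 2 * Y ^+ 2 + 2.
    by have := sqr_ge0 (Y - 1); nra.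
  have k6 : X <= 1 + X ^+ 2 by have := sqr_ge0 (X - 1); nra.
  have k7 := ler_normD (- dotv (x r) (A *m x r) - dotv (g r) (B (x r) (x r))) (dotv (g r) (A *m x r)).
  have k8 := ler_normB (- dotv (x r) (A *m x r)) (dotv (g r) (B (x r) (x r))).
  rewrite normrN in k8.
  have k9 : D * X <= D * (1 + X ^+ 2) by rewrite ler_wpM2l // ltW.
  have k10 : (2 * D + C) * X ^+ 2 <= (2 * D + C) * (2 * Y ^+ 2 + 2).
    by rewrite ler_wpM2l // addr_ge0 ?mulr_ge0 // ltW.
  have k11 : 0 <= C * Y ^+ 2 by rewrite mulr_ge0 ?sqr_ge0 // ltW.
  have k12 : 0 <= D * Y ^+ 2 by rewrite mulr_ge0 ?sqr_ge0 // ltW.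
  rewrite /E; lra.
have f0E : f 0 = 1 + enorm (x 0) ^+ 2 by rewrite /f mul1mx -enorm_sqr /y g0 subr0.
have ftE : f t = 1 + enorm (x t - g t) ^+ 2 by rewrite /f mul1mx -enorm_sqr.
rewrite -f0E -ftE; split.
  have := @exp_monotone R f df (- E) t t0 cf hf.
  rewrite mulNr expRN mulrC ler_pdivrMr ?expR_gt0 // (mulrC (f 0)); apply.
  by move=> r r0 rt; have := bound r r0 rt; rewrite ler_norml => /andP[_]; lra.
have := @exp_monotone R (fun s => - f s) (fun s => - df s) E t t0.
rewrite mulrN lerN2; apply.
- by move=> s; apply: cvgN; exact: cf.
- by move=> r r0 rt; apply: is_deriveN; exact: hf.
by move=> r r0 rt; have := bound r r0 rt; rewrite ler_norml => /andP[]; lra.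
Qed.

(** Up to [t1] the exponential factor of [path_energy] is at most [2]; the lower bound [10] absorbs
    the constant [1] and the noise. *)
Lemma path_range : exists2 t1 : R, 0 < t1 & forall (g x : R -> 'cV[R]_n) (t : R), path_sol b g x -> 0 <= t -> t <= t1 ->
  (forall s : R, 0 <= s -> s <= t -> enorm (g s) <= 1) -> 10 <= enorm (x 0) ->
  enorm (x 0) <= 2 * enorm (x t) /\ enorm (x t) <= 2 * enorm (x 0).
Proof.
have [C C0 hC] := path_energy; exists (2 * C)^-1; first by rewrite invr_gt0 mulr_gt0.
move=> g x t hx t0 tt hg x0.
have [h1 h2] := hC g x t hx t0 hg.
have e2 : expR (C * t) <= 2.
  have k : C * t <= 2^-1.
    apply: (@le_trans _ _ (C * (2 * C)^-1)); first by rewrite ler_pM2l.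
    by rewrite invfM mulrCA mulfV ?mulr1 // gt_eqF.
  have k2 : 2^-1 <= expR (- (C * t)).
    by apply: le_trans (expR_ge1Dx _); lra.
  rewrite -[leLHS]invrK -expRN -[leRHS]invrK lef_pV2 ?posrE ?invr_gt0 ?expR_gt0 //.
set Y := enorm (x t - g t) in h1 h2; set X0 := enorm (x 0) in x0 h1 h2 *; set X := enorm (x t).
have Y0 : 0 <= Y by exact: enorm_ge0.
have gt1 : enorm (g t) <= 1 by apply: hg.
have k1 : X <= Y + 1.
  rewrite /X -{1}(subrK (g t) (x t)); apply: le_trans (enormD _ _) _.
  by rewrite lerD2l.
have k2 : Y <= X + 1 by apply: le_trans (enormB _ _) _; rewrite lerD2l.
have {}h1 : 1 + Y ^+ 2 <= 2 * (1 + X0 ^+ 2).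
  by apply: le_trans h1 _; rewrite ler_wpM2r // addr_ge0 // sqr_ge0.
have {}h2 : 1 + X0 ^+ 2 <= 2 * (1 + Y ^+ 2).
  by apply: le_trans h2 _; rewrite ler_wpM2r // addr_ge0 // sqr_ge0.
split.
  have : X0 / 2 + 1 <= Y.
    rewrite leNgt; apply/negP => lt.
    have : Y ^+ 2 < (X0 / 2 + 1) ^+ 2 by rewrite ltrXn2r ?nnegrE //; lra.
    by nra.
  by lra.
have : Y <= 2 * X0 - 1.
  rewrite leNgt; apply/negP => lt.
  have : (2 * X0 - 1) ^+ 2 < Y ^+ 2 by rewrite ltrXn2r ?nnegrE //; lra.
  by nra.
by lra.
Qed.

(** A large interaction at time [a] would persist for a time [N^-1], since the kernel components
    move only by [O (S)] in that time. It would then push [Pw x] by about [N^-1] times its size,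
    whereas [Pw x] stays below [S]. *)
Lemma cross_bounded : exists2 C : R, 0 < C & forall (g x : R -> 'cV[R]_n) (N T S : R), path_sol b g x ->
  1 <= N -> N^-1 <= T -> 1 <= S ->
  (forall r : R, 0 <= r -> r <= T ->
     [/\ enorm (g r) <= 1, enorm (x r) <= 16 * N & enorm (Pw *m x r) <= S]) ->
  forall a : R, 0 <= a -> a <= T -> enorm (L (P1 *m x a) (P2 *m x a)) <= C * N * S.
Proof.
have [C1 C10 hC1] := drift_split; have [C2 C20 hC2] := linearization_bounded.
pose be := 17 * C1; pose d := be + 2; pose th := be + C2 * 16 * (2 * d).
have be0 : 0 < be by rewrite mulr_gt0.
have d0 : 0 < d by rewrite addr_gt0.
have th0 : 0 < th by rewrite addr_gt0 // !mulr_gt0.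
exists (th + 4); first by rewrite addr_gt0.
move=> g x N T S hx N1 NT S1 H a a0 aT.
have N0 : 0 < N by lra.
have Ni0 : 0 < N^-1 by rewrite invr_gt0.
have NN : N^-1 * N = 1 by rewrite mulVf // gt_eqF.
have S0 : 0 <= S by lra.
have hL r : 0 <= r -> r <= T -> enorm (b (x r) - L (P1 *m x r) (P2 *m x r)) <= be * N * S.
  move=> r0 rT; have [_ xr wr] := H r r0 rT.
  apply: le_trans (hC1 _) _.
  apply: (@le_trans _ _ (C1 * (17 * N) * S)).
    apply: ler_pM => //; rewrite ?enorm_ge0 ?mulr_ge0 ?addr_ge0 ?enorm_ge0 ?(ltW C10) //.
    by rewrite ler_pM2l //; lra.
  by rewrite /be le_eqVlt; apply/orP; left; apply/eqP; ring.
(* Left end of a window of length [N^-1] that contains [a] and stays inside [[0, T]]. *)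
pose l := Num.min a (T - N^-1).
have l0 : 0 <= l by rewrite le_min a0 subr_ge0.
have la : l <= a by rewrite ge_min lexx.
have lT : l + N^-1 <= T by rewrite -lerBrDr ge_min lexx orbT.
have al : a <= l + N^-1.
  by rewrite -lerBlDr le_min lerBlDr lerDl (ltW Ni0) /= lerB.
(* The interaction has no component in [V1] or [V2], so these projections of the drift are of size
   [N S] rather than [N ^ 2]. The noise adds [2], absorbed by [1 <= S]. *)
have mv (P : 'M[R]_n) : (forall z : 'cV[R]_n, enorm (P *m z) <= enorm z) ->
    (forall y z : 'cV[R]_n, P *m L (P1 *m y) (P2 *m z) = 0) ->
    forall r : R, l <= r -> r <= l + N^-1 -> enorm (P *m x r - P *m x a) <= d * S.
  move=> Ple PL r lr ru.
  have r0 : 0 <= r by exact: le_trans lr.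
  have rT : r <= T by exact: le_trans lT.
  have hP s : 0 <= s -> s <= T -> enorm (P *m b (x s)) <= be * N * S.
    move=> s0 sT; apply: le_trans (hL s s0 sT).
    by rewrite -[P *m b _]subr0 -(PL (x s) (x s)) -mulmxBr.
  have := path_sol_lipschitz hx hP a0 aT r0 rT.
  have -> : P *m x r - P *m x a = P *m ((x r - g r) - (x a - g a)) + P *m (g r - g a).
    by rewrite -mulmxBr -mulmxDr; congr (_ *m _); apply/colP => i; rewrite !mxE; ring.
  move=> h; apply: le_trans (enormD _ _) _.
  have ra : `|r - a| <= N^-1 by rewrite ler_norml; apply/andP; split; lra.
  have h1 : `|r - a| * (be * N * S) <= be * S.
    apply: (@le_trans _ _ (N^-1 * (be * N * S))).
      by rewrite ler_wpM2r // !mulr_ge0 // ltW.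
    have -> : N^-1 * (be * N * S) = (N^-1 * N) * (be * S) by ring.
    by rewrite NN mul1r.
  have [ga _ _] := H a a0 aT; have [gr _ _] := H r r0 rT.
  have h2 := le_trans (Ple (g r - g a)) (enormB _ _).
  rewrite /d mulrDl; lra.
have m1 := mv P1 proj1_le (sp_cross1 sp); have m2 := mv P2 proj2_le (sp_cross2 sp).
set q := L (P1 *m x a) (P2 *m x a).
have bq r : l <= r -> r <= l + N^-1 -> enorm (b (x r) - q) <= th * N * S.
  move=> lr ru.
  have r0 : 0 <= r by exact: le_trans lr.
  have rT : r <= T by exact: le_trans lT.
  have -> : b (x r) - q = (b (x r) - L (P1 *m x r) (P2 *m x r)) +
     (L (P1 *m x r - P1 *m x a) (P2 *m x r) + L (P1 *m x a) (P2 *m x r - P2 *m x a)).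
    rewrite linearizationBl linearizationBr /q; apply/colP => i; rewrite !mxE; ring.
  apply: le_trans (enormD _ _) _.
  have [_ xr _] := H r r0 rT; have [_ xa _] := H a a0 aT.
  have k1 : enorm (L (P1 *m x r - P1 *m x a) (P2 *m x r)) <= C2 * (d * S) * (16 * N).
    apply: le_trans (hC2 _ _) _; apply: ler_pM; rewrite ?mulr_ge0 ?enorm_ge0 ?(ltW C20) //.
      by rewrite ler_pM2l // m1.
    exact: le_trans (proj2_le _) xr.
  have k2 : enorm (L (P1 *m x a) (P2 *m x r - P2 *m x a)) <= C2 * (16 * N) * (d * S).
    apply: le_trans (hC2 _ _) _; apply: ler_pM; rewrite ?mulr_ge0 ?enorm_ge0 ?(ltW C20) //.
      by rewrite ler_pM2l // (le_trans (proj1_le _) xa).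
    exact: m2.
  have k3 := hL r r0 rT; have k4 := enormD (L (P1 *m x r - P1 *m x a) (P2 *m x r)) (L (P1 *m x a) (P2 *m x r - P2 *m x a)).
  have -> : th * N * S = be * N * S + (C2 * (d * S) * (16 * N) + C2 * (16 * N) * (d * S)).
    by rewrite /th; ring.
  lra.
have lu : l <= l + N^-1 by rewrite lerDl ltW.
have inc := @path_sol_increment R n b g x Pw q l (l + N^-1) (th * N * S) hx l0 lu.
have {}inc : enorm (Pw *m (x (l + N^-1) - g (l + N^-1) - (x l - g l)) - (l + N^-1 - l) *: q) <=
  (l + N^-1 - l) * (th * N * S).
  apply: inc => r lr ru; rewrite -[q]projw_cross -mulmxBr.
  exact: le_trans (projw_le _) (bq r lr ru).
have e1 : l + N^-1 - l = N^-1 by rewrite addrC addKr.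
rewrite e1 in inc; have e2 : N^-1 * (th * N * S) = th * S.
  have -> : N^-1 * (th * N * S) = (N^-1 * N) * (th * S) by ring.
  by rewrite NN mul1r.
rewrite e2 in inc.
have [gl _ wl] := H l l0 (le_trans lu lT); have [gu _ wu] := H _ (le_trans l0 lu) lT.
have : enorm (N^-1 *: q) <= (th + 4) * S.
  have -> : N^-1 *: q = Pw *m x (l + N^-1) - Pw *m x l - Pw *m (g (l + N^-1) - g l)
     - (Pw *m (x (l + N^-1) - g (l + N^-1) - (x l - g l)) - N^-1 *: q).
    by rewrite !mulmxBr; apply/colP => i; rewrite !mxE; ring.
  apply: le_trans (enormB _ _) _; apply: le_trans (lerD (enormB _ _) (lexx _)) _.
  have k1 := enormB (Pw *m x (l + N^-1)) (Pw *m x l).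
  have k2 := le_trans (projw_le (g (l + N^-1) - g l)) (enormB _ _).
  lra.
rewrite enormZ gtr0_norm // mulrC ler_pdivrMr // => h.
by rewrite mulrAC.
Qed.

End Dynamics.

(** * Exponential growth of a perturbed linear equation *)

Section Growth.
Context {R : realType} {n : nat}.
Implicit Types (y u : R -> 'cV[R]_n) (p q : 'cV[R]_n) (m Q : 'M[R]_n).

(** Expand the nonnegative form [Q] at [a x - e], and compare [Q] with the Euclidean square through
    [c0]. *)
Lemma quad_perturbation Q (c0 a : R) (x e : 'cV[R]_n) : Q^T = Q -> 0 < c0 -> 0 < a ->
  (forall z : 'cV[R]_n, c0 * dotv z z <= dotv z (Q *m z) /\ dotv z (Q *m z) <= dotv z z) ->
  enorm e <= a * enorm x ->
  2 * dotv x (Q *m e) <= a * (1 + c0^-1) * dotv x (Q *m x).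
Proof.
move=> sQ c00 a0 hQ he.
have [q1 _] := hQ x; have [_ q2] := hQ e; have [q3 _] := hQ (a *: x - e).
have Q0 : 0 <= dotv (a *: x - e) (Q *m (a *: x - e)).
  by apply: le_trans q3; rewrite mulr_ge0 ?dotvv_ge0 // ltW.
have sym : dotv e (Q *m x) = dotv x (Q *m e) by rewrite dotv_tr sQ dotvC.
move: Q0; rewrite mulmxBr -scalemxAr !(dotvDl, dotvDr, dotvNl, dotvNr, dotvZl, dotvZr) sym => Q0.
have e2 : dotv e e <= a ^+ 2 * dotv x x.
  by rewrite -!enorm_sqr -exprMn ler_sqr ?nnegrE ?enorm_ge0 // mulr_ge0 ?enorm_ge0 // ltW.
have q4 : dotv x x <= c0^-1 * dotv x (Q *m x) by rewrite mulrC ler_pdivlMr // mulrC.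
have q5 : a ^+ 2 * dotv x x <= a ^+ 2 * (c0^-1 * dotv x (Q *m x)) by rewrite ler_wpM2l ?sqr_ge0.
rewrite -(ler_pM2l a0).
have -> : a * (a * (1 + c0^-1) * dotv x (Q *m x)) =
  a * (a * dotv x (Q *m x)) + a ^+ 2 * (c0^-1 * dotv x (Q *m x)) by ring.
lra.
Qed.

Lemma dir_perturbation p q (a : R) (x e : 'cV[R]_n) : dotv p p + dotv q q = 1 -> 0 <= a ->
  enorm e <= a * enorm x ->
  - (a * dotv x x) <= dotv p x * dotv p e + dotv q x * dotv q e.
Proof.
move=> pq a0 he.
have k (z : 'cV[R]_n) : - (a * dotv x x * dotv z z) <= dotv z x * dotv z e.
  have h1 := dotv_abs z x; have h2 := dotv_abs z e.
  have h3 : `|dotv z x * dotv z e| <= a * dotv x x * dotv z z.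
    rewrite normrM; apply: (@le_trans _ _ ((enorm z * enorm x) * (enorm z * (a * enorm x)))).
      apply: ler_pM => //; apply: le_trans h2 _; by rewrite ler_wpM2l ?enorm_ge0.
    by rewrite -!enorm_sqr le_eqVlt; apply/orP; left; apply/eqP; ring.
  by move: h3; rewrite ler_norml => /andP[].
have hp := k p; have hq := k q.
have -> : a * dotv x x = a * dotv x x * dotv p p + a * dotv x x * dotv q q.
  by rewrite -mulrDr pq mulr1.
lra.
Qed.

(* [phi] measures the component along the most unstable directions and [psi]
   bounds the whole vector; they grow at rates [2 r La] and [2 r (La + 2 ep)]. *)
Lemma unstable_growth y u m Q p q (r a La ep c0 T ka : R) :
  continuous y -> (forall t : R, 0 < t -> coord_derive y t (u t)) ->
  0 <= T -> 0 <= r -> 0 < a -> 0 < c0 -> 0 <= ep ->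
  (forall t : R, 0 <= t -> t <= T -> enorm (u t - r *: (m *m y t)) <= a * enorm (y t)) ->
  dotv p p + dotv q q = 1 ->
  (forall x : 'cV[R]_n, dotv p x * dotv p (m *m x) + dotv q x * dotv q (m *m x)
     = La * (dotv p x ^+ 2 + dotv q x ^+ 2)) ->
  Q^T = Q ->
  (forall x : 'cV[R]_n, [/\ dotv x (Q *m (m *m x)) <= (La + ep) * dotv x (Q *m x),
     c0 * dotv x x <= dotv x (Q *m x) & dotv x (Q *m x) <= dotv x x]) ->
  a * (1 + c0^-1) <= 2 * r * ep ->
  T * (2 * a / c0 * expR (4 * r * ep * T)) <= ka / 2 ->
  ka * enorm (y 0) ^+ 2 <= dotv p (y 0) ^+ 2 + dotv q (y 0) ^+ 2 ->
  ka / 2 * expR (2 * r * La * T) * enorm (y 0) ^+ 2 <= enorm (y T) ^+ 2.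
Proof.
move=> cy hy T0 r0 a0 c00 ep0 hu pq hm sQ hQ ha hT h0.
set e := fun t => u t - r *: (m *m y t).
have uE t : u t = r *: (m *m y t) + e t by rewrite /e addrC subrK.
pose psi t := dotv (y t) (Q *m y t).
pose phi t := dotv p (y t) ^+ 2 + dotv q (y t) ^+ 2.
have cpsi : continuous psi by apply: continuous_dotv => //; exact: continuous_mulmx_path.
have cdot (z : 'cV[R]_n) : continuous (fun s => dotv z (y s)).
  by apply: continuous_dotv => // s; exact: cvg_cst.
have cphi : continuous phi.
  have cd z : continuous (fun s => dotv z (y s) ^+ 2).
    by move=> s; apply: cvgM; exact: cdot.
  by move=> s; apply: cvgD; exact: cd.
have psi_bound (t : R) : 0 <= t -> t <= T -> expR (- (2 * r * (La + 2 * ep)) * t) * psi t <= psi 0.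
  move=> t0 tT.
  apply: (@exp_monotone R psi (fun t => 2 * dotv (y t) (Q *m u t)) _ t t0 cpsi).
    by move=> s s0 _; apply: coord_derive_quad => //; exact: hy.
  move=> s s0 st; have sT := le_trans st tT.
  have [k1 k2 k3] := hQ (y s).
  have k4 : 2 * dotv (y s) (Q *m e s) <= a * (1 + c0^-1) * psi s.
    apply: quad_perturbation => // [z|]; first by have [] := hQ z.
    exact: hu.
  rewrite uE mulmxDr -scalemxAr dotvDr dotvZr.
  have k5 : r * dotv (y s) (Q *m (m *m y s)) <= r * ((La + ep) * psi s) by rewrite ler_wpM2l.
  have p0 : 0 <= psi s by apply: le_trans k2; rewrite mulr_ge0 ?dotvv_ge0 // ltW.
  have k6 : a * (1 + c0^-1) * psi s <= 2 * r * ep * psi s by rewrite ler_wpM2r.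
  lra.
have cst0 : 0 <= 2 * a / c0 by rewrite divr_ge0 ?mulr_ge0 // ltW.
(* Bounds the loss per unit time in [expR (- 2 r La t) * phi t]: the perturbation costs at most
   [2 a |y| ^ 2], and [|y| ^ 2 <= psi / c0], where [psi] outgrows the rate [2 r La] by a factor at
   most [expR (4 r ep T)]. *)
pose M := 2 * a / c0 * expR (4 * r * ep * T) * enorm (y 0) ^+ 2.
pose dphi t := 2 * (dotv p (y t) * dotv p (u t) + dotv q (y t) * dotv q (u t)).
have dphiE (s : R) : 0 < s -> is_derive s 1 phi (dphi s).
  move=> s0.
  have dd z : is_derive s 1 (fun s => dotv z (y s)) (dotv z (u s)).
    by have := coord_derive_dot (coord_derive_cst z s) (hy _ s0); rewrite dotv0l addr0.
  have := is_deriveD (is_derive_mul (dd p) (dd p)) (is_derive_mul (dd q) (dd q)).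
  set v := (X in is_derive s 1 _ X -> _); have -> : dphi s = v by rewrite /dphi /v; ring.
  exact.
(* With the correction [M t] the rescaled [phi] is nondecreasing; by assumption [M T] uses up at
   most half of its initial value. *)
have main : - (expR (- (2 * r * La) * T) * phi T + M * T) <= - (expR (- (2 * r * La) * 0) * phi 0 + M * 0).
  apply: (@derive_le0_le R (fun t => - (expR (- (2 * r * La) * t) * phi t + M * t))
    (fun t => - ((expR (- (2 * r * La) * t) * dphi t + (- (2 * r * La) * expR (- (2 * r * La) * t)) * phi t) + M)) 0 T T0).
  - move=> s; apply: cvgN; apply: cvgD; first by apply: cvgM; [exact: continuous_expRM|exact: cphi].
    by apply: cvgM; [exact: cvg_cst|exact: cvg_id].
  - move=> s s0 _; apply: is_deriveN; apply: is_deriveD.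
      apply: is_derive_mul; [exact: is_derive_expRM|exact: dphiE].
    have := is_derive_mul (@is_derive_cst _ R R M s 1) (is_derive_id s 1).
    by rewrite mul0r addr0 mulr1.
  move=> s s0 sT.
  have he := hu s s0 sT; rewrite -/(e s) in he.
  have k1 := dir_perturbation pq (ltW a0) he.
  have k2 : dphi s = 2 * r * La * phi s + 2 * (dotv p (y s) * dotv p (e s) + dotv q (y s) * dotv q (e s)).
    have h1 : dphi s = 2 * (r * (dotv p (y s) * dotv p (m *m y s) + dotv q (y s) * dotv q (m *m y s)) +
       (dotv p (y s) * dotv p (e s) + dotv q (y s) * dotv q (e s))).
      by rewrite /dphi !uE !dotvDr !dotvZr; ring.
    by rewrite h1 hm /phi; ring.
  have [_ k3 _] := hQ (y s).
  have k4 : dotv (y s) (y s) <= c0^-1 * psi s by rewrite mulrC ler_pdivlMr // mulrC.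
  have [_ _ k5] := hQ (y 0); rewrite -enorm_sqr in k5.
  have k6 := psi_bound s s0 sT.
  set E := expR (- (2 * r * La) * s).
  have k7 : E * psi s <= expR (4 * r * ep * T) * enorm (y 0) ^+ 2.
    have -> : E = expR (4 * r * ep * s) * expR (- (2 * r * (La + 2 * ep)) * s).
      by rewrite -expRD; congr expR; ring.
    rewrite -mulrA; apply: ler_pM; rewrite ?expR_ge0 //.
    - rewrite mulr_ge0 ?expR_ge0 //; apply: le_trans k3.
      by rewrite mulr_ge0 ?dotvv_ge0 // ltW.
    - by rewrite ler_expR ler_wpM2l // !mulr_ge0.
    exact: le_trans k5.
  have k8 : 2 * a * (E * dotv (y s) (y s)) <= M.
    apply: (@le_trans _ _ (2 * a * (E * (c0^-1 * psi s)))).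
      by rewrite ler_pM2l ?mulr_gt0 // ler_wpM2l // expR_ge0.
    have -> : 2 * a * (E * (c0^-1 * psi s)) = (2 * a / c0) * (E * psi s) by ring.
    by rewrite /M -(mulrA (2 * a / c0)) ler_wpM2l.
  have k9 : - (2 * a * (E * dotv (y s) (y s))) <= E * (2 * (dotv p (y s) * dotv p (e s) + dotv q (y s) * dotv q (e s))).
    have -> : - (2 * a * (E * dotv (y s) (y s))) = E * (2 * - (a * dotv (y s) (y s))) by ring.
    by rewrite ler_wpM2l ?expR_ge0 // ler_pM2l.
  rewrite k2 mulrDr; lra.
rewrite mulr0 expR0 mul1r mulr0 addr0 lerN2 in main.
have k1 : phi T <= enorm (y T) ^+ 2.
  have k (z : 'cV[R]_n) : dotv z (y T) ^+ 2 <= dotv z z * enorm (y T) ^+ 2.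
    rewrite -enorm_sqr -exprMn -ler_sqrt ?sqr_ge0 // !sqrtr_sqr.
    by apply: le_trans (dotv_abs _ _) _; rewrite ler_norm.
  apply: le_trans (lerD (k p) (k q)) _; by rewrite -mulrDl pq mul1r.
have k2 : M * T <= ka / 2 * enorm (y 0) ^+ 2.
  have -> : M * T = T * (2 * a / c0 * expR (4 * r * ep * T)) * enorm (y 0) ^+ 2 by rewrite /M; ring.
  by rewrite ler_wpM2r ?sqr_ge0.
have k3 : ka / 2 * enorm (y 0) ^+ 2 <= expR (- (2 * r * La) * T) * phi T.
  have : ka * enorm (y 0) ^+ 2 <= phi 0 by exact: h0.
  lra.
apply: le_trans k1; rewrite mulrAC -ler_pdivlMr ?expR_gt0 //.
by rewrite -expRN (mulrC (phi T)) -mulNr.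
Qed.

Lemma coord_increment y u (s t c : R) : continuous y ->
  (forall r : R, 0 < r -> coord_derive y r (u r)) -> 0 <= s -> s <= t ->
  (forall r : R, s <= r -> r <= t -> enorm (u r) <= c) -> enorm (y t - y s) <= (t - s) * c.
Proof.
move=> cy hy s0 st hc; set w := y t - y s.
have [w0|w0] := eqVneq (enorm w) 0.
  by rewrite w0 mulr_ge0 ?subr_ge0 // (le_trans (enorm_ge0 _) (hc s _ _)).
have wp : 0 < enorm w by rewrite lt0r w0 enorm_ge0.
have cf : continuous (fun r => dotv w (y r)).
  by apply: continuous_dotv => // r; exact: cvg_cst.
have df (r : R) : s < r -> r < t -> is_derive r 1 (fun r => dotv w (y r)) (dotv w (u r)).
  move=> sr _; have := coord_derive_dot (coord_derive_cst w r) (hy r (le_lt_trans s0 sr)).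
  by rewrite dotv0l addr0.
have [r /andP[sr rt] e] := MVT_continuous st cf df.
have : enorm w ^+ 2 <= (t - s) * (enorm w * c).
  rewrite enorm_sqr {2}/w dotvDr dotvNr e mulrC ler_wpM2l ?subr_ge0 //.
  by apply: le_trans (dotv_le _ _) _; rewrite ler_wpM2l ?enorm_ge0 ?hc.
by rewrite expr2 mulrCA ler_pM2l.
Qed.

Lemma decay_ratio (k : nat) : (11 <= k)%N ->
  (k.+2%:R ^+ 2 * (3 / 4) ^+ k.+1 <= 9 / 10 * (k.+1%:R ^+ 2 * (3 / 4) ^+ k) :> R).
Proof.
move=> hk; have k1 : 12 <= k.+1%:R :> R by rewrite ler_nat.
have e : (3 / 4 : R) ^+ k.+1 = 3 / 4 * (3 / 4) ^+ k by rewrite exprS.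
have p : 0 <= (3 / 4 : R) ^+ k by rewrite exprn_ge0 // divr_ge0.
rewrite e -(natr1 k.+1); set x := k.+1%:R in k1 *; set z := (3 / 4) ^+ k in p *.
have h : (x + 1) ^+ 2 * (3 / 4) <= 9 / 10 * x ^+ 2 by nra.
have := ler_wpM2r p h; lra.
Qed.

(** All largeness conditions on [k] in [pair_exit] are reduced to this one sequence. It contracts by
    [9 / 10] at each step from [k = 11] on, where it is at most [12 ^ 2]. *)
Lemma polynomial_decay (C : R) : exists k0 : nat, forall k, (k0 <= k)%N ->
  C * (k.+1%:R ^+ 2 * (3 / 4) ^+ k) <= 1.
Proof.
have bnd (j : nat) : (j + 11).+1%:R ^+ 2 * (3 / 4) ^+ (j + 11) <= 144 * (9 / 10) ^+ j :> R.
  elim: j => [|j IH].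
    rewrite add0n expr0 mulr1 -[leRHS]mulr1; apply: ler_pM; rewrite ?exprn_ge0 ?divr_ge0 //.
      by rewrite -natrX ler_nat.
    by apply: exprn_ile1; rewrite ?divr_ge0 //; lra.
  rewrite addSn; apply: le_trans (decay_ratio _) _; first exact: leq_addl.
  by rewrite [in leRHS]exprS (mulrCA 144) ler_pM2l // divr_gt0.
have lt1 : `|9 / 10 : R| < 1 by rewrite ger0_norm ?divr_ge0 //; lra.
have C1 : 0 < (144 * (`|C| + 1))^-1 by rewrite invr_gt0 mulr_gt0 // ltr_wpDl.
have /cvgrPdist_lt /(_ _ C1) [j0 _ hj] := cvg_expr lt1.
exists (j0 + 11)%N => k kj.
have k11 : (11 <= k)%N by apply: leq_trans kj; exact: leq_addl.
have := hj (k - 11)%N; rewrite /= sub0r normrN => /(_ _).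
have jk : (j0 <= k - 11)%N by rewrite -(leq_add2r 11) subnK.
move=> /(_ jk) h; have := bnd (k - 11)%N; rewrite subnK // => h2.
set s := _ * _ in h2 *.
have s0 : 0 <= s by rewrite mulr_ge0 ?sqr_ge0 // exprn_ge0 // divr_ge0.
have {}h : (9 / 10) ^+ (k - 11) <= (144 * (`|C| + 1))^-1.
  by apply: le_trans (ltW h); rewrite ler_norm.
have h3 : s <= (`|C| + 1)^-1.
  apply: le_trans h2 _; apply: le_trans (ler_wpM2l _ h) _ => //.
  by rewrite invfM mulrA mulfV ?mul1r // pnatr_eq0.
apply: (@le_trans _ _ (`|C| * s)); first by rewrite ler_wpM2r // ler_norm.
apply: (@le_trans _ _ ((`|C| + 1) * s)); first by rewrite ler_wpM2r // lerDl.
apply: le_trans (ler_wpM2l _ h3) _; first by rewrite addr_ge0.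
by rewrite mulfV // gt_eqF // ltr_wpDl.
Qed.

End Growth.

(** * The difference of two solutions *)

Section Dynamics.
Context {R : realType} {n : nat}.
Variables (B : {bilinear 'cV[R]_n -> 'cV[R]_n -> 'cV[R]_n}) (A : 'M[R]_n).
Implicit Types (x y : 'cV[R]_n).
Local Notation b := (drift B A).
Local Notation L x y := (linearization B x y).

(** Polarization of a quadratic map: the difference is exactly the linearization at the midpoint,
    without remainder. *)
Lemma drift_sub x y : b x - b y = L (2^-1 *: (x + y)) (x - y) - A *m (x - y).
Proof.
have e1 z : B z (x - y) = B z x - B z y by exact: linearBr.
have e2 z : B (x - y) z = B x z - B y z by exact: linearBl.
have e3 z : B z (x + y) = B z x + B z y by exact: linearDr.
have e4 z : B (x + y) z = B x z + B y z by exact: linearDl.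
rewrite linearizationZl /drift /linearization e1 e2 !e3 !e4 mulmxBr.
by apply/colP => i; rewrite !mxE; field.
Qed.

Lemma drift_lip : exists2 C : R, 0 < C & forall (N : R) x y, 1 <= N ->
  enorm x <= 16 * N -> enorm y <= 16 * N -> enorm (b x - b y) <= C * N * enorm (x - y).
Proof.
have [C C0 hC] := linearization_bounded B; have [D D0 hD] := mulmx_bounded A.
exists (16 * C + D); first by rewrite addr_gt0 // mulr_gt0.
move=> N x y N1 hx hy; rewrite drift_sub.
apply: le_trans (enormB _ _) _.
have h1 := hC (2^-1 *: (x + y)) (x - y); have h2 := hD (x - y).
have d0 : 0 <= enorm (x - y) by exact: enorm_ge0.
have h3 : enorm (2^-1 *: (x + y)) <= 16 * N.
  rewrite enormZ ger0_norm // ?invr_ge0 //; have := enormD x y; lra.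
have h4 : C * enorm (2^-1 *: (x + y)) * enorm (x - y) <= C * (16 * N) * enorm (x - y).
  by rewrite ler_wpM2r // ler_pM2l.
have h5 : D * enorm (x - y) <= D * N * enorm (x - y).
  by rewrite ler_wpM2r // -{1}[D]mulr1 ler_pM2l.
lra.
Qed.

(** Over a small fraction of the time [1 / N], two paths with different noises differ by their
    initial difference and the difference of the noises, up to a small relative error. *)
Lemma short_time : exists2 C : R, 0 < C & forall (g g' x x' : R -> 'cV[R]_n) (N h G : R),
  path_sol b g x -> path_sol b g' x' -> 1 <= N -> 0 <= h -> C * N * h <= 4^-1 -> 0 < G ->
  (forall r : R, 0 <= r -> r <= h ->
     [/\ enorm (x r) <= 16 * N, enorm (x' r) <= 16 * N & enorm (g r - g' r) <= G]) ->
  (forall r : R, 0 <= r -> r <= h -> enorm (x r - x' r) <= 2 * (enorm (x 0 - x' 0) + G)) /\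
  enorm ((x h - x' h) - (x 0 - x' 0) - (g h - g' h)) <=
    2 * (C * N * h) * (enorm (x 0 - x' 0) + G).
Proof.
have [C C0 hC] := drift_lip; exists C => // g g' x x' N h G hx hx' N1 h0 Nh G0 H.
have [cx cg g0 dx] := hx; have [cx' cg' g'0 dx'] := hx'.
set D := enorm (x 0 - x' 0) + G.
have d0 : 0 <= enorm (x 0 - x' 0) by exact: enorm_ge0.
have D0 : 0 < D by rewrite ltr_wpDl.
pose y s := (x s - g s) - (x' s - g' s).
have cy : continuous y by apply: continuous_subv; apply: continuous_subv.
have hy (r : R) : 0 < r -> coord_derive y r (b (x r) - b (x' r)).
  move=> r0 i; have := is_deriveB (dx r r0 i) (dx' r r0 i).
  rewrite !mxE (_ : (fun _ => _) - _ = (fun s => y s i 0)) //.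
  by apply/funext => s; rewrite !fctE /y !mxE; ring.
have N0 : 0 <= C * N by rewrite mulr_ge0 ?(ltW C0) //; lra.
have inc (s : R) : 0 <= s -> s <= h -> (forall r : R, 0 <= r -> r <= s -> enorm (x r - x' r) <= 2 * D) ->
    enorm ((x s - x' s) - (x 0 - x' 0) - (g s - g' s)) <= 2 * (C * N * s) * D.
  move=> s0 sh hr.
  have -> : (x s - x' s) - (x 0 - x' 0) - (g s - g' s) = y s - y 0.
    by rewrite /y g0 g'0; apply/colP => i; rewrite !mxE; ring.
  have -> : 2 * (C * N * s) * D = (s - 0) * (C * N * (2 * D)) by ring.
  apply: (coord_increment cy hy (lexx 0) s0) => r r0 rs.
  have [h1 h2 _] := H r r0 (le_trans rs sh).
  apply: le_trans (hC N _ _ N1 h1 h2) _; rewrite ler_wpM2l //; exact: hr.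
have cd := continuous_enorm_path (continuous_subv cx cx').
have boot : forall s : R, 0 <= s -> s <= h -> enorm (x s - x' s) < 2 * D.
  apply: (continuous_bootstrap h0 cd); first by rewrite /D; lra.
  move=> s s0 sh hr; have h1 := inc s s0 sh hr.
  have [_ _ h2] := H s s0 sh.
  have h3 : 2 * (C * N * s) * D <= 2 * 4^-1 * D.
    rewrite ler_pM2r // ler_pM2l //; apply: le_trans Nh; by rewrite ler_wpM2l.
  have -> : x s - x' s = ((x s - x' s) - (x 0 - x' 0) - (g s - g' s)) + (x 0 - x' 0) + (g s - g' s).
    by apply/colP => i; rewrite !mxE; ring.
  apply: le_lt_trans (enormD _ _) _; apply: le_lt_trans (lerD (enormD _ _) (lexx _)) _.
  have : D = enorm (x 0 - x' 0) + G by []. lra.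
split; first by move=> r r0 rh; apply/ltW/boot.
by apply: inc => // r r0 rh; apply/ltW/boot.
Qed.

End Dynamics.

(** * Paths that stay close to the kernel *)

Section Quiet.
Context {R : realType} {n : nat}.
Variables (B : {bilinear 'cV[R]_n -> 'cV[R]_n -> 'cV[R]_n}) (A : 'M[R]_n).
Implicit Types (x y v : 'cV[R]_n).
Local Notation b := (drift B A).
Local Notation L x y := (linearization B x y).

Definition quiet (Pw : 'M[R]_n) (N T S : R) (g x : R -> 'cV[R]_n) : Prop :=
  forall r : R, 0 <= r -> r <= T ->
    [/\ enorm (g r) <= 1, enorm (x r) <= 16 * N & enorm (Pw *m x r) <= S].

(** Points of [V1] are equilibria of the noiseless equation and serve as reference paths. *)
Lemma kernel_path P1 P2 Pw v : splitting B A P1 P2 Pw -> P1 *m v = v ->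
  path_sol b (fun=> 0) (fun=> v).
Proof.
move=> sp Pv; split => //.
- by move=> s; exact: cvg_cst.
- by move=> s; exact: cvg_cst.
have e : b v = 0 by rewrite /drift -Pv (sp_B1 sp) (sp_A1 sp) subr0.
by move=> t t0 i; rewrite e [(0 : 'cV_n) i 0]mxE; exact: is_derive_cst.
Qed.

Lemma driftP_bounded P1 P2 Pw : splitting B A P1 P2 Pw -> exists2 C : R, 0 < C &
  forall (N S : R) x, 1 <= N -> enorm x <= 16 * N -> enorm (Pw *m x) <= S ->
  enorm (P1 *m b x) <= C * N * S.
Proof.
move=> sp; have [C C0 hC] := drift_split sp; exists (17 * C); first by rewrite mulr_gt0.
move=> N S x N1 hx hw.
have -> : P1 *m b x = P1 *m (b x - L (P1 *m x) (P2 *m x)) by rewrite [RHS]mulmxBr (sp_cross1 sp) subr0.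
apply: le_trans (proj1_le sp _) _; apply: le_trans (hC _) _.
have -> : 17 * C * N * S = (C * (17 * N)) * S by ring.
apply: ler_pM => //; rewrite ?enorm_ge0 ?mulr_ge0 ?addr_ge0 ?enorm_ge0 ?(ltW C0) //.
by rewrite ler_pM2l //; lra.
Qed.

(** Look at the time where [|Pw x|] is largest, with value [S]. There [cross_bounded] applies with
    this very [S], so the speed of [Pw x] is [O (N S)] and a time of order [1 / N] changes it by at
    most [S / 4]. The noise takes away at most [2], hence the threshold [8]. *)
Lemma persist P1 P2 Pw : splitting B A P1 P2 Pw -> exists c : R, [/\ 0 < c, c <= 1 &
  forall (g x : R -> 'cV[R]_n) (N T H : R), path_sol b g x -> 1 <= N -> N^-1 <= T -> 8 <= H ->
  (forall r : R, 0 <= r -> r <= T -> enorm (g r) <= 1 /\ enorm (x r) <= 16 * N) ->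
  (exists t0 : R, [/\ 0 <= t0, t0 <= T & H <= enorm (Pw *m x t0)]) ->
  exists l : R, [/\ 0 <= l, l + c / N <= T &
    forall r : R, l <= r -> r <= l + c / N -> H / 2 <= enorm (Pw *m x r)]].
Proof.
move=> sp; have [C1 C10 hC1] := drift_split sp; have [C2 C20 hC2] := cross_bounded sp.
pose C5 := 17 * C1 + C2; have C50 : 0 < C5 by rewrite addr_gt0 // mulr_gt0.
pose c := Num.min 1 (4 * C5)^-1.
have c0 : 0 < c by rewrite lt_min ltr01 invr_gt0 mulr_gt0.
have c1 : c <= 1 by rewrite ge_min lexx.
have cC : c * C5 <= 4^-1.
  apply: (@le_trans _ _ ((4 * C5)^-1 * C5)); first by rewrite ler_pM2r // ge_min lexx orbT.
  by rewrite invfM -mulrA mulVf ?mulr1 // gt_eqF.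
exists c; split=> // g x N T H hx N1 NT H8 hr [t0 [t00 t0T ht0]].
have N0 : 0 < N by lra.
have T0 : 0 <= T by apply: le_trans t0T.
have cN : c / N <= T by apply: le_trans NT; rewrite -[leRHS]mul1r ler_pM2r ?invr_gt0.
have cN0 : 0 < c / N by rewrite divr_gt0.
have [cx cg _ _] := hx.
have cf := continuous_enorm_path (@continuous_mulmx_path R n Pw _ cx).
have [ts] := @EVT_max R _ 0 T T0 (continuous_subspaceT cf).
rewrite in_itv /= => /andP[ts0 tsT] hmax.
set S := enorm (Pw *m x ts) in hmax.
have SH : H <= S by apply: le_trans ht0 _; apply: hmax; rewrite in_itv /= t00.
have hw r : 0 <= r -> r <= T -> enorm (Pw *m x r) <= S.
  by move=> r0 rT; apply: hmax; rewrite in_itv /= r0.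
have hb (r : R) : 0 <= r -> r <= T -> enorm (Pw *m b (x r)) <= C5 * N * S.
  move=> r0 rT; apply: le_trans (projw_le sp _) _.
  have [_ xr] := hr r r0 rT.
  rewrite -[b (x r)](subrK (L (P1 *m x r) (P2 *m x r))).
  apply: le_trans (enormD _ _) _.
  have k1 : enorm (L (P1 *m x r) (P2 *m x r)) <= C2 * N * S.
    apply: (hC2 g x N T S hx N1 NT _ _ r r0 rT); first by lra.
    by move=> s s0 sT; have [? ?] := hr s s0 sT; split => //; exact: hw.
  have k2 : enorm (b (x r) - L (P1 *m x r) (P2 *m x r)) <= C1 * (17 * N) * S.
    apply: le_trans (hC1 _) _; apply: ler_pM; rewrite ?enorm_ge0 ?mulr_ge0 ?addr_ge0 ?enorm_ge0 ?(ltW C10) ?hw //.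
    by rewrite ler_pM2l //; lra.
  have -> : C5 * N * S = C1 * (17 * N) * S + C2 * N * S by rewrite /C5; ring.
  exact: lerD.
have lip := path_sol_lipschitz hx hb ts0 tsT.
exists (Num.min ts (T - c / N)); set l := Num.min _ _.
have l0 : 0 <= l by rewrite le_min ts0 subr_ge0.
have lT : l + c / N <= T by rewrite -lerBrDr ge_min lexx orbT.
have lts : l <= ts by rewrite ge_min lexx.
have tsl : ts <= l + c / N.
  by rewrite -lerBlDr le_min lerBlDr lerDl (ltW cN0) /= lerB.
split => // r lr rl.
have r0 : 0 <= r by exact: le_trans lr.
have rT : r <= T by exact: le_trans lT.
have := lip r r0 rT.
have rts : `|r - ts| <= c / N by rewrite ler_norml; apply/andP; split; lra.
have k1 : `|r - ts| * (C5 * N * S) <= 4^-1 * S.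
  apply: (@le_trans _ _ (c / N * (C5 * N * S))).
    by rewrite ler_wpM2r // !mulr_ge0 ?(ltW C50) ?(ltW N0) //; lra.
  have -> : c / N * (C5 * N * S) = (N^-1 * N) * (c * C5 * S) by ring.
  by rewrite mulVf ?gt_eqF // mul1r ler_wpM2r //; lra.
set z := Pw *m _ => k2.
have [gr _] := hr r r0 rT; have [gts _] := hr ts ts0 tsT.
have k3 := le_trans (projw_le sp (g r - g ts)) (enormB _ _).
have k4 : S <= enorm (Pw *m x r) + enorm z + enorm (Pw *m (g r - g ts)).
  rewrite /S; have -> : Pw *m x ts = Pw *m x r - z - Pw *m (g r - g ts).
    by rewrite /z !mulmxBr; apply/colP => i; rewrite !mxE; ring.
  apply: le_trans (enormB _ _) _; rewrite lerD2r; exact: enormB.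
lra.
Qed.

(** The components in [V1] and [V2] move at speed [O (N S)], because their interaction has no part
    there, and the third component never exceeds [S]. *)
Lemma quiet_motion P1 P2 Pw : splitting B A P1 P2 Pw -> exists2 C : R, 0 < C &
  forall (g x : R -> 'cV[R]_n) (N T S : R), path_sol b g x -> 1 <= N -> 0 <= T -> 1 <= S ->
  quiet Pw N T S g x ->
  forall r : R, 0 <= r -> r <= T -> enorm (x r - x 0) <= C * (N * T + 1) * S.
Proof.
move=> sp; have [C1 C10 hC1] := driftP_bounded sp.
have [C2 C20 hC2] := driftP_bounded (splitting_swap sp).
exists (C1 + C2 + 4); first by rewrite !addr_gt0.
move=> g x N T S hx N1 T0 S1 hq r r0 rT.
have N0 : 0 <= N by lra.
have [_ _ g0 _] := hx.
have mv (P : 'M[R]_n) (C : R) : 0 < C -> (forall z : 'cV[R]_n, enorm (P *m z) <= enorm z) ->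
   (forall (N S : R) y, 1 <= N -> enorm y <= 16 * N -> enorm (Pw *m y) <= S -> enorm (P *m b y) <= C * N * S) ->
   enorm (P *m (x r - x 0)) <= C * (N * T) * S + 1.
  move=> C0 Ple hC.
  have hb (s : R) : 0 <= s -> s <= T -> enorm (P *m b (x s)) <= C * N * S.
    by move=> s0 sT; have [_ ? ?] := hq s s0 sT; exact: hC.
  have := path_sol_lipschitz hx hb (lexx 0) T0 r0 rT; rewrite g0 !subr0 ger0_norm // => h.
  have [gr _ _] := hq r r0 rT.
  have -> : P *m (x r - x 0) = P *m (x r - g r - x 0) + P *m g r.
    by rewrite -mulmxDr; congr (_ *m _); apply/colP => i; rewrite !mxE; ring.
  apply: le_trans (enormD _ _) _; apply: lerD; last exact: le_trans (Ple _) gr.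
  apply: le_trans h _; have -> : C * (N * T) * S = T * (C * N * S) by ring.
  by rewrite ler_wpM2r // !mulr_ge0 ?(ltW C0) //; lra.
have m1 := mv P1 C1 C10 (proj1_le sp) hC1; have m2 := mv P2 C2 C20 (proj2_le sp) hC2.
have [_ _ wr] := hq r r0 rT; have [_ _ w0] := hq 0 (lexx 0) T0.
have m3 := enormB (Pw *m x r) (Pw *m x 0); rewrite -mulmxBr in m3.
rewrite -(sp_add sp (x r - x 0)).
have m4 := enormD (P1 *m (x r - x 0) + P2 *m (x r - x 0)) (Pw *m (x r - x 0)).
have m5 := enormD (P1 *m (x r - x 0)) (P2 *m (x r - x 0)).
have NT : 0 <= N * T by rewrite mulr_ge0.
have k1 : 0 <= C1 * S by rewrite mulr_ge0 ?(ltW C10) //; lra.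
have k2 : 0 <= C2 * S by rewrite mulr_ge0 ?(ltW C20) //; lra.
have k3 : 0 <= N * T * S by rewrite mulr_ge0 //; lra.
have -> : (C1 + C2 + 4) * (N * T + 1) * S =
  C1 * (N * T) * S + C2 * (N * T) * S + 4 * (N * T * S) + C1 * S + C2 * S + 4 * S by ring.
lra.
Qed.

(** The product of the two kernel components is [O (N S)], by the lower bound for the interaction.
    As [|x| >= N] and [Pw x] is small, one of them is at least [N / 2], so the other is [O (S)]. *)
Lemma quiet_cross P1 P2 Pw : splitting B A P1 P2 Pw -> exists2 C : R, 0 < C &
  forall (g x : R -> 'cV[R]_n) (N T S : R), path_sol b g x -> 1 <= N -> N^-1 <= T -> 1 <= S ->
  quiet Pw N T S g x -> N <= enorm (x 0) -> 8 * S <= N ->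
  enorm (P1 *m x 0) <= C * S \/ enorm (P2 *m x 0) <= C * S.
Proof.
move=> sp; have [C C0 hC] := cross_bounded sp; have [c c0 hc] := sp_cross sp.
exists (2 * C / c); first by rewrite divr_gt0 // mulr_gt0.
move=> g x N T S hx N1 NT S1 hq Nx SN.
have N0 : 0 < N by lra.
have T0 : 0 <= T by apply: le_trans NT; rewrite invr_ge0 ltW.
have h := le_trans (hc _ _) (hC g x N T S hx N1 NT S1 hq 0 (lexx 0) T0).
have [_ _ w0] := hq 0 (lexx 0) T0.
have py := sp_pyth sp (x 0).
set a := enorm (P1 *m x 0) in h py *; set d := enorm (P2 *m x 0) in h py *.
have a0 : 0 <= a by exact: enorm_ge0.
have d0 : 0 <= d by exact: enorm_ge0.
have key (u v : R) : 0 <= u -> 0 <= v -> c * u * v <= C * N * S -> N / 2 <= v -> u <= 2 * C / c * S.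
  move=> u0 v0 huv hv.
  have k : c * u * (N / 2) <= C * N * S by apply: le_trans huv; rewrite ler_wpM2l // mulr_ge0 // ltW.
  have -> : 2 * C / c * S = (2 * C * S) / c by ring.
  rewrite ler_pdivlMr // -(ler_pM2r N0); lra.
have [dN|dN] := leP (N / 2) d; first by left; apply: (key _ d).
right; apply: (key _ a) => //; first by move: h; lra.
rewrite leNgt; apply/negP => aN.
have w1 : 0 <= enorm (Pw *m x 0) by exact: enorm_ge0.
have h1 : enorm (Pw *m x 0) <= N / 8 by lra.
have h2 : N ^+ 2 <= enorm (x 0) ^+ 2 by rewrite ler_sqr ?nnegrE ?enorm_ge0 // ltW.
have h3 : a ^+ 2 <= (N / 2) ^+ 2 by rewrite ler_sqr ?nnegrE ?(ltW aN) // divr_ge0 // ltW.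
have h4 : d ^+ 2 <= (N / 2) ^+ 2 by rewrite ler_sqr ?nnegrE ?(ltW dN) // divr_ge0 // ltW.
have h5 : enorm (Pw *m x 0) ^+ 2 <= (N / 8) ^+ 2 by rewrite ler_sqr ?nnegrE // divr_ge0 // ltW.
have h6 : 0 < N ^+ 2 by rewrite exprn_gt0.
move: h3 h4 h5; rewrite !expr_div_n; lra.
Qed.

(* Two solutions driven by the same noise from nearby points cannot both stay
   close to the kernel of [A] for a time of order [k / 4 ^ k]. *)
Lemma pair_exit P1 P2 Pw : splitting B A P1 P2 Pw -> exists K0 : nat, forall D ka eta : R,
  0 < D -> 0 < ka -> 0 < eta -> exists k0 : nat, forall k v, (k0 <= k)%N -> P1 *m v = v ->
  4 ^+ k / 4 <= enorm v -> enorm v <= 8 * 4 ^+ k ->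
  exists p q : 'cV[R]_n, dotv p p + dotv q q = 1 /\
  forall (g x x' : R -> 'cV[R]_n) (K : nat), (K0 <= K)%N -> path_sol b g x -> path_sol b g x' ->
  enorm (x 0 - v) <= D * 2 ^+ k -> enorm (x' 0 - v) <= D * 2 ^+ k ->
  quiet Pw (4 ^+ k) (K%:R * k%:R / 4 ^+ k) (2 ^+ k) g x ->
  quiet Pw (4 ^+ k) (K%:R * k%:R / 4 ^+ k) (2 ^+ k) g x' ->
  ka * enorm (x 0 - x' 0) ^+ 2 <= dotv p (x 0 - x' 0) ^+ 2 + dotv q (x 0 - x' 0) ^+ 2 ->
  eta / 4 ^+ k <= enorm (x 0 - x' 0) ^+ 2 -> False.
Proof.
move=> sp; have [Cm Cm0 hCm] := quiet_motion sp.
have [C2 C20 hC2] := linearization_bounded B; have [DA DA0 hDA] := mulmx_bounded A.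
have [lmin lmin0 heig] := sp_eig1 sp.
(* With [r >= N / 4], the exponent [2 r La T] of the growth is at least [lmin K k / 2], so
   [lmin K >= 16] makes the growth factor at least [expR (8 k)], which exceeds [N ^ 4]. *)
pose K := (Num.trunc (16 / lmin)).+1; exists K.
have K16 : 16 <= lmin * K%:R.
  rewrite mulrC -ler_pdivrMr //; apply/ltW.
  by have /andP[_] := @truncn_itv R (16 / lmin) (divr_ge0 (ler0n _ _) (ltW lmin0)).
have K0 : 0 < K%:R :> R by rewrite ltr0n.
(* As [r <= 8 N], the loss [expR (4 r ep T)] is at most [expR (32 k / 100)], hence at most
   [(3 / 2) ^ k]. *)
pose ep : R := (100 * K%:R)^-1.
have ep0 : 0 < ep by rewrite invr_gt0 mulr_gt0.
have epK : ep * K%:R = 100^-1 by rewrite /ep invfM -mulrA mulVf ?mulr1 // gt_eqF.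
have [c0 c00 hforms] := @unstable_forms R n ep C2 ep0 C20.
move=> D ka eta D0 ka0 eta0.
pose C9 := C2 * (D + Cm * (K%:R + 1)) + DA.
have C90 : 0 < C9 by rewrite addr_gt0 // mulr_gt0 // addr_gt0 // mulr_gt0 // addr_gt0.
have [k1 hk1] := polynomial_decay (2 * (C9 * (1 + c0^-1)) / ep).
have [k2 hk2] := polynomial_decay (4 * K%:R * C9 / (c0 * ka)).
have [k3 hk3] := polynomial_decay (4096 / (ka * eta)).
exists (maxn k1 (maxn k2 k3)) => k v kk Pv v1 v2.
have {}hk1 := hk1 k (leq_trans (leq_maxl _ _) kk).
have {}hk2 := hk2 k (leq_trans (leq_trans (leq_maxl _ _) (leq_maxr _ _)) kk).
have {}hk3 := hk3 k (leq_trans (leq_trans (leq_maxr _ _) (leq_maxr _ _)) kk).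
set N : R := 4 ^+ k in v1 v2 *; set H : R := 2 ^+ k.
have H1 : 1 <= H by rewrite exprn_ege1 // ler1n.
have NH : N = H * H by rewrite /N /H -exprMn; congr (_ ^+ k); ring.
have N1 : 1 <= N by rewrite exprn_ege1 // ler1n.
have N0 : 0 < N by exact: lt_le_trans N1.
have H0 : 0 < H by exact: lt_le_trans H1.
set r := enorm v in v1 v2 *.
have r0 : 0 < r by apply: lt_le_trans v1; rewrite divr_gt0.
pose v' := r^-1 *: v.
have Pv' : P1 *m v' = v' by rewrite /v' -scalemxAr Pv.
have nv' : enorm v' = 1 by rewrite /v' enormZ ger0_norm ?invr_ge0 ?(ltW r0) // mulVf ?gt_eqF.
pose m := lin_mx_of B v'.
have mb i j : `|m i j| <= C2.
  rewrite mx_entry_delta; apply: le_trans (coord_le_enorm _ _) _.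
  rewrite /m lin_mx_ofE; apply: le_trans (hC2 _ _) _; rewrite nv' mulr1.
  have -> : enorm (delta_mx j 0 : 'cV[R]_n) = 1.
    rewrite /enorm /dotv (bigD1 j) //= big1 ?addr0 => [|l lj]; last first.
      by rewrite !mxE (negbTE lj) mulr0.
    by rewrite !mxE !eqxx mulr1 sqrtr1.
  by rewrite mulr1.
have heig' : exists2 la : R[i], eigenvalue (map_mx (real_complex R) m) la & lmin <= complex.Re la.
  by rewrite /m -Pv'; apply: heig; rewrite Pv'.
have [La [p [q [Q [La0 pq hm sQ hQ]]]]] := hforms m lmin mb heig'.
exists p, q; split => // g x x' K' KK hx hx' xv xv' hq0 hq0' h0 d0.
(* Quietness over the longer horizon of [K'] is used only up to the horizon of [K], to which [ep] is
   tuned. *)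
pose T : R := K%:R * k%:R / N.
have TT : T <= K'%:R * k%:R / N by rewrite ler_pM2r ?invr_gt0 // ler_wpM2r // ler_nat.
have hq : quiet Pw N T H g x by move=> s s0 sT; apply: hq0 => //; apply: le_trans TT.
have hq' : quiet Pw N T H g x' by move=> s s0 sT; apply: hq0' => //; apply: le_trans TT.
have T0 : 0 <= T by rewrite divr_ge0 ?mulr_ge0 // ltW.
have NT : N * T = K%:R * k%:R by rewrite /T mulrC mulfVK // gt_eqF.
pose kk1 : R := k.+1%:R; have kE : kk1 = k%:R + 1 by rewrite /kk1 -natr1.
have kk0 : 0 <= k%:R :> R by [].
have kk10 : 1 <= kk1 by rewrite kE lerDr.
have KKb : (K%:R * k%:R + 1) <= (K%:R + 1) * kk1 :> R.
  rewrite kE; have : 0 <= K%:R :> R by [].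
  by move: kk0; set X : R := k%:R; set Y : R := K%:R; clear - B A; nra.
have kk1p : 0 < kk1 by exact: lt_le_trans kk10.
pose a := C9 * kk1 * H.
have a0 : 0 < a by rewrite !mulr_gt0.
have [cx _ _ _] := hx; have [cx' _ _ _] := hx'.
have near (y : R -> 'cV[R]_n) : path_sol b g y -> enorm (y 0 - v) <= D * H -> quiet Pw N T H g y ->
    forall t : R, 0 <= t -> t <= T -> enorm (y t - v) <= (D + Cm * (K%:R + 1)) * kk1 * H.
  move=> hy yv yq t t0 tT; have := hCm g y N T H hy N1 T0 H1 yq t t0 tT; rewrite NT => h.
  have -> : y t - v = (y t - y 0) + (y 0 - v) by rewrite addrA subrK.
  apply: le_trans (enormD _ _) _.
  have e1 : Cm * (K%:R * k%:R + 1) * H <= Cm * ((K%:R + 1) * kk1) * H by rewrite ler_pM2r // ler_pM2l.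
  have e2 : D * H <= D * kk1 * H by rewrite ler_pM2r // -{1}[D]mulr1 ler_pM2l.
  have -> : (D + Cm * (K%:R + 1)) * kk1 * H = D * kk1 * H + Cm * ((K%:R + 1) * kk1) * H by ring.
  move: h e1 yv e2; clear - B A; lra.
have vE : r *: v' = v by rewrite /v' scalerA mulfV ?scale1r // gt_eqF.
have hu (t : R) : 0 <= t -> t <= T ->
    enorm ((b (x t) - b (x' t)) - r *: (m *m (x t - x' t))) <= a * enorm (x t - x' t).
  move=> t0 tT; have h1 := near x hx xv hq t t0 tT; have h2 := near x' hx' xv' hq' t t0 tT.
  rewrite drift_sub /m lin_mx_ofE -linearizationZl vE.
  set z := 2^-1 *: (x t + x' t); set de := x t - x' t.
  have -> : L z de - A *m de - L v de = L (z - v) de - A *m de.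
    by rewrite linearizationBl; apply/colP => i; rewrite !mxE; ring.
  apply: le_trans (enormB _ _) _; have h3 := hC2 (z - v) de; have h4 := hDA de.
  have h5 : enorm (z - v) <= (D + Cm * (K%:R + 1)) * kk1 * H.
    have -> : z - v = 2^-1 *: ((x t - v) + (x' t - v)).
      by apply/colP => i; rewrite !mxE; field.
    rewrite enormZ ger0_norm ?invr_ge0 //; move: h1 h2 (enormD (x t - v) (x' t - v)); clear - B A; lra.
  have de0 : 0 <= enorm de by exact: enorm_ge0.
  have h6 : C2 * enorm (z - v) * enorm de <= C2 * ((D + Cm * (K%:R + 1)) * kk1 * H) * enorm de.
    by rewrite ler_wpM2r // ler_pM2l.
  have kH : 1 <= kk1 * H by rewrite -[leLHS]mulr1; apply: ler_pM.
  have h7 : DA * enorm de <= DA * (kk1 * H) * enorm de by rewrite ler_wpM2r // -{1}[DA]mulr1 ler_pM2l.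
  have -> : a * enorm de = C2 * ((D + Cm * (K%:R + 1)) * kk1 * H) * enorm de + DA * (kk1 * H) * enorm de.
    by rewrite /a /C9; ring.
  move: h3 h4 h6 h7; clear - B A; lra.
pose s : R := kk1 ^+ 2 * (3 / 4) ^+ k.
have s0 : 0 < s by rewrite mulr_gt0 ?exprn_gt0 ?divr_gt0.
have hH : H^-1 <= (3 / 4) ^+ k.
  rewrite /H -exprVn; apply: lerXn2r; rewrite ?nnegrE ?invr_ge0 ?divr_ge0 //.
  by clear - B A; lra.
have hs : kk1 * H <= s * N.
  rewrite NH mulrA ler_pM2r // -ler_pdivrMr // /s.
  rewrite expr2 -mulrA; apply: ler_pM; rewrite ?invr_ge0 ?(ltW H0) ?(ltW kk1p) //.
  by apply: le_trans hH _; rewrite -{1}[(3 / 4) ^+ k]mul1r ler_wpM2r // exprn_ge0 // divr_ge0.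
have q1 : a * (1 + c0^-1) <= 2 * r * ep.
  apply: (@le_trans _ _ (C9 * (1 + c0^-1) * (s * N))).
    have -> : a * (1 + c0^-1) = C9 * (1 + c0^-1) * (kk1 * H) by rewrite /a; ring.
    by rewrite ler_wpM2l // mulr_ge0 ?(ltW C90) // addr_ge0 // invr_ge0 ltW.
  apply: (@le_trans _ _ (N / 4 * 2 * ep)); last first.
    by rewrite ler_pM2r // mulrC ler_pM2l.
  move: hk1; rewrite -/kk1 -/s mulrAC ler_pdivrMr // mul1r => h.
  move: (ler_wpM2r (ltW N0) h); clear - B A; lra.
(* The relative error over the horizon is of order [k (k + 1) / 2 ^ k]; multiplied by the loss
   [(3 / 2) ^ k] it decays like [(3 / 4) ^ k] up to a polynomial. *)
have q2 : T * (2 * a / c0 * expR (4 * r * ep * T)) <= ka / 2.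
  have e1 : expR (4 * r * ep * T) <= (3 / 2) ^+ k.
    apply: (@le_trans _ _ (expR (k%:R * (32 / 100)))).
      rewrite ler_expR.
      have -> : 4 * r * ep * T = 4 * (r / N) * (ep * K%:R) * k%:R by rewrite /T; ring.
      rewrite epK; have : r / N <= 8 by rewrite ler_pdivrMr.
      set X := r / N => h; move: (ler_wpM2r kk0 h); clear - B A; lra.
    rewrite expRM_natl; apply: lerXn2r; rewrite ?nnegrE ?expR_ge0 ?divr_ge0 //.
    rewrite -[leLHS]invrK -expRN -[leRHS]invrK lef_pV2 ?posrE ?invr_gt0 ?expR_gt0 ?divr_gt0 //.
    by apply: le_trans (expR_ge1Dx _); rewrite invf_div; clear - B A; lra.
  have pw : (2 * a / c0) * T * (3 / 2) ^+ k <= 2 * K%:R * C9 / c0 * s.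
    have e2 : H^-1 * (3 / 2) ^+ k = (3 / 4) ^+ k.
      by rewrite /H -exprVn -exprMn; congr (_ ^+ k); field.
    have -> : 2 * a / c0 * T * (3 / 2) ^+ k =
        2 * K%:R * C9 / c0 * (k%:R * kk1 * (H^-1 * (3 / 2) ^+ k)).
      rewrite /T /a NH; field; by rewrite !gt_eqF.
    rewrite e2 /s expr2; apply: ler_wpM2l; first by rewrite divr_ge0 ?mulr_ge0 ?(ltW C90) ?(ltW c00).
    apply: ler_wpM2r; first by rewrite exprn_ge0 // divr_ge0.
    by apply: ler_wpM2r; [exact: ltW kk1p|rewrite kE lerDl].
  apply: (@le_trans _ _ ((2 * a / c0) * T * (3 / 2) ^+ k)).
    have -> : T * (2 * a / c0 * expR (4 * r * ep * T)) = 2 * a / c0 * T * expR (4 * r * ep * T) by ring.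
    by rewrite ler_wpM2l // mulr_ge0 // divr_ge0 ?mulr_ge0 // ltW.
  apply: le_trans pw _.
  have -> : 2 * K%:R * C9 / c0 * s = ka / 2 * (4 * K%:R * C9 / (c0 * ka) * s).
    by field; rewrite !gt_eqF.
  by rewrite -[leRHS]mulr1 ler_wpM2l // divr_ge0 // ltW.
have gr := @unstable_growth R n (fun t => x t - x' t) (fun t => b (x t) - b (x' t)) m Q p q
  r a La ep c0 T ka (continuous_subv cx cx') (fun t t0 => path_sol_sub_derive hx hx' t0)
  T0 (ltW r0) a0 c00 (ltW ep0) hu pq hm sQ hQ q1 q2 h0.
have E8 : N ^+ 4 <= expR (2 * r * La * T).
  apply: (@le_trans _ _ (expR (k%:R * 8))).
    rewrite expRM_natl /N -exprM mulnC exprM; apply: lerXn2r; rewrite ?nnegrE ?expR_ge0 ?exprn_ge0 //.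
    have -> : (8 : R) = 8%:R * 1 by rewrite mulr1.
    rewrite expRM_natl; have -> : (4 : R) ^+ 4 = 2 ^+ 8 by ring.
    apply: lerXn2r; rewrite ?nnegrE ?expR_ge0 //.
    by apply: le_trans (expR_ge1Dx _); clear - B A; lra.
  rewrite ler_expR.
  have -> : 2 * r * La * T = 2 * (r / N) * (La * K%:R) * k%:R by rewrite /T; ring.
  rewrite (mulrC k%:R) ler_wpM2r //.
  have e1 : 4^-1 <= r / N by rewrite ler_pdivlMr // mulrC.
  have e2 : 16 <= La * K%:R by apply: le_trans K16 _; rewrite ler_wpM2r.
  have : 4^-1 * 16 <= r / N * (La * K%:R) by apply: ler_pM; rewrite ?invr_ge0.
  rewrite -[2 * (r / N) * _]mulrA; clear - B A; lra.
have far : enorm (x T - x' T) <= 32 * N.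
  have [_ k4 _] := hq T T0 (lexx _); have [_ k5 _] := hq' T T0 (lexx _).
  by apply: le_trans (enormB _ _) _; move: k4 k5; clear - B A; lra.
have far2 : enorm (x T - x' T) ^+ 2 <= (32 * N) ^+ 2.
  by rewrite ler_sqr ?nnegrE ?enorm_ge0 // mulr_ge0 // ltW.
(* The squared distance has grown from [eta / N] to order [N ^ 3], while both paths lie in a ball of
   radius [16 N]: impossible for large [N]. *)
have low : ka / 2 * N ^+ 4 * (eta / N) <= (32 * N) ^+ 2.
  apply: le_trans far2; apply: le_trans gr; apply: ler_pM => //.
  - by rewrite mulr_ge0 ?exprn_ge0 ?divr_ge0 // ltW.
  - by rewrite divr_ge0 // ltW.
  by rewrite ler_pM2l // divr_gt0.
have N2 : 0 < N ^+ 2 by rewrite exprn_gt0.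
have {}low : ka * eta * N <= 2048.
  have e1 : ka / 2 * N ^+ 4 * (eta / N) = (ka * eta * N) / 2 * N ^+ 2.
    by field; rewrite gt_eqF.
  move: low; rewrite e1 exprMn ler_pM2r //; clear - B A; lra.
have sN : 1 <= s * N.
  rewrite /s -mulrA; apply: (@le_trans _ _ (1 * 1)); first by rewrite mulr1.
  apply: ler_pM => //; first by rewrite expr2 -[leLHS]mulr1; apply: ler_pM.
  by rewrite /N -exprMn exprn_ege1 //; clear - B A; lra.
have ke : 0 < ka * eta by rewrite mulr_gt0.
move: hk3; rewrite -/kk1 -/s mulrAC ler_pdivrMr // mul1r => h.
move: low sN (ler_wpM2r (ltW N0) h) (ler_wpM2l (ltW ke) sN); clear - B A; lra.
Qed.

End Quiet.

(** * Exits from the neighbourhood of the kernel *)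

Section Excursion.
Context {R : realType} {n : nat}.
Variables (B : {bilinear 'cV[R]_n -> 'cV[R]_n -> 'cV[R]_n}) (A sigma : 'M[R]_n).
Hypothesis B_energy : forall x, dotv x (B x x) = 0.
Implicit Types (x y v : 'cV[R]_n).
Local Notation b := (drift B A).
Local Notation L x y := (linearization B x y).

Lemma pow2_large (C : R) : exists k0 : nat, forall k, (k0 <= k)%N -> C <= 2 ^+ k.
Proof.
exists (Num.trunc `|C|).+1 => k hk; apply: le_trans (ler_norm C) _.
have /andP[_ h] := truncn_itv (normr_ge0 C); apply: le_trans (ltW h) _.
apply: (@le_trans _ _ k%:R); first by rewrite ler_nat.
by rewrite -natrX ler_nat ltnW // ltn_expl.
Qed.

Lemma small_time (K t1 : R) : 0 < K -> 0 < t1 -> exists k0 : nat, forall k, (k0 <= k)%N ->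
  K * k%:R / 4 ^+ k <= t1.
Proof.
move=> K0 t10; have [k0 hk] := polynomial_decay (K / t1); exists k0 => k /hk.
rewrite mulrAC ler_pdivrMr // mul1r => h; apply: le_trans h.
rewrite -mulrA ler_pM2l //.
have k1 : k%:R <= k.+1%:R ^+ 2 :> R by rewrite -natrX ler_nat; apply: leq_trans (leq_pexp2l (m := k.+1) _ (_ : (0 < 2)%N)).
apply: ler_pM => //; rewrite ?invr_ge0 ?exprn_ge0 // -exprVn; apply: lerXn2r; rewrite ?nnegrE ?invr_ge0 ?divr_ge0 //.
by clear - B A sigma; lra.
Qed.

(* The time scale [K k / 4 ^ k] exceeds the time scale [4 ^ - k] of the dynamics
   at distance [4 ^ k] by a logarithmic factor. *)
Definition horizon (K k : nat) : R := K%:R * k%:R / 4 ^+ k.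

Definition exits (Pw : 'M[R]_n) (k : nat) (T : R) (x : R -> 'cV[R]_n) : Prop :=
  exists t0 : R, [/\ 0 <= t0, t0 <= T & 2 ^+ k <= enorm (Pw *m x t0)].

(** The cap makes this a bounded continuous observable, whose average the truncated energy can
    control; [4 ^ k] is the size of [|Pw x| ^ 2] at an exit. *)
Definition capped (Pw : 'M[R]_n) (k : nat) (x : 'cV[R]_n) : R :=
  Num.min (enorm (Pw *m x) ^+ 2) (4 ^+ k).

Lemma pow4E (k : nat) : (4 : R) ^+ k = 2 ^+ k * 2 ^+ k.
Proof. by rewrite -exprMn; congr (_ ^+ k); ring. Qed.

Lemma pow2_ge8 (k : nat) : (3 <= k)%N -> (8 : R) <= 2 ^+ k.
Proof.
move=> k3; have -> : (8 : R) = 2 ^+ 3 by ring.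
by apply: ler_weXn2l => //; rewrite ler1n.
Qed.

Lemma capped_ge0 Pw k x : 0 <= capped Pw k x.
Proof. by rewrite le_min sqr_ge0 exprn_ge0. Qed.

Lemma horizon_ge K k : (0 < K)%N -> (0 < k)%N -> (4 ^+ k)^-1 <= horizon K k.
Proof.
move=> K0 k0; rewrite /horizon ler_peMl ?invr_ge0 ?exprn_ge0 //.
by rewrite -natrM ler1n muln_gt0 K0.
Qed.

(** After an exit [|Pw x| ^ 2] is at least [4 ^ k / 4] during a time [c / 4 ^ k]: the product does
    not depend on [k]. *)
Lemma exits_occupation P1 P2 Pw : splitting B A P1 P2 Pw -> exists2 c : R, 0 < c &
  exists m0 : nat, forall K : nat, (0 < K)%N -> exists k0 : nat,
  forall (k m J : nat) (g x : R -> 'cV[R]_n), (k0 <= k)%N -> (k + m0 <= m)%N ->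
  horizon K k < 4^-1 ^+ m * J%:R -> path_sol b g x ->
  (forall r : R, 0 <= r -> r <= horizon K k -> enorm (g r) <= 1) ->
  10 <= enorm (x 0) -> enorm (x 0) <= 8 * 4 ^+ k -> exits Pw k (horizon K k) x ->
  c <= 4^-1 ^+ m * \sum_(j < J) capped Pw k (x (4^-1 ^+ m * j%:R)).
Proof.
move=> sp; have [c [c0 c1 hc]] := persist sp.
exists (c / 8); first by rewrite divr_gt0.
(* This makes the mesh [4 ^ - m] at most a quarter of the time [c / 4 ^ k], as [riemann_lower]
   requires. *)
have [m0 hm0] := pow2_large (4 / c); exists m0 => K K0.
have [t1 t10 ht1] := path_range A B_energy.
have KR : 0 < K%:R :> R by rewrite ltr0n.
have [k1 hk1] := small_time KR t10.
exists (maxn 3 k1) => k m J g x kk mk TJ hx hg x10 x8 hex.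
have k3 : (3 <= k)%N by apply: leq_trans kk; exact: leq_maxl.
have Tt1 : horizon K k <= t1 by apply: hk1; apply: leq_trans kk; exact: leq_maxr.
set N : R := 4 ^+ k in x8; set H : R := 2 ^+ k; set T := horizon K k in TJ hg hex Tt1.
have N0 : 0 < N by rewrite exprn_gt0.
have N1 : 1 <= N by rewrite exprn_ege1 // ler1n.
have H8 : 8 <= H by exact: pow2_ge8.
have NT : N^-1 <= T by apply: horizon_ge => //; apply: leq_trans k3.
have xN (r : R) : 0 <= r -> r <= T -> enorm (g r) <= 1 /\ enorm (x r) <= 16 * N.
  move=> r0 rT; split; first exact: hg.
  have gr (s : R) : 0 <= s -> s <= r -> enorm (g s) <= 1.
    by move=> s0 sr; apply: hg => //; apply: le_trans rT.
  have [_ h] := ht1 g x r hx r0 (le_trans rT Tt1) gr x10.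
  apply: le_trans h _; have -> : 16 * N = 2 * (8 * N) by ring.
  by rewrite ler_pM2l.
have [l [l0 lT hl]] := hc g x N T H hx N1 NT H8 xN hex.
have h0 : 0 < (4^-1 : R) ^+ m by rewrite exprn_gt0 // invr_gt0.
have hd : 4 * 4^-1 ^+ m <= c / N.
  apply: (@le_trans _ _ (4 * 4^-1 ^+ (k + m0))).
    by rewrite ler_pM2l // ler_wiXn2l // ?invr_ge0 // invf_le1 // ler1n.
  have e2 : (2 : R) ^+ m0 <= 4 ^+ m0 by apply: lerXn2r; rewrite ?nnegrE // ler_nat.
  have e3 : 4 <= c * 4 ^+ m0.
    rewrite mulrC; apply: (@le_trans _ _ (2 ^+ m0 * c)); last by rewrite ler_pM2r.
    by rewrite -ler_pdivrMr //; exact: hm0.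
  have e4 : 4 * 4^-1 ^+ m0 <= c by rewrite exprVn ler_pdivrMr // exprn_gt0.
  rewrite exprD (exprVn _ k) -/N mulrCA mulrC ler_pM2r // invr_gt0 //.
have := @riemann_lower R (fun t => capped Pw k (x t)) (4^-1 ^+ m) l (c / N) (N / 4) J h0 l0 hd (le_lt_trans lT TJ).
have -> : c / N / 2 * (N / 4) = c / 8 by field; rewrite gt_eqF.
apply; first by move=> r; exact: capped_ge0.
  by rewrite divr_ge0 // ltW.
move=> r lr rl; rewrite le_min; apply/andP; split; last by rewrite -/N ler_pdivrMr // ler_peMr ?(ltW N0) ?ler1n.
have h := hl r lr rl.
have -> : N / 4 = (H / 2) ^+ 2 by rewrite /N pow4E -/H; field.
by rewrite ler_sqr ?nnegrE ?enorm_ge0 // divr_ge0 // exprn_ge0.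
Qed.

Lemma exits_or_near P1 P2 Pw : splitting B A P1 P2 Pw -> exists2 C : R, 0 < C &
  forall K : nat, (0 < K)%N -> exists k0 : nat,
  forall (k : nat) (g x : R -> 'cV[R]_n), (k0 <= k)%N -> path_sol b g x ->
  (forall r : R, 0 <= r -> r <= horizon K k -> enorm (g r) <= 1) ->
  4 ^+ k <= enorm (x 0) -> enorm (x 0) <= 8 * 4 ^+ k ->
  [\/ exits Pw k (horizon K k) x,
      enorm (P2 *m x 0) <= C * 2 ^+ k /\ enorm (Pw *m x 0) <= 2 ^+ k |
      enorm (P1 *m x 0) <= C * 2 ^+ k /\ enorm (Pw *m x 0) <= 2 ^+ k].
Proof.
move=> sp; have [C C0 hC] := quiet_cross sp; exists C => // K K0.
have [t1 t10 ht1] := path_range A B_energy.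
have KR : 0 < K%:R :> R by rewrite ltr0n.
have [k1 hk1] := small_time KR t10.
exists (maxn 3 k1) => k g x kk hx hg x1 x8.
have k3 : (3 <= k)%N by apply: leq_trans kk; exact: leq_maxl.
have Tt1 : horizon K k <= t1 by apply: hk1; apply: leq_trans kk; exact: leq_maxr.
set N : R := 4 ^+ k in x1 x8; set H : R := 2 ^+ k; set T := horizon K k in hg Tt1 *.
have N0 : 0 < N by rewrite exprn_gt0.
have N1 : 1 <= N by rewrite exprn_ege1 // ler1n.
have H1 : 1 <= H by rewrite exprn_ege1 // ler1n.
have H8 : 8 <= H by exact: pow2_ge8.
have NT : N^-1 <= T by apply: horizon_ge => //; apply: leq_trans k3.
have T0 : 0 <= T by apply: le_trans NT; rewrite invr_ge0 ltW.
have NH : N = H * H by rewrite /N pow4E.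
have HN : 8 * H <= N by rewrite NH ler_pM2r // exprn_gt0.
have x10 : 10 <= enorm (x 0) by move: x1 H8 HN; clear - B A sigma; lra.
have [ex|nex] := pselect (exits Pw k T x); first by constructor 1.
have hq : quiet Pw N T H g x.
  move=> r r0 rT; split; first exact: hg.
    have gr (s : R) : 0 <= s -> s <= r -> enorm (g s) <= 1.
      by move=> s0 sr; apply: hg => //; apply: le_trans rT.
    have [_ h] := ht1 g x r hx r0 (le_trans rT Tt1) gr x10.
    apply: le_trans h _; have -> : 16 * N = 2 * (8 * N) by ring.
    by rewrite ler_pM2l.
  rewrite leNgt; apply/negP => lt; apply: nex; exists r; split => //; exact: ltW.
have [_ _ w0] := hq 0 (lexx 0) T0.
have [h|h] := hC g x N T H hx N1 NT H1 hq x1 HN; first by constructor 3.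
by constructor 2.
Qed.

Hypothesis sigma_unit : sigma \in unitmx.

(* The direction is one of the two unstable directions [p], [q]; [s] is the sign
   pattern of [sigma^T p], so that noise of this sign pattern pushes along [p]. *)
Lemma spread_direction : exists2 s0 : R, 0 < s0 & forall p q : 'cV[R]_n,
  dotv p p + dotv q q = 1 -> exists s : 'I_n -> bool,
  forall (W1 W2 : 'cV[R]_n) (a : R), 0 <= a ->
  (forall i, a <= (-1) ^+ s i * W1 i 0) -> (forall i, (-1) ^+ s i * W2 i 0 <= - a) ->
  forall de : 'cV[R]_n, enorm (de - sigma *m (W1 - W2)) <= s0 * a ->
  (s0 * a) ^+ 2 <= dotv p de ^+ 2 + dotv q de ^+ 2.
Proof.
have [C C0 hC] := mulmx_bounded (invmx sigma^T).
pose s0 : R := (2 * C)^-1.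
have s00 : 0 < s0 by rewrite invr_gt0 mulr_gt0.
exists s0 => // p q pq.
have low (z : 'cV[R]_n) : enorm z <= C * enorm (sigma^T *m z).
  by apply: le_trans (hC _); rewrite mulKmx // unitmx_tr.
have main (x : 'cV[R]_n) : 2^-1 <= dotv x x -> dotv x x <= 1 -> exists s : 'I_n -> bool,
  forall (W1 W2 : 'cV[R]_n) (a : R), 0 <= a ->
  (forall i, a <= (-1) ^+ s i * W1 i 0) -> (forall i, (-1) ^+ s i * W2 i 0 <= - a) ->
  forall de : 'cV[R]_n, enorm (de - sigma *m (W1 - W2)) <= s0 * a -> s0 * a <= dotv x de.
  move=> x1 x2; set u := sigma^T *m x; exists (fun i => u i 0 < 0) => W1 W2 a a0 h1 h2 de hde.
  have xn : enorm x <= 1.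
    by rewrite -(ler_pXn2r (n := 2)) ?nnegrE ?enorm_ge0 // expr1n enorm_sqr.
  have xn2 : 2^-1 <= enorm x.
    rewrite -(ler_pXn2r (n := 2)) ?nnegrE ?enorm_ge0 ?invr_ge0 // enorm_sqr.
    by apply: le_trans x1; rewrite expr2 ler_piMl ?invr_ge0 // invf_le1 // ler1n.
  have un : s0 <= enorm u.
    rewrite /s0 invfM ler_pdivrMr //; apply: le_trans xn2 _; rewrite mulrC; exact: low.
  have e1 : 2 * a * enorm u <= dotv x (sigma *m (W1 - W2)).
    rewrite dotv_tr -/u; apply: (@le_trans _ _ (2 * a * \sum_i `|u i 0|)).
      by rewrite ler_wpM2l ?mulr_ge0 // enorm_le_sum.
    rewrite /dotv mulr_sumr; apply: ler_sum => i _; have k1 := h1 i; have k2 := h2 i.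
    have -> : (W1 - W2) i 0 = W1 i 0 - W2 i 0 by rewrite !mxE.
    case: (ltP (u i 0) 0) k1 k2 => ui; rewrite /= ?expr1 ?expr0 => k1 k2.
      rewrite ltr0_norm // mulrC mulNr -mulrN; apply: ler_wnM2l; first exact: ltW.
      by move: k1 k2; clear - B A sigma; lra.
    rewrite ger0_norm // mulrC; apply: ler_wpM2l => //.
    by move: k1 k2; clear - B A sigma; lra.
  have e2 : dotv x (sigma *m (W1 - W2)) - s0 * a <= dotv x de.
    have -> : de = sigma *m (W1 - W2) + (de - sigma *m (W1 - W2)) by rewrite addrC subrK.
    rewrite dotvDr lerD2l; have := dotv_abs x (de - sigma *m (W1 - W2)).
    rewrite ler_norml => /andP[h _]; apply: le_trans h; rewrite lerN2.
    by rewrite -[leRHS]mul1r; apply: ler_pM => //; exact: enorm_ge0.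
  have e3 : a * s0 <= a * enorm u by rewrite ler_wpM2l.
  by move: e1 e2 e3; clear - B A sigma; lra.
(* One of [p] and [q] carries at least half of the squared norm and suffices alone. *)
have [hp|hp] := leP 2^-1 (dotv p p).
  have [|s hs] := main p hp; first by rewrite -pq lerDl dotvv_ge0.
  exists s => W1 W2 a a0 h1 h2 de hde.
  have h := hs W1 W2 a a0 h1 h2 de hde.
  apply: (@le_trans _ _ (dotv p de ^+ 2)); last by rewrite lerDl sqr_ge0.
  by apply: lerXn2r => //; rewrite nnegrE ?(le_trans _ h) // mulr_ge0 // ltW.
have hq : 2^-1 <= dotv q q by move: pq hp; clear - B A sigma; lra.
have [|s hs] := main q hq; first by rewrite -pq lerDr dotvv_ge0.
exists s => W1 W2 a a0 h1 h2 de hde.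
have h := hs W1 W2 a a0 h1 h2 de hde.
apply: (@le_trans _ _ (dotv q de ^+ 2)); last by rewrite lerDr sqr_ge0.
by apply: lerXn2r => //; rewrite nnegrE ?(le_trans _ h) // mulr_ge0 // ltW.
Qed.

(* [1 / 2 ^ (k + e)] is the standard deviation of the noise at time [4 ^ - (k + e)]. *)
Lemma kernel_pair_exit P1 P2 Pw : splitting B A P1 P2 Pw -> exists K0 : nat, forall (K : nat) (C Gam : R),
  (0 < K)%N -> (K0 <= K)%N -> 0 < C -> 0 < Gam -> exists e0 : nat, forall e : nat, (e0 <= e)%N ->
  exists k0 : nat, forall (k : nat) x, (k0 <= k)%N ->
  4 ^+ k <= enorm x -> enorm x <= 4 * 4 ^+ k ->
  enorm (P2 *m x) <= C * 2 ^+ k -> enorm (Pw *m x) <= 2 ^+ k ->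
  exists s : 'I_n -> bool, forall W1 W2 y1 y2 : R -> 'cV[R]_n,
  let h := 4^-1 ^+ (k + e) in let a := 2^-1 ^+ (k + e) in
  path_sol b (fun t => sigma *m W1 t) y1 -> path_sol b (fun t => sigma *m W2 t) y2 ->
  y1 0 = x -> y2 0 = x ->
  (forall r : R, 0 <= r -> r <= h -> enorm (W1 r) <= Gam * a /\ enorm (W2 r) <= Gam * a) ->
  (forall i, a <= (-1) ^+ s i * W1 h i 0) -> (forall i, (-1) ^+ s i * W2 h i 0 <= - a) ->
  [/\ 10 <= enorm (y1 h), enorm (y1 h) <= 8 * 4 ^+ k, 10 <= enorm (y2 h), enorm (y2 h) <= 8 * 4 ^+ k &
  forall g z1 z2 : R -> 'cV[R]_n, path_sol b g z1 -> path_sol b g z2 ->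
    z1 0 = y1 h -> z2 0 = y2 h ->
    (forall r : R, 0 <= r -> r <= horizon K k -> enorm (g r) <= 1) ->
    exits Pw k (horizon K k) z1 \/ exits Pw k (horizon K k) z2].
Proof.
move=> sp; have [K0 hK] := pair_exit sp; exists K0 => K C Gam Kp KK C0 Gam0.
have [s0 s00 hs] := spread_direction.
have [Cs Cs0 hCs] := mulmx_bounded sigma.
have [Ct Ct0 hCt] := @short_time R n B A.
have [t1 t10 ht1] := path_range A B_energy.
(* The spreading time is the fraction [4 ^ - e] of the dynamical time [4 ^ - k]: [e1] makes it short
   enough for [short_time], and [e2] makes the effect of the drift on [y1 h - y2 h] at most [s0 a],
   so that the noise decides the direction. *)
have [e1 he1] := pow2_large (4 * Ct); have [e2 he2] := pow2_large (4 * Ct * Cs * Gam / s0).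
have p24 (j : nat) : (2 : R) ^+ j <= 4 ^+ j by apply: lerXn2r; rewrite ?nnegrE // ler_nat.
exists (maxn e1 e2) => e ee.
have {}he1 : 4 * Ct <= 4 ^+ e by apply: le_trans (p24 e); apply: he1; apply: leq_trans ee; exact: leq_maxl.
have {}he2 : 4 * Ct * Cs * Gam / s0 <= 4 ^+ e.
  by apply: le_trans (p24 e); apply: he2; apply: leq_trans ee; exact: leq_maxr.
pose D := 2 * (C + 2); have D0 : 0 < D by rewrite mulr_gt0 // addr_gt0.
(* [ka] compares the guaranteed component [s0 a] with the largest possible deviation [4 Cs Gam a];
   [eta] is [(s0 a) ^ 2] in units of [4 ^ - k]. *)
pose ka := s0 ^+ 2 / (4 * Cs * Gam) ^+ 2; pose eta := s0 ^+ 2 / 4 ^+ e.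
have ka0 : 0 < ka by rewrite divr_gt0 ?exprn_gt0 // !mulr_gt0.
have eta0 : 0 < eta by rewrite divr_gt0 ?exprn_gt0.
have [k1 hk1] := hK D ka eta D0 ka0 eta0.
have KR : 0 < K%:R :> R by rewrite ltr0n.
have [k2 hk2] := small_time KR t10.
have [k3 hk3] := pow2_large (Cs * Gam); have [k4 hk4] := pow2_large (4 * (C + 1)).
have [k5 hk5] := pow2_large t1^-1.
pose k0 := maxn k1 (maxn k2 (maxn k3 (maxn k4 (maxn k5 3)))).
exists k0 => k x kk x1 x2 xp2 xw.
have big (j : nat) : (j <= k0)%N -> (j <= k)%N by move=> h; apply: leq_trans kk.
have b1 : (k1 <= k)%N by apply: big; rewrite /k0 leq_maxl.
have b2 : (k2 <= k)%N by apply: big; rewrite /k0 !leq_max leqnn ?orbT.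
have b3 : (k3 <= k)%N by apply: big; rewrite /k0 !leq_max leqnn ?orbT.
have b4 : (k4 <= k)%N by apply: big; rewrite /k0 !leq_max leqnn ?orbT.
have b5 : (k5 <= k)%N by apply: big; rewrite /k0 !leq_max leqnn ?orbT.
have b6 : (3 <= k)%N by apply: big; rewrite /k0 !leq_max ?orbT.
set N : R := 4 ^+ k in x1 x2 *; set H : R := 2 ^+ k in xp2 xw.
have N0 : 0 < N by rewrite exprn_gt0.
have N1 : 1 <= N by rewrite exprn_ege1 // ler1n.
have H0 : 0 < H by rewrite exprn_gt0.
have H1 : 1 <= H by rewrite exprn_ege1 // ler1n.
have H8 : 8 <= H by exact: pow2_ge8.
have NH : N = H * H by rewrite /N pow4E.
have x10 : 10 <= enorm x.
  apply: le_trans x1; rewrite NH; have : 8 * 8 <= H * H by apply: ler_pM.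
  by clear - B A sigma; lra.
pose v := P1 *m x.
have Pv : P1 *m v = v by rewrite /v (sp_11 sp).
have xv : enorm (x - v) <= (C + 1) * H.
  have -> : x - v = P2 *m x + Pw *m x.
    by rewrite -{1}(sp_add sp x) -/v; apply/colP => i; rewrite !mxE; ring.
  by apply: le_trans (enormD _ _) _; rewrite mulrDl mul1r lerD.
have v1 : N / 4 <= enorm v.
  have h1 : enorm x <= enorm (x - v) + enorm v.
    by rewrite -{1}(subrK v x); exact: enormD.
  have h2 : 4 * ((C + 1) * H) <= N by rewrite NH mulrA ler_pM2r //; exact: hk4.
  by move: h1 h2 x1 xv N0; clear - B A sigma; lra.
have v2 : enorm v <= 8 * N.
  apply: le_trans (proj1_le sp x) _; apply: le_trans x2 _.
  by rewrite ler_pM2r // ler_nat.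
have [p [q [pq hpq]]] := hk1 k v b1 Pv v1 v2.
have [s hsp] := hs p q pq; exists s => W1 W2 y1 y2 h a hy1 hy2 y10 y20 hW s1 s2.
have h0 : 0 < h by rewrite exprn_gt0 // invr_gt0.
have a0 : 0 < a by rewrite exprn_gt0 // invr_gt0.
have ha : h = a ^+ 2 by rewrite /h /a -exprM mulnC exprM; congr (_ ^+ _); field.
have hN : h = N^-1 / 4 ^+ e by rewrite /h exprD !exprVn.
have E0 : 0 < (4 : R) ^+ e by rewrite exprn_gt0.
have E1 : 1 <= (4 : R) ^+ e by rewrite exprn_ege1 // ler1n.
have NV : N * N^-1 = 1 by rewrite mulfV // gt_eqF.
have Nh : N * h = (4 ^+ e)^-1 by rewrite hN mulrA NV mul1r.
have Ga1 : Cs * (Gam * a) <= 1.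
  rewrite mulrA /a exprVn ler_pdivrMr ?exprn_gt0 // mul1r.
  apply: (@le_trans _ _ H); first exact: hk3.
  by rewrite /H exprD ler_peMr // ?exprn_ege1 // ?ler1n // ltW.
have ht : h <= t1.
  have : t1^-1 <= N by apply: le_trans (p24 k); exact: hk5.
  rewrite -[t1 in h <= t1]invrK -[h]invrK lef_pV2 ?posrE ?invr_gt0 // => h1.
  apply: le_trans h1 _; rewrite hN invf_div ?invrK; by rewrite ler_peMl // ltW.
have hg (W y : R -> 'cV[R]_n) : path_sol b (fun t => sigma *m W t) y -> y 0 = x ->
    (forall r : R, 0 <= r -> r <= h -> enorm (W r) <= Gam * a) ->
    [/\ (forall r : R, 0 <= r -> r <= h -> enorm (y r) <= 8 * N),
        10 <= enorm (y h) & enorm (y h - v) <= D * H].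
  move=> hy y0 Wb.
  have gb (r : R) : 0 <= r -> r <= h -> enorm (sigma *m W r) <= Cs * (Gam * a).
    by move=> r0 rh; apply: le_trans (hCs _) _; rewrite ler_pM2l // Wb.
  have rng (r : R) : 0 <= r -> r <= h -> enorm x <= 2 * enorm (y r) /\ enorm (y r) <= 2 * enorm x.
    move=> r0 rh; rewrite -y0; apply: (ht1 _ _ _ hy r0 (le_trans rh ht)); last by rewrite y0.
    by move=> u u0 ur; apply: le_trans Ga1; apply: gb => //; apply: le_trans rh.
  have up (r : R) : 0 <= r -> r <= h -> enorm (y r) <= 8 * N.
    move=> r0 rh; have [_ h1] := rng r r0 rh.
    by apply: le_trans h1 _; move: x2; clear - B A sigma; lra.
  split=> //.
    have [h1 _] := rng h (ltW h0) (lexx _).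
    have h2 : 8 * 8 <= H * H by apply: ler_pM.
    by move: h1 x1 h2; rewrite NH; clear - B A sigma; lra.
  have Cth : Ct * N * h <= 4^-1.
    by rewrite -mulrA Nh ler_pdivrMr // mulrC ler_pdivlMr // mulrC.
  have Gd0 : 0 < Cs * (Gam * a) by rewrite !mulr_gt0.
  have hyp (r : R) : 0 <= r -> r <= h -> [/\ enorm (y r) <= 16 * N, enorm v <= 16 * N &
      enorm (sigma *m W r - 0) <= Cs * (Gam * a)].
    move=> r0 rh; rewrite subr0; split; last exact: gb.
      by move: (up r r0 rh) N0; clear - B A sigma; lra.
    by move: v2 N0; clear - B A sigma; lra.
  (* Comparison with the constant path [v], an equilibrium without noise. *)
  have [h1 _] := hCt _ _ _ _ N h _ hy (kernel_path sp Pv) N1 (ltW h0) Cth Gd0 hyp.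
  apply: le_trans (h1 h (ltW h0) (lexx _)) _; rewrite y0 /D.
  by move: xv Ga1 H1; rewrite !mulrDl; clear - B A sigma; lra.
have W1b (r : R) : 0 <= r -> r <= h -> enorm (W1 r) <= Gam * a by move=> r0 /(hW r r0)[].
have W2b (r : R) : 0 <= r -> r <= h -> enorm (W2 r) <= Gam * a by move=> r0 /(hW r r0)[].
have [u1 l1 d1] := hg W1 y1 hy1 y10 W1b; have [u2 l2 d2] := hg W2 y2 hy2 y20 W2b.
split => //; [exact: u1 (ltW h0) (lexx _)|exact: u2 (ltW h0) (lexx _)|].
have Cth : Ct * N * h <= 4^-1.
  by rewrite -mulrA Nh ler_pdivrMr // mulrC ler_pdivlMr // mulrC.
pose G := 2 * (Cs * (Gam * a)).
have G0 : 0 < G by rewrite !mulr_gt0.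
have hyp (r : R) : 0 <= r -> r <= h -> [/\ enorm (y1 r) <= 16 * N, enorm (y2 r) <= 16 * N &
    enorm (sigma *m W1 r - sigma *m W2 r) <= G].
  move=> r0 rh; split.
  - by move: (u1 r r0 rh) N0; clear - B A sigma; lra.
  - by move: (u2 r r0 rh) N0; clear - B A sigma; lra.
  apply: le_trans (enormB _ _) _.
  have g1 : enorm (sigma *m W1 r) <= Cs * (Gam * a).
    by apply: le_trans (hCs _) _; rewrite ler_pM2l // W1b.
  have g2 : enorm (sigma *m W2 r) <= Cs * (Gam * a).
    by apply: le_trans (hCs _) _; rewrite ler_pM2l // W2b.
  by rewrite /G; move: g1 g2; clear - B A sigma; lra.
have [sb sd] := hCt _ _ _ _ N h G hy1 hy2 N1 (ltW h0) Cth G0 hyp.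
rewrite y10 y20 subrr enorm0 add0r subr0 in sb sd.
set de := y1 h - y2 h in sd.
have {}sb : enorm de <= 2 * G by apply: sb => //; exact: ltW.
rewrite -mulmxBr in sd.
have sd2 : enorm (de - sigma *m (W1 h - W2 h)) <= s0 * a.
  apply: le_trans sd _; rewrite /G.
  have -> : 2 * (Ct * N * h) * (2 * (Cs * (Gam * a))) = (4 * Ct * Cs * Gam) * (N * h) * a by ring.
  by rewrite Nh ler_pM2r // ler_pdivrMr // -ler_pdivrMl // mulrC.
have dlow := hsp (W1 h) (W2 h) a (ltW a0) s1 s2 de sd2.
have de2 : (s0 * a) ^+ 2 <= enorm de ^+ 2.
  have kz (z : 'cV[R]_n) : dotv z de ^+ 2 <= dotv z z * enorm de ^+ 2.
    rewrite -enorm_sqr -exprMn -ler_sqrt ?sqr_ge0 // !sqrtr_sqr.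
    by apply: le_trans (dotv_abs _ _) _; rewrite ler_norm.
  apply: le_trans dlow _; apply: le_trans (lerD (kz p) (kz q)) _.
  by rewrite -mulrDl pq mul1r.
move=> g z1 z2 hz1 hz2 z10 z20 gb.
have [ex1|nex1] := pselect (exits Pw k (horizon K k) z1); first by left.
have [ex2|nex2] := pselect (exits Pw k (horizon K k) z2); first by right.
have Tt1 : horizon K k <= t1 by exact: hk2.
exfalso.
have hq (y z : R -> 'cV[R]_n) : path_sol b g z -> z 0 = y h -> 10 <= enorm (y h) -> enorm (y h) <= 8 * N ->
    ~ exits Pw k (horizon K k) z -> quiet Pw N (horizon K k) H g z.
  move=> hz z0 yl yu nex r r0 rT; split; first exact: gb.
    have gr (u : R) : 0 <= u -> u <= r -> enorm (g u) <= 1.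
      by move=> u0 ur; apply: gb => //; apply: le_trans rT.
    have zl : 10 <= enorm (z 0) by rewrite z0.
    have [_ h1] := ht1 g z r hz r0 (le_trans rT Tt1) gr zl.
    apply: le_trans h1 _; rewrite z0; have -> : 16 * N = 2 * (8 * N) by ring.
    by rewrite ler_pM2l.
  rewrite leNgt; apply/negP => lt; apply: nex; exists r; split => //; exact: ltW.
have q1 := hq y1 z1 hz1 z10 l1 (u1 h (ltW h0) (lexx _)) nex1.
have q2 := hq y2 z2 hz2 z20 l2 (u2 h (ltW h0) (lexx _)) nex2.
apply: (hpq g z1 z2 K KK hz1 hz2 _ _ q1 q2); rewrite ?z10 ?z20 //.
  apply: le_trans dlow; rewrite -/de.
  have G2 : 0 < (4 * Cs * Gam) ^+ 2 by rewrite exprn_gt0 // !mulr_gt0.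
  have -> : (s0 * a) ^+ 2 = ka * (2 * G) ^+ 2.
    by rewrite /ka /G; field; rewrite ?gt_eqF //.
  have G2p : 0 <= 2 * G by rewrite mulr_ge0 // ltW.
  by rewrite ler_pM2l // lerXn2r // ?nnegrE ?enorm_ge0.
apply: le_trans de2; rewrite exprMn -ha hN /eta le_eqVlt; apply/orP; left; apply/eqP.
by rewrite mulrA mulrAC.
Qed.

End Excursion.

(** * The Markov and Feller properties *)

Section Borel.
Context {R : realType} {n : nat}.

Lemma open_borel (U : set 'cV[R]_n) : open U -> measurable (U : set (borelV R n)).
Proof. by move=> oU; apply: sub_sigma_algebra. Qed.

Lemma continuous_borel (f : 'cV[R]_n -> R) : continuous f ->
  measurable_fun setT (f : borelV R n -> R).
Proof.
move=> cf; apply: (measurability _ (RGenOInfty.measurableE R)) => // _ [_ [a ->] <-].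
rewrite setTI; apply: open_borel; apply: open_comp; last exact: interval_open.
by move=> x _; exact: cf.
Qed.

End Borel.

Section Code.
Context {R : realType}.
Variable M : nat.
Local Notation M1 := (M.+1%:R : R).

Definition threshold (c : 'I_((2 * M.+1 * M.+1).+1)) : R := c%:R / M1 - M1.

(* A finite-valued code of a real number, by comparison with a grid of mesh
   [1 / (M + 1)] in [[-(M + 1), M + 1]]; [decode] recovers the number up to the mesh. *)
Definition code (r : R) : {ffun 'I_((2 * M.+1 * M.+1).+1) -> bool} := [ffun c => r < threshold c].

Definition decode z : R := xget 0 [set r | code r = z].

Lemma decode_near (r : R) : `|r| <= M%:R -> `|decode (code r) - r| <= M1^-1.
Proof.
move=> rM; set r0 := decode (code r).
(* [decode] returns some number with the given code, which therefore lies between the same two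
   thresholds as [r]. *)
have e : code r0 = code r by rewrite /r0 /decode; exact: (@xgetPex _ 0 [set r' | code r' = code r] (ex_intro _ r erefl)).
have M0 : 0 < M1 by rewrite ltr0n.
have ME : M1 = M%:R + 1 by rewrite -natr1.
have /andP[r1 r2] : - M%:R <= r <= M%:R by rewrite -ler_norml.
have u0 : 0 <= M1 * (r + M1) by rewrite mulr_ge0 ?(ltW M0) //; rewrite ME; lra.
have /andP[a1 a2] := truncn_itv u0; set c := Num.trunc _ in a1 a2.
have cb : (c.+1 < (2 * M.+1 * M.+1).+1)%N.
  rewrite ltnS -(ltr_nat R) !natrM; apply: le_lt_trans a1 _.
  have -> : 2%:R * M1 * M1 = M1 * (2 * M1) by ring.
  by rewrite ltr_pM2l // ME; lra.
pose c1 := Ordinal cb; pose c0 := Ordinal (ltnW cb).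
have h1 : threshold c0 <= r.
  by rewrite /threshold /= lerBlDr ler_pdivrMr // mulrC.
have h2 : r < threshold c1 by rewrite /threshold /= ltrBrDr ltr_pdivlMr // mulrC.
have /ffunP/(_ c0) := e; rewrite !ffunE [RHS]ltNge h1 /= => /negbT; rewrite -leNgt => h3.
have /ffunP/(_ c1) := e; rewrite !ffunE h2 => /idP h4.
have d : threshold c1 - threshold c0 = M1^-1.
  rewrite /threshold /= -(natr1 c); field; by rewrite gt_eqF // ltr_pwDr.
move: d; set e0 := M1^-1 => d.
by rewrite ler_norml; apply/andP; split; move: h1 h2 h3 h4 d; clear; lra.
Qed.

Lemma measurable_code z : measurable [set r | code r = z].
Proof.
have -> : [set r | code r = z] =
    \bigcap_(c in [set` predT]) (if z c then `]-oo, threshold c[ else `[threshold c, +oo[)%classic.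
  apply/seteqP; split => [r /= <- c _|r /= h]; rewrite /=.
    by rewrite ffunE; case: ltP => ht /=; rewrite in_itv /= ?andbT.
  apply/ffunP => c; have := h c isT; rewrite ffunE.
  by case: (z c); rewrite /= in_itv /= ?andbT // leNgt => /negbTE.
apply: fin_bigcap_measurable; first exact: finite_finset.
by move=> c _; case: (z c); exact: measurable_itv.
Qed.

End Code.

Lemma decode_cvg {R : realType} (r : R) : decode (code M r) @[M --> \oo] --> r.
Proof.
apply/cvgrPdist_le => e e0.
pose m := maxn (Num.trunc `|r|).+1 (Num.trunc e^-1).+1.
exists m => // M /= mM; rewrite distrC; apply: le_trans (decode_near _) _.
  have /andP[_ h] := truncn_itv (normr_ge0 r); apply: le_trans (ltW h) _.
  by rewrite ler_nat; apply: leq_trans mM; exact: leq_maxl.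
have ei : 0 <= e^-1 by rewrite invr_ge0 ltW.
have /andP[_ h] := truncn_itv ei.
rewrite -[leRHS]invrK lef_pV2 ?posrE ?invr_gt0 //; apply: le_trans (ltW h) _.
by rewrite ler_nat; apply: leqW; apply: leq_trans mM; exact: leq_maxr.
Qed.

(** * Euler chains with finite-valued noise *)

Section Chain.
Context {R : realType} {n : nat} d {T : measurableType d} (P : probability T R).
Variable W : R -> T -> 'cV[R]_n.
Hypothesis W_bm : brownian_motion P W.
Implicit Types (b : 'cV[R]_n -> 'cV[R]_n) (f : 'cV[R]_n -> R) (x y : 'cV[R]_n).
Variables (b0 : 'cV[R]_n -> 'cV[R]_n) (sigma : 'M[R]_n) (h : R) (M : nat).
Hypothesis h_gt0 : 0 < h.

Definition noise_step (j : nat) (w : T) : 'cV[R]_n := W (h * j.+1%:R) w - W (h * j%:R) w.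

Lemma measurable_coord t i : 0 <= t -> measurable_fun setT (fun w => W t w i 0).
Proof.
move=> t0; have mc : measurable_fun setT (fun x : borelV R n => (x : 'cV[R]_n) i 0).
  apply: (@continuous_borel R n (fun x => x i 0)) => x.
  exact: (@cvg_coord R n _ (nbhs x) (nbhs_filter x) id x i (@cvg_id _ (nbhs x))).
exact: measurableT_comp mc (bm_measurable W_bm t0).
Qed.

Lemma measurable_noise_step j i : measurable_fun setT (fun w => noise_step j w i 0).
Proof.
under eq_fun do rewrite /noise_step !mxE.
by apply: measurable_funB; apply: measurable_coord; rewrite mulr_ge0 // ltW.
Qed.

Local Notation J := {ffun 'I_((2 * M.+1 * M.+1).+1) -> bool}.

Definition step_code (j : nat) (w : T) : {ffun 'I_n -> J} := [ffun i => code M (noise_step j w i 0)].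

Definition past_code (k : nat) (w : T) : {ffun 'I_k * 'I_n -> J} :=
  [ffun ij : ('I_k * 'I_n)%type => code M (noise_step ij.1 w ij.2 0)].

Definition cell_weight (z : J) : R := fine (normal_prob 0 (Num.sqrt h) [set r : R | code M r = z]).

Lemma noise_law j i (E : set R) : measurable E ->
  P ((fun w => noise_step j w i 0) @^-1` E) = normal_prob 0 (Num.sqrt h) E.
Proof.
move=> mE; have lt : h * j%:R < h * j.+1%:R by rewrite ltr_pM2l // ltr_nat.
have := bm_normal W_bm (mulr_ge0 (ltW h_gt0) (ler0n _ j)) lt i mE.
by have -> : h * j.+1%:R - h * j%:R = h by rewrite -natr1; ring.
Qed.

Definition noise_box k (E : ('I_k * 'I_n)%type -> set R) : set T :=
  \bigcap_(ij in [set: 'I_k * 'I_n]) ((fun w => noise_step (ij.1 : 'I_k) w ij.2 0) @^-1` E ij).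

Lemma noise_independent (k : nat) (E : ('I_k * 'I_n)%type -> set R) : (forall ij, measurable (E ij)) ->
  Pr P (noise_box E) =
  \prod_(ij : ('I_k * 'I_n)%type) fine (normal_prob 0 (Num.sqrt h) (E ij)).
Proof.
move=> mE; pose t (j : nat) := h * j%:R.
have t0 : 0 <= t 0%N by rewrite /t mulr0.
have ht : nondecreasing_seq t by move=> i j ij; rewrite /t ler_pM2l // ler_nat.
have := bm_independent W_bm t0 ht (k := k) mE; rewrite /Pr /noise_box => ->.
rewrite (eq_bigr (fun ij => (fine (normal_prob 0 (Num.sqrt h) (E ij)))%:E)); last first.
  move=> ij _; have := noise_law ij.1 ij.2 (mE ij); rewrite /noise_step /t => ->.
  exact: (@PrE _ _ R (normal_prob 0 (Num.sqrt h)) (E ij) (mE ij)).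
by rewrite prodEFin.
Qed.

Lemma past_codeE k c : [set w | past_code k w = c] = noise_box (fun ij => [set r | code M r = c ij]).
Proof.
apply/seteqP; split => [w /= <- ij _|w /= hw]; first by rewrite /= ffunE.
by apply/ffunP => ij; rewrite ffunE; exact: hw.
Qed.

Lemma measurable_past k c : measurable [set w | past_code k w = c].
Proof.
rewrite past_codeE; apply: fin_bigcap_measurable; first exact: finite_finset.
move=> ij _; rewrite -[X in measurable X]setTI.
by apply: measurable_noise_step => //; exact: measurable_code.
Qed.

Lemma measurable_step k z : measurable [set w | step_code k w = z].
Proof.
have -> : [set w | step_code k w = z] =
    \bigcap_(i in [set` predT]) ((fun w => noise_step k w i 0) @^-1` [set r | code M r = z i]).
  apply/seteqP; split => [w /= <- i _|w /= hw]; first by rewrite /= ffunE.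
  by apply/ffunP => i; rewrite ffunE; exact: hw.
apply: fin_bigcap_measurable; first exact: finite_finset.
move=> i _; rewrite -[X in measurable X]setTI.
by apply: measurable_noise_step => //; exact: measurable_code.
Qed.

Definition step_weight (z : {ffun 'I_n -> J}) : R := \prod_i cell_weight (z i).

Lemma prod_pair k (G : ('I_k * 'I_n)%type -> R) : \prod_ij G ij = \prod_j \prod_i G (j, i).
Proof. by rewrite (pair_bigA _ (fun j i => G (j, i))); apply: eq_bigr => -[]. Qed.

Lemma past_step_independent k c z :
  Pr P ([set w | past_code k w = c] `&` [set w | step_code k w = z]) =
  Pr P [set w | past_code k w = c] * step_weight z.
Proof.
(* One box over [k + 1] steps: [insub] sends the first [k] indices to [c] and the last one to [z].
   Joint independence is then used for the whole box and for the past alone. *)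
pose E (ij : ('I_k.+1 * 'I_n)%type) := [set r : R | code M r =
  if insub (ij.1 : nat) is Some j then c (j, ij.2) else z ij.2].
have mE ij : measurable (E ij) by exact: measurable_code.
have EL (j : 'I_k) i : E (widen_ord (leqnSn k) j, i) = [set r : R | code M r = c (j, i)].
  by rewrite /E /= valK.
have ER i : E (ord_max, i) = [set r : R | code M r = z i].
  by rewrite /E /= insubF // ltnn.
have -> : [set w | past_code k w = c] `&` [set w | step_code k w = z] =
    noise_box E.
  apply/seteqP; split => [w [/= h1 h2] [j i] _|w hw].
    rewrite /= /E /=; case: insubP => [j' _ e|nj].
      by rewrite -h1 ffunE /= e.
    rewrite -h2 ffunE; congr (code M (noise_step _ _ _ _)).
    by apply/eqP; rewrite eqn_leq -ltnS ltn_ord /= leqNgt.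
  split; apply/ffunP => /=.
    by move=> [j i]; have := hw (widen_ord (leqnSn k) j, i) I; rewrite ffunE EL.
  by move=> i; have := hw (ord_max, i) I; rewrite ffunE ER.
rewrite past_codeE !noise_independent // => [|ij]; last exact: measurable_code.
rewrite !prod_pair big_ord_recr /=; congr (_ * _).
  by apply: eq_bigr => j _; apply: eq_bigr => i _; rewrite EL.
by apply: eq_bigr => i _; rewrite ER.
Qed.

Lemma Ex_finite (I : finType) (C : T -> I) (F : I -> R) : (forall c, measurable [set w | C w = c]) ->
  Ex P (fun w => F (C w)) = \sum_c F c * Pr P [set w | C w = c].
Proof.
move=> mC.
have e : (fun w => F (C w)) = (fun w => \sum_(c <- index_enum I) F c * \1_[set w | C w = c] w).
  apply/funext => w; rewrite (bigD1 (C w)) //= big1 ?addr0 => [|c cw].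
    by rewrite indicE mem_set // mulr1.
  by rewrite indicE memNset ?mulr0 //= => /esym/eqP; exact/negP.
have bi c : bmeas (\1_[set w | C w = c] : T -> R) by exact: bmeas_indic.
rewrite e Ex_sum => [|c]; last by apply: bmeas_integrable; apply: bmeasM => //; exact: bmeas_cst.
by apply: eq_bigr => c _; rewrite ExZ ?Ex_indic //; exact: bmeas_integrable.
Qed.

Lemma Ex_finite2 (I I' : finType) (C : T -> I) (D : T -> I') (F : I -> I' -> R) :
  (forall c, measurable [set w | C w = c]) -> (forall z, measurable [set w | D w = z]) ->
  Ex P (fun w => F (C w) (D w)) =
  \sum_c \sum_z F c z * Pr P ([set w | C w = c] `&` [set w | D w = z]).
Proof.
move=> mC mD.
have e c z : [set w | (C w, D w) = (c, z)] = [set w | C w = c] `&` [set w | D w = z].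
  by apply/seteqP; split => [w /= [-> ->]//|w /= [-> ->]].
have m2 cz : measurable [set w | (C w, D w) = cz].
  by case: cz => c z; rewrite e; exact: measurableI.
have := @Ex_finite _ (fun w => (C w, D w)) (fun cz => F cz.1 cz.2) m2.
rewrite /= => ->; rewrite [RHS]pair_bigA; apply: eq_bigr => -[c z] _ /=.
by rewrite e.
Qed.

Definition step_vec (z : {ffun 'I_n -> J}) : 'cV[R]_n := \col_i decode (z i).

Definition coded_noise (w : T) (j : nat) : 'cV[R]_n := sigma *m step_vec (step_code j w).

Definition transition f y : R := \sum_z step_weight z * f (y + h *: b0 y + sigma *m step_vec z).

Definition coded_euler (w : T) := euler b0 h (coded_noise w).

Lemma euler_ext b (s : R) (d1 d2 : nat -> 'cV[R]_n) x k : (forall j, (j < k)%N -> d1 j = d2 j) ->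
  euler b s d1 x k = euler b s d2 x k.
Proof.
elim: k => [//|k IH] hd /=; rewrite hd // IH // => j jk.
by apply: hd; exact: ltnW.
Qed.

(** Rebuilds the noise of the first [k] steps from its code; the value [0] at later indices is never
    read within [k] steps. *)
Definition past_noise k (c : {ffun 'I_k * 'I_n -> J}) (j : nat) : 'cV[R]_n :=
  if insub j is Some j' then sigma *m step_vec [ffun i => c (j', i)] else 0.

Lemma coded_eulerE w x k : coded_euler w x k = euler b0 h (past_noise (past_code k w)) x k.
Proof.
apply: euler_ext => j jk; rewrite /coded_noise /past_noise insubT /=; congr (_ *m step_vec _).
by apply/ffunP => i; rewrite !ffunE.
Qed.

Lemma Ex_transition f x k : Ex P (fun w => f (coded_euler w x k.+1)) =
  Ex P (fun w => transition f (coded_euler w x k)).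
Proof.
pose Y c := euler b0 h (@past_noise k c) x k.
pose G c z := f (Y c + h *: b0 (Y c) + sigma *m step_vec z).
have -> : (fun w => f (coded_euler w x k.+1)) = (fun w => G (past_code k w) (step_code k w)).
  by apply/funext => w; rewrite {1}/coded_euler /= -/(coded_euler w x k) coded_eulerE.
rewrite (Ex_finite2 G (@measurable_past k) (@measurable_step k)).
have -> : (fun w => transition f (coded_euler w x k)) =
    (fun w => (fun c => transition f (Y c)) (past_code k w)).
  by apply/funext => w; rewrite coded_eulerE.
rewrite (Ex_finite (fun c => transition f (Y c)) (@measurable_past k)).
apply: eq_bigr => c _; rewrite /transition mulr_suml; apply: eq_bigr => z _.
by rewrite past_step_independent /G; ring.
Qed.

Lemma Ex_transition_iter f x k l : Ex P (fun w => f (coded_euler w x (k + l))) =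
  Ex P (fun w => iter l transition f (coded_euler w x k)).
Proof.
elim: l f => [|l IH] f; first by rewrite addn0.
by rewrite addnS Ex_transition IH iterSr.
Qed.

(** The inner expectation restarts at time [0] with the same noise instead of shifting it: both
    sides reduce to [l] iterations of [transition], which depends on the law of one increment
    only. *)
Lemma coded_markov f x k l : Ex P (fun w => f (coded_euler w x (k + l))) =
  Ex P (fun w => Ex P (fun w' => f (coded_euler w' (coded_euler w x k) l))).
Proof.
rewrite Ex_transition_iter; congr (Ex P _); apply/funext => w.
have := Ex_transition_iter f (coded_euler w x k) 0 l; rewrite add0n => ->.
exact: esym (Ex_cst _ _).
Qed.

End Chain.

Section Sequences.
Context {R : realType} {n : nat}.
Implicit Types (x y : 'cV[R]_n) (u : nat -> 'cV[R]_n).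

Lemma sequential_continuous (f : 'cV[R]_n -> R) :
  (forall u y, u m @[m --> \oo] --> y -> f (u m) @[m --> \oo] --> f y) -> continuous f.
Proof.
move=> hf y; apply/(@cvgrPdist_lt _ _ _ _ (nbhs_filter y)) => e e0; apply: contrapT => nn.
have bad (m : nat) : exists z : 'cV[R]_n, enorm (z - y) <= (m.+1%:R)^-1 /\ e <= `|f y - f z|.
  apply: contrapT => nz; apply: nn.
  have idy : id z @[z --> y] --> y by exact: cvg_id.
  have /(@cvg_enormP R n _ _ (nbhs_filter y)) h := idy.
  have m0 : 0 < (m.+1%:R : R)^-1 by rewrite invr_gt0.
  apply: (@filterS _ (nbhs y) (nbhs_filter y) _ _ _ (h _ m0)) => z /= hz.
  rewrite ltNge; apply/negP => ez; apply: nz; exists z; split => //; exact: ltW.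
have [u hu] := choice bad.
have uy : u m @[m --> \oo] --> y.
  apply/cvg_enormP => e1 e10; have e1i : 0 <= e1^-1 by rewrite invr_ge0 ltW.
  exists (Num.trunc e1^-1).+1 => // m /= hm; have [h _] := hu m; apply: le_lt_trans h _.
  rewrite -[ltRHS]invrK ltf_pV2 ?posrE ?invr_gt0 //.
  have /andP[_ h] := truncn_itv e1i; apply: lt_le_trans h _.
  by rewrite ler_nat; apply: leqW.
have /cvgrPdist_lt /(_ e e0) [m0 _ hm] := hf u y uy.
by have := hm m0 (leqnn _); have [_ h] := hu m0; rewrite ltNge h.
Qed.

Lemma euler_cvg (b : 'cV[R]_n -> 'cV[R]_n) (h : R) (dm : nat -> nat -> 'cV[R]_n) dl u x k :
  continuous b -> (forall j, dm m j @[m --> \oo] --> dl j) -> u m @[m --> \oo] --> x ->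
  euler b h (dm m) (u m) k @[m --> \oo] --> euler b h dl x k.
Proof.
move=> cb hd hu; elim: k => [//|k IH] /=.
apply: cvgD; last exact: hd.
apply: cvgD; first exact: IH.
apply: cvgZr; apply: continuous_cvg; [exact: cb|exact: IH].
Qed.

End Sequences.

Section Limits.
Context {R : realType} {n : nat} d {T : measurableType d} (P : probability T R).

Lemma Ex_abs_le (f : T -> R) (M : R) : measurable_fun setT f -> (forall w, `|f w| <= M) -> `|Ex P f| <= M.
Proof.
move=> mf hM; have bf : bmeas f by split => //; exists M.
rewrite ler_norml; apply/andP; split.
  rewrite -(Ex_cst P (- M)); apply: Ex_le; [exact/bmeas_integrable/bmeas_cst|exact: bmeas_integrable|].
  by apply: aeW => w; have := hM w; rewrite ler_norml => /andP[].
rewrite -(Ex_cst P M); apply: Ex_le; [exact: bmeas_integrable|exact/bmeas_integrable/bmeas_cst|].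
by apply: aeW => w; have := hM w; rewrite ler_norml => /andP[].
Qed.

Lemma finite_measurable (I : finType) (C : T -> I) (F : I -> R) : (forall c, measurable [set w | C w = c]) ->
  measurable_fun setT (fun w => F (C w)).
Proof.
move=> mC.
have -> : (fun w => F (C w)) = (fun w => \sum_(c <- index_enum I) F c * \1_[set w | C w = c] w).
  apply/funext => w; rewrite (bigD1 (C w)) //= big1 ?addr0 => [|c cw].
    by rewrite indicE mem_set // mulr1.
  by rewrite indicE memNset ?mulr0 //= => /esym/eqP; exact/negP.
apply: (bmeas_sum _ _).1 => c; apply: bmeasM; [exact: bmeas_cst|exact: bmeas_indic].
Qed.

(* Passage to the limit in the Markov property of approximate flows [G_m], [F_m], [H_m]. *)
Lemma markov_limit (f : 'cV[R]_n -> R) (M : R) (Fm Hm : nat -> T -> 'cV[R]_n) (F H : T -> 'cV[R]_n)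
    (Gm : nat -> 'cV[R]_n -> T -> 'cV[R]_n) (G : 'cV[R]_n -> T -> 'cV[R]_n) :
  continuous f -> (forall x, `|f x| <= M) ->
  (forall m, Ex P (fun w => f (Hm m w)) = Ex P (fun w => Ex P (fun w' => f (Gm m (Fm m w) w')))) ->
  {ae P, forall w, Hm m w @[m --> \oo] --> H w} -> {ae P, forall w, Fm m w @[m --> \oo] --> F w} ->
  (forall (u : nat -> 'cV[R]_n) y, u m @[m --> \oo] --> y ->
     {ae P, forall w, Gm m (u m) w @[m --> \oo] --> G y w}) ->
  (forall m, measurable_fun setT (fun w => f (Hm m w))) -> measurable_fun setT (fun w => f (H w)) ->
  (forall m y, measurable_fun setT (fun w => f (Gm m y w))) ->
  (forall y, measurable_fun setT (fun w => f (G y w))) ->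
  (forall m, measurable_fun setT (fun w => Ex P (fun w' => f (Gm m (Fm m w) w')))) ->
  measurable_fun setT (fun w => Ex P (fun w' => f (G (F w) w'))) ->
  Ex P (fun w => f (H w)) = Ex P (fun w => Ex P (fun w' => f (G (F w) w'))).
Proof.
move=> cf hM e hH hF hG mHm mH mGm mG mEm mE.
have c1 : Ex P (fun w => f (Hm m w)) @[m --> \oo] --> Ex P (fun w => f (H w)).
  apply: (@Ex_cvg _ _ _ _ _ _ M) => //; apply: filterS hH => w hw.
  by apply: continuous_cvg => //; exact: cf.
have c2 : Ex P (fun w => Ex P (fun w' => f (Gm m (Fm m w) w'))) @[m --> \oo] -->
    Ex P (fun w => Ex P (fun w' => f (G (F w) w'))).
  apply: (@Ex_cvg _ _ _ _ (fun m w => Ex P (fun w' => f (Gm m (Fm m w) w'))) _ M) => //.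
    by move=> m w; exact: Ex_abs_le.
  apply: filterS hF => w hw.
  apply: (@Ex_cvg _ _ _ _ (fun m w' => f (Gm m (Fm m w) w')) _ M) => //.
  apply: filterS (hG _ _ hw) => w' hw'.
  by apply: continuous_cvg => //; exact: cf.
rewrite (funext e) in c1.
exact: (cvg_unique _ c1 c2).
Qed.

End Limits.

(** * From Euler schemes to the flow of the equation *)

Section Flow.
Context {R : realType} {n : nat} d {T : measurableType d} (P : probability T R).
Variables (B : {bilinear 'cV[R]_n -> 'cV[R]_n -> 'cV[R]_n}) (A sigma : 'M[R]_n).
Variables (W : R -> T -> 'cV[R]_n) (X : 'cV[R]_n -> R -> T -> 'cV[R]_n).
Hypothesis W_bm : brownian_motion P W.
Hypothesis X_sol : forall x, sde_solution P B A sigma W x (X x).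
Implicit Types (f : 'cV[R]_n -> R) (x y : 'cV[R]_n).
Local Notation b := (drift B A).

Definition noise_euler (h : R) (w : T) := euler b h (fun j => sigma *m noise_step W h j w).

Lemma drift_continuous : continuous b.
Proof. exact: locally_lipschitz_continuous (drift_lipschitz B A). Qed.

Lemma measurable_coded_euler f (h : R) M x k : 0 < h ->
  measurable_fun setT (fun w => f (coded_euler W b sigma h M w x k)).
Proof.
move=> h0; under eq_fun do rewrite coded_eulerE.
apply: (finite_measurable (fun c => f (euler b h (past_noise sigma c) x k))).
exact: (measurable_past W_bm).
Qed.

Lemma coded_euler_cvg (h : R) w (u : nat -> 'cV[R]_n) x k : u m @[m --> \oo] --> x ->
  coded_euler W b sigma h m w (u m) k @[m --> \oo] --> noise_euler h w x k.
Proof.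
move=> hu; apply: euler_cvg => // [|j]; first exact: drift_continuous.
apply: continuous_cvg; first exact: mulmx_continuous.
apply/(@cvg_colP _ _ _ \oo) => i; rewrite /step_vec /step_code.
under eq_fun do rewrite mxE ffunE.
exact: decode_cvg.
Qed.

Lemma measurable_noise_euler f (h : R) x k : 0 < h -> continuous f ->
  measurable_fun setT (fun w => f (noise_euler h w x k)).
Proof.
move=> h0 cf; apply: (@measurable_fun_cvg _ _ _ _ (fun m w => f (coded_euler W b sigma h m w x k))).
  by move=> m; exact: measurable_coded_euler.
move=> w _; apply: continuous_cvg; first exact: cf.
by apply: coded_euler_cvg; exact: cvg_cst.
Qed.

Lemma measurable_coded_euler2 f (h : R) (M : nat) x k l : 0 < h ->
  measurable_fun setT (fun w => Ex P (fun w' => f (coded_euler W b sigma h M w' (coded_euler W b sigma h M w x k) l))).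
Proof.
move=> h0.
have e w : coded_euler W b sigma h M w x k = euler b h (past_noise sigma (past_code W h M k w)) x k.
  exact: coded_eulerE.
under eq_fun do rewrite e.
apply: (finite_measurable (fun c => Ex P (fun w' => f (coded_euler W b sigma h M w' (euler b h (past_noise sigma c) x k) l)))).
exact: (measurable_past W_bm).
Qed.

Lemma measurable_noise_euler2 f (M h : R) x k l : 0 < h -> continuous f -> (forall z, `|f z| <= M) ->
  measurable_fun setT (fun w => Ex P (fun w' => f (noise_euler h w' (noise_euler h w x k) l))).
Proof.
move=> h0 cf hM.
apply: (@measurable_fun_cvg _ _ _ _ (fun m w => Ex P (fun w' => f (coded_euler W b sigma h m w' (coded_euler W b sigma h m w x k) l)))).
  by move=> m; exact: measurable_coded_euler2.
move=> w _; apply: (@Ex_cvg _ _ _ _ _ _ M) => //.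
- by move=> m; exact: measurable_coded_euler.
- exact: measurable_noise_euler.
apply: aeW => w'; apply: continuous_cvg; first exact: cf.
by apply: coded_euler_cvg; apply: coded_euler_cvg; exact: cvg_cst.
Qed.

Lemma noise_euler_markov f (M h : R) x k l : 0 < h -> continuous f -> (forall z, `|f z| <= M) ->
  Ex P (fun w => f (noise_euler h w x (k + l))) =
  Ex P (fun w => Ex P (fun w' => f (noise_euler h w' (noise_euler h w x k) l))).
Proof.
move=> h0 cf hM.
apply: (@markov_limit _ _ _ _ P f M (fun m w => coded_euler W b sigma h m w x k)
  (fun m w => coded_euler W b sigma h m w x (k + l)) _ _
  (fun m y w => coded_euler W b sigma h m w y l) (fun y w => noise_euler h w y l)) => //.
- by move=> m; exact: (coded_markov W_bm).
- by apply: aeW => w; apply: coded_euler_cvg; exact: cvg_cst.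
- by apply: aeW => w; apply: coded_euler_cvg; exact: cvg_cst.
- by move=> u y hu; apply: aeW => w; exact: coded_euler_cvg.
- by move=> m; exact: measurable_coded_euler.
- exact: measurable_noise_euler.
- by move=> m y; exact: measurable_coded_euler.
- by move=> y; exact: measurable_noise_euler.
- by move=> m; exact: measurable_coded_euler2.
exact: (@measurable_noise_euler2 f M).
Qed.

Definition flow_path x w : Prop :=
  path_sol b (fun t => sigma *m W (Num.max 0 t) w) (fun t => X x (Num.max 0 t) w) /\ X x 0 w = x.

Lemma ae_flow_path x : {ae P, forall w, flow_path x w}.
Proof.
have [_ hX] := X_sol x.
have h0 := bm_start W_bm; have hc := bm_continuous W_bm.
apply: filterS2 (filterI h0 hc) hX => w [w0 wc] [xc hx].
exact: (sde_path_sol wc w0 xc hx).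
Qed.

Lemma measurable_flow f x (t : R) : 0 <= t -> continuous f ->
  measurable_fun setT (fun w => f (X x t w)).
Proof.
move=> t0 cf; have [mX _] := X_sol x.
exact: measurableT_comp (continuous_borel cf) (mX t t0).
Qed.

Definition Pt (t : R) f y : R := Ex P (fun w => f (X y t w)).

Lemma flow_stable (u : nat -> 'cV[R]_n) y w (t : R) : 0 <= t ->
  (forall m, flow_path (u m) w) -> flow_path y w -> u m @[m --> \oo] --> y ->
  X (u m) t w @[m --> \oo] --> X y t w.
Proof.
move=> t0 hu [hy y0] uy.
have [C C0 hC] := path_sol_stable (drift_lipschitz B A) hy t0.
have mx : Num.max 0 t = t by apply/max_idPr.
have m0 : Num.max 0 0 = 0 :> R by exact: maxxx.
apply/cvg_enormP => e e0; move/cvg_enormP: uy => uy.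
pose e1 := Num.min (C^-1) (e / C).
have e10 : 0 < e1 by rewrite lt_min invr_gt0 C0 divr_gt0.
apply: (filterS _ (uy e1 e10)) => m hm.
have [hum um0] := hu m.
have := hC _ hum; rewrite m0 um0 y0 mx => h.
have h1 : C * enorm (u m - y) < 1.
  by rewrite mulrC -ltr_pdivlMr // mul1r; apply: lt_le_trans hm _; rewrite ge_min lexx.
apply: le_lt_trans (h h1) _.
rewrite mulrC -ltr_pdivlMr //; apply: lt_le_trans hm _; by rewrite ge_min lexx orbT.
Qed.

(** The null set of [flow_path] depends on the starting point, so only countably many starting
    points are handled at once. Hence the Feller property is derived along sequences. *)
Lemma ae_flow_stable (u : nat -> 'cV[R]_n) y (t : R) : 0 <= t -> u m @[m --> \oo] --> y ->
  {ae P, forall w, X (u m) t w @[m --> \oo] --> X y t w}.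
Proof.
move=> t0 uy; have h1 := ae_flow_path y.
have h2 : {ae P, forall w, forall m, flow_path (u m) w} by apply: ae_foralln => m; exact: ae_flow_path.
by apply: filterS2 h1 h2 => w hy hu; exact: flow_stable.
Qed.

Lemma Pt_continuous f (M t : R) : 0 <= t -> continuous f -> (forall z, `|f z| <= M) ->
  continuous (Pt t f).
Proof.
move=> t0 cf hM; apply: sequential_continuous => u y uy.
apply: (@Ex_cvg _ _ _ _ _ _ M) => //.
- by move=> m; exact: measurable_flow.
- exact: measurable_flow.
apply: filterS (ae_flow_stable t0 uy) => w hw.
by apply: continuous_cvg => //; exact: cf.
Qed.

Lemma Pt_bounded f (M t : R) y : 0 <= t -> continuous f -> (forall z, `|f z| <= M) -> `|Pt t f y| <= M.
Proof. by move=> t0 cf hM; apply: Ex_abs_le => //; exact: measurable_flow. Qed.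

(** The step [h / (m + 1)] makes every multiple of [h] a grid time of all schemes. The starting
    point may vary with [m], as it does in the inner expectation of the Markov property. *)
Lemma noise_euler_flow (h : R) (a : nat) (u : nat -> 'cV[R]_n) y w : 0 < h ->
  flow_path y w -> u m @[m --> \oo] --> y ->
  noise_euler (h / m.+1%:R) w (u m) (a * m.+1) @[m --> \oo] --> X y (h * a%:R) w.
Proof.
move=> h0 [hy y0] uy; apply/cvg_enormP => e e0.
have ha : 0 <= h * a%:R by rewrite mulr_ge0 // ltW.
have [h1 [d0 [h10 d00 H]]] := euler_near (drift_lipschitz B A) hy ha (divr_gt0 e0 (ltr0n R 2)).
move/cvg_enormP: uy => /(_ d0 d00) [m1 _ hm1].
have hh1 : 0 <= h / h1 by rewrite divr_ge0 // ltW.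
exists (maxn m1 (Num.trunc (h / h1))) => // m /= mm.
have m0 : 0 < m.+1%:R :> R by rewrite ltr0n.
have e1 : h / m.+1%:R * (a * m.+1)%:R = h * a%:R.
  by rewrite natrM; field; rewrite gt_eqF // ltr_pwDr.
have e2 : h / m.+1%:R <= h1.
  rewrite ler_pdivrMr // mulrC -ler_pdivrMr //.
  have /andP[_ h2] := truncn_itv hh1; apply: le_trans (ltW h2) _.
  by rewrite ler_nat ltnS; apply: leq_trans mm; exact: leq_maxr.
have um : enorm (u m - X y (Num.max 0 0) w) <= d0.
  by rewrite maxxx y0; apply: ltW; apply: hm1; apply: leq_trans mm; exact: leq_maxl.
have hm0 : 0 <= h / m.+1%:R by rewrite divr_ge0 // ltW.
have := H (h / m.+1%:R) (a * m.+1)%N (u m) hm0 e2; rewrite e1 => /(_ (lexx _) um).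
rewrite (max_idPr ha) => h3.
have -> : noise_euler (h / m.+1%:R) w (u m) (a * m.+1) =
  euler b (h / m.+1%:R) (fun j => sigma *m W (Num.max 0 (h / m.+1%:R * j.+1%:R)) w -
     sigma *m W (Num.max 0 (h / m.+1%:R * j%:R)) w) (u m) (a * m.+1).
  apply: euler_ext => j _; rewrite /noise_step mulmxBr.
  by rewrite !(max_idPr _) // mulr_ge0.
by apply: le_lt_trans h3 _; rewrite ltr_pdivrMr // ltr_pMr // ltr1n.
Qed.

(** The finite-noise identity passes to the limit twice: first in the resolution of the code, then
    in the time step. Both times are multiples of [h], so that a single grid serves them. *)
Lemma markov_property f (M h : R) x (a c : nat) : 0 < h -> continuous f -> (forall z, `|f z| <= M) ->
  Pt (h * (a + c)%:R) f x = Ex P (fun w => Pt (h * c%:R) f (X x (h * a%:R) w)).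
Proof.
move=> h0 cf hM.
have hn (k : nat) : 0 <= h * k%:R by rewrite mulr_ge0 // ltW.
have hm (m : nat) : 0 < h / m.+1%:R by rewrite divr_gt0.
apply: (@markov_limit _ _ _ _ P f M (fun m w => noise_euler (h / m.+1%:R) w x (a * m.+1))
  (fun m w => noise_euler (h / m.+1%:R) w x ((a + c) * m.+1)) _ _
  (fun m y w => noise_euler (h / m.+1%:R) w y (c * m.+1)) (fun y w => X y (h * c%:R) w)) => //.
- by move=> m; rewrite mulnDl; exact: (@noise_euler_markov f M).
- apply: filterS (ae_flow_path x) => w hw; apply: noise_euler_flow => //; exact: cvg_cst.
- apply: filterS (ae_flow_path x) => w hw; apply: noise_euler_flow => //; exact: cvg_cst.
- by move=> u y hu; apply: filterS (ae_flow_path y) => w hw; exact: noise_euler_flow.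
- by move=> m; exact: measurable_noise_euler.
- exact: measurable_flow.
- by move=> m y; exact: measurable_noise_euler.
- by move=> y; exact: measurable_flow.
- by move=> m; exact: (@measurable_noise_euler2 f M).
exact: (measurable_flow x (hn a) (Pt_continuous (hn c) cf hM)).
Qed.

End Flow.

(** * Brownian increments *)

Section Clip.
Context {R : realType}.

Lemma geometric_bound (r : R) (m : nat) : 0 <= r -> r < 1 -> \sum_(i < m) r ^+ i <= (1 - r)^-1.
Proof.
move=> r0 r1; have d : 0 < 1 - r by rewrite subr_gt0.
rewrite -[leRHS]mul1r ler_pdivlMr // mulrC.
elim: m => [|m IH]; first by rewrite big_ord0 mulr0.
have e : (1 - r) * \sum_(i < m.+1) r ^+ i = 1 - r ^+ m.+1.
  elim: m.+1 => [|k IH']; first by rewrite big_ord0 mulr0 expr0 subrr.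
  by rewrite big_ord_recr /= mulrDr IH' exprS; ring.
by rewrite e gerBl exprn_ge0.
Qed.

Definition clip (u r : R) : R := Num.max (- u) (Num.min r u).

Lemma clip_bound u r : 0 <= u -> `|clip u r| <= u.
Proof.
move=> u0; rewrite ler_norml /clip le_max lexx /= ge_max ge_min lexx orbT andbT.
by rewrite (le_trans _ u0) // oppr_le0.
Qed.

Lemma clip_id u r : `|r| <= u -> clip u r = r.
Proof.
by rewrite ler_norml => /andP[h1 h2]; rewrite /clip (min_idPl h2) (max_idPr h1).
Qed.

Lemma clip_continuous u : continuous (clip u).
Proof.
move=> r; apply: (@continuous_max R R^o (fun=> - u) (fun r => Num.min r u) r); first exact: cvg_cst.
by apply: (@continuous_min R R^o id (fun=> u) r); [exact: cvg_id|exact: cvg_cst].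
Qed.

(** A layer-cake bound over dyadic levels; it reduces the second moment of a clipped increment to
    tail probabilities. *)
Lemma clip_sqr_le (u s : R) (L : nat) r : 0 < s -> 0 <= u -> u <= 2 ^+ L * s ->
  clip u r ^+ 2 <= s ^+ 2 + \sum_(l < L) 4 * 4 ^+ l * s ^+ 2 * \1_[set x : R | 2 ^+ l * s <= `|x|] r.
Proof.
move=> s0 u0 uL.
have c1 : clip u r ^+ 2 <= Num.min (r ^+ 2) (4 ^+ L * s ^+ 2).
  rewrite le_min; apply/andP; split.
    rewrite -[leRHS]real_normK ?num_real // -[leLHS]real_normK ?num_real //.
    apply: lerXn2r; rewrite ?nnegrE //.
    have [h|h] := leP `|r| u; first by rewrite clip_id.
    by apply: le_trans (clip_bound _ u0) _; exact: ltW.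
  rewrite -[leLHS]real_normK ?num_real //.
  have -> : 4 ^+ L * s ^+ 2 = (2 ^+ L * s) ^+ 2.
    rewrite exprMn -exprM mulnC exprM; congr (_ ^+ _ * _); ring.
  by apply: lerXn2r; rewrite ?nnegrE ?(le_trans (clip_bound _ u0)) // mulr_ge0 ?exprn_ge0 // ltW.
apply: le_trans c1 _.
elim: L {uL} => [|L IH]; first by rewrite big_ord0 addr0 expr0 mul1r ge_min lexx orbT.
rewrite big_ord_recr /=; set S := \sum_(_ < _) _ in IH *.
have S0 : 0 <= S by apply: sumr_ge0 => l _; rewrite !mulr_ge0 ?exprn_ge0 ?sqr_ge0 // ltW.
have s2 : 0 < s ^+ 2 by rewrite exprn_gt0.
have [h|h] := leP (2 ^+ L * s) `|r|.
  rewrite indicE mem_set // mulr1 -exprS.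
  have : Num.min (r ^+ 2) (4 ^+ L.+1 * s ^+ 2) <= 4 ^+ L.+1 * s ^+ 2 by rewrite ge_min lexx orbT.
  by move: S0 s2; lra.
rewrite indicE memNset /=; last by apply/negP; rewrite -ltNge.
rewrite mulr0 addr0; apply: le_trans IH; rewrite le_min ge_min lexx /=.
rewrite ge_min; apply/orP; left; rewrite -[leLHS]real_normK ?num_real //.
have -> : 4 ^+ L * s ^+ 2 = (2 ^+ L * s) ^+ 2.
  rewrite exprMn -exprM mulnC exprM; congr (_ ^+ _ * _); ring.
by apply: lerXn2r; rewrite ?nnegrE ?(ltW h) // mulr_ge0 ?exprn_ge0 // ltW.
Qed.

(* Layers of height [v], approximating [Num.min r (v N)] for [r >= 0]. *)
Definition layers (N : nat) (v r : R) : R := \sum_(i < N) v * \1_[set x : R | v * i.+1%:R <= x] r.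

Lemma layers_near (N : nat) (v r : R) : 0 < v -> 0 <= r ->
  `|Num.min r (v * N%:R) - layers N v r| <= v.
Proof.
move=> v0 r0.
have [ha hb hc] : [/\ layers N v r <= r, v * N%:R <= r -> layers N v r = v * N%:R &
    r < v * N%:R -> r - v <= layers N v r].
  rewrite /layers; elim: N => [|k [ia ib ic]].
    rewrite big_ord0 mulr0; split=> // h.
    by move: (lt_le_trans h r0); rewrite ltxx.
  rewrite big_ord_recr /=; set S := \sum_(_ < _) _ in ia ib ic *.
  have kE : v * k.+1%:R = v * k%:R + v by rewrite -natr1 mulrDr mulr1.
  have [h|h] := leP (v * k.+1%:R) r.
    rewrite indicE mem_set // mulr1.
    have h' : v * k%:R <= r by apply: le_trans h; rewrite kE lerDl ltW.
    by have := ib h' => ->; split; rewrite -?kE.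
  rewrite indicE memNset /=; last by apply/negP; rewrite -ltNge.
  rewrite mulr0 addr0; split=> // _.
  have [h2|h2] := leP (v * k%:R) r; last exact: ic.
  by rewrite (ib h2); move: h; rewrite kE; lra.
have [h|h] := leP (v * N%:R) r.
  by rewrite (hb h) subrr normr0 ltW.
by have := hc h; rewrite ler_norml => h2; apply/andP; split; lra.
Qed.

Lemma layers_neg (N : nat) (v r : R) : 0 < v -> r <= 0 -> layers N v r = 0.
Proof.
move=> v0 r0; rewrite /layers big1 // => i _; rewrite indicE memNset ?mulr0 //=.
by apply/negP; rewrite -ltNge; apply: le_lt_trans r0 _; rewrite mulr_gt0.
Qed.

Lemma clipN (u r : R) : 0 <= u -> clip u (- r) = - clip u r.
Proof.
move=> u0; have [h|h] := leP `|r| u; first by rewrite !clip_id ?normrN.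
rewrite /clip; have [r0|r0] := leP 0 r.
  rewrite ger0_norm // in h.
  rewrite (min_idPr (ltW h)) (max_idPr (_ : - u <= u)) ?ge0_cp //.
  rewrite (min_idPl (_ : - r <= u)); last by lra.
  by rewrite (max_idPl _) // lerN2 ltW.
rewrite ltr0_norm // in h.
rewrite (min_idPr (ltW h)) (max_idPr (_ : - u <= u)) ?ge0_cp //.
rewrite (min_idPl (_ : r <= u)); last by lra.
by rewrite (max_idPl _) ?opprK //; lra.
Qed.

(** Clipping is odd, and its approximation by layers is odd as well. The mean of a clipped increment
    thus becomes a combination of differences between the probabilities of opposite half-lines,
    which vanish by symmetry. *)
Lemma clip_layers (N : nat) (v r : R) : 0 < v ->
  `|clip (v * N%:R) r - (layers N v r - layers N v (- r))| <= v.
Proof.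
move=> v0; have u0 : 0 <= v * N%:R by rewrite mulr_ge0 // ltW.
have main (x : R) : 0 <= x -> `|clip (v * N%:R) x - (layers N v x - layers N v (- x))| <= v.
  move=> x0; rewrite (@layers_neg N v (- x)) ?oppr_le0 // subr0.
  rewrite /clip (max_idPr _); first exact: layers_near.
  by rewrite le_min; apply/andP; split; lra.
have [r0|r0] := leP 0 r; first exact: main.
rewrite -normrN; have := main (- r); rewrite clipN // opprK oppr_ge0 (ltW r0) => /(_ isT).
by congr (`|_| <= _); ring.
Qed.

End Clip.

Section NormalSymmetry.
Context {R : realType}.

Lemma normal_symmetric (s a : R) : 0 < s ->
  normal_prob 0 s [set x : R | a <= x] = normal_prob 0 s [set x : R | a <= - x].
Proof.
move=> s0; rewrite /normal_prob.
have -> : [set x : R | a <= x] = `[a, +oo[%classic.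
  by apply/seteqP; split => x /=; rewrite in_itv /= andbT.
have -> : [set x : R | a <= - x] = `]-oo, (- a)]%classic.
  by apply/seteqP; split => x /=; rewrite in_itv /= lerNr.
rewrite ge0_integration_by_substitutionNy.
- apply: eq_integral => x _; congr (_%:E); rewrite /= !normal_pdfE ?gt_eqF //.
  by rewrite /normal_fun !subr0 sqrrN.
- by apply: continuous_subspaceT; apply: continuous_normal_pdf; rewrite gt_eqF.
by move=> x _; exact: normal_pdf_ge0.
Qed.

End NormalSymmetry.

Section Union.
Context {R : realType} d {T : measurableType d} (P : probability T R).

Lemma measurable_exists (I : finType) (A : I -> set T) : (forall i, measurable (A i)) ->
  measurable [set w | exists i, A i w].
Proof.
move=> mA; rewrite (_ : [set w | _] = \bigcup_(i in [set` predT]) A i).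
  by apply: fin_bigcup_measurable => [|i _]; [exact: finite_finset|exact: mA].
by apply/seteqP; split => [w [i Ai]|w [i _ Ai]]; exists i.
Qed.

Lemma Pr_exists (I : finType) (A : I -> set T) : (forall i, measurable (A i)) ->
  Pr P [set w | exists i, A i w] <= \sum_i Pr P (A i).
Proof.
move=> mA; have mE := measurable_exists mA.
have bA i : bmeas (\1_(A i) : T -> R) by exact: bmeas_indic.
rewrite -(Ex_indic P mE) (eq_bigr (fun i => Ex P (\1_(A i)))) => [|i _]; last by rewrite Ex_indic.
rewrite -Ex_sum => [|i]; last exact: bmeas_integrable.
apply: Ex_le; [exact/bmeas_integrable/bmeas_indic|exact/bmeas_integrable/bmeas_sum|].
apply: aeW => w; rewrite indicE; have s0 : 0 <= \sum_i \1_(A i) w :> R by apply: sumr_ge0.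
case: (boolP (w \in _)) => [|_ //]; rewrite inE => -[i Ai].
rewrite (bigD1 i) //= indicE mem_set //= lerDl.
by apply: sumr_ge0.
Qed.

Lemma Pr_bigcap_ge (A : nat -> set T) (p : R) : (forall m, measurable (A m)) ->
  (forall m, A m.+1 `<=` A m) -> (forall m, p <= Pr P (A m)) ->
  p <= Pr P (\bigcap_m A m).
Proof.
move=> mA decA hp.
have mI : measurable (\bigcap_m A m) by exact: bigcapT_measurable.
have dec m k : A (m + k)%N `<=` A m.
  elim: k => [|k IH]; first by rewrite addn0.
  by rewrite addnS; apply: subset_trans IH; exact: decA.
have : Ex P (\1_(A m)) @[m --> \oo] --> Ex P (\1_(\bigcap_m A m)).
  apply: (@Ex_cvg _ _ _ _ _ _ 1).
  - by move=> m; exact: (bmeas_indic (mA m)).1.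
  - exact: (bmeas_indic mI).1.
  - by move=> m w; rewrite indicE; case: (w \in _); rewrite ?normr1 ?normr0.
  apply: aeW => w; have [h|h] := pselect ((\bigcap_m A m) w).
    rewrite indicE mem_set //; apply: cvg_near_cst; apply: nearW => m.
    by rewrite indicE mem_set //; exact: h.
  have [m hm] : exists m, ~ A m w.
    by apply: contrapT => nh; apply: h => m _; apply: contrapT => nm; apply: nh; exists m.
  rewrite indicE memNset //; apply: cvg_near_cst; exists m => // k /= mk.
  by rewrite indicE memNset // => /= Ak; apply: hm; move: Ak; rewrite -(subnKC mk); exact: dec.
rewrite Ex_indic // => h.
have cv : cvgn (fun m => Ex P (\1_(A m))) by apply/cvg_ex; eexists; exact: h.
rewrite -(cvg_lim _ h) //; apply: limr_ge => //.
by apply: nearW => m; rewrite Ex_indic.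
Qed.

End Union.

(** * Maximal inequality and moments of increments *)

Section Noise.
Context {R : realType} {n : nat} d {T : measurableType d} (P : probability T R).
Variable W : R -> T -> 'cV[R]_n.
Hypothesis W_bm : brownian_motion P W.

Lemma Pr_noise (h : R) j i (E : set R) : 0 < h -> measurable E ->
  Pr P [set w | E (noise_step W h j w i 0)] = fine (normal_prob 0 (Num.sqrt h) E).
Proof. by move=> h0 mE; have := noise_law W_bm h0 j i mE; rewrite /Pr => <-. Qed.

Lemma noise_tail (h u : R) j i : 0 < h -> 0 < u ->
  Pr P [set w | u <= `|noise_step W h j w i 0|] <= 30 * h ^+ 2 / u ^+ 4.
Proof.
move=> h0 u0; have s0 : 0 < Num.sqrt h by rewrite sqrtr_gt0.
have mE : measurable [set r : R | u <= `|r|].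
  by apply: measurable_ge; apply: (@normr_measurable R setT).
rewrite (Pr_noise j i h0 mE) -lee_fin fineK; last exact: (@fin_num_measure _ _ _ (normal_prob 0 (Num.sqrt h))).
apply: le_trans (normal_tail s0 u0) _; rewrite lee_fin expr_div_n mulrA.
have -> : Num.sqrt h ^+ 4 = h ^+ 2 by rewrite -[4%N]/(2 * 2)%N exprM sqr_sqrtr // ltW.
by [].
Qed.

Definition good_path (w : T) : Prop := W 0 w = 0 /\ continuous (fun t : R => W (Num.max 0 t) w).

Lemma ae_good_path : {ae P, forall w, good_path w}.
Proof.
apply: filterS2 (bm_start W_bm) (bm_continuous W_bm) => w w0 wc; split; first exact: w0.
have h := continuous_max0 wc; exact: h.
Qed.

(** An odd dyadic point of level [m + 1] is one increment away from a point of level [m], and an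
    even one already belongs to level [m]. *)
Lemma dyadic_chaining (w : T) (h : R) (i : 'I_n) (v : nat -> R) : W 0 w = 0 -> (forall m, 0 <= v m) ->
  (forall m j, (j < 2 ^ m)%N -> `|noise_step W (h / 2 ^+ m) j w i 0| <= v m) ->
  forall m j, (j <= 2 ^ m)%N -> `|W (h / 2 ^+ m * j%:R) w i 0| <= \sum_(l < m.+1) v l.
Proof.
move=> w0 v0 hv; elim=> [|m IH] j jm.
  rewrite big_ord_recl big_ord0 addr0; case: j jm => [|[|//]] _.
    by rewrite mulr0 w0 mxE normr0.
  by have := hv 0%N 0%N isT; rewrite /noise_step mulr0 w0 subr0.
rewrite big_ord_recr /=.
have half k : h / 2 ^+ m.+1 * (2 * k)%:R = h / 2 ^+ m * k%:R.
  by rewrite natrM exprS; field; rewrite expf_neq0.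
have jE : j = (odd j + (2 * j./2))%N by rewrite mul2n odd_double_half.
have j2 : (j./2 <= 2 ^ m)%N.
  by rewrite -(leq_pmul2l (isT : (0 < 2)%N)) -expnS; apply: leq_trans jm; rewrite [leqRHS]jE leq_addl.
case ho: (odd j) jE => jE.
  rewrite jE add1n; have jlt : (2 * j./2 < 2 ^ m.+1)%N by move: jm; rewrite {1}jE.
  have := hv m.+1 _ jlt; rewrite /noise_step half.
  set y := W _ w; set x := W (h / 2 ^+ m * _) w => k1.
  have k2 := IH _ j2; rewrite -/x in k2.
  have -> : y i 0 = x i 0 + (y - x) i 0 by rewrite !mxE; ring.
  by apply: le_trans (ler_normD _ _) _; exact: lerD.
rewrite jE add0n half; apply: le_trans (IH _ j2) _; by rewrite lerDl.
Qed.

Lemma dyadic_dense (f : R -> R) (h r c : R) : 0 < h -> continuous f -> 0 <= r -> r <= h ->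
  (forall m j, (j <= 2 ^ m)%N -> f (h / 2 ^+ m * j%:R) <= c) -> f r <= c.
Proof.
move=> h0 cf r0 rh hd; rewrite leNgt; apply/negP => lt.
have e0 : 0 < f r - c by rewrite subr_gt0.
have /cvgrPdist_lt /(_ _ e0) /= [e /= e1 he] := cf r.
have [m hm] : exists m : nat, h / 2 ^+ m < e.
  exists (Num.trunc (h / e)).+1; rewrite ltr_pdivrMr ?exprn_gt0 // mulrC -ltr_pdivrMr //.
  have he0 : 0 <= h / e by rewrite divr_ge0 // ltW.
  have /andP[_ h1] := truncn_itv he0; apply: lt_le_trans h1 _.
  by rewrite -natrX ler_nat ltnW // ltn_expl.
have v0 : 0 < h / 2 ^+ m by rewrite divr_gt0 // exprn_gt0.
pose j := Num.trunc (r / (h / 2 ^+ m)).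
have rv : 0 <= r / (h / 2 ^+ m) by rewrite divr_ge0 // ltW.
have /andP[j1 j2] := truncn_itv rv; rewrite -/j in j1 j2.
have jm : (j <= 2 ^ m)%N.
  rewrite -(ler_nat R) natrX; apply: le_trans j1 _.
  by rewrite ler_pdivrMr // mulrCA divff ?mulr1 // expf_neq0.
have := hd m j jm; apply/negP; rewrite -ltNge.
rewrite ler_pdivlMr // in j1; rewrite ltr_pdivrMr // -natr1 in j2.
have : `|f r - f (h / 2 ^+ m * j%:R)| < f r - c.
  apply: he; rewrite /ball_ /=; apply: le_lt_trans hm.
  by rewrite ler_norml; apply/andP; split; move: j1 j2; lra.
by rewrite ltr_norml => /andP[]; lra.
Qed.

(** Kolmogorov chaining with the fourth-power tail. The event is made of good paths, so continuity
    extends the bound from dyadic times to all times. *)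
Lemma noise_max : exists2 C : R, 0 < C & forall h u : R, 0 < h -> 0 < u -> exists G : set T,
  [/\ measurable G, 1 - C * h ^+ 2 / u ^+ 4 <= Pr P G &
  forall w, G w -> good_path w /\ forall r : R, 0 <= r -> r <= h -> enorm (W r w) <= u].
Proof.
pose nn : R := n%:R + 1.
have nn0 : 0 < nn by rewrite ltr_wpDl.
(* The thresholds [v m] decrease like [(9 / 10) ^ m]: slowly enough for the union bound over [2 ^ m]
   increments to decay like [rho ^ m], fast enough for their sum to stay below [u / nn]. *)
pose K := 30 * nn * (10 * nn) ^+ 4; pose rho : R := 2^-1 * (10 / 9) ^+ 4.
have K0 : 0 < K by rewrite !mulr_gt0 // exprn_gt0 // mulr_gt0.
have rho0 : 0 <= rho by rewrite mulr_ge0 ?exprn_ge0 ?divr_ge0 ?invr_ge0.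
have rho1 : rho < 4 / 5 by rewrite /rho; lra.
exists (5 * K); first by rewrite mulr_gt0.
move=> h u h0 u0.
have [Om [mO PO hO]] := ae_full_set ae_good_path.
pose v (m : nat) : R := u / (10 * nn) * (9 / 10) ^+ m.
have v0 m : 0 < v m by rewrite mulr_gt0 ?exprn_gt0 ?divr_gt0 // mulr_gt0.
have hm0 m : 0 < h / 2 ^+ m by rewrite divr_gt0 // exprn_gt0.
pose bad m := [set w | exists ji : 'I_(2 ^ m) * 'I_n, v m <= `|noise_step W (h / 2 ^+ m) ji.1 w ji.2 0|].
have mbad1 m (ji : 'I_(2 ^ m) * 'I_n) : measurable [set w | v m <= `|noise_step W (h / 2 ^+ m) ji.1 w ji.2 0|].
  apply: measurable_ge; apply: measurableT_comp; first exact: (@normr_measurable R setT).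
  exact: (measurable_noise_step W_bm).
have mbad m : measurable (bad m) by exact: (measurable_exists (@mbad1 m)).
have Pbad m : Pr P (bad m) <= K * h ^+ 2 / u ^+ 4 * rho ^+ m.
  apply: le_trans (Pr_exists P (@mbad1 m)) _.
  apply: (@le_trans _ _ (\sum_(ji : 'I_(2 ^ m) * 'I_n) 30 * (h / 2 ^+ m) ^+ 2 / v m ^+ 4)).
    by apply: ler_sum => ji _; exact: noise_tail.
  set c := 30 * (h / 2 ^+ m) ^+ 2 / v m ^+ 4.
  rewrite sumr_const card_prod !card_ord -(mulr_natl c) natrM natrX.
  have -> : K * h ^+ 2 / u ^+ 4 * rho ^+ m = 2 ^+ m * nn * c.
    have -> : rho ^+ m = (2 ^+ m)^-1 / ((9 / 10) ^+ m) ^+ 4.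
      rewrite /rho exprMn exprVn -exprM mulnC exprM; congr (_ * _).
      by rewrite -exprVn -exprVn invf_div.
    rewrite /c /v /K; set a := 2 ^+ m; set b := (9 / 10) ^+ m.
    have a0 : a != 0 by rewrite expf_neq0.
    have b0 : b != 0 by rewrite expf_neq0 // mulf_neq0 // invr_neq0.
    by field; rewrite a0 b0 (gt_eqF nn0) (gt_eqF u0).
  apply: ler_wpM2r; last by rewrite ler_wpM2l ?exprn_ge0 // lerDl.
  apply: divr_ge0; [apply: mulr_ge0 => //; apply: exprn_ge0|apply: exprn_ge0]; exact: ltW.
pose G m := Om `&` [set w | forall l : 'I_m, ~ bad l w].
have GE m : G m = Om `&` ~` [set w | exists l : 'I_m, bad l w].
  rewrite /G; congr (_ `&` _); apply/seteqP; split => w /= hw; first by case=> l; exact: hw.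
  by move=> l hl; apply: hw; exists l.
have mE m : measurable [set w | exists l : 'I_m, bad l w].
  by apply: (@measurable_exists _ _ _ (fun l : 'I_m => bad l)) => l; exact: mbad.
exists (\bigcap_m G m); split.
- by apply: bigcapT_measurable => m; rewrite GE; apply: measurableI => //; exact: measurableC.
- apply: Pr_bigcap_ge.
  + by move=> m; rewrite GE; apply: measurableI => //; exact: measurableC.
  + by move=> m w [ow hw]; split => // l; exact: (hw (widen_ord (leqnSn m) l)).
  move=> m; rewrite GE.
  have h1 : Pr P [set w | exists l : 'I_m, bad l w] <= 5 * K * h ^+ 2 / u ^+ 4.
    apply: le_trans (Pr_exists P (fun l : 'I_m => mbad l)) _.
    apply: (@le_trans _ _ (\sum_(l < m) K * h ^+ 2 / u ^+ 4 * rho ^+ l)).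
      by apply: ler_sum => l _; exact: Pbad.
    rewrite -mulr_sumr; have -> : 5 * K * h ^+ 2 / u ^+ 4 = K * h ^+ 2 / u ^+ 4 * 5 by ring.
    apply: ler_wpM2l; first by rewrite divr_ge0 ?mulr_ge0 ?exprn_ge0 // ltW.
    apply: le_trans (geometric_bound _ rho0 _) _; first by move: rho1; lra.
    by rewrite -[leRHS]invrK lef_pV2 ?posrE ?invr_gt0 //; move: rho1; lra.
  set A := [set w | _] in h1 *.
  have := Pr_setU P (measurableC mO) (mE m); rewrite -/A.
  have -> : Om `&` ~` A = ~` (~` Om `|` A) by rewrite setCU setCK.
  rewrite (Pr_setC P (measurableU _ _ (measurableC mO) (mE m))) (Pr_setC P mO).
  have -> : Pr P Om = 1 by rewrite /Pr PO.
  by rewrite subrr add0r; move: h1; lra.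
move=> w hw; have gw : good_path w by apply: hO; have [] := hw 0%N I.
split => // r r0 rh; have [w0 wc] := gw.
have step m j i : (j < 2 ^ m)%N -> `|noise_step W (h / 2 ^+ m) j w i 0| <= v m.
  move=> jm; rewrite leNgt; apply/negP => lt.
  have [_ /(_ (@Ordinal m.+1 m (ltnSn m)))] := hw m.+1 I; apply.
  by exists (Ordinal jm, i); exact: ltW.
have coord i : `|W r w i 0| <= u / nn.
  have cf : continuous (fun t : R => `|W (Num.max 0 t) w i 0|).
    by move=> t; apply: cvg_norm; apply: cvg_coord; exact: wc.
  have := @dyadic_dense _ h r (u / nn) h0 cf r0 rh; rewrite (max_idPr r0); apply => m j jm.
  have hj : 0 <= h / 2 ^+ m * j%:R := mulr_ge0 (ltW (hm0 m)) (ler0n _ _).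
  rewrite (max_idPr hj).
  apply: le_trans (dyadic_chaining w0 (fun m => ltW (v0 m)) (fun m j => @step m j i) jm) _.
  rewrite -mulr_sumr; have -> : u / nn = u / (10 * nn) * 10.
    by field; rewrite gt_eqF.
  apply: ler_wpM2l; first by rewrite divr_ge0 ?mulr_ge0 // ltW.
  apply: le_trans (geometric_bound _ _ _) _; [by lra|by lra|].
  by rewrite -[leRHS]invrK lef_pV2 ?posrE ?invr_gt0 //; lra.
apply: le_trans (enorm_le_sum _) _; apply: (@le_trans _ _ (\sum_(i < n) u / nn)).
  by apply: ler_sum => i _; exact: coord.
rewrite sumr_const card_ord -mulr_natl mulrCA ler_piMr ?(ltW u0) //.
by rewrite ler_pdivrMr // mul1r lerDl.
Qed.

(** Independence gives the prescribed signs and sizes a probability at least [normal_const ^ n];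
    [Gam] is so large that the maximal bound fails with at most half of it. By Brownian scaling
    neither constant depends on [h]. *)
Lemma spread_event : exists c Gam : R, [/\ 0 < c, 0 < Gam & forall (h : R) (s : 'I_n -> bool), 0 < h ->
  exists E : set T, [/\ measurable E, c <= Pr P E & forall w, E w ->
    [/\ good_path w, forall i, Num.sqrt h <= (-1) ^+ s i * W h w i 0 &
    forall r : R, 0 <= r -> r <= h -> enorm (W r w) <= Gam * Num.sqrt h]]].
Proof.
have [C C0 hC] := noise_max.
pose c := @normal_const R ^+ n; have c0 : 0 < c by rewrite exprn_gt0 // normal_const_gt0.
pose Gam := 2 * C / c + 1.
have G1 : 1 <= Gam by rewrite lerDr divr_ge0 ?mulr_ge0 // ltW.
have G0 : 0 < Gam by apply: lt_le_trans G1.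
have GC : C / Gam ^+ 4 <= c / 2.
  have h1 : 2 * C / c <= Gam ^+ 4.
    apply: (@le_trans _ _ Gam); first by rewrite lerDl.
    by rewrite -{1}[Gam]expr1; apply: ler_weXn2l.
  rewrite ler_pdivrMr ?exprn_gt0 //; rewrite ler_pdivrMr // in h1; lra.
exists (c / 2), Gam; split; [by rewrite divr_gt0|exact: G0|] => h s h0.
have s0 : 0 < Num.sqrt h by rewrite sqrtr_gt0.
have sh : Num.sqrt h ^+ 2 = h by rewrite sqr_sqrtr // ltW.
have [G [mG PG hG]] := hC h (Gam * Num.sqrt h) h0 (mulr_gt0 G0 s0).
pose E (ij : ('I_1 * 'I_n)%type) : set R := [set r | Num.sqrt h <= (-1) ^+ s ij.2 * r].
have EE ij : E ij = if s ij.2 then `]-oo, (- Num.sqrt h)%R]%classic else `[Num.sqrt h, +oo[%classic.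
  rewrite /E; case: (s ij.2); apply/seteqP; split => r /=; rewrite in_itv /= ?andbT ?expr1 ?expr0 ?mul1r //.
    by rewrite mulN1r lerNr.
  by rewrite mulN1r lerNr.
have mE ij : measurable (E ij) by rewrite EE; case: ifP => _; exact: measurable_itv.
have PE := noise_independent W_bm h0 mE.
have low : c <= Pr P (noise_box W h E).
  rewrite PE prod_pair big_ord1 /c -[n in leLHS]card_ord -prodr_const.
  apply: ler_prod => i _; rewrite (ltW normal_const_gt0) /= -lee_fin.
  rewrite fineK; last exact: (@fin_num_measure _ _ _ (normal_prob 0 (Num.sqrt h)) _ (mE _)).
  by rewrite EE; case: ifP => _; [exact: normal_lower_neg|exact: normal_lower_pos].
have mB : measurable (noise_box W h E).
  apply: fin_bigcap_measurable; first exact: finite_finset.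
  move=> ij _; rewrite -[X in measurable X]setTI.
  by apply: (measurable_noise_step W_bm h0) => //; exact: mE.
exists (noise_box W h E `&` G); split.
- exact: measurableI.
- have := Pr_setU P (measurableC mB) (measurableC mG).
  rewrite -setCI (Pr_setC P (measurableI _ _ mB mG)) (Pr_setC P mB) (Pr_setC P mG).
  have e : C * h ^+ 2 / (Gam * Num.sqrt h) ^+ 4 = C / Gam ^+ 4.
    rewrite exprMn; have -> : Num.sqrt h ^+ 4 = h ^+ 2 by rewrite -[4%N]/(2 * 2)%N exprM sh.
    by field; rewrite (gt_eqF h0) (gt_eqF G0).
  by rewrite e in PG; move: PG GC low; lra.
move=> w [bw gw]; have [gp hb] := hG w gw; split=> // i.
have [w0 _] := gp.
by have := bw (ord0, i) I; rewrite /E /= /noise_step mulr0 w0 subr0 mulr1.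
Qed.

Lemma Ex_clip (h u : R) i : 0 < h -> 0 < u -> Ex P (fun w => clip u (noise_step W h 0 w i 0)) = 0.
Proof.
move=> h0 u0; set Z := fun w => noise_step W h 0 w i 0.
have mZ : measurable_fun setT Z by exact: (measurable_noise_step W_bm h0).
have mC : measurable_fun setT (fun w => clip u (Z w)).
  by apply: measurableT_comp mZ; apply: continuous_measurable_fun; exact: clip_continuous.
have bC : bmeas (fun w => clip u (Z w)) by split => //; exists u => w; apply: clip_bound; exact: ltW.
have s0 : 0 < Num.sqrt h by rewrite sqrtr_gt0.
have mge (a : R) : measurable [set x : R | a <= x] by apply: measurable_ge; exact: measurable_id.
have mNZ : measurable_fun setT (fun w => - Z w) by apply: measurableT_comp mZ; exact: oppr_measurable.
have mL (N : nat) (v : R) (Y : T -> R) : measurable_fun setT Y -> bmeas (fun w => layers N v (Y w)).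
  move=> mY; apply: bmeas_sum => j; apply: bmeasM; first exact: bmeas_cst.
  exact: (bmeas_indic (measurable_ge (v * j.+1%:R) mY)).
have sym (N : nat) (v : R) : Ex P (fun w => layers N v (Z w) - layers N v (- Z w)) = 0.
  rewrite ExB; [|exact/bmeas_integrable/mL|exact/bmeas_integrable/mL].
  apply/eqP; rewrite subr_eq0; apply/eqP.
  have EL (Y : T -> R) : measurable_fun setT Y ->
      Ex P (fun w => layers N v (Y w)) = \sum_(j < N) v * Pr P [set w | v * j.+1%:R <= Y w].
    move=> mY; have bj (j : nat) : bmeas (\1_[set w | v * j.+1%:R <= Y w] : T -> R).
      exact: (bmeas_indic (measurable_ge _ mY)).
    rewrite /layers Ex_sum => [|j]; last first.
      apply: bmeas_integrable; apply: bmeasM; [exact: bmeas_cst|exact: bj].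
    apply: eq_bigr => j _.
    rewrite (_ : (fun w => _) = (fun w => v * \1_[set w | v * j.+1%:R <= Y w] w)) //.
    rewrite ExZ; last exact: (bmeas_integrable P (bj j)).
    by rewrite -(Ex_indic P (measurable_ge _ mY)).
  rewrite !EL //; apply: eq_bigr => j _; congr (_ * _).
  have mge' : measurable [set x : R | v * j.+1%:R <= - x].
    by apply: measurable_ge; exact: oppr_measurable.
  have := Pr_noise 0 i h0 (mge (v * j.+1%:R)); rewrite /= => ->.
  have := Pr_noise 0 i h0 mge'; rewrite /= => ->.
  by rewrite normal_symmetric.
apply/eqP; rewrite -normr_le0; apply/ler_addgt0Pl => e e0; rewrite addr0.
pose N := (Num.trunc (u / e)).+1; pose v := u / N%:R.
have N0 : 0 < N%:R :> R by rewrite ltr0n.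
have v0 : 0 < v by rewrite divr_gt0.
have vN : v * N%:R = u by rewrite /v mulfVK // gt_eqF.
have ve : v <= e.
  rewrite /v ler_pdivrMr // mulrC -ler_pdivrMr //.
  have ue : 0 <= u / e by rewrite divr_ge0 // ltW.
  by have /andP[_ h1] := truncn_itv ue; exact: ltW.
have bS : bmeas (fun w => layers N v (Z w) - layers N v (- Z w)).
  have := bmeasD (mL N v Z mZ) (bmeasM (bmeas_cst (- 1)) (mL N v _ mNZ)).
  by under eq_fun do rewrite mulN1r.
rewrite -[Ex P _]subr0 -(sym N v) -ExB; [|exact: bmeas_integrable|exact: bmeas_integrable].
apply: le_trans ve; apply: Ex_abs_le.
  have := bmeasD bC (bmeasM (bmeas_cst (- 1)) bS) => -[].
  by under eq_fun do rewrite mulN1r.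
by move=> w; have := clip_layers N (Z w) v0; rewrite vN.
Qed.

(** Tails [30 / 16 ^ l] against weights of order [4 ^ l] leave a geometric series, with total at
    most [181 h]. *)
Lemma Ex_clip_sqr (h u : R) i : 0 < h -> 0 < u ->
  Ex P (fun w => clip u (noise_step W h 0 w i 0) ^+ 2) <= 200 * h.
Proof.
move=> h0 u0; set Z := fun w => noise_step W h 0 w i 0.
have mZ : measurable_fun setT Z by exact: (measurable_noise_step W_bm h0).
have mC : measurable_fun setT (fun w => clip u (Z w)).
  by apply: measurableT_comp mZ; apply: continuous_measurable_fun; exact: clip_continuous.
have bC : bmeas (fun w => clip u (Z w)) by split => //; exists u => w; apply: clip_bound; exact: ltW.
have s0 : 0 < Num.sqrt h by rewrite sqrtr_gt0.
have sh : Num.sqrt h ^+ 2 = h by rewrite sqr_sqrtr // ltW.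
have [L hL] : exists L : nat, u <= 2 ^+ L * Num.sqrt h.
  exists (Num.trunc (u / Num.sqrt h)).+1; rewrite -ler_pdivrMr //.
  have us : 0 <= u / Num.sqrt h by rewrite divr_ge0 // ltW.
  have /andP[_ h1] := truncn_itv us; apply: le_trans (ltW h1) _.
  by rewrite -natrX ler_nat ltnW // ltn_expl.
have mA (l : nat) : measurable [set w | 2 ^+ l * Num.sqrt h <= `|Z w|].
  by apply: measurable_ge; apply: measurableT_comp mZ; exact: (@normr_measurable R setT).
have bA (l : nat) : bmeas (\1_[set w | 2 ^+ l * Num.sqrt h <= `|Z w|] : T -> R) by exact: bmeas_indic.
have bT (l : nat) : bmeas (fun w => 4 * 4 ^+ l * h * \1_[set w | 2 ^+ l * Num.sqrt h <= `|Z w|] w).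
  by apply: bmeasM; [exact: bmeas_cst|exact: bA].
pose F w := h + \sum_(l < L) 4 * 4 ^+ l * h * \1_[set w | 2 ^+ l * Num.sqrt h <= `|Z w|] w.
have bF : bmeas F by apply: bmeasD; [exact: bmeas_cst|apply: bmeas_sum => l; exact: bT].
apply: (@le_trans _ _ (Ex P F)).
  apply: Ex_le; [exact/bmeas_integrable/(bmeasM bC bC)|exact: bmeas_integrable|].
  apply: aeW => w; have := clip_sqr_le (Z w) s0 (ltW u0) hL; rewrite sh.
  by apply.
rewrite /F ExD; [|exact/bmeas_integrable/bmeas_cst|apply/bmeas_integrable/bmeas_sum => l; exact: bT].
rewrite Ex_cst Ex_sum => [|l]; last exact/bmeas_integrable/bT.
have tail (l : nat) : Ex P (fun w => 4 * 4 ^+ l * h * \1_[set w | 2 ^+ l * Num.sqrt h <= `|Z w|] w) <= 120 * h * (4^-1) ^+ l.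
  rewrite ExZ; last exact/bmeas_integrable/bA.
  rewrite (Ex_indic P (mA l)).
  have u1 : 0 < 2 ^+ l * Num.sqrt h by rewrite mulr_gt0 ?exprn_gt0.
  have := noise_tail 0 i h0 u1; rewrite -/Z.
  have -> : 30 * h ^+ 2 / (2 ^+ l * Num.sqrt h) ^+ 4 = 30 / 4 ^+ l / 4 ^+ l.
    rewrite exprMn; have -> : Num.sqrt h ^+ 4 = h ^+ 2 by rewrite -[4%N]/(2 * 2)%N exprM sh.
    have -> : (2 : R) ^+ l ^+ 4 = 4 ^+ l * 4 ^+ l.
      by rewrite -exprMn -exprM mulnC exprM; congr (_ ^+ _); ring.
    by field; rewrite (gt_eqF h0) expf_neq0.
  move=> hP; apply: le_trans (ler_wpM2l _ hP) _; first by rewrite !mulr_ge0 ?exprn_ge0 // ltW.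
  rewrite exprVn le_eqVlt; apply/orP; left; apply/eqP; field; by rewrite expf_neq0.
apply: (@le_trans _ _ (h + 120 * h * (\sum_(l < L) 4^-1 ^+ l))).
  by rewrite lerD2l mulr_sumr; apply: ler_sum => l _; exact: tail.
have := @geometric_bound R 4^-1 L; rewrite invr_ge0 ler0n => /(_ isT) gb.
have {}gb : \sum_(i < L) (4^-1 : R) ^+ i <= 3 / 2.
  apply: le_trans (gb _) _; first by lra.
  by rewrite -[leRHS]invrK lef_pV2 ?posrE ?invr_gt0 //; lra.
have := ler_wpM2l (ltW h0) gb; lra.
Qed.

End Noise.

(** * The energy balance *)

Section Theta.
Context {R : realType}.
Implicit Types (L u v : R).

(* A bounded concave truncation of the identity: [u - u ^ 2 / (2 L)] up to [u = L],
   constant afterwards; [theta' L] is its derivative. *)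
Definition theta L u : R := Num.min u L - Num.min u L ^+ 2 / (2 * L).
Definition theta' L u : R := 1 - Num.min u L / L.

Lemma theta'_ge0 L u : 0 < L -> 0 <= theta' L u.
Proof. by move=> L0; rewrite subr_ge0 ler_pdivrMr // mul1r ge_min lexx orbT. Qed.

Lemma theta'_le1 L u : 0 < L -> 0 <= u -> theta' L u <= 1.
Proof. by move=> L0 u0; rewrite gerBl divr_ge0 ?(ltW L0) // le_min u0 ltW. Qed.

Lemma theta_le L u : 0 < L -> theta L u <= L / 2.
Proof.
move=> L0; rewrite /theta; set m := Num.min u L.
have -> : m - m ^+ 2 / (2 * L) = L / 2 - (m - L) ^+ 2 / (2 * L).
  by field; rewrite gt_eqF.
by rewrite gerBl divr_ge0 ?sqr_ge0 // mulr_ge0 // ltW.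
Qed.

Lemma theta_ge L u : 0 < L -> 0 <= u -> Num.min u L / 2 <= theta L u.
Proof.
move=> L0 u0; rewrite /theta; set m := Num.min u L.
have m0 : 0 <= m by rewrite le_min u0 ltW.
have mL : m <= L by rewrite ge_min lexx orbT.
have : m ^+ 2 / (2 * L) <= m / 2.
  rewrite ler_pdivrMr ?mulr_gt0 //; have -> : m / 2 * (2 * L) = m * L by field.
  by rewrite expr2 ler_wpM2l.
lra.
Qed.

Lemma theta_ge0 L u : 0 < L -> 0 <= u -> 0 <= theta L u.
Proof.
move=> L0 u0; apply: le_trans (theta_ge L0 u0).
by rewrite divr_ge0 // le_min u0 ltW.
Qed.

(** The tangent line bounds [theta] from above for all arguments. This replaces a second-order
    expansion in the energy balance. *)
Lemma theta_concave L u v : 0 < L -> 0 <= u -> 0 <= v -> theta L v <= theta L u + theta' L u * (v - u).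
Proof.
move=> L0 u0 v0; have [uL|uL] := leP L u.
  have -> : theta L u = L / 2.
    by rewrite /theta (min_idPr uL); field; rewrite gt_eqF.
  have -> : theta' L u = 0 by rewrite /theta' (min_idPr uL) divff ?subrr // gt_eqF.
  by rewrite mul0r addr0 theta_le.
have uE : Num.min u L = u := min_idPl (ltW uL).
have tan w : w <= L -> w - w ^+ 2 / (2 * L) <= theta L u + theta' L u * (w - u).
  move=> wL; rewrite /theta /theta' uE.
  have -> : w - w ^+ 2 / (2 * L) = u - u ^+ 2 / (2 * L) + (1 - u / L) * (w - u) - (w - u) ^+ 2 / (2 * L).
    by field; rewrite gt_eqF.
  by rewrite gerBl divr_ge0 ?sqr_ge0 // mulr_ge0 // ltW.
have mL : Num.min v L <= L by rewrite ge_min lexx orbT.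
apply: le_trans (tan _ mL) _; rewrite lerD2l ler_wpM2l ?theta'_ge0 // lerD2r.
by rewrite ge_min lexx.
Qed.

End Theta.

Section Increment.
Context {R : realType} {n : nat}.
Variables (B : {bilinear 'cV[R]_n -> 'cV[R]_n -> 'cV[R]_n}) (A : 'M[R]_n).
Local Notation b := (drift B A).

(** A bootstrap keeps the path within unit distance of [x 0], where [b] varies by at most
    [L (e + D h)] around [b (x 0)]. *)
Lemma drift_increment (K : R) : 0 <= K -> exists2 C : R, 0 < C &
  forall (g x : R -> 'cV[R]_n) (h e : R), path_sol b g x -> enorm (x 0) <= K -> 0 <= h ->
  C * h <= 2^-1 -> e <= 4^-1 -> (forall r : R, 0 <= r -> r <= h -> enorm (g r) <= e) ->
  enorm (x h - x 0 - h *: b (x 0) - g h) <= C * h * (h + e) /\ enorm (b (x 0)) <= C.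
Proof.
move=> K0; have [L L0 hL] := @drift_lipschitz R n B A (K + 1).
pose D := L * (K + 1); have K1 : 0 < K + 1 by rewrite ltr_wpDl.
have D0 : 0 < D by rewrite mulr_gt0.
have b0 : b 0 = 0 by rewrite /drift linear0r mulmx0 subr0.
have hD y : enorm y <= K + 1 -> enorm (b y) <= D.
  move=> yK; rewrite -[b y]subr0 -b0; apply: le_trans (hL y 0 yK _) _.
    by rewrite enorm0 ltW.
  by rewrite subr0 ler_pM2l.
exists ((L + 2) * (D + 1)); first by rewrite mulr_gt0 // ltr_wpDl // ltW.
move=> g x h e hx x0 h0 Ch e4 hg; have [cx cg g0 _] := hx.
have Dh : D * h <= 4^-1.
  have k1 : 0 <= L * D * h by rewrite !mulr_ge0 // ltW.
  have k2 : 0 <= L * h by rewrite mulr_ge0 // ltW.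
  by move: Ch k1 k2 h0; clear; lra.
have e0 : 0 <= e by apply: le_trans (hg 0 (lexx _) h0); exact: enorm_ge0.
have x0K : enorm (x 0) <= K + 1 by apply: le_trans x0 _; rewrite lerDl.
have inball r : enorm (x r - x 0) <= 1 -> enorm (x r) <= K + 1.
  move=> h1; rewrite -(subrK (x 0) (x r)); apply: le_trans (enormD _ _) _.
  by rewrite addrC; exact: lerD.
have inc s : 0 <= s -> s <= h -> (forall r : R, 0 <= r -> r <= s -> enorm (x r - x 0) <= 1) ->
    enorm (x s - x 0) <= e + D * h.
  move=> s0 sh hr.
  have := @path_sol_increment1 R n b g x 0 0 s D hx (lexx 0) s0.
  rewrite scaler0 !subr0 g0 subr0 => /(_ _).
  have hb r : 0 <= r -> r <= s -> enorm (b (x r) - 0) <= D.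
    by move=> r0 rs; rewrite subr0; apply: hD; apply: inball; exact: hr.
  move=> /(_ hb) h1.
  have -> : x s - x 0 = (x s - g s - x 0) + g s by apply/colP => i; rewrite !mxE; ring.
  apply: le_trans (enormD _ _) _; have h2 := hg s s0 sh.
  have h3 : s * D <= D * h by rewrite mulrC ler_pM2l.
  lra.
have boot : forall s : R, 0 <= s -> s <= h -> enorm (x s - x 0) < 1.
  apply: (@continuous_bootstrap R (fun s => enorm (x s - x 0)) h 1 h0).
  - by apply: continuous_enorm_path; apply: (continuous_subv cx) => s; exact: cvg_cst.
  - by rewrite subrr enorm0.
  by move=> s s0 sh hr; have := inc s s0 sh hr; lra.
split; last by apply: le_trans (hD _ x0K) _; nra.
have := @path_sol_increment1 R n b g x (b (x 0)) 0 h (L * (e + D * h)) hx (lexx 0) h0.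
rewrite g0 !subr0 => hinc.
have -> : x h - x 0 - h *: b (x 0) - g h = x h - g h - x 0 - h *: b (x 0).
  by apply/colP => i; rewrite !mxE; ring.
apply: le_trans (hinc _) _.
  move=> r r0 rh; have k1 : enorm (x r - x 0) <= e + D * h.
    by apply: inc => // s s0 sr; apply/ltW/boot => //; exact: le_trans rh.
  apply: le_trans (hL _ _ _ x0K) _; last by rewrite ler_pM2l.
  by apply: inball; apply/ltW/boot.
have -> : h * (L * (e + D * h)) = h * (L * e + L * D * h) by ring.
have k1 : L * e + L * D * h <= (L + 2) * (D + 1) * (h + e).
  have : 0 <= L * h by rewrite mulr_ge0 // ltW.
  have : 0 <= D * h by rewrite mulr_ge0 // ltW.
  have : 0 <= L * D * e by rewrite !mulr_ge0 // ltW.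
  have : 0 <= D * e by rewrite !mulr_ge0 // ltW.
  lra.
have -> : (L + 2) * (D + 1) * h * (h + e) = h * ((L + 2) * (D + 1) * (h + e)) by ring.
by rewrite ler_wpM2l.
Qed.

End Increment.

Section Energy.
Context {R : realType} {n : nat} d {T : measurableType d} (P : probability T R).
Variables (B : {bilinear 'cV[R]_n -> 'cV[R]_n -> 'cV[R]_n}) (A sigma : 'M[R]_n).
Variables (W : R -> T -> 'cV[R]_n) (X : 'cV[R]_n -> R -> T -> 'cV[R]_n).
Hypothesis B_energy : forall x, dotv x (B x x) = 0.
Hypothesis W_bm : brownian_motion P W.
Hypothesis X_sol : forall x, sde_solution P B A sigma W x (X x).
Implicit Types (x y : 'cV[R]_n).
Local Notation b := (drift B A).
Local Notation Pt := (Pt P X).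

Definition energy (L : R) x : R := theta L (enorm x ^+ 2).
Definition energy' (L : R) x : R := theta' L (enorm x ^+ 2).

Lemma energy_bounded L x : 0 < L -> `|energy L x| <= L / 2.
Proof. by move=> L0; rewrite ger0_norm ?theta_ge0 ?sqr_ge0 // theta_le. Qed.

Lemma minsqr_continuous L : continuous (fun x : 'cV[R]_n => Num.min (enorm x ^+ 2) L).
Proof.
have cm : continuous (fun u : R => Num.min u L).
  by move=> u; apply: (@continuous_min R R^o id (fun=> L) u); [exact: cvg_id|exact: cvg_cst].
move=> x; have ce : enorm y @[y --> x] --> enorm x := @enorm_continuous R n x.
have c2 : (fun y : 'cV[R]_n => enorm y ^+ 2) y @[y --> x] --> enorm x ^+ 2 := cvgM ce ce.
exact: (cvg_comp _ _ (c2 (nbhs_filter x)) (cm _)).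
Qed.

Lemma energy_continuous L : continuous (energy L).
Proof.
move=> x; have c1 := @minsqr_continuous L.
have c1x : Num.min (enorm y ^+ 2) L @[y --> x] --> Num.min (enorm x ^+ 2) L := c1 x.
exact: (cvgB c1x (cvgM (cvgM c1x c1x) (cvg_cst _))).
Qed.

(** Concavity of [theta] turns the expansion of [|x h| ^ 2] into a one-sided bound, and conservation
    of energy by [B] removes it from the term of order [h]. *)
Lemma energy_pointwise (L : R) : 0 < L -> exists2 C : R, 0 < C &
  forall (g x : R -> 'cV[R]_n) (h e : R), path_sol b g x -> enorm (x 0) ^+ 2 <= L -> 0 <= h -> h <= 1 ->
  C * h <= 2^-1 -> e <= 4^-1 -> (forall r : R, 0 <= r -> r <= h -> enorm (g r) <= e) ->
  energy L (x h) <= energy L (x 0) + energy' L (x 0) *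
    (- 2 * h * dotv (x 0) (A *m x 0) + 2 * dotv (x 0) (g h) + 2 * enorm (g h) ^+ 2 + C * h * (h + e)).
Proof.
move=> L0; have sL : 0 < Num.sqrt L by rewrite sqrtr_gt0.
have [C C0 hC] := @drift_increment R n B A (Num.sqrt L) (ltW sL).
exists (C + 2 * Num.sqrt L * C + 18 * C ^+ 2).
  by rewrite addr_gt0 // ?addr_gt0 ?mulr_gt0 ?exprn_gt0.
move=> g x h e hx xL h0 h1 Ch e4 hg.
have xK : enorm (x 0) <= Num.sqrt L.
  by rewrite -(ler_pXn2r (n := 2)) ?nnegrE ?enorm_ge0 ?sqrtr_ge0 // (sqr_sqrtr (ltW L0)).
have sC : 0 <= 2 * Num.sqrt L * C by rewrite !mulr_ge0 // ltW.
have C2 : 0 <= 18 * C ^+ 2 by rewrite mulr_ge0 // exprn_ge0 // ltW.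
have Ch' : C * h <= 2^-1 by apply: le_trans Ch; rewrite ler_wpM2r //; lra.
have [i1 i2] := hC g x h e hx xK h0 Ch' e4 hg.
have e0 : 0 <= e by apply: le_trans (hg 0 (lexx _) h0); exact: enorm_ge0.
set r := x h - x 0 - h *: b (x 0) - g h in i1.
set z := h *: b (x 0) + r.
have xhE : x h - x 0 = z + g h by rewrite /z /r; apply/colP => i; rewrite !mxE; ring.
have zb : enorm z <= 3 * C * h.
  apply: le_trans (enormD _ _) _; rewrite enormZ ger0_norm //.
  have k1 : h * enorm (b (x 0)) <= h * C by rewrite ler_wpM2l.
  have k2 : C * h * (h + e) <= C * h * 2.
    by rewrite ler_wpM2l ?mulr_ge0 ?(ltW C0) //; lra.
  lra.
have sq : enorm (x h) ^+ 2 - enorm (x 0) ^+ 2 =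
    2 * dotv (x 0) (x h - x 0) + enorm (x h - x 0) ^+ 2.
  rewrite !enorm_sqr !(dotvDl, dotvDr, dotvNl, dotvNr) (dotvC (x h) (x 0)); ring.
have dz : dotv (x 0) z <= - h * dotv (x 0) (A *m x 0) + Num.sqrt L * (C * h * (h + e)).
  rewrite /z dotvDr dotvZr /drift dotvDr dotvNr B_energy add0r.
  have k1 := dotv_le (x 0) r.
  have k2 : enorm (x 0) * enorm r <= Num.sqrt L * (C * h * (h + e)).
    by apply: ler_pM; rewrite ?enorm_ge0.
  lra.
have q : enorm (x h - x 0) ^+ 2 <= 18 * C ^+ 2 * h * (h + e) + 2 * enorm (g h) ^+ 2.
  rewrite xhE; have k1 := enormD z (g h).
  have k2 : enorm (z + g h) ^+ 2 <= (enorm z + enorm (g h)) ^+ 2.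
    by apply: lerXn2r; rewrite ?nnegrE ?enorm_ge0 // addr_ge0 // enorm_ge0.
  have k3 : enorm z ^+ 2 <= (3 * C * h) ^+ 2.
    by apply: lerXn2r; rewrite ?nnegrE ?enorm_ge0 // !mulr_ge0 // ltW.
  have k4 := sqr_ge0 (enorm z - enorm (g h)).
  have k5 : 0 <= 18 * C ^+ 2 * h * e by rewrite !mulr_ge0 // ?exprn_ge0 // ltW.
  have k6 : 0 <= C ^+ 2 * h ^+ 2 by rewrite mulr_ge0 ?sqr_ge0.
  rewrite !expr2 in k2 k3 k4 k5 k6 *; lra.
apply: le_trans (theta_concave L0 (sqr_ge0 (enorm (x 0))) (sqr_ge0 _)) _.
rewrite lerD2l ler_wpM2l ?theta'_ge0 // sq xhE dotvDr -xhE.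
have k : 0 <= C * h * (h + e) by rewrite !mulr_ge0 ?addr_ge0 // ltW.
lra.
Qed.

(** A one-sided form of Ito's formula. While the noise stays below [u], its increment equals the
    clipped one, which is centred and has variance [O (h)]; the complement has probability
    [O (h ^ 2)], absorbed in [eps * h]. The constant [C0] is independent of the truncation level
    [L]. *)
Lemma energy_step : exists2 C0 : R, 0 < C0 & forall L eps : R, 0 < L -> 0 < eps ->
  exists2 h0 : R, 0 < h0 & forall (h : R) x, 0 < h -> h <= h0 ->
  Pt h (energy L) x <= energy L x + h * (energy' L x * (C0 - 2 * dotv x (A *m x))) + eps * h.
Proof.
have aux1 (a z e : R) : `|z| <= a -> 0 <= e -> - (2 * a) <= - 2 * z + e.
  by rewrite ler_norml => /andP[? ?] ?; lra.
have aux2 (E e Y f1 f2 l a b : R) : E <= l -> 0 <= e -> - a <= Y -> - b <= f1 -> 0 <= f2 ->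
  E <= e + Y + f1 + (f2 + (l + a + b)) by move=> *; lra.
have aux3 (e p a b c g f : R) : p * c <= f -> e + p * (a + b + c + g) <= e + p * (a + g) + p * b + (f + 0).
  by move=> ?; lra.
have aux4 (C h s e : R) : C * h <= e / 4 -> C * s <= e / 4 -> 0 < h -> C * h * (h + s) <= e * h / 2.
  by move=> h1 h2 h3; have := ler_wpM2r (ltW h3) h1; have := ler_wpM2r (ltW h3) h2; lra.
have aux5 (e p h v g s N E2 E3 ep : R) : E2 <= p * (2 * s * (N * (200 * h))) -> E3 <= ep * h / 4 ->
  p * g <= ep * h / 2 -> 0 <= p * h -> 0 < ep * h ->
  e + p * (- 2 * h * v + g) + 0 + (E2 + E3) <= e + h * (p * (400 * N * s + 1 - 2 * v)) + ep * h.
  by move=> *; lra.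
have [Cs Cs0 hCs] := mulmx_bounded sigma; have [Ct Ct0 hCt] := mulmx_bounded sigma^T.
have [DA DA0 hDA] := mulmx_bounded A; have [Cm Cm0 hCm] := noise_max W_bm.
have pos (z : R) : 0 <= z -> 0 <= z * Cs ^+ 2 by move=> z0; apply: mulr_ge0 => //; exact: sqr_ge0.
exists (400 * n%:R * Cs ^+ 2 + 1); first by apply: ltr_wpDl; [apply: pos; apply: mulr_ge0; exact: ler0n|exact: ltr01].
move=> L eps L0 eps0; have [C C0 hC] := energy_pointwise L0.
have sL : 0 < Num.sqrt L by rewrite sqrtr_gt0.
(* Small enough for [energy_pointwise] to apply and for its error [C * h * (h + Cs * u)] to cost at
   most [eps * h / 2]. *)
pose u := Num.min (4 * Cs)^-1 (eps / (4 * C * Cs)).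
have u0 : 0 < u by rewrite lt_min invr_gt0 divr_gt0 ?mulr_gt0.
have u1 : Cs * u <= 4^-1.
  apply: (@le_trans _ _ (Cs * (4 * Cs)^-1)); first by rewrite ler_pM2l // ge_min lexx.
  by rewrite invfM mulrCA mulfV ?mulr1 // gt_eqF.
have u2 : C * (Cs * u) <= eps / 4.
  apply: (@le_trans _ _ (C * (Cs * (eps / (4 * C * Cs))))).
    by rewrite ler_pM2l // ler_pM2l // ge_min lexx orbT.
  by rewrite le_eqVlt; apply/orP; left; apply/eqP; field; rewrite (gt_eqF C0) (gt_eqF Cs0).
(* The most by which the bound can fail on the exceptional event, where only crude size bounds are
   available. *)
pose D := L / 2 + 2 * DA * L + n%:R * (2 * (Ct * Num.sqrt L) * u).
have D0 : 0 < D.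
  have q1 : 0 <= DA * L by rewrite mulr_ge0 // ltW.
  have q2 : 0 <= n%:R * (2 * (Ct * Num.sqrt L) * u).
    apply: mulr_ge0 => //; apply: mulr_ge0; last exact: ltW.
    by apply: mulr_ge0 => //; apply: mulr_ge0; exact: ltW.
  rewrite /D; lra.
pose h0 := Num.min (Num.min 1 (2 * C)^-1) (Num.min (eps / (4 * C)) (eps * u ^+ 4 / (4 * D * Cm))).
have h00 : 0 < h0 by rewrite !lt_min ltr01 invr_gt0 !divr_gt0 ?mulr_gt0 // exprn_gt0.
exists h0 => // h x hp hh0.
have /andP[h1 h2] : (h <= 1) && (h <= (2 * C)^-1).
  by rewrite -le_min; apply: le_trans hh0 _; rewrite ge_min lexx.
have /andP[h3 h4] : (h <= eps / (4 * C)) && (h <= eps * u ^+ 4 / (4 * D * Cm)).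
  by rewrite -le_min; apply: le_trans hh0 _; rewrite ge_min lexx orbT.
have mF y : measurable_fun setT (fun w => energy L (X y h w)).
  by apply: (measurable_flow X_sol) => //; [exact: ltW|exact: energy_continuous].
have bF : bmeas (fun w => energy L (X x h w)).
  by split => //; exists (L / 2) => w; exact: energy_bounded.
(* Above the truncation level the energy is already maximal. *)
have [xL|xL] := leP L (enorm x ^+ 2).
  have -> : energy' L x = 0 by rewrite /energy' /theta' (min_idPr xL) divff ?subrr // gt_eqF.
  have -> : energy L x = L / 2 by rewrite /energy /theta (min_idPr xL); field; rewrite gt_eqF.
  rewrite mul0r mulr0 addr0; apply: (@le_trans _ _ (L / 2)); last by rewrite lerDl mulr_ge0 // ltW.
  rewrite /Pt -(Ex_cst P (L / 2)).
  apply: Ex_le; [exact: bmeas_integrable|exact/bmeas_integrable/bmeas_cst|].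
  by apply: aeW => w; exact: theta_le.
have xs : enorm x <= Num.sqrt L.
  by rewrite -(ler_pXn2r (n := 2)) ?nnegrE ?enorm_ge0 ?sqrtr_ge0 // (sqr_sqrtr (ltW L0)) ltW.
set p := energy' L x.
have p0 : 0 <= p by exact: theta'_ge0.
have p1 : p <= 1 by apply: theta'_le1 => //; exact: sqr_ge0.
have [G [mG PG hG]] := hCm h u hp u0.
(* Clipping acts on all outcomes, so [F1] has mean exactly zero; restricting to [G] could destroy
   the symmetry. *)
pose tau i w := clip u (noise_step W h 0 w i 0).
pose a i := (sigma^T *m x) i 0.
have mtau i : measurable_fun setT (tau i).
  apply: measurableT_comp (measurable_noise_step W_bm hp 0 i).
  by apply: continuous_measurable_fun; exact: clip_continuous.
have btau i : bmeas (tau i) by split => //; exists u => w; apply: clip_bound; exact: ltW.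
pose c1 := energy L x + p * (- 2 * h * dotv x (A *m x) + C * h * (h + Cs * u)).
pose F1 w := \sum_i p * 2 * a i * tau i w.
pose F2 w := \sum_i p * 2 * Cs ^+ 2 * tau i w ^+ 2.
pose F3 w := D * \1_(~` G) w.
have bF1 : bmeas F1 by apply: bmeas_sum => i; apply: bmeasM; [exact: bmeas_cst|exact: btau].
have bF2 : bmeas F2.
  by apply: bmeas_sum => i; apply: bmeasM; [exact: bmeas_cst|exact: bmeasM].
have mGC := measurableC mG.
have bF3 : bmeas F3 by apply: bmeasM; [exact: bmeas_cst|exact: bmeas_indic].
have main : {ae P, forall w, energy L (X x h w) <= c1 + F1 w + (F2 w + F3 w)}.
  apply: filterS (ae_flow_path W_bm X_sol x) => w [hx hx0].
  have F20 : 0 <= F2 w.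
    apply: sumr_ge0 => i _; apply: mulr_ge0; last exact: sqr_ge0.
    by apply: pos; apply: mulr_ge0.
  have [gw|ngw] := pselect (G w); last first.
    have -> : F3 w = D by rewrite /F3 indicE mem_set ?mulr1.
    have k1 : energy L (X x h w) <= L / 2 by exact: theta_le.
    have k2 : 0 <= energy L x by apply: theta_ge0 => //; exact: sqr_ge0.
    have k3 : - (2 * DA * L) <= p * (- 2 * h * dotv x (A *m x) + C * h * (h + Cs * u)).
      have q1 : `|dotv x (A *m x)| <= DA * L.
        apply: le_trans (dotv_abs _ _) _.
        have -> : DA * L = Num.sqrt L * (DA * Num.sqrt L) by rewrite -{1}(sqr_sqrtr (ltW L0)); ring.
        apply: ler_pM; rewrite ?enorm_ge0 //; apply: le_trans (hDA _) _; by rewrite ler_pM2l.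
      have q2 : 0 <= C * h * (h + Cs * u) by rewrite !mulr_ge0 ?addr_ge0 ?mulr_ge0 // ltW.
      have q3 : - (2 * DA * L) <= - 2 * h * dotv x (A *m x) + C * h * (h + Cs * u).
        have q4 : `|h * dotv x (A *m x)| <= DA * L.
          rewrite normrM (gtr0_norm hp) -[leRHS]mul1r; apply: ler_pM => //; exact: ltW.
        by have := aux1 _ _ _ q4 q2; rewrite !mulrA.
      have q5 : 0 <= 2 * DA * L by rewrite !mulr_ge0 // ltW.
      set Y := (X in _ <= X) in q3; rewrite -/Y; have := ler_wpM2l p0 q3.
      have : p * (2 * DA * L) <= 2 * DA * L by rewrite ler_piMl.
      by move=> q6 q7; apply: le_trans q7; rewrite mulrN lerN2.
    have k4 : - (n%:R * (2 * (Ct * Num.sqrt L) * u)) <= F1 w.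
      rewrite -[n in n%:R]card_ord mulr_natl -sumr_const -sumrN; apply: ler_sum => i _.
      have q1 : `|a i| <= Ct * Num.sqrt L.
        apply: le_trans (coord_le_enorm _ _) _; apply: le_trans (hCt _) _; by rewrite ler_pM2l.
      have q2 : `|tau i w| <= u by apply: clip_bound; exact: ltW.
      have : `|p * 2 * a i * tau i w| <= 2 * (Ct * Num.sqrt L) * u.
        rewrite normrM; apply: ler_pM => //; rewrite normrM; apply: ler_pM => //.
        by rewrite ger0_norm ?mulr_ge0 // ler_piMl.
      by rewrite ler_norml => /andP[].
    exact: aux2 k1 k2 k3 k4 F20.
  have -> : F3 w = 0 by rewrite /F3 indicE memNset ?mulr0.
  have [[w0 wc] hw] := hG w gw.
  have hmax : Num.max 0 h = h by apply/max_idPr; exact: ltW.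
  have e4 : Cs * u <= 4^-1 by [].
  have gb (r : R) : 0 <= r -> r <= h -> enorm (sigma *m W (Num.max 0 r) w) <= Cs * u.
    by move=> r0 rh; rewrite (max_idPr r0); apply: le_trans (hCs _) _; rewrite ler_pM2l // hw.
  have Ch : C * h <= 2^-1.
    by rewrite mulrC -ler_pdivlMr // -invfM.
  have := hC _ _ h (Cs * u) hx _ (ltW hp) h1 Ch e4 gb; rewrite maxxx hx0 => /(_ (ltW xL)).
  rewrite hmax -/p => hE.
  have tauE i : tau i w = W h w i 0.
    have e : noise_step W h 0 w = W h w by rewrite /noise_step mulr0 mulr1 w0 subr0.
    rewrite /tau e clip_id //; apply: le_trans (coord_le_enorm _ _) _.
    by apply: hw => //; exact: ltW.
  have f1 : F1 w = p * (2 * dotv x (sigma *m W h w)).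
    rewrite dotv_tr /dotv !mulr_sumr; apply: eq_bigr => i _; rewrite tauE /a; ring.
  have f2 : p * (2 * enorm (sigma *m W h w) ^+ 2) <= F2 w.
    have -> : F2 w = p * (2 * (Cs * enorm (W h w)) ^+ 2).
      rewrite exprMn enorm_sqr /dotv !mulr_sumr; apply: eq_bigr => i _; rewrite tauE; ring.
    rewrite ler_wpM2l // ler_pM2l //; apply: lerXn2r; rewrite ?nnegrE ?enorm_ge0 ?mulr_ge0 ?enorm_ge0 //.
    exact: ltW.
  by apply: le_trans hE _; rewrite f1; exact: aux3 f2.
have bR : bmeas (fun w => c1 + F1 w + (F2 w + F3 w)).
  by apply: bmeasD; [apply: bmeasD => //; exact: bmeas_cst|exact: bmeasD].
apply: (@le_trans _ _ (Ex P (fun w => c1 + F1 w + (F2 w + F3 w)))).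
  by apply: Ex_le => //; exact: bmeas_integrable.
have i1 := bmeas_integrable P bF1; have i2 := bmeas_integrable P bF2; have i3 := bmeas_integrable P bF3.
rewrite ExD; [|exact/bmeas_integrable/(bmeasD (bmeas_cst _))|exact/bmeas_integrable/bmeasD].
rewrite (ExD _ i1); last exact/bmeas_integrable/bmeas_cst.
rewrite (ExD i2 i3) Ex_cst.
have -> : Ex P F1 = 0.
  rewrite Ex_sum => [|i]; last by apply: bmeas_integrable; apply: bmeasM; [exact: bmeas_cst|exact: btau].
  by rewrite big1 // => i _; rewrite ExZ ?(Ex_clip W_bm) ?mulr0 //; exact: bmeas_integrable.
have e2 : Ex P F2 <= p * (2 * Cs ^+ 2 * (n%:R * (200 * h))).
  rewrite Ex_sum => [|i]; last by apply: bmeas_integrable; apply: bmeasM; [exact: bmeas_cst|exact: bmeasM].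
  have -> : p * (2 * Cs ^+ 2 * (n%:R * (200 * h))) = \sum_(i < n) p * 2 * Cs ^+ 2 * (200 * h).
    rewrite sumr_const card_ord -(mulr_natl _ n); ring.
  apply: ler_sum => i _; rewrite ExZ; last exact/bmeas_integrable/bmeasM.
  by apply: ler_wpM2l; [apply: pos; apply: mulr_ge0|exact: (Ex_clip_sqr W_bm)].
have e3 : Ex P F3 <= eps * h / 4.
  rewrite ExZ; last exact/bmeas_integrable/bmeas_indic.
  rewrite (Ex_indic P mGC) (Pr_setC P mG).
  have q1 : D * (1 - Pr P G) <= D * (Cm * h ^+ 2 / u ^+ 4) by rewrite ler_pM2l // lerBlDr addrC -lerBlDr.
  apply: le_trans q1 _.
  have u4 : 0 < u ^+ 4 by rewrite exprn_gt0.
  rewrite ler_pdivlMr ?mulr_gt0 // in h4.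
  have -> : D * (Cm * h ^+ 2 / u ^+ 4) = (h * (4 * D * Cm)) * (h / (4 * u ^+ 4)).
    by field; rewrite (gt_eqF u0).
  apply: le_trans (ler_wpM2r _ h4) _; first by rewrite divr_ge0 ?mulr_ge0 // ltW.
  by rewrite le_eqVlt; apply/orP; left; apply/eqP; field; rewrite (gt_eqF u0).
have e4 : C * h * (h + Cs * u) <= eps * h / 2.
  have q1 : C * h <= eps / 4.
    rewrite ler_pdivlMr ?mulr_gt0 // in h3; rewrite ler_pdivlMr //.
    by have -> : C * h * 4 = h * (4 * C) by ring.
  exact: aux4 q1 u2 hp.
have e5 : p * (C * h * (h + Cs * u)) <= eps * h / 2.
  apply: le_trans e4; rewrite ler_piMl // !mulr_ge0 ?addr_ge0 ?mulr_ge0 //; exact: ltW.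
have e6 : 0 <= p * h by rewrite mulr_ge0 // ltW.
have e7 : 0 < eps * h by rewrite mulr_gt0.
exact: aux5 e2 e3 e5 e6 e7.
Qed.

End Energy.

(** * Occupation times *)

Section Occupation.
Context {R : realType} {n : nat} d {T : measurableType d} (P : probability T R).
Variables (B : {bilinear 'cV[R]_n -> 'cV[R]_n -> 'cV[R]_n}) (A sigma : 'M[R]_n).
Variables (W : R -> T -> 'cV[R]_n) (X : 'cV[R]_n -> R -> T -> 'cV[R]_n).
Hypothesis W_bm : brownian_motion P W.
Hypothesis X_sol : forall x, sde_solution P B A sigma W x (X x).
Implicit Types (x y : 'cV[R]_n) (q : 'cV[R]_n -> R).
Local Notation b := (drift B A).
Local Notation Pt := (Pt P X).

Lemma Ex_event_ge (f : T -> R) (E : set T) (c : R) : bmeas f -> (forall w, 0 <= f w) -> measurable E ->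
  (forall w, E w -> c <= f w) -> c * Pr P E <= Ex P f.
Proof.
move=> bf f0 mE h; have bE : bmeas (\1_E : T -> R) by exact: bmeas_indic.
rewrite -(Ex_indic P mE) -ExZ; last exact: bmeas_integrable.
apply: Ex_le; [exact/bmeas_integrable/(bmeasM (bmeas_cst _))|exact: bmeas_integrable|].
apply: aeW => w; rewrite indicE; case: (boolP (w \in E)) => wE; rewrite ?mulr1 ?mulr0 //.
by apply: h; rewrite inE in wE.
Qed.

Definition occupation (h : R) (J : nat) q x : R := h * \sum_(j < J) Pt (h * j%:R) q x.

Lemma flow_bmeas q (M t : R) x : 0 <= t -> continuous q -> (forall y, `|q y| <= M) ->
  bmeas (fun w => q (X x t w)).
Proof. by move=> t0 cq hM; split; [exact: (measurable_flow X_sol)|exists M]. Qed.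

Lemma occupation_Ex q (M h : R) J x : 0 < h -> continuous q -> (forall y, `|q y| <= M) ->
  occupation h J q x = Ex P (fun w => h * \sum_(j < J) q (X x (h * j%:R) w)).
Proof.
move=> h0 cq hM; have hn (k : nat) : 0 <= h * k%:R by rewrite mulr_ge0 // ltW.
have bq (j : nat) := flow_bmeas x (hn j) cq hM.
rewrite ExZ; last by apply: bmeas_integrable; apply: bmeas_sum => j; exact: bq.
by rewrite Ex_sum // => j; exact: bmeas_integrable.
Qed.

Lemma occupation_ge0 q (h : R) J x : 0 < h -> (forall y, 0 <= q y) -> 0 <= occupation h J q x.
Proof.
by move=> h0 q0; rewrite mulr_ge0 ?(ltW h0) //; apply: sumr_ge0 => j _; exact: Ex_ge0.
Qed.

Lemma sum_continuous (I : Type) (r : seq I) (F : I -> 'cV[R]_n -> R) : (forall i, continuous (F i)) ->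
  continuous (fun x => \sum_(i <- r) F i x).
Proof. by move=> cF x; apply: (@cvg_bigsum _ _ _ (nbhs_filter x)) => i; exact: cF. Qed.

Lemma occupation_continuous q (M h : R) J : 0 < h -> continuous q -> (forall y, `|q y| <= M) ->
  continuous (occupation h J q).
Proof.
move=> h0 cq hM; have hn (k : nat) : 0 <= h * k%:R by rewrite mulr_ge0 // ltW.
have cs : continuous (fun x => \sum_(j < J) Pt (h * j%:R) q x).
  by apply: sum_continuous => j; exact: (Pt_continuous W_bm X_sol (hn j) cq hM).
move=> x; have csx : (fun x => \sum_(j < J) Pt (h * j%:R) q x) y @[y --> x] --> \sum_(j < J) Pt (h * j%:R) q x := cs x.
exact: (cvgM (cvg_cst h) csx).
Qed.

Lemma occupation_bounded q (M h : R) J x : 0 < h -> continuous q -> (forall y, `|q y| <= M) ->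
  `|occupation h J q x| <= h * (J%:R * M).
Proof.
move=> h0 cq hM; rewrite normrM gtr0_norm // ler_pM2l //.
apply: le_trans (ler_norm_sum _ _ _) _; rewrite mulr_natl -[J in leRHS]card_ord -sumr_const.
apply: ler_sum => j _; apply: (Pt_bounded X_sol) => //; by rewrite mulr_ge0 // ltW.
Qed.

Lemma occupation2_ge q (M h c : R) J y1 y2 (E : set T) : 0 < h -> continuous q ->
  (forall y, `|q y| <= M) -> (forall y, 0 <= q y) -> 0 <= c -> measurable E -> 2^-1 <= Pr P E ->
  (forall w, E w -> c <= h * \sum_(j < J) q (X y1 (h * j%:R) w) + h * \sum_(j < J) q (X y2 (h * j%:R) w)) ->
  c / 2 <= occupation h J q y1 + occupation h J q y2.
Proof.
move=> h0 cq hM q0 c0 mE PE hE.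
have hn (k : nat) : 0 <= h * k%:R by rewrite mulr_ge0 // ltW.
have bS y : bmeas (fun w => h * \sum_(j < J) q (X y (h * j%:R) w)).
  by apply: bmeasM; [exact: bmeas_cst|apply: bmeas_sum => j; exact: (flow_bmeas y (hn j) cq hM)].
have S0 y w : 0 <= h * \sum_(j < J) q (X y (h * j%:R) w).
  by rewrite mulr_ge0 ?(ltW h0) //; apply: sumr_ge0.
rewrite !(occupation_Ex _ _ h0 cq hM) -ExD; try exact: bmeas_integrable.
apply: le_trans (Ex_event_ge (bmeasD (bS y1) (bS y2)) _ mE hE); first by rewrite ler_wpM2l.
by move=> w; rewrite addr_ge0.
Qed.

Lemma occupation1_ge q (M h c : R) J y (E : set T) : 0 < h -> continuous q ->
  (forall y, `|q y| <= M) -> (forall y, 0 <= q y) -> 0 <= c -> measurable E -> 2^-1 <= Pr P E ->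
  (forall w, E w -> c <= h * \sum_(j < J) q (X y (h * j%:R) w)) ->
  c / 2 <= occupation h J q y.
Proof.
move=> h0 cq hM q0 c0 mE PE hE.
have : (2 * c) / 2 <= occupation h J q y + occupation h J q y.
  apply: (occupation2_ge (E := E) h0 cq hM) => //; first by rewrite mulr_ge0.
  by move=> w /hE; lra.
lra.
Qed.

(** By the Markov property, waiting [a] steps turns the occupation from the random position into the
    later part of a longer occupation from [x]. *)
Lemma occupation_shift q (M h : R) (a J : nat) x : 0 < h -> continuous q -> (forall y, `|q y| <= M) ->
  (forall y, 0 <= q y) ->
  Ex P (fun w => occupation h J q (X x (h * a%:R) w)) <= occupation h (a + J) q x.
Proof.
move=> h0 cq hM q0; have hn (k : nat) : 0 <= h * k%:R by rewrite mulr_ge0 // ltW.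
have cP (j : nat) := Pt_continuous W_bm X_sol (hn j) cq hM.
have bP (j : nat) : bmeas (fun w => Pt (h * j%:R) q (X x (h * a%:R) w)).
  by apply: (flow_bmeas x (hn a) (cP j) (M := M)) => y; exact: (Pt_bounded X_sol).
rewrite ExZ; last by apply: bmeas_integrable; apply: bmeas_sum => j; exact: bP.
rewrite ler_pM2l // Ex_sum => [|j]; last exact/bmeas_integrable/bP.
rewrite big_split_ord /=.
have -> : \sum_(i < J) Pt (h * (a + i)%N%:R) q x =
    \sum_(i < J) Ex P (fun w => Pt (h * i%:R) q (X x (h * a%:R) w)).
  by apply: eq_bigr => i _; exact: (markov_property W_bm X_sol x a i h0 cq hM).
by rewrite lerDr; apply: sumr_ge0 => j _; exact: Ex_ge0.
Qed.

(** Either every outcome of [E1] has occupation at least [c / 2], or one [w1] fails and then, paired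
    with it, every outcome of [E2] succeeds. In both cases a whole event of probability [p] is
    available, and no coupling of the two outcomes is needed. *)
Lemma occupation_pair q (M h c p : R) (a J : nat) x (E1 E2 : set T) : 0 < h -> continuous q ->
  (forall y, `|q y| <= M) -> (forall y, 0 <= q y) -> 0 <= c -> measurable E1 -> measurable E2 ->
  p <= Pr P E1 -> p <= Pr P E2 ->
  (forall w1 w2, E1 w1 -> E2 w2 ->
     c <= occupation h J q (X x (h * a%:R) w1) + occupation h J q (X x (h * a%:R) w2)) ->
  c / 2 * p <= occupation h (a + J) q x.
Proof.
move=> h0 cq hM q0 c0 m1 m2 p1 p2 hE.
apply: le_trans (occupation_shift a J x h0 cq hM q0).
have hn (k : nat) : 0 <= h * k%:R by rewrite mulr_ge0 // ltW.
have bO : bmeas (fun w => occupation h J q (X x (h * a%:R) w)).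
  have cO := @occupation_continuous q M h J h0 cq hM.
  have bO y : `|occupation h J q y| <= h * (J%:R * M) by exact: occupation_bounded.
  have := flow_bmeas x (hn a) cO bO; exact.
have O0 w : 0 <= occupation h J q (X x (h * a%:R) w) by exact: occupation_ge0.
have fin (E : set T) : measurable E -> p <= Pr P E ->
    (forall w, E w -> c / 2 <= occupation h J q (X x (h * a%:R) w)) ->
    c / 2 * p <= Ex P (fun w => occupation h J q (X x (h * a%:R) w)).
  move=> mE pE hc; apply: le_trans (Ex_event_ge bO O0 mE hc).
  by rewrite ler_wpM2l // divr_ge0.
have [h1|h1] := pselect (forall w, E1 w -> c / 2 <= occupation h J q (X x (h * a%:R) w)).
  exact: (fin E1).
have [w1 [e1 lt]] : exists w, E1 w /\ occupation h J q (X x (h * a%:R) w) < c / 2.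
  apply: contrapT => nh; apply: h1 => w ew; rewrite leNgt; apply/negP => lt; apply: nh.
  by exists w.
apply: (fin E2) => // w2 e2; have := hE w1 w2 e1 e2; lra.
Qed.

Lemma capped_continuous (Pw : 'M[R]_n) k : continuous (@capped R n Pw k).
Proof.
have cm : continuous (fun u : R => Num.min u (4 ^+ k)).
  by move=> u; apply: (@continuous_min R R^o id (fun=> 4 ^+ k) u); [exact: cvg_id|exact: cvg_cst].
move=> x; have ce : enorm (Pw *m y) @[y --> x] --> enorm (Pw *m x).
  apply: (@cvg_enorm R n _ _ (nbhs_filter x) (fun y => Pw *m y)); exact: (@mulmx_continuous R n Pw x).
have c2 : (fun y : 'cV[R]_n => enorm (Pw *m y) ^+ 2) y @[y --> x] --> enorm (Pw *m x) ^+ 2 := cvgM ce ce.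
exact: (cvg_comp _ _ (c2 (nbhs_filter x)) (cm _)).
Qed.

Lemma capped_bounded (Pw : 'M[R]_n) k x : `|capped Pw k x| <= 4 ^+ k.
Proof. by rewrite ger0_norm ?capped_ge0 // ge_min lexx orbT. Qed.

Hypothesis B_energy : forall x, dotv x (B x x) = 0.
Hypothesis sigma_unit : sigma \in unitmx.

Lemma small_noise_event (K : nat) : (0 < K)%N -> exists k0 : nat, forall k, (k0 <= k)%N ->
  exists E : set T, [/\ measurable E, 2^-1 <= Pr P E &
  forall w, E w -> forall r : R, 0 <= r -> r <= horizon K k -> enorm (sigma *m W (Num.max 0 r) w) <= 1].
Proof.
move=> K0; have [Cs Cs0 hCs] := mulmx_bounded sigma; have [C C0 hC] := noise_max W_bm.
have KR : 0 < K%:R :> R by rewrite ltr0n.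
pose u := Cs^-1; have u0 : 0 < u by rewrite invr_gt0.
pose t1 := Num.min 1 (u ^+ 4 / (2 * C)).
have t10 : 0 < t1 by rewrite lt_min ltr01 divr_gt0 ?exprn_gt0 // mulr_gt0.
have [k0 hk0] := small_time KR t10; exists (maxn 1 k0) => k kk.
have k1 : (0 < k)%N by apply: leq_trans kk; exact: leq_maxl.
have ht : horizon K k <= t1 by apply: hk0; apply: leq_trans kk; exact: leq_maxr.
have h0 : 0 < horizon K k :> R by rewrite /horizon divr_gt0 ?exprn_gt0 // mulr_gt0 // ltr0n.
have [G [mG PG hG]] := hC _ u h0 u0.
exists G; split=> // [|w gw r r0 rh].
  apply: le_trans PG; set h : R := horizon K k in h0 ht *.
  have /andP[h1 h2] : (h <= 1) && (h <= u ^+ 4 / (2 * C)) by rewrite -le_min.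
  have u4 : 0 < u ^+ 4 by rewrite exprn_gt0.
  have : C * h ^+ 2 / u ^+ 4 <= 2^-1.
    rewrite ler_pdivrMr //; rewrite ler_pdivlMr ?mulr_gt0 // in h2.
    have : C * h ^+ 2 <= C * h by rewrite ler_pM2l // expr2 ler_piMl // ltW.
    lra.
  lra.
rewrite (max_idPr r0); apply: le_trans (hCs _) _.
have [_ hw] := hG w gw; have := hw r r0 rh => h.
by rewrite mulrC -ler_pdivlMr // mul1r.
Qed.

(** During a short spreading time the noise is pushed along a sign pattern or its opposite, by two
    outcomes [w1] and [w2]. From the two positions reached, a common new noise [w] drives both
    paths, and one of them exits. Averaging over [w] gives the pair bound required by
    [occupation_pair]. *)
Lemma near_occupation P1 P2 Pw : splitting B A P1 P2 Pw -> forall C : R, 0 < C ->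
  exists K0 : nat, forall K : nat, (0 < K)%N -> (K0 <= K)%N ->
  exists (c : R) (m0 : nat), 0 < c /\ forall m1 : nat, (m0 <= m1)%N ->
  exists k0 : nat, forall (k J : nat) x, (k0 <= k)%N ->
  (horizon K k : R) < 4^-1 ^+ (k + m1) * J%:R ->
  4 ^+ k <= enorm x -> enorm x <= 4 * 4 ^+ k ->
  enorm (P2 *m x) <= C * 2 ^+ k -> enorm (Pw *m x) <= 2 ^+ k ->
  c <= occupation (4^-1 ^+ (k + m1)) (4 ^ m1 + J) (capped Pw k) x.
Proof.
move=> sp C C0.
have [cp [Gam [cp0 Gam0 hsp]]] := spread_event W_bm.
have [K0 hK0] := kernel_pair_exit B_energy sigma_unit sp; exists K0 => K Kp KK.
have [e0 he0] := hK0 K C Gam Kp KK C0 Gam0.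
have [k1 hk1] := he0 e0 (leqnn _).
have [co co0 [mo hmo]] := exits_occupation B_energy sp.
exists (co / 2 / 2 * cp), (maxn e0 mo); split; first by rewrite mulr_gt0 // !divr_gt0.
move=> m1 mm.
have em : (e0 <= m1)%N by apply: leq_trans mm; exact: leq_maxl.
have [k2 hk2] := hmo K Kp; have [k3 hk3] := small_noise_event Kp.
exists (maxn k1 (maxn k2 k3)) => k J x kk hJ x1 x2 xp xw.
have kk1 : (k1 <= k)%N by apply: leq_trans kk; exact: leq_maxl.
have kk2 : (k2 <= k)%N by apply: leq_trans kk; rewrite leq_max leq_max leqnn orbT.
have kk3 : (k3 <= k)%N by apply: leq_trans kk; rewrite !leq_max leqnn !orbT.
have km : (k + mo <= k + m1)%N by rewrite leq_add2l; apply: leq_trans mm; exact: leq_maxr.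
set h : R := 4^-1 ^+ (k + m1) in hJ *.
have h0 : 0 < h by rewrite exprn_gt0 // invr_gt0.
(* [a] steps of the fine mesh make up the spreading time [h1], at which the standard deviation of
   the noise is [2 ^ - (k + e0)]. *)
pose a := (4 ^ (m1 - e0))%N; pose h1 : R := 4^-1 ^+ (k + e0).
have h10 : 0 < h1 by rewrite exprn_gt0 // invr_gt0.
have hE : h * a%:R = h1.
  rewrite /h /h1 /a -{1}(subnK em) addnCA exprD natrX -mulrA mulrC -mulrA -exprMn.
  by rewrite mulfV ?expr1n ?mulr1 // pnatr_eq0.
have sq : Num.sqrt h1 = 2^-1 ^+ (k + e0).
  have -> : h1 = (2^-1 ^+ (k + e0)) ^+ 2 by rewrite /h1 -exprM mulnC exprM; congr (_ ^+ _); field.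
  by rewrite sqrtr_sqr ger0_norm // exprn_ge0 // invr_ge0.
have [s hs] := hk1 k x kk1 x1 x2 xp xw.
have [E1 [mE1 PE1 hE1]] := hsp h1 s h10.
have [E2 [mE2 PE2 hE2]] := hsp h1 (fun i => ~~ s i) h10.
have [F1 [mF1 sF1 PF1 hF1]] := Pr_ae (ae_flow_path W_bm X_sol x) mE1.
have [F2 [mF2 sF2 PF2 hF2]] := Pr_ae (ae_flow_path W_bm X_sol x) mE2.
have cq := @capped_continuous Pw k; have bq := @capped_bounded Pw k.
have q0 := @capped_ge0 R n Pw k.
have main w1 w2 : F1 w1 -> F2 w2 ->
    co / 2 <= occupation h J (capped Pw k) (X x (h * a%:R) w1) + occupation h J (capped Pw k) (X x (h * a%:R) w2).
  move=> f1 f2; rewrite hE.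
  have [_ s1 b1] := hE1 w1 (sF1 w1 f1); have [_ s2 b2] := hE2 w2 (sF2 w2 f2).
  have [p1 q1] := hF1 w1 f1; have [p2 q2] := hF2 w2 f2.
  have m00 : Num.max 0 0 = 0 :> R by exact: maxxx.
  have mh1 : Num.max 0 h1 = h1 by apply/max_idPr; exact: ltW.
  have := hs (fun t => W (Num.max 0 t) w1) (fun t => W (Num.max 0 t) w2) _ _ p1 p2.
  rewrite /= -/h1 m00 mh1 => /(_ q1 q2) hh.
  have bb (r : R) : 0 <= r -> r <= h1 -> enorm (W (Num.max 0 r) w1) <= Gam * 2^-1 ^+ (k + e0) /\
      enorm (W (Num.max 0 r) w2) <= Gam * 2^-1 ^+ (k + e0).
    by move=> r0 rh; rewrite (max_idPr r0) -sq; split; [exact: b1|exact: b2].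
  have s1' i : 2^-1 ^+ (k + e0) <= (-1) ^+ s i * W h1 w1 i 0 by rewrite -sq.
  have s2' i : (-1) ^+ s i * W h1 w2 i 0 <= - 2^-1 ^+ (k + e0).
    by have := s2 i; rewrite sq signrN mulNr lerNr.
  have [l1 u1 l2 u2 hex] := hh bb s1' s2'.
  have [E [mE PE hE']] := hk3 k kk3.
  set y1 := X x h1 w1 in l1 u1 hex *; set y2 := X x h1 w2 in l2 u2 hex *.
  have [F [mF sF PF hF]] := Pr_ae (filterI (ae_flow_path W_bm X_sol y1) (ae_flow_path W_bm X_sol y2)) mE.
  apply: (occupation2_ge (E := F) h0 cq bq) => //; [exact: ltW|by rewrite PF|].
  move=> w fw; have [[r1 z1] [r2 z2]] := hF w fw.
  have nb := hE' w (sF w fw).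
  have mj (j : nat) : Num.max 0 (h * j%:R) = h * j%:R by apply/max_idPr; rewrite mulr_ge0 // ltW.
  have S0 y : 0 <= h * \sum_(j < J) capped Pw k (X y (h * j%:R) w).
    by rewrite mulr_ge0 ?(ltW h0) //; apply: sumr_ge0 => j _; exact: q0.
  have fin y : flow_path B A sigma W X y w -> 10 <= enorm y -> enorm y <= 8 * 4 ^+ k ->
     exits Pw k (horizon K k) (fun t => X y (Num.max 0 t) w) ->
     co <= h * \sum_(j < J) capped Pw k (X y (h * j%:R) w).
    move=> [ry y0] yl yu ey.
    have := hk2 k (k + m1)%N J _ _ kk2 km hJ ry nb; rewrite /= m00 y0 => /(_ yl yu ey).
    by under eq_bigr do rewrite mj.
  have := hex _ _ _ r1 r2; rewrite /= m00 => /(_ z1 z2 nb) [ex|ex].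
    by apply: (le_trans (fin y1 _ l1 u1 ex)); [|rewrite lerDl].
  by apply: (le_trans (fin y2 _ l2 u2 ex)); [|rewrite lerDr].
have := occupation_pair (a := a) (J := J) h0 cq bq q0 _ mF1 mF2 _ _ main.
move=> /(_ cp) hfin.
apply: (@le_trans _ _ (occupation h (a + J) (capped Pw k) x)).
  by apply: hfin; rewrite ?PF1 ?PF2 // divr_ge0 // ltW.
rewrite /occupation ler_pM2l //.
have aJ : (a + J <= 4 ^ m1 + J)%N by rewrite leq_add2r leq_exp2l // leq_subr.
rewrite -(subnKC aJ) [leRHS]big_split_ord /= lerDl.
by apply: sumr_ge0 => j _; exact: Ex_ge0.
Qed.

Lemma occupation_lower P1 P2 Pw : splitting B A P1 P2 Pw -> exists (c : R) (K m1 k0 : nat), 0 < c /\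
  forall k x, (k0 <= k)%N -> 4 ^+ k <= enorm x -> enorm x <= 4 * 4 ^+ k ->
  c <= occupation (4^-1 ^+ (k + m1)) ((K * k + 2) * 4 ^ m1) (capped Pw k) x.
Proof.
move=> sp; have sp' := splitting_swap sp.
have [C C0 hC] := exits_or_near B_energy sp.
have [co co0 [mo hmo]] := exits_occupation B_energy sp.
have [K1 hK1] := near_occupation sp C0; have [K2 hK2] := near_occupation sp' C0.
pose K := (maxn K1 K2).+1.
have [c1 [n1 [c10 hn1]]] := hK1 K isT (leqW (leq_maxl _ _)).
have [c2 [n2 [c20 hn2]]] := hK2 K isT (leqW (leq_maxr _ _)).
pose m1 := maxn mo (maxn n1 n2).
have [k1 hk1] := hn1 m1 (leq_trans (leq_maxl _ _) (leq_maxr _ _)).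
have [k2 hk2] := hn2 m1 (leq_trans (leq_maxr _ _) (leq_maxr _ _)).
have [k3 hk3] := hC K isT; have [k4 hk4] := hmo K isT.
have [k5 hk5] := @small_noise_event K isT.
exists (Num.min (co / 2) (Num.min c1 c2)), K, m1, (maxn 2 (maxn k1 (maxn k2 (maxn k3 (maxn k4 k5))))).
split; first by rewrite !lt_min divr_gt0 // c10 c20.
move=> k x; rewrite !geq_max => /andP[k22 /andP[kk1 /andP[kk2 /andP[kk3 /andP[kk4 kk5]]]]] x1 x2.
set h : R := 4^-1 ^+ (k + m1).
have h0 : 0 < h by rewrite exprn_gt0 // invr_gt0.
have h4 : h * (4 ^ m1)%:R = (4 ^+ k)^-1.
  by rewrite /h exprD natrX -mulrA -exprMn mulVf ?expr1n ?mulr1 ?exprVn // pnatr_eq0.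
have N0 : 0 < (4 : R) ^+ k by rewrite exprn_gt0.
(* One unit [4 ^ - k] beyond the horizon makes the inequality on the window strict; the other extra
   unit, [4 ^ m1] steps, leaves room for the spreading time. *)
pose J := ((K * k + 1) * 4 ^ m1)%N.
have JE : ((K * k + 2) * 4 ^ m1 = 4 ^ m1 + J)%N by rewrite /J addnS mulSn -addn1.
have hJ : horizon K k < h * J%:R.
  rewrite /J natrM mulrCA h4 /horizon ltr_pM2r ?invr_gt0 // natrD natrM ltrDl; exact: ltr01.
have cq := @capped_continuous Pw k; have bq := @capped_bounded Pw k.
have q0 := @capped_ge0 R n Pw k.
have x8 : enorm x <= 8 * 4 ^+ k by apply: le_trans x2 _; rewrite ler_pM2r // ler_nat.
have x10 : 10 <= enorm x.
  apply: le_trans x1; apply: (@le_trans _ _ (4 ^+ 2)); first by lra.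
  by rewrite ler_weXn2l // ler1n.
rewrite JE.
have [nr1|nr1] := pselect (enorm (P2 *m x) <= C * 2 ^+ k /\ enorm (Pw *m x) <= 2 ^+ k).
  have [a1 a2] := nr1; apply: le_trans (hk1 k J x kk1 hJ x1 x2 a1 a2).
  by rewrite ge_min; apply/orP; right; rewrite ge_min lexx.
have [nr2|nr2] := pselect (enorm (P1 *m x) <= C * 2 ^+ k /\ enorm (Pw *m x) <= 2 ^+ k).
  have [a1 a2] := nr2; apply: le_trans (hk2 k J x kk2 hJ x1 x2 a1 a2).
  by rewrite ge_min; apply/orP; right; rewrite ge_min lexx orbT.
apply: (@le_trans _ _ (co / 2)); first by rewrite ge_min lexx.
have [E [mE PE hE]] := hk5 k kk5.
have [F [mF sF PF hF]] := Pr_ae (ae_flow_path W_bm X_sol x) mE.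
have hJ2 : horizon K k < h * (4 ^ m1 + J)%N%:R.
  by apply: lt_le_trans hJ _; rewrite ler_pM2l // ler_nat leq_addl.
apply: (occupation1_ge (E := F) h0 cq bq) => //; [exact: ltW|by rewrite PF|].
move=> w fw; have [px px0] := hF w fw; have nb := hE w (sF w fw).
have m00 : Num.max 0 0 = 0 :> R by exact: maxxx.
have mj (j : nat) : Num.max 0 (h * j%:R) = h * j%:R by apply/max_idPr; rewrite mulr_ge0 // ltW.
have := hk3 k _ _ kk3 px nb; rewrite /= m00 px0 => /(_ x1 x8) [ex|//|//].
have km : (k + mo <= k + m1)%N by rewrite leq_add2l leq_maxl.
have := hk4 k (k + m1)%N (4 ^ m1 + J)%N _ _ kk4 km hJ2 px nb; rewrite /= m00 px0 => /(_ x10 x8 ex).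
by under eq_bigr do rewrite mj.
Qed.

End Occupation.

(** * Time averages and their limit *)

Section BoundedContinuous.
Context {R : realType} {n : nat}.
Implicit Types f g : 'cV[R]_n -> R.

Definition cb f : Prop := continuous f /\ exists M : R, forall x, `|f x| <= M.

Lemma cb_cst (a : R) : cb (fun=> a).
Proof. by split; [exact: cst_continuous|exists `|a| => x]. Qed.

Lemma cbD f g : cb f -> cb g -> cb (fun x => f x + g x).
Proof.
move=> [cf [M hM]] [cg [N hN]]; split; first by move=> x; exact: (cvgD (cf x) (cg x)).
by exists (M + N) => x; apply: (le_trans (ler_normD _ _)); exact: lerD.
Qed.

Lemma cbM f g : cb f -> cb g -> cb (fun x => f x * g x).
Proof.
move=> [cf [M hM]] [cg [N hN]]; split; first by move=> x; exact: (cvgM (cf x) (cg x)).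
by exists (M * N) => x; rewrite normrM; apply: ler_pM.
Qed.

Lemma cbZ (a : R) f : cb f -> cb (fun x => a * f x).
Proof. by move=> cf; exact: (cbM (cb_cst a) cf). Qed.

Lemma cbB f g : cb f -> cb g -> cb (fun x => f x - g x).
Proof.
move=> cf cg; have h := cbD cf (cbZ (-1) cg).
by under eq_fun do rewrite -mulN1r.
Qed.

Lemma cb_sum (I : Type) (r : seq I) (F : I -> 'cV[R]_n -> R) : (forall i, cb (F i)) ->
  cb (fun x => \sum_(i <- r) F i x).
Proof.
move=> h; elim: r => [|i r IH].
  by have h0 := cb_cst 0; under eq_fun do rewrite big_nil.
by have h1 := cbD (h i) IH; under eq_fun do rewrite big_cons.
Qed.

Lemma cb_min f g : cb f -> cb g -> cb (fun x => Num.min (f x) (g x)).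
Proof.
move=> [cf [M hM]] [cg [N hN]]; split.
  by move=> x; apply: (@continuous_min _ _ _ _ x); [exact: cf|exact: cg].
exists (M + N) => x; have := hM x; have := hN x.
have := normr_ge0 (f x); have := normr_ge0 (g x).
by case: (leP (f x) (g x)); lra.
Qed.

Lemma cb_max f g : cb f -> cb g -> cb (fun x => Num.max (f x) (g x)).
Proof.
move=> [cf [M hM]] [cg [N hN]]; split.
  by move=> x; apply: (@continuous_max _ _ _ _ x); [exact: cf|exact: cg].
exists (M + N) => x; have := hM x; have := hN x.
have := normr_ge0 (f x); have := normr_ge0 (g x).
by case: (leP (f x) (g x)); lra.
Qed.

Lemma cb_bounded f (a b : R) : continuous f -> (forall x, a <= f x) -> (forall x, f x <= b) -> cb f.
Proof.
move=> cf ha hb; split=> //; exists (`|a| + `|b|) => x.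
rewrite ler_norml; have := ha x; have := hb x; have := ler_norm a; have := ler_norm b.
have := ler_norm (- a); rewrite normrN.
have := normr_ge0 a; have := normr_ge0 b; lra.
Qed.

End BoundedContinuous.

Section Averages.
Context {R : realType} {n : nat} d {T : measurableType d} (P : probability T R).
Variables (B : {bilinear 'cV[R]_n -> 'cV[R]_n -> 'cV[R]_n}) (A sigma : 'M[R]_n).
Variables (W : R -> T -> 'cV[R]_n) (X : 'cV[R]_n -> R -> T -> 'cV[R]_n).
Hypothesis W_bm : brownian_motion P W.
Hypothesis X_sol : forall x, sde_solution P B A sigma W x (X x).
Implicit Types (x y : 'cV[R]_n) (f g q : 'cV[R]_n -> R).
Local Notation Pt := (Pt P X).

Lemma cb_flow f (t : R) x : 0 <= t -> cb f -> P.-integrable setT (EFin \o (fun w => f (X x t w))).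
Proof.
move=> t0 [cf [M hM]]; apply: bmeas_integrable.
exact: (flow_bmeas X_sol _ t0 cf hM).
Qed.

Lemma cb_Pt f (t : R) : 0 <= t -> cb f -> cb (Pt t f).
Proof.
move=> t0 [cf [M hM]]; split; first exact: (Pt_continuous W_bm X_sol t0 cf hM).
by exists M => x; exact: (Pt_bounded X_sol).
Qed.

Lemma PtD f g (t : R) x : 0 <= t -> cb f -> cb g -> Pt t (fun y => f y + g y) x = Pt t f x + Pt t g x.
Proof. by move=> t0 cf cg; apply: ExD; exact: cb_flow. Qed.

Lemma PtZ (a : R) f (t : R) x : 0 <= t -> cb f -> Pt t (fun y => a * f y) x = a * Pt t f x.
Proof. by move=> t0 cf; apply: ExZ; exact: cb_flow. Qed.

Lemma Pt_cst (a t : R) x : Pt t (fun=> a) x = a.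
Proof. exact: Ex_cst. Qed.

Lemma Pt_le f g (t : R) x : 0 <= t -> cb f -> cb g -> (forall y, f y <= g y) -> Pt t f x <= Pt t g x.
Proof. by move=> t0 cf cg h; apply: Ex_le; [exact: cb_flow|exact: cb_flow|exact: aeW]. Qed.

Lemma Pt0 f x : cb f -> Pt 0 f x = f x.
Proof.
move=> cf; have e : {ae P, forall w, f (X x 0 w) = f x}.
  by apply: filterS (ae_flow_path W_bm X_sol x) => w [_ ->].
have i0 := cb_flow x (lexx 0) cf.
have i1 : P.-integrable setT (EFin \o (fun _ : T => f x)) by exact/bmeas_integrable/bmeas_cst.
rewrite -(Ex_cst P (f x)); apply/eqP; rewrite eq_le; apply/andP; split.
  by apply: Ex_le => //; apply: filterS e => w ->.
by apply: Ex_le => //; apply: filterS e => w ->.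
Qed.

Lemma Pt_sum (I : Type) (r : seq I) (F : I -> 'cV[R]_n -> R) (t : R) x : 0 <= t -> (forall i, cb (F i)) ->
  Pt t (fun y => \sum_(i <- r) F i y) x = \sum_(i <- r) Pt t (F i) x.
Proof.
move=> t0 h; apply: (Ex_sum (P := P) r (F := fun i w => F i (X x t w))) => i.
exact: cb_flow.
Qed.

Lemma Pt_semigroup f (h : R) x (a c : nat) : 0 < h -> cb f ->
  Pt (h * a%:R) (Pt (h * c%:R) f) x = Pt (h * (a + c)%N%:R) f x.
Proof. by move=> h0 [cf [M hM]]; rewrite (markov_property W_bm X_sol _ _ _ h0 cf hM). Qed.

(** Discrete Dynkin inequality: the one-step bound, summed along the semigroup. *)
Lemma iterate_step f q (h c : R) x J : 0 < h -> cb f -> cb q ->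
  (forall y, Pt h f y <= f y + c - q y) ->
  Pt (h * J%:R) f x + \sum_(j < J) Pt (h * j%:R) q x <= f x + c * J%:R.
Proof.
move=> h0 cf cq hs; have hJ (j : nat) : 0 <= h * j%:R by rewrite mulr_ge0 ?ler0n // ltW.
elim: J => [|J IH]; first by rewrite big_ord0 !mulr0 !addr0 Pt0.
have : Pt (h * J.+1%:R) f x <= Pt (h * J%:R) f x + c - Pt (h * J%:R) q x.
  have c1 : cb (fun y => f y + c) := cbD cf (cb_cst c).
  have cN : cb (fun y => - 1 * q y) := cbZ (-1) cq.
  rewrite -addn1 -(Pt_semigroup x J 1 h0 cf) mulr1 -[X in _ + X - _](Pt_cst c (h * J%:R) x).
  rewrite -mulN1r -PtD //; last exact: cb_cst.
  rewrite -PtZ // -PtD //; apply: Pt_le => //; [exact/cb_Pt/cf/ltW|exact: cbD|].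
  by move=> y; rewrite mulN1r; exact: hs.
rewrite big_ord_recr /= (_ : J.+1%:R = J%:R + 1 :> R) ?mulrSr // mulrDr mulr1; lra.
Qed.

Hypothesis B_energy : forall x, dotv x (B x x) = 0.

Lemma cb_minsqr (L : R) : 0 < L -> cb (fun x => Num.min (enorm x ^+ 2) L).
Proof.
move=> L0; apply: (cb_bounded (a := 0) (b := L)); first exact: minsqr_continuous.
  by move=> x; rewrite le_min sqr_ge0 ltW.
by move=> x; rewrite ge_min lexx orbT.
Qed.

Lemma cb_energy (L : R) : 0 < L -> cb (@energy R n L).
Proof.
by move=> L0; split; [exact: energy_continuous|exists (L / 2) => x; exact: energy_bounded].
Qed.

Lemma cb_capped (Pw : 'M[R]_n) k : cb (capped Pw k).
Proof. by split; [exact: capped_continuous|exists (4 ^+ k) => x; exact: capped_bounded]. Qed.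

Lemma energy0 (L : R) : 0 < L -> energy L (0 : 'cV[R]_n) = 0.
Proof.
move=> L0; rewrite /energy /theta enorm0 expr0n /= (min_idPl (ltW L0)).
by rewrite expr0n mul0r subr0.
Qed.

Lemma minsqr_energy (L : R) x : 0 < L -> Num.min (enorm x ^+ 2) L <= 2 * energy L x.
Proof. by move=> L0; have := theta_ge L0 (sqr_ge0 (enorm x)); rewrite /energy; lra. Qed.

(** For [2 |x| ^ 2 <= L] the factor [energy'] is at least [1 / 2]. Otherwise [Num.min (|x| ^ 2) L]
    is at least [L / 2], and the correction makes the left side nonpositive. *)
Lemma capped_energy (Pw : 'M[R]_n) (a L : R) k x : 0 < L -> 0 < a ->
  a * enorm (Pw *m x) ^+ 2 <= dotv x (A *m x) ->
  a * (capped Pw k x - 2 * 4 ^+ k / L * Num.min (enorm x ^+ 2) L) <= 2 * (energy' L x * dotv x (A *m x)).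
Proof.
move=> L0 a0 hd; set u := enorm x ^+ 2; set m := Num.min u L.
have D0 : 0 <= dotv x (A *m x) by apply: le_trans hd; rewrite mulr_ge0 ?sqr_ge0 // ltW.
have t0 : 0 <= energy' L x by apply: theta'_ge0.
have k0 : 0 <= (4 : R) ^+ k by rewrite exprn_ge0.
have q1 : capped Pw k x <= 4 ^+ k by rewrite /capped ge_min lexx orbT.
have q2 : capped Pw k x <= enorm (Pw *m x) ^+ 2 by rewrite /capped ge_min lexx.
case: (leP (2 * u) L) => hu.
  have mu : m = u by rewrite /m; apply/min_idPl; have := sqr_ge0 (enorm x); rewrite -/u; lra.
  have e2 : 2^-1 <= energy' L x.
    rewrite /energy' /theta' -/u -/m mu.
    have : u / L <= 2^-1 by rewrite ler_pdivrMr //; lra.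
    lra.
  have h1 : a * capped Pw k x <= dotv x (A *m x) by apply: le_trans hd; rewrite ler_pM2l.
  have h2 : 2^-1 * dotv x (A *m x) <= energy' L x * dotv x (A *m x) by apply: ler_wpM2r.
  have h3 : 0 <= a * (2 * 4 ^+ k / L * m).
    apply: mulr_ge0; first exact: ltW.
    apply: mulr_ge0; last by rewrite mu; exact: sqr_ge0.
    by apply: divr_ge0; [exact: mulr_ge0|exact: ltW].
  rewrite mulrBr; lra.
have m2 : L <= 2 * m by rewrite /m; case: (leP u L); lra.
have h1 : 4 ^+ k <= 2 * 4 ^+ k / L * m.
  rewrite (_ : 2 * 4 ^+ k / L * m = 4 ^+ k * ((2 * m) / L)); last by ring.
  by rewrite ler_peMr // ler_pdivlMr // mul1r.
have h2 : a * (capped Pw k x - 2 * 4 ^+ k / L * m) <= 0 by apply: mulr_ge0_le0; lra.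
apply: (le_trans h2); apply: mulr_ge0 => //; exact: mulr_ge0.
Qed.

(* With the energy truncated at [N ^ 3], the region [2 |x| ^ 2 > N ^ 3] contributes
   at most [4 ^ k * N ^ 2 / N ^ 3 <= N] to the occupation of [capped Pw k]. *)
Lemma energy_average P1 P2 Pw : splitting B A P1 P2 Pw -> exists2 C : R, 0 < C &
  forall N : nat, (0 < N)%N -> exists m0 : nat, forall m J : nat, (m0 <= m)%N ->
  4^-1 ^+ m * J%:R <= 2 * N%:R :> R ->
  occupation P X (4^-1 ^+ m) J (fun x => Num.min (enorm x ^+ 2) (N%:R ^+ 3)) 0 <= C * N%:R ^+ 2 /\
  forall k : nat, (4 : R) ^+ k <= N%:R ^+ 2 -> occupation P X (4^-1 ^+ m) J (capped Pw k) 0 <= C * N%:R.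
Proof.
move=> sp; have [a a0 hd] := sp_diss sp.
have [C0 C00 hs] := energy_step B_energy W_bm X_sol.
set E := C0 + 1; have E0 : 0 < E by rewrite /E; lra.
have Ea0 : 0 < E / a by rewrite divr_gt0.
exists (2 * (E / a) + 16 * E); first by lra.
move=> N N0; set L : R := N%:R ^+ 3.
have NR0 : 0 < N%:R :> R by rewrite ltr0n.
have L0 : 0 < L by rewrite exprn_gt0.
have [h0 h00 {}hs] := hs L 1 L0 ltr01.
have [m0 hm0] := pow2_large h0^-1.
exists m0 => m J m0m hJ; set h : R := 4^-1 ^+ m.
have hp : 0 < h by rewrite exprn_gt0 // invr_gt0.
have hh0 : h <= h0.
  rewrite /h exprVn -[leRHS]invrK lef_pV2 ?posrE ?exprn_gt0 ?invr_gt0 //.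
  apply: (le_trans (hm0 _ m0m)); apply: lerXn2r; rewrite ?nnegrE //; lra.
have hj (j : nat) : 0 <= h * j%:R by rewrite mulr_ge0 ?ler0n // ltW.
have {}hs x : Pt h (energy L) x <= energy L x + h * E - 2 * h * (energy' L x * dotv x (A *m x)).
  have := hs h x hp hh0; have : energy' L x <= 1 by apply: theta'_le1; rewrite ?sqr_ge0.
  have t0 : 0 <= energy' L x by apply: theta'_ge0.
  move=> t1; have : h * (energy' L x * C0) <= h * C0.
    by rewrite ler_pM2l // ler_piMl // ltW.
  rewrite /E; lra.
have De x : 0 <= energy' L x * dotv x (A *m x).
  apply: mulr_ge0; first exact: theta'_ge0.
  by apply: le_trans (hd x); rewrite mulr_ge0 ?sqr_ge0 // ltW.
have ce := cb_energy L0; have cm := cb_minsqr L0.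
have e0 (j : nat) : 0 <= Pt (h * j%:R) (energy L) 0.
  by apply: Ex_ge0 => w; apply: theta_ge0 => //; exact: sqr_ge0.
have em (j : nat) : Pt (h * j%:R) (energy L) 0 <= h * E * j%:R.
  have := @iterate_step (energy L) (fun=> 0) h (h * E) 0 j hp ce (cb_cst 0).
  rewrite energy0 // add0r big1 => [|i _]; last exact: Pt_cst.
  rewrite addr0; apply=> y; apply: (le_trans (hs y)); rewrite lerD2l lerN2.
  by rewrite mulr_ge0 // mulr_ge0 // ltW.
have mm (j : nat) : (j < J)%N -> Pt (h * j%:R) (fun x => Num.min (enorm x ^+ 2) L) 0 <= 4 * N%:R * E.
  move=> jJ; apply: (le_trans (Pt_le 0 (hj j) cm (cbZ 2 ce) (fun y => minsqr_energy y L0))).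
  rewrite PtZ //; have := em j.
  have : h * j%:R * E <= h * J%:R * E by rewrite ler_pM2r // ler_pM2l // ler_nat ltnW.
  have : h * J%:R * E <= 2 * N%:R * E by rewrite ler_pM2r.
  lra.
have sm : occupation P X h J (fun x => Num.min (enorm x ^+ 2) L) 0 <= 8 * E * N%:R ^+ 2.
  have : \sum_(j < J) Pt (h * j%:R) (fun x => Num.min (enorm x ^+ 2) L) 0 <= \sum_(j < J) 4 * N%:R * E.
    by apply: ler_sum => j _; exact: mm.
  rewrite sumr_const card_ord -[leRHS]mulr_natr => hsum.
  apply: (le_trans (ler_wpM2l (ltW hp) hsum)).
  have : h * J%:R * (4 * N%:R * E) <= 2 * N%:R * (4 * N%:R * E).
    by rewrite ler_pM2r // !mulr_gt0.
  lra.
split; first by apply: (le_trans sm); rewrite ler_pM2r ?exprn_gt0 //; lra.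
move=> k kN; set r := 2 * 4 ^+ k / L.
set q := fun x => h * a * (capped Pw k x - r * Num.min (enorm x ^+ 2) L).
have cq0 : cb (fun x => capped Pw k x - r * Num.min (enorm x ^+ 2) L).
  by apply: cbB; [exact: cb_capped|exact: cbZ].
have cq : cb q by exact: cbZ.
have hq : Pt (h * J%:R) (energy L) 0 + \sum_(j < J) Pt (h * j%:R) q 0 <= h * E * J%:R.
  have := @iterate_step (energy L) q h (h * E) 0 J hp ce cq; rewrite energy0 // add0r; apply=> y.
  apply: (le_trans (hs y)); rewrite lerD2l lerN2 /q.
  have := capped_energy k L0 a0 (hd y); rewrite -/r => h1.
  by have := ler_wpM2l (ltW hp) h1; lra.
have qe : \sum_(j < J) Pt (h * j%:R) q 0 = a * (occupation P X h J (capped Pw k) 0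
    - r * occupation P X h J (fun x => Num.min (enorm x ^+ 2) L) 0).
  rewrite /occupation mulrCA -mulrBr mulrA [a * h]mulrC mulr_sumr -sumrB mulr_sumr.
  apply: eq_bigr => j _; rewrite PtZ //; congr (_ * _).
  have cN : cb (fun y => - r * Num.min (enorm y ^+ 2) L) by exact: cbZ.
  rewrite -mulNr -PtZ // -PtD //; last exact: cb_capped.
  by congr (Ex P _); apply/funext => w; rewrite mulNr.
have rN : r * (8 * E * N%:R ^+ 2) <= 16 * E * N%:R.
  rewrite /r /L -[X in _ <= X](_ : 2 * N%:R ^+ 2 / N%:R ^+ 3 * (8 * E * N%:R ^+ 2) = _); last first.
    by field; rewrite gt_eqF.
  rewrite ler_pM2r ?mulr_gt0 ?exprn_gt0 // ler_pM2r ?invr_gt0 ?exprn_gt0 //.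
  by rewrite ler_pM2l.
have r0 : 0 <= r by rewrite mulr_ge0 ?invr_ge0 ?(ltW L0) // mulr_ge0 ?exprn_ge0.
have rs := ler_wpM2l r0 sm.
have hJE : h * E * J%:R <= 2 * N%:R * E by rewrite mulrAC ler_pM2r.
have := e0 J; rewrite qe in hq => eJ.
have h1 : a * (occupation P X h J (capped Pw k) 0
    - r * occupation P X h J (fun x => Num.min (enorm x ^+ 2) L) 0) <= 2 * N%:R * E by lra.
rewrite mulrC -ler_pdivlMr // in h1.
have e1 : 2 * N%:R * E / a = 2 * (E / a) * N%:R by ring.
rewrite e1 in h1.
lra.
Qed.

Lemma sum_shift (u : nat -> R) (a J M : nat) : (forall j, 0 <= u j) -> (J + a <= M)%N ->
  \sum_(j < J) u (j + a)%N <= \sum_(l < M) u l.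
Proof.
move=> u0 aJ; rewrite -(big_mkord xpredT (fun j => u (j + a)%N)) -(big_mkord xpredT u).
have -> : \sum_(0 <= i < J) u (i + a)%N = \sum_(a <= i < J + a) u i.
  by have := big_addn 0 (J + a) a xpredT u; rewrite add0n addnK => ->.
rewrite [leRHS](big_cat_nat (n := a)) //=; last by rewrite (leq_trans _ aJ) ?leq_addl.
rewrite [X in _ + X](big_cat_nat (n := (J + a)%N)) ?leq_addl //=.
by rewrite addrCA lerDl addr_ge0 // sumr_ge0.
Qed.

(** After exchanging the sums, each shift of the outer window stays inside the longer one, and the
    factor in front is the length of the inner window. For inner windows of order [k / 4 ^ k] this
    factor is the source of the decay in [k]. *)
Lemma occupation_comp q (h : R) (J J' s : nat) : 0 < h -> cb q -> (forall y, 0 <= q y) ->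
  occupation P X h J (occupation P X (h * (4 ^ s)%N%:R) J' q) 0 <=
  h * (4 ^ s * J')%N%:R * occupation P X h (J + 4 ^ s * J') q 0.
Proof.
move=> h0 cq q0; set h' := h * (4 ^ s)%N%:R.
have hj (j : nat) : 0 <= h * j%:R by rewrite mulr_ge0 ?ler0n // ltW.
have h'j (j : nat) : h' * j%:R = h * (4 ^ s * j)%N%:R by rewrite /h' -mulrA -natrM.
have cF (i : 'I_J') : cb (Pt (h' * i%:R) q) by apply: cb_Pt => //; rewrite h'j.
pose u l := Pt (h * l%:R) q 0.
have u0 l : 0 <= u l by apply: Ex_ge0.
have e (j : nat) : Pt (h * j%:R) (occupation P X h' J' q) 0 = h' * \sum_(i < J') u (j + 4 ^ s * i)%N.
  rewrite /occupation PtZ //; last exact: cb_sum.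
  rewrite Pt_sum //; congr (_ * _); apply: eq_bigr => i _.
  by rewrite h'j Pt_semigroup.
rewrite {1}/occupation; under eq_bigr do rewrite e.
rewrite -mulr_sumr exchange_big /= -mulrA; apply: ler_wpM2l; first exact: ltW.
have : \sum_(i < J') \sum_(j < J) u (j + 4 ^ s * i)%N <= \sum_(i < J') \sum_(l < J + 4 ^ s * J') u l.
  apply: ler_sum => i _; apply: sum_shift => //.
  by rewrite leq_add2l leq_mul2l ltnW ?orbT.
rewrite sumr_const card_ord -[leRHS]mulr_natl => hs.
rewrite /occupation natrM; have h'0 : 0 <= h' by rewrite /h' mulr_ge0 ?ler0n // ltW.
have := ler_wpM2l h'0 hs; rewrite /h' /u; lra.
Qed.

Definition average (m N : nat) f : R :=
  N%:R^-1 * occupation P X (4^-1 ^+ m) (N * 4 ^ m) f 0.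

Hypothesis sigma_unit : sigma \in unitmx.

(* [f k] is the truncated occupation of [capped Pw k] over a time of order
   [k / 4 ^ k]: it is bounded below on the annulus by instability, and its time
   average is bounded above by the energy balance. *)
Lemma average_decay P1 P2 Pw : splitting B A P1 P2 Pw ->
  exists (C : R) (k0 N0 : nat) (f : nat -> 'cV[R]_n -> R), [/\ 0 < C,
  forall k, cb (f k) /\ forall x, 0 <= f k x <= 1,
  forall k x, (k0 <= k)%N -> 4 ^+ k <= enorm x -> enorm x <= 4 * 4 ^+ k -> 1 <= f k x &
  forall N, (N0 <= N)%N -> exists2 m, (N <= m)%N &
  (forall k, (4 : R) ^+ k <= N%:R ^+ 2 -> average m N (f k) <= C * (k.+1%:R * 4^-1 ^+ k)) /\
  average m N (fun x => Num.min (enorm x ^+ 2) (N%:R ^+ 3)) <= C * N%:R].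
Proof.
move=> sp; have [c [K [m1 [k0 [c0 hf]]]]] := occupation_lower W_bm X_sol B_energy sigma_unit sp.
have [C C0 hC] := energy_average sp.
pose hk (k : nat) : R := 4^-1 ^+ (k + m1); pose Jk k := ((K * k + 2) * 4 ^ m1)%N.
pose f k x := Num.min 1 (c^-1 * occupation P X (hk k) (Jk k) (capped Pw k) x).
have hk0 k : 0 < hk k by rewrite exprn_gt0 // invr_gt0.
have cocc k : cb (occupation P X (hk k) (Jk k) (capped Pw k)).
  have [cq [M hM]] := cb_capped Pw k; split; first exact: (occupation_continuous W_bm X_sol (hk0 k) cq hM).
  by exists (hk k * ((Jk k)%:R * M)) => x; exact: (occupation_bounded X_sol _ _ (hk0 k) cq hM).
have occ0 k x : 0 <= occupation P X (hk k) (Jk k) (capped Pw k) x.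
  by apply: occupation_ge0 => // y; exact: capped_ge0.
have cf k : cb (f k) by apply: cb_min; [exact: cb_cst|exact: cbZ].
have hJk k : hk k * (Jk k)%:R = (K * k + 2)%N%:R * 4^-1 ^+ k.
  rewrite /hk /Jk natrM natrX exprD !exprVn; field.
  by rewrite !expf_neq0.
have hJk1 k : hk k * (Jk k)%:R <= (K + 2)%N%:R * (k.+1%:R * 4^-1 ^+ k).
  rewrite hJk mulrA ler_pM2r ?exprn_gt0 ?invr_gt0 // -natrM ler_nat; nia.
have k4 (k : nat) : k.+1%:R * 4^-1 ^+ k <= 1 :> R.
  rewrite exprVn ler_pdivrMr ?exprn_gt0 // mul1r -natrX ler_nat.
  exact: ltn_expl.
exists (C + c^-1 * (K + 2)%N%:R * C), k0, (K + 2)%N, f; split.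
- by rewrite addr_gt0 // !mulr_gt0 ?invr_gt0 ?ltr0n ?addn2.
- by move=> k; split=> // x; rewrite /f le_min ler01 ge_min lexx mulr_ge0 // invr_ge0 ltW.
- move=> k x kk x1 x2; rewrite /f le_min lexx /= ler_pdivlMl // mulr1; exact: hf.
move=> N KN; have N0 : (0 < N)%N by apply: leq_trans KN; rewrite addn2.
(* [4 ^ k <= N ^ 2] forces [k < N ^ 2], so the mesh [4 ^ - m] refines the inner meshes [hk k] of all
   scales considered. *)
have [m0 hm] := hC N N0; pose m := (m0 + N ^ 2 + N + m1)%N.
have NR0 : 0 < N%:R :> R by rewrite ltr0n.
exists m; first by rewrite /m; lia.
set h : R := 4^-1 ^+ m; have h0 : 0 < h by rewrite exprn_gt0 // invr_gt0.
have hNm : h * (N * 4 ^ m)%N%:R = N%:R.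
  by rewrite natrM natrX /h exprVn mulrCA mulVf ?mulr1 // expf_neq0.
have m0m : (m0 <= m)%N by rewrite /m; lia.
have C1 : C <= C + c^-1 * (K + 2)%N%:R * C.
  by rewrite lerDl !mulr_ge0 ?invr_ge0 ?ler0n // ltW.
split; last first.
  rewrite /average ler_pdivrMl // mulrCA -expr2.
  have J1 : h * (N * 4 ^ m)%N%:R <= 2 * N%:R by rewrite hNm; lra.
  have [h1 _] := hm m _ m0m J1.
  by apply: (le_trans h1); rewrite ler_pM2r ?exprn_gt0.
move=> k kN.
have km : (k + m1 <= m)%N.
  have : (k < N ^ 2)%N by rewrite (leq_trans (ltn_expl k (isT : 1 < 4)%N)) // -(ler_nat R) !natrX.
  by rewrite /m; lia.
pose s := (m - (k + m1))%N.
have hks : hk k = h * (4 ^ s)%N%:R.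
  have -> : h = 4^-1 ^+ (s + (k + m1)) by rewrite /h /s subnK.
  by rewrite natrX exprD mulrAC -exprMn mulVf ?expr1n ?mul1r.
have cq := cb_capped Pw k.
(* The inner window lengthens the averaging time by at most [K + 2 <= N]; hence the bound [2 N] on
   the time in [energy_average]. *)
have J2 : h * (N * 4 ^ m + 4 ^ s * Jk k)%N%:R <= 2 * N%:R.
  rewrite natrD mulrDr hNm natrM mulrA -hks mulr2n mulrDl mul1r lerD2l.
  apply: (le_trans (hJk1 k)); apply: (@le_trans _ _ (K + 2)%N%:R); last by rewrite ler_nat.
  by rewrite ler_piMr ?ler0n.
have [_ /(_ k kN) h1] := hm m _ m0m J2.
have h2 := occupation_comp (N * 4 ^ m) (Jk k) s h0 cq (@capped_ge0 R n Pw k).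
rewrite -hks in h2.
have h3 : occupation P X h (N * 4 ^ m) (f k) 0 <=
    c^-1 * occupation P X h (N * 4 ^ m) (occupation P X (hk k) (Jk k) (capped Pw k)) 0.
  rewrite /occupation mulrCA; apply: ler_wpM2l; first exact: ltW.
  rewrite mulr_sumr; apply: ler_sum => j _.
  have hj : 0 <= h * j%:R by rewrite mulr_ge0 ?ler0n // ltW.
  rewrite -PtZ //; last exact: cocc.
  by apply: Pt_le => //; [exact/cbZ/cocc|move=> y; rewrite /f ge_min lexx orbT].
have ci : 0 <= c^-1 by rewrite invr_ge0 ltW.
have h4 : h * (4 ^ s * Jk k)%N%:R <= (K + 2)%N%:R * (k.+1%:R * 4^-1 ^+ k).
  by rewrite natrM mulrA -hks.
have h5 : occupation P X h (N * 4 ^ m) (f k) 0 <=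
    c^-1 * ((K + 2)%N%:R * (k.+1%:R * 4^-1 ^+ k) * (C * N%:R)).
  apply: (le_trans h3); apply: ler_wpM2l => //; apply: (le_trans h2).
  apply: ler_pM => //; first by rewrite mulr_ge0 ?ler0n // ltW.
  by apply: occupation_ge0 => // y; exact: capped_ge0.
rewrite /average -/h ler_pdivrMl //; apply: (le_trans h5).
have : 0 <= C * (k.+1%:R * 4^-1 ^+ k) * N%:R.
  by rewrite !mulr_ge0 ?ler0n ?exprn_ge0 ?invr_ge0 ?ler0n // ltW.
lra.
Qed.

End Averages.

(** * Limits along an ultrafilter *)

Section GeneralisedLimit.
Context {R : realType}.

Lemma ultra_cvg (G : set_system nat) (u : nat -> R) (M : R) : UltraFilter G ->
  (forall N, `|u N| <= M) -> exists p : R, u @ G --> p.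
Proof.
move=> UG hM; have hG : (u @ G) `[(- M), M]%classic.
  have gT : G setT by exact: filterT.
  suff : G [set N | `[(- M), M]%classic (u N)] by [].
  by apply: filterS gT => N _ /=; rewrite in_itv /= -ler_norml.
have [p [_ cp]] := @segment_compact R (- M) M (u @ G) _ hG.
exists p => U nU; case: (in_ultra_setVsetC (u @^-1` U) UG) => // hC.
have [y [/= yC yU]] := cp _ _ (hC : (u @ G) (~` U)) nU.
by [].
Qed.

(** An ultrafilter finer than [\oo] gives a limit to all bounded sequences at once, linearly, so no
    subsequence depending on the test function has to be extracted. *)
Lemma generalised_limit : exists l : (nat -> R) -> R, forall u (M : R), (forall N, `|u N| <= M) ->
  [/\ forall v (M' : R), (forall N, `|v N| <= M') -> l (fun N => u N + v N) = l u + l v,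
      forall a : R, l (fun N => a * u N) = a * l u &
      forall (N0 : nat) (c : R), (forall N, (N0 <= N)%N -> u N <= c) -> l u <= c].
Proof.
have [G [UG hG]] := @ultraFilterLemma nat \oo _.
exists (fun u => lim (u @ G)) => u M hu; have [p cp] := ultra_cvg UG hu.
have hR := @Rhausdorff R.
rewrite (cvg_lim hR cp); split.
- move=> v M' hv; have [q cq] := ultra_cvg UG hv.
  by rewrite (cvg_lim hR cq); apply: cvg_lim => //; exact: cvgD.
- by move=> a; apply: cvg_lim => //; apply: cvgM => //; exact: cvg_cst.
move=> N0 c hc; rewrite leNgt; apply/negP => cp'.
have h1 : G [set N | c < u N] by exact: (cvgr_gt _ cp).
have h2 : G [set N | (N0 <= N)%N] by apply: hG; exists N0.
have [N [/= h3 h4]] := filter_ex (filterI h1 h2).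
by move: h3; rewrite ltNge hc.
Qed.

End GeneralisedLimit.

Section Mean.
Context {R : realType} {n : nat}.

(** On a noncompact space a positive normalized functional need not come from a measure: mass may
    escape to infinity. This is what [mean_tight] excludes. *)
Record mean_functional (Lam : ('cV[R]_n -> R) -> R) : Prop := MeanFunctional {
  meanD : forall f g, cb f -> cb g -> Lam (fun x => f x + g x) = Lam f + Lam g ;
  meanZ : forall (a : R) f, cb f -> Lam (fun x => a * f x) = a * Lam f ;
  mean_ge0 : forall f, cb f -> (forall x, 0 <= f x) -> 0 <= Lam f ;
  mean1 : Lam (fun=> 1) = 1 ;
  mean_tight : forall e : R, 0 < e -> exists r : R, forall f, cb f ->
    (forall x, 0 <= f x <= 1) -> (forall x, enorm x <= r -> f x = 0) -> Lam f <= e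
}.

End Mean.

Lemma pow4_bracket {R : realType} (r : R) : 1 <= r -> exists k : nat, 4 ^+ k <= r < 4 ^+ k.+1.
Proof.
move=> r1; have [k0 hk0] := pow2_large (r + 1).
have ex : exists k : nat, r < 4 ^+ k.
  exists k0; apply: (@lt_le_trans _ _ (r + 1)); first by rewrite ltrDl.
  apply: (le_trans (hk0 k0 (leqnn _))); apply: lerXn2r; rewrite ?nnegrE //; lra.
case: (ex_minnP ex) => -[|k] hk hm; first by move: hk; rewrite expr0 ltNge r1.
exists k; rewrite hk andbT leNgt; apply/negP => /hm; by rewrite ltnn.
Qed.

Section LimitFunctional.
Context {R : realType} {n : nat} d {T : measurableType d} (P : probability T R).
Variables (B : {bilinear 'cV[R]_n -> 'cV[R]_n -> 'cV[R]_n}) (A sigma : 'M[R]_n).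
Variables (W : R -> T -> 'cV[R]_n) (X : 'cV[R]_n -> R -> T -> 'cV[R]_n).
Hypothesis W_bm : brownian_motion P W.
Hypothesis X_sol : forall x, sde_solution P B A sigma W x (X x).
Implicit Types (x y : 'cV[R]_n) (f g q : 'cV[R]_n -> R).
Local Notation Pt := (Pt P X).
Local Notation average := (average P X).

Lemma grid_ge0 (m j : nat) : 0 <= (4^-1 : R) ^+ m * j%:R.
Proof. by rewrite mulr_ge0 ?exprn_ge0 ?invr_ge0 ?ler0n. Qed.

Lemma averageD m N f g : cb f -> cb g -> average m N (fun x => f x + g x) = average m N f + average m N g.
Proof.
move=> cf cg; rewrite /average /occupation -!mulrDr -big_split /=; congr (_ * (_ * _)).
by apply: eq_bigr => j _; rewrite (PtD X_sol) ?grid_ge0.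
Qed.

Lemma averageZ m N (a : R) f : cb f -> average m N (fun x => a * f x) = a * average m N f.
Proof.
move=> cf; rewrite /average /occupation [RHS]mulrCA (mulrCA a) [in RHS]mulr_sumr; congr (_ * (_ * _)).
by apply: eq_bigr => j _; rewrite (PtZ X_sol) ?grid_ge0.
Qed.

Lemma average_le m N f g : cb f -> cb g -> (forall x, f x <= g x) -> average m N f <= average m N g.
Proof.
move=> cf cg h; rewrite /average /occupation ler_wpM2l ?invr_ge0 ?ler0n //.
rewrite ler_wpM2l ?exprn_ge0 ?invr_ge0 ?ler0n //; apply: ler_sum => j _.
by apply: (Pt_le X_sol) => //; exact: grid_ge0.
Qed.

Lemma average_cst m N (a : R) : (0 < N)%N -> average m N (fun=> a) = a.
Proof.
move=> N0; rewrite /average /occupation.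
under eq_bigr do rewrite Pt_cst.
rewrite sumr_const card_ord -[a *+ _]mulr_natr natrM natrX exprVn.
by field; rewrite pnatr_eq0 -lt0n N0 expf_neq0.
Qed.

Lemma average_bounded m N f (M : R) : (0 < N)%N -> cb f -> (forall x, `|f x| <= M) -> `|average m N f| <= M.
Proof.
move=> N0 cf hM; rewrite ler_norml -{1}(average_cst m (- M) N0) -{2}(average_cst m M N0).
by apply/andP; split; apply: average_le => //; try exact: cb_cst;
  move=> x; move: (hM x); rewrite ler_norml => /andP[].
Qed.

Lemma average_sum m N (I : Type) (r : seq I) (F : I -> 'cV[R]_n -> R) : (forall i, cb (F i)) ->
  average m N (fun x => \sum_(i <- r) F i x) = \sum_(i <- r) average m N (F i).
Proof.
move=> cF; elim: r => [|i r IH].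
  rewrite big_nil; under [X in average _ _ X]eq_fun do rewrite big_nil.
  rewrite /average /occupation big1 ?mulr0 // => j _; exact: Pt_cst.
rewrite big_cons -IH -averageD //; last exact: cb_sum.
by congr average; apply/funext => x; rewrite big_cons.
Qed.

(** A time shift by [c] steps changes only [c] terms at either end of the sum, each bounded by
    [M]. *)
Lemma average_shift g (M : R) (m0 a m N : nat) : (m0 <= m)%N -> continuous g -> (forall x, `|g x| <= M) ->
  average m N (Pt (4^-1 ^+ m0 * a%:R) g) <= average m N g + 2 * (4^-1 ^+ m0 * a%:R) * M / N%:R.
Proof.
move=> mm cg hM; set h : R := 4^-1 ^+ m; have h0 : 0 < h by rewrite exprn_gt0 // invr_gt0.
have cbg : cb g by split=> //; exists M.
pose c := (a * 4 ^ (m - m0))%N; have hc : 4^-1 ^+ m0 * a%:R = h * c%:R.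
  have -> : h = 4^-1 ^+ (m0 + (m - m0)) by rewrite /h subnKC.
  rewrite exprD /c natrM natrX [a%:R * _]mulrC !mulrA; congr (_ * _).
  by rewrite -mulrA -exprMn mulVf ?expr1n ?mulr1.
rewrite hc; set J := (N * 4 ^ m)%N; pose u j := Pt (h * j%:R) g 0.
have hu j : `|u j| <= M by apply: (Pt_bounded X_sol) => //; exact: grid_ge0.
have e1 : \sum_(j < J) Pt (h * j%:R) (Pt (h * c%:R) g) 0 = \sum_(j < J) u (j + c)%N.
  by apply: eq_bigr => j _; rewrite (Pt_semigroup W_bm X_sol).
have e2 : \sum_(j < J) u (j + c)%N = \sum_(j < J) u j + \sum_(j < c) (u (j + J)%N - u j).
  have e3 (a1 b1 : nat) : \sum_(j < a1 + b1) u j = \sum_(j < a1) u j + \sum_(j < b1) u (j + a1)%N.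
    rewrite big_split_ord /=; congr (_ + _); apply: eq_bigr => j _; by rewrite addnC.
  have := e3 c J; rewrite addnC e3 sumrB; lra.
have e4 : \sum_(j < c) (u (j + J)%N - u j) <= 2 * M * c%:R.
  have : \sum_(j < c) (u (j + J)%N - u j) <= \sum_(j < c) (2 * M).
    apply: ler_sum => j _; have := hu (j + J)%N; have := hu j.
    rewrite !ler_norml => /andP[? ?] /andP[? ?]; lra.
  by rewrite sumr_const card_ord -[leRHS]mulr_natr.
rewrite /average /occupation -/h -/J e1 e2 2!mulrDr lerD2l.
rewrite [leRHS]mulrC; apply: ler_wpM2l; first by rewrite invr_ge0 ler0n.
have := ler_wpM2l (ltW h0) e4; lra.
Qed.

Hypothesis B_energy : forall x, dotv x (B x x) = 0.
Hypothesis sigma_unit : sigma \in unitmx.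

Lemma limit_functional P1 P2 Pw : splitting B A P1 P2 Pw ->
  exists (Lam : ('cV[R]_n -> R) -> R) (C : R) (k0 : nat) (f : nat -> 'cV[R]_n -> R),
  [/\ mean_functional Lam,
  forall (m a : nat) g, cb g -> Lam (Pt (4^-1 ^+ m * a%:R) g) = Lam g,
  forall k, cb (f k) /\ forall x, 0 <= f k x <= 1,
  forall k x, (k0 <= k)%N -> 4 ^+ k <= enorm x -> enorm x <= 4 * 4 ^+ k -> 1 <= f k x &
  forall k, Lam (f k) <= C * (k.+1%:R * 4^-1 ^+ k)].
Proof.
move=> sp; have [C [k0 [N0 [f [C0 cf hf hN]]]]] := average_decay W_bm X_sol B_energy sigma_unit sp.
have [m hm] := choice (fun N : nat => let: ex_intro2 m h1 h2 := hN (N0 + N).+1 (leqW (leq_addr _ _))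
  in ex_intro (fun m => _ /\ _) m (conj h1 h2)).
have [l hl] := @generalised_limit R.
pose av (N : nat) g := average (m N) (N0 + N).+1 g.
pose Lam g := l (fun N => av N g).
have avb g (M : R) N : cb g -> (forall x, `|g x| <= M) -> `|av N g| <= M.
  by move=> cg hM; exact: average_bounded.
have lamD g1 g2 : cb g1 -> cb g2 -> Lam (fun x => g1 x + g2 x) = Lam g1 + Lam g2.
  move=> c1 c2; have [_ [M1 h1]] := c1; have [_ [M2 h2]] := c2.
  have [h _ _] := hl _ _ (fun N => avb g1 M1 N c1 h1).
  rewrite -(h _ _ (fun N => avb g2 M2 N c2 h2)); congr l; apply/funext => N; exact: averageD.
have lamZ (a : R) g : cb g -> Lam (fun x => a * g x) = a * Lam g.
  move=> cg; have [_ [M hM]] := cg; have [_ h _] := hl _ _ (fun N => avb g M N cg hM).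
  rewrite -h; congr l; apply/funext => N; exact: averageZ.
have lam_le g (N1 : nat) (c : R) : cb g -> (forall N, (N1 <= N)%N -> av N g <= c) -> Lam g <= c.
  move=> cg; have [_ [M hM]] := cg; have [_ _ h] := hl _ _ (fun N => avb g M N cg hM).
  exact: h.
have lam_ge g (N1 : nat) (c : R) : cb g -> (forall N, (N1 <= N)%N -> c <= av N g) -> c <= Lam g.
  move=> cg h; rewrite -lerN2 -mulN1r -lamZ //; apply: (lam_le _ N1); first exact: cbZ.
  by move=> N hN1; rewrite /av averageZ // mulN1r lerN2; exact: h.
have large (e r : R) : 0 < e -> exists N1 : nat, forall N, (N1 <= N)%N -> r / (N0 + N).+1%:R <= e.
  move=> e0; have [k hk] := pow2_large (r / e); exists (2 ^ k)%N => N hN1.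
  rewrite ler_pdivrMr ?ltr0n // mulrC -ler_pdivrMr //.
  apply: (le_trans (hk k (leqnn _))); rewrite -natrX ler_nat; lia.
(* One inequality is enough: the reverse one follows by applying it to [-1 * g]. *)
have inv_le (m1 a : nat) g : cb g -> Lam (Pt (4^-1 ^+ m1 * a%:R) g) <= Lam g.
  move=> cg; set t : R := 4^-1 ^+ m1 * a%:R; have t0 : 0 <= t := grid_ge0 m1 a.
  have cPt := cb_Pt W_bm X_sol t0 cg; have [cg1 [M hM]] := cg.
  rewrite -subr_le0; apply/ler_addgt0Pl => e e0; rewrite addr0.
  have cN : cb (fun x => -1 * g x) := cbZ (-1) cg.
  rewrite -mulN1r -lamZ // -lamD //.
  have [N1 hN1] := large e (2 * t * M) e0.
  apply: (lam_le _ (maxn m1 N1)); first exact: cbD.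
  move=> N; rewrite geq_max => /andP[N1m N1N]; rewrite /av averageD // averageZ // mulN1r lerBlDl.
  have [h1 _] := hm N.
  have mm : (m1 <= m N)%N by apply: leq_trans h1; lia.
  apply: (le_trans (average_shift a (N0 + N).+1 mm cg1 hM)); rewrite lerD2l; exact: hN1.
exists Lam, C, k0, f; split => //.
- split=> //.
  + by move=> g cg g0; apply: (lam_ge _ 0%N) => // N _; rewrite -(average_cst (m N) 0 (ltn0Sn (N0 + N)));
      apply: average_le => //; exact: cb_cst.
  + by apply/eqP; rewrite eq_le; apply/andP; split;
      [apply: (lam_le _ 0%N)|apply: (lam_ge _ 0%N)] => //; try exact: cb_cst;
      move=> N _; rewrite /av average_cst.
  move=> e e0; have [k1 hk1] := pow2_large (4 * C / e).
  pose kk := (k0 + k1)%N; exists (4 ^+ kk) => g cg g01 g0.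
  have e20 : 0 < e / 2 by lra.
  have [N1 hN1] := large (e / 2) C e20.
  apply: (lam_le _ N1) => // N /hN1 hN2; set N' := (N0 + N).+1 in hN2 *.
  have [_ [hd hq]] := hm N; rewrite -/N' in hd hq.
  have N'0 : 0 < N'%:R :> R by rewrite ltr0n.
  have N'1 : 1 <= N'%:R :> R by rewrite ler1n.
  (* Scales beyond [N'] are dropped: points with [|x| >= N'] are left to the truncated energy, whose
     average divided by [N' ^ 2] is [O (1 / N')]. *)
  pose F k := if (4 : R) ^+ (kk + k) <= N'%:R then f (kk + k)%N else fun=> 0.
  have cF k : cb (F k) by rewrite /F; case: ifP => _; [exact: (cf _).1|exact: cb_cst].
  have F0 k x : 0 <= F k x.
    by rewrite /F; case: ifP => // _; have /andP[] := (cf (kk + k)%N).2 x.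
  have N3 : (0 : R) < N'%:R ^+ 3 by rewrite exprn_gt0.
  have cm := cb_minsqr (n := n) N3.
  have cS : cb (fun x => \sum_(k < N') F k x) by exact: cb_sum.
  have cZ : cb (fun x => (N'%:R ^- 2) * Num.min (enorm x ^+ 2) (N'%:R ^+ 3)) by exact: cbZ.
  (* Outside the ball of radius [4 ^ kk] a point lies either in an annulus where some [F k] is at
     least [1], or at distance at least [N'], where [Num.min (|x| ^ 2) (N' ^ 3) >= N' ^ 2]. *)
  have cover x : g x <= \sum_(k < N') F k x + (N'%:R ^- 2) * Num.min (enorm x ^+ 2) (N'%:R ^+ 3).
    have S0 : 0 <= \sum_(k < N') F k x by exact: sumr_ge0.
    have M0 : 0 <= (N'%:R ^- 2) * Num.min (enorm x ^+ 2) (N'%:R ^+ 3).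
      by rewrite mulr_ge0 ?invr_ge0 ?exprn_ge0 // le_min sqr_ge0 exprn_ge0.
    case: (leP (enorm x) (4 ^+ kk)) => x1; first by rewrite g0 // addr_ge0.
    have /andP[_ gx1] := g01 x; apply: (le_trans gx1).
    case: (leP N'%:R (enorm x)) => x2.
      have h1 : 1 <= (N'%:R ^- 2) * Num.min (enorm x ^+ 2) (N'%:R ^+ 3).
        rewrite ler_pdivlMl ?exprn_gt0 // mulr1 le_min lerXn2r ?nnegrE //=; last by rewrite enorm_ge0.
        by rewrite ler_weXn2l.
      lra.
    have [k /andP[k2 k3]] : exists k : nat, 4 ^+ k <= enorm x < 4 ^+ k.+1.
      by apply: pow4_bracket; apply: (le_trans _ (ltW x1)); rewrite exprn_ege1 // ler1n.
    have kkk : (kk <= k)%N by rewrite -ltnS -(@ltr_eXn2l R 4) ?ltr1n //; exact: lt_trans x1 k3.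
    have kN : (k - kk < N')%N.
      apply: (leq_ltn_trans (leq_subr _ _)); apply: (ltn_trans (ltn_expl k (isT : 1 < 4)%N)).
      by rewrite -(ltr_nat R) natrX; exact: le_lt_trans k2 x2.
    rewrite (bigD1 (Ordinal kN)) //= -addrA.
    have h1 : 1 <= F (k - kk)%N x.
      rewrite /F subnKC // (ltW (le_lt_trans k2 x2)); apply: hf => //.
        by apply: leq_trans kkk; rewrite leq_addr.
      by rewrite -exprS ltW.
    by apply: (le_trans h1); rewrite lerDl addr_ge0 // sumr_ge0.
  have avF (k : nat) : av N (F k) <= C * 2^-1 ^+ kk * 2^-1 ^+ k.
    have p0 : 0 <= C * 2^-1 ^+ kk * 2^-1 ^+ k by rewrite !mulr_ge0 ?exprn_ge0 ?invr_ge0 ?ler0n // ltW.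
    rewrite /F; case: ifP => hk; last by rewrite /av average_cst.
    have h4 : (4 : R) ^+ (kk + k) <= N'%:R ^+ 2.
      by apply: (le_trans hk); rewrite expr2 ler_peMl // ltW.
    apply: (le_trans (hd _ h4)); rewrite -mulrA -exprD; apply: ler_wpM2l; first exact: ltW.
    rewrite (_ : 4^-1 = 2^-1 * 2^-1 :> R); last by field.
    rewrite exprMn mulrA ler_piMl ?exprn_ge0 ?invr_ge0 ?ler0n //.
    by rewrite exprVn ler_pdivrMr ?exprn_gt0 // mul1r -natrX ler_nat ltn_expl.
  have h1 : av N g <= \sum_(k < N') av N (F k) + N'%:R ^- 2 * av N (fun x => Num.min (enorm x ^+ 2) (N'%:R ^+ 3)).
    rewrite /av -averageZ // -average_sum // -averageD //; apply: average_le => //; exact: cbD.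
  have h2 : \sum_(k < N') av N (F k) <= C * 2^-1 ^+ kk * 2.
    have : \sum_(k < N') av N (F k) <= \sum_(k < N') C * 2^-1 ^+ kk * 2^-1 ^+ k.
      by apply: ler_sum => k _; exact: avF.
    have -> : \sum_(k < N') C * 2^-1 ^+ kk * 2^-1 ^+ k = C * 2^-1 ^+ kk * \sum_(k < N') 2^-1 ^+ k.
      by rewrite mulr_sumr.
    move=> h; apply: (le_trans h); apply: ler_wpM2l.
      by rewrite mulr_ge0 ?exprn_ge0 ?invr_ge0 ?ler0n // ltW.
    apply: (le_trans (geometric_bound N' _ _)); [by rewrite invr_ge0|lra|].
    by rewrite (_ : 1 - 2^-1 = 2^-1 :> R) ?invrK //; field.
  have h3 : C * 2^-1 ^+ kk * 2 <= e / 2.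
    have := hk1 kk (leq_addl _ _); rewrite ler_pdivrMr // exprVn => h.
    rewrite mulrAC ler_pdivrMr ?exprn_gt0 //; lra.
  have h4 : N'%:R ^- 2 * av N (fun x => Num.min (enorm x ^+ 2) (N'%:R ^+ 3)) <= e / 2.
    apply: le_trans hN2; rewrite ler_pdivrMl ?exprn_gt0 //.
    rewrite (_ : N'%:R ^+ 2 * (C / N'%:R) = C * N'%:R) //; field; exact: lt0r_neq0.
  lra.
- move=> m1 a g cg; apply/eqP; rewrite eq_le inv_le //=.
  have cN : cb (fun x => -1 * g x) := cbZ (-1) cg.
  have t0 := grid_ge0 m1 a; have := inv_le m1 a _ cN; rewrite lamZ // !mulN1r.
  have -> : Pt (4^-1 ^+ m1 * a%:R) (fun x => -1 * g x) = fun x => -1 * Pt (4^-1 ^+ m1 * a%:R) g x.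
    by apply/funext => x; rewrite (PtZ X_sol).
  by rewrite lamZ ?mulN1r ?lerN2 //; exact: (cb_Pt W_bm X_sol).
move=> k; apply: (lam_le _ (4 ^ k)%N); first exact: (cf k).1.
move=> N hk; have [_ [hd _]] := hm N; apply: hd.
apply: (@le_trans _ _ (N0 + N).+1%:R).
  by rewrite -natrX ler_nat; lia.
by rewrite expr2 ler_peMl ?ler0n // ler1n.
Qed.

End LimitFunctional.

(** * The Riesz representation *)

Section Balls.
Context {R : realType} {n : nat}.
Implicit Types (x y : 'cV[R]_n) (U E : set 'cV[R]_n).

Lemma norm_tr_le x : `|x^T| <= enorm x.
Proof.
rewrite [leLHS]/Num.norm /= mx_normrE; apply/bigmax_leP; split; first exact: enorm_ge0.
by move=> [i j] _ /=; rewrite mxE (ord1 i); exact: coord_le_enorm.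
Qed.

Lemma tr_continuous : continuous (fun v : 'rV[R]_n => v^T : 'cV[R]_n).
Proof.
move=> v; apply/(@cvg_colP R n _ _ (nbhs_filter v)) => i.
have -> : (fun t : 'rV[R]_n => t^T i 0) = fun t => t 0 i by apply/funext => t; rewrite mxE.
by rewrite mxE; exact: coord_continuous.
Qed.

Lemma compact_cover (r : R) : exists K : set 'cV[R]_n, compact K /\ forall x, enorm x <= r -> K x.
Proof.
exists ((fun v : 'rV[R]_n => v^T) @` [set v | `|v| <= r]); split.
  apply: continuous_compact; first by apply: continuous_subspaceT; exact: tr_continuous.
  apply: bounded_closed_compact.
    by exists r; split => [|M rM v /= vr]; [exact: num_real|exact: le_trans vr (ltW rM)].
  have -> : [set v : 'rV[R]_n | `|v| <= r] = (fun v => `|v|) @^-1` [set u : R | u <= r] by [].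
  by apply: closed_comp; [move=> v _; exact: norm_continuous|exact: closed_le].
by move=> x xr; exists x^T; rewrite ?trmxK //=; exact: le_trans (norm_tr_le x) xr.
Qed.

(** Monotonicity lets one index serve a neighbourhood, and compactness selects a common one. *)
Lemma dini (g : nat -> 'cV[R]_n -> R) (h : 'cV[R]_n -> R) (K : set 'cV[R]_n) : compact K ->
  (forall k, continuous (g k)) -> continuous h -> (forall k x, g k x <= g k.+1 x) ->
  (forall x, K x -> exists k, h x < g k x) -> exists k, forall x, K x -> h x < g k x.
Proof.
move=> /compact_near_coveringP cK cg ch gS hx.
have gle x k k' : (k <= k')%N -> g k x <= g k' x.
  by move=> kk'; rewrite -(subnK kk'); elim: (k' - k)%N => [|m IH] //; exact: le_trans IH (gS _ _).
have [] := cK nat \oo (fun k x => h x < g k x) _ _.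
  move=> x /hx [k hk].
  have cgh : (fun y => g k y - h y) y @[y --> x] --> g k x - h x by exact: (cvgB (cg k x) (ch x)).
  exists ([set y | 0 < g k y - h y], [set k' | (k <= k')%N]).
    by split; [apply: (cvgr_gt _ cgh); rewrite subr_gt0|exists k].
  by move=> [y k'] [/= h1 h2]; rewrite subr_gt0 in h1; exact: lt_le_trans h1 (gle _ _ _ h2).
by move=> k _ hk; exists k => x /(hk k (leqnn k)).
Qed.

Lemma lipschitz1_continuous (f : 'cV[R]_n -> R) : (forall x y, f x <= f y + enorm (x - y)) -> continuous f.
Proof.
move=> hf x; apply/(@cvgrPdist_lt _ _ _ _ (nbhs_filter x)) => e e0.
have idx : id y @[y --> x] --> x by exact: cvg_id.
have /(@cvg_enormP R n _ _ (nbhs_filter x)) /(_ _ e0) := idx.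
apply: filterS => y; rewrite enormBC => h; rewrite ltr_norml.
by have := hf x y; have := hf y x; rewrite (enormBC y); lra.
Qed.

(** The distance to [E] capped at [1]; including the value [1] keeps the infimum meaningful when [E]
    is empty. *)
Definition dist1 E x : R := inf [set r | r = 1 \/ exists2 y, E y & r = enorm (x - y)].

Lemma dist1_lbound E x : has_lbound [set r | r = 1 \/ exists2 y, E y & r = enorm (x - y)].
Proof. by exists 0 => r /= [->|[y _ ->]] //; exact: enorm_ge0. Qed.

Lemma dist1_le1 E x : dist1 E x <= 1.
Proof. by apply: ge_inf; [exact: dist1_lbound|left]. Qed.

Lemma dist1_ge E x (c : R) : c <= 1 -> (forall y, E y -> c <= enorm (x - y)) -> c <= dist1 E x.
Proof. by move=> c1 h; apply: lb_le_inf; [exists 1; left|move=> r /= [->|[y Ey ->]] //; exact: h]. Qed.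

Lemma dist1_le E x y : E y -> dist1 E x <= enorm (x - y).
Proof. by move=> Ey; apply: ge_inf; [exact: dist1_lbound|right; exists y]. Qed.

Lemma dist1_ge0 E x : 0 <= dist1 E x.
Proof. by apply: dist1_ge => // y _; exact: enorm_ge0. Qed.

Lemma dist1_eq0 E x : E x -> dist1 E x = 0.
Proof. by move=> /(dist1_le x); rewrite subrr enorm0 => h; apply/eqP; rewrite eq_le h dist1_ge0. Qed.

Lemma dist1_continuous E : continuous (dist1 E).
Proof.
apply: lipschitz1_continuous => x y; rewrite -lerBlDr; apply: dist1_ge.
  by rewrite lerBlDr; apply: (le_trans (dist1_le1 _ _)); rewrite lerDl enorm_ge0.
move=> z Ez; rewrite lerBlDr; apply: (le_trans (dist1_le x Ez)).
have -> : x - z = (x - y) + (y - z) by rewrite addrA subrK.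
by rewrite [leRHS]addrC; exact: enormD.
Qed.

Lemma dist1_gt0 U x : open U -> U x -> 0 < dist1 (~` U) x.
Proof.
move=> oU Ux; have /nbhs_ballP [e /= e0 hb] : nbhs x U by exact: open_nbhs_nbhs.
have m0 : 0 < Num.min 1 e by rewrite lt_min ltr01.
apply: (lt_le_trans m0); apply: dist1_ge; first by rewrite ge_min lexx.
move=> y Uy; rewrite ge_min; apply/orP; right; rewrite leNgt; apply/negP => h; apply: Uy; apply: hb.
by rewrite -ball_normE /=; exact: le_lt_trans (norm_le_enorm _) h.
Qed.

(** For open [U] these functions increase to the indicator of [U]. *)
Definition cutoff U (k : nat) x : R := Num.min 1 (k%:R * dist1 (~` U) x).

Lemma cb_cutoff U k : cb (cutoff U k).
Proof.
apply: cb_min; first exact: cb_cst.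
apply: cbZ; apply: (cb_bounded (a := 0) (b := 1)); first exact: dist1_continuous.
  exact: dist1_ge0.
exact: dist1_le1.
Qed.

Lemma cutoff_bound U k x : 0 <= cutoff U k x <= 1.
Proof. by rewrite le_min ler01 ge_min lexx mulr_ge0 ?ler0n ?dist1_ge0. Qed.

Lemma cutoff_mono U k x : cutoff U k x <= cutoff U k.+1 x.
Proof.
rewrite /cutoff le_min !ge_min lexx /=; apply/orP; right.
by rewrite ler_wpM2r ?dist1_ge0 // ler_nat.
Qed.

Lemma cutoff_out U k x : ~ U x -> cutoff U k x = 0.
Proof. by move=> h; rewrite /cutoff dist1_eq0 // mulr0; apply/min_idPr. Qed.

Lemma cutoff_in U x : open U -> U x -> exists k, cutoff U k x = 1.
Proof.
move=> oU Ux; have p := dist1_gt0 oU Ux; have [k hk] := pow2_large (dist1 (~` U) x)^-1.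
exists (2 ^ k)%N; rewrite /cutoff; apply/min_idPl.
by rewrite -ler_pdivrMr // mul1r natrX; exact: hk.
Qed.

End Balls.

Lemma sum_layers {R : realType} (u : R) (N : nat) : 0 <= u ->
  \sum_(i < N) Num.min 1 (Num.max 0 (u - i%:R)) = Num.min u N%:R.
Proof.
move=> u0; elim: N => [|N IH]; first by rewrite big_ord0 (min_idPr u0).
rewrite big_ord_recr /= {}IH -natr1.
case: (leP u N%:R) => h.
  rewrite (max_idPl _) ?subr_le0 // (min_idPr ler01) addr0; apply/esym/min_idPl; lra.
rewrite (max_idPr _); last by lra.
case: (leP 1 (u - N%:R)) => h2.
  by rewrite addrC [RHS]minElt; case: ltP => h3; lra.
by rewrite [RHS]minElt; case: ltP => h3; lra.
Qed.

(** * The measure of a tight positive functional *)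

Section Riesz.
Context {R : realType} {n : nat}.
Variable Lam : ('cV[R]_n -> R) -> R.
Hypothesis LamP : mean_functional Lam.
Implicit Types (f g h : 'cV[R]_n -> R) (A U : set 'cV[R]_n).

Lemma mean_le f g : cb f -> cb g -> (forall x, f x <= g x) -> Lam f <= Lam g.
Proof.
move=> cf cg fg; have cN : cb (fun x => -1 * f x) := cbZ (-1) cf.
have : 0 <= Lam (fun x => g x + -1 * f x).
  by apply: (mean_ge0 LamP); [exact: cbD|move=> x; rewrite mulN1r subr_ge0].
by rewrite (meanD LamP) // (meanZ LamP) // mulN1r subr_ge0.
Qed.

Lemma meanB f g : cb f -> cb g -> Lam (fun x => f x - g x) = Lam f - Lam g.
Proof.
move=> cf cg; have cN : cb (fun x => -1 * g x) := cbZ (-1) cg.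
by rewrite -mulN1r -(meanZ LamP) // -(meanD LamP) //; congr Lam; apply/funext => x; rewrite mulN1r.
Qed.

Lemma mean_cst (a : R) : Lam (fun=> a) = a.
Proof.
rewrite -[RHS]mulr1 -(mean1 LamP) -(meanZ LamP); last exact: cb_cst.
by congr Lam; apply/funext => x; rewrite mulr1.
Qed.

Lemma mean_sum (I : Type) (r : seq I) (F : I -> 'cV[R]_n -> R) : (forall i, cb (F i)) ->
  Lam (fun x => \sum_(i <- r) F i x) = \sum_(i <- r) Lam (F i).
Proof.
move=> cF; elim: r => [|i r IH].
  by rewrite big_nil -[RHS](mean_cst 0); congr Lam; apply/funext => x; rewrite big_nil.
rewrite big_cons -IH -(meanD LamP) //; last exact: cb_sum.
by congr Lam; apply/funext => x; rewrite big_cons.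
Qed.

(* The outer measure of the Daniell construction: increasing sequences of
   continuous functions stand for open covers. *)
Definition covers A (c : R) : Prop := exists g : nat -> 'cV[R]_n -> R,
  [/\ forall k, cb (g k), forall k x, 0 <= g k x, forall k x, g k x <= g k.+1 x,
      forall x, A x -> exists k, 1 <= g k x & forall k, Lam (g k) <= c].

Definition outer A : R := inf [set c | covers A c].

Lemma chain_le (g : nat -> 'cV[R]_n -> R) x k k' : (forall k x, g k x <= g k.+1 x) ->
  (k <= k')%N -> g k x <= g k' x.
Proof. by move=> gS kk'; rewrite -(subnK kk'); elim: (k' - k)%N => [|m IH] //; exact: le_trans IH (gS _ _). Qed.

Lemma covers_ge0 A c : covers A c -> 0 <= c.
Proof. by case=> g [cg g0 _ _ gc]; apply: le_trans (gc 0%N); exact: (mean_ge0 LamP). Qed.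

Lemma covers_lbound A : has_lbound [set c | covers A c].
Proof. by exists 0 => c; exact: covers_ge0. Qed.

Lemma covers1 A : covers A 1.
Proof.
exists (fun _ _ => 1); split => [_|_ x|_ x|x _|_] //; first exact: cb_cst.
by rewrite mean_cst.
Qed.

Lemma outer_le A c : covers A c -> outer A <= c.
Proof. by move=> h; apply: ge_inf => //; exact: covers_lbound. Qed.

Lemma outer_ge A (c : R) : (forall c', covers A c' -> c <= c') -> c <= outer A.
Proof. by move=> h; apply: lb_le_inf; [exists 1; exact: covers1|move=> c' /h]. Qed.

Lemma outer_ge0 A : 0 <= outer A.
Proof. by apply: outer_ge => c /covers_ge0. Qed.

Lemma outer_covers A (e : R) : 0 < e -> covers A (outer A + e).
Proof.
move=> e0; have hi : has_inf [set c | covers A c] by split; [exists 1; exact: covers1|exact: covers_lbound].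
have [c /= [g [cg g0 gS gA gc]] lc] := inf_adherent e0 hi.
by exists g; split => // k; exact: le_trans (gc k) (ltW lc).
Qed.

Lemma outer_mono A U : A `<=` U -> outer A <= outer U.
Proof.
move=> AU; apply: outer_ge => c [g [cg g0 gS gU gc]]; apply: outer_le.
by exists g; split => // x /AU /gU.
Qed.

Lemma outer_set0 : outer set0 = 0.
Proof.
apply/eqP; rewrite eq_le outer_ge0 andbT; apply: outer_le.
by exists (fun _ _ => 0); split => //; [move=> _; exact: cb_cst|move=> _; rewrite mean_cst].
Qed.

Lemma outer_bigcup (F : nat -> set 'cV[R]_n) (s : R) :
  (forall k, \sum_(i < k) outer (F i) <= s) -> outer (\bigcup_i F i) <= s.
Proof.
move=> hs; apply/ler_addgt0Pl => e e0; rewrite addrC.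
pose ee (i : nat) : R := e / 2 * 2^-1 ^+ i.
have ee0 i : 0 < ee i by rewrite mulr_gt0 ?exprn_gt0 ?invr_gt0 // divr_gt0.
have [g hg] := choice (fun i => outer_covers (F i) (ee0 i)).
(* Diagonal sum: stage [k] uses the covers of [F 0] to [F k], each at its own stage [k], so the sums
   are finite and increase with [k]. *)
apply: outer_le; exists (fun k x => \sum_(i < k.+1) g i k x); split.
- by move=> k; apply: cb_sum => i; have [] := hg i.
- by move=> k x; apply: sumr_ge0 => i _; have [] := hg i.
- move=> k x; rewrite [leRHS]big_ord_recr /=.
  have g0 : 0 <= g k.+1 k.+1 x by have [] := hg k.+1.
  have : \sum_(i < k.+1) g i k x <= \sum_(i < k.+1) g i k.+1 x.
    by apply: ler_sum => i _; have [] := hg i.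
  lra.
- move=> x [i _ Fx]; have [_ _ gS gF _] := hg i; have [k hk] := gF x Fx.
  exists (maxn i k); have ik : (i < (maxn i k).+1)%N by rewrite ltnS leq_maxl.
  rewrite (bigD1 (Ordinal ik)) //=; apply: (le_trans (le_trans hk (chain_le x gS (leq_maxr i k)))).
  by rewrite lerDl; apply: sumr_ge0 => j _; have [] := hg j.
move=> k; rewrite (mean_sum _ (F := fun i : 'I_k.+1 => g i k)); last by move=> i; have [] := hg i.
have h1 : \sum_(i < k.+1) Lam (g i k) <= \sum_(i < k.+1) (outer (F i) + ee i).
  by apply: ler_sum => i _; have [_ _ _ _] := hg i; exact.
apply: (le_trans h1); rewrite big_split /=; apply: lerD; first exact: hs.
rewrite -mulr_sumr -ler_pdivlMl ?divr_gt0 //.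
apply: (le_trans (geometric_bound k.+1 _ _)); [by rewrite invr_ge0|lra|].
have -> : (1 - 2^-1)^-1 = 2 :> R by field.
by rewrite invfM invrK mulrAC mulVf ?mul1r // lt0r_neq0.
Qed.

(** A cover dominates [h] only in the limit. The Dini argument makes this uniform on a compact set
    up to [e / 2], and tightness pays the other [e / 2] outside it. *)
Lemma mean_le_outer h U : cb h -> (forall x, 0 <= h x <= 1) -> (forall x, ~ U x -> h x = 0) -> Lam h <= outer U.
Proof.
move=> ch h01 hU; apply: outer_ge => c [g [cg g0 gS gU gc]].
apply/ler_addgt0Pl => e e0; have e20 : 0 < e / 2 by lra.
have [r hr] := mean_tight LamP e20.
pose chi (x : 'cV[R]_n) : R := Num.min 1 (Num.max 0 (enorm x - r)).
have cchi : cb chi.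
  apply: (cb_bounded (a := 0) (b := 1)) => [x|x|x].
  - apply: (@continuous_min _ _ _ _ x); first exact: cst_continuous.
    apply: (@continuous_max _ _ _ _ x); first exact: cst_continuous.
    by apply: (cvgB (@enorm_continuous R n x)); exact: cvg_cst.
  - by rewrite le_min ler01 le_max lexx.
  - by rewrite ge_min lexx.
have chi01 x : 0 <= chi x <= 1 by rewrite le_min ler01 le_max lexx ge_min lexx.
have hchi : Lam chi <= e / 2.
  by apply: hr => // x xr; rewrite /chi (max_idPl _) ?subr_le0 //; apply/min_idPr.
have [K [cK hK]] := @compact_cover R n (r + 1).
have cge k : cb (fun x => g k x + e / 2) by exact: (cbD (cg k) (cb_cst _)).
have [k hk] : exists k, forall x, K x -> h x < g k x + e / 2.
  apply: (dini (g := fun k x => g k x + e / 2)) => //.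
  - by move=> k; exact: (cge k).1.
  - exact: ch.1.
  - by move=> k x; rewrite lerD2r.
  move=> x _; have [Ux|Ux] := pselect (U x).
    by have [k hk] := gU x Ux; exists k; have := h01 x; lra.
  by exists 0%N; rewrite hU // ltr_wpDl.
have : Lam h <= Lam (fun x => g k x + e / 2 + chi x).
  apply: mean_le => //; first exact: cbD.
  move=> x; have /andP[c0 c1] := chi01 x; have /andP[h0 h1] := h01 x; have gk := g0 k x.
  have [Kx|Kx] := pselect (K x); first by have := hk x Kx; lra.
  have xr : r + 1 <= enorm x by rewrite leNgt; apply/negP => /ltW /hK.
  have -> : chi x = 1.
    by rewrite /chi; apply/min_idPl; rewrite le_max; apply/orP; right; lra.
  lra.
rewrite (meanD LamP) // (meanD LamP) ?mean_cst //; last exact: cb_cst.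
by have := gc k; lra.
Qed.

(** A cover [g] of [A] is split into [g * cutoff], which covers the part inside [U], and
    [g * (1 - cutoff)], which covers the part outside for each fixed cutoff; their means add up to
    that of [g]. *)
Lemma outer_open U A : open U -> outer (A `&` U) + outer (A `&` ~` U) <= outer A.
Proof.
move=> oU; apply: outer_ge => c [g [cg g0 gS gA gc]].
have cgp k j : cb (fun x => g k x * cutoff U j x) by apply: cbM => //; exact: cb_cutoff.
have p0 k x : 0 <= cutoff U k x by have /andP[] := cutoff_bound U k x.
have p1 k x : cutoff U k x <= 1 by have /andP[] := cutoff_bound U k x.
have pS : forall k x, cutoff U k x <= cutoff U k.+1 x by exact: cutoff_mono.
have cgq k j : cb (fun x => g k x * (1 - cutoff U j x)).
  by apply: cbM => //; apply: cbB; [exact: cb_cst|exact: cb_cutoff].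
have qE k j : Lam (fun x => g k x * (1 - cutoff U j x)) = Lam (g k) - Lam (fun x => g k x * cutoff U j x).
  by rewrite -meanB //; congr Lam; apply/funext => x; rewrite mulrBr mulr1.
have h1 j : outer (A `&` ~` U) <= c - Lam (fun x => g j x * cutoff U j x).
  apply: outer_le; exists (fun k x => g k x * (1 - cutoff U j x)); split => //.
  - by move=> k x; rewrite mulr_ge0 // subr_ge0.
  - by move=> k x; rewrite ler_wpM2r // subr_ge0.
  - by move=> x [Ax Ux]; have [k hk] := gA x Ax; exists k; rewrite cutoff_out // subr0 mulr1.
  have big k : (j <= k)%N -> Lam (fun x => g k x * (1 - cutoff U j x)) <= c - Lam (fun x => g j x * cutoff U j x).
    move=> jk; rewrite qE; apply: lerB => //; apply: mean_le => // x.
    by rewrite ler_wpM2r //; exact: chain_le.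
  move=> k; case: (leqP j k) => [/big //|kj]; apply: le_trans (big j (leqnn j)).
  apply: mean_le => // x; rewrite ler_wpM2r ?subr_ge0 //; exact: chain_le (ltnW kj).
suff : outer (A `&` U) <= c - outer (A `&` ~` U) by lra.
apply: outer_le; exists (fun k x => g k x * cutoff U k x); split => //.
- by move=> k x; rewrite mulr_ge0.
- by move=> k x; apply: ler_pM.
- move=> x [Ax Ux]; have [k hk] := gA x Ax; have [j hj] := cutoff_in oU Ux.
  exists (maxn k j); rewrite -[leLHS]mulr1; apply: ler_pM => //.
    by apply: (le_trans hk); apply: chain_le => //; exact: leq_maxl.
  by rewrite -hj; apply: (chain_le (g := cutoff U)) => //; exact: leq_maxr.
by move=> j; have := h1 j; lra.
Qed.

Definition nu_outer (A : set 'cV[R]_n) : \bar R := (outer A)%:E.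

Lemma nu_sigma_subadditive : sigma_subadditive nu_outer.
Proof.
move=> F; have p0 i : (0 <= nu_outer (F i))%E by rewrite lee_fin outer_ge0.
have [->|fs] := eqVneq (\sum_(i <oo) nu_outer (F i))%E +oo%E; first exact: leey.
have s0 : (0 <= \sum_(i <oo) nu_outer (F i))%E by exact: nneseries_ge0.
have ff : (\sum_(i <oo) nu_outer (F i))%E \is a fin_num.
  by rewrite ge0_fin_numE // lt_neqAle fs leey.
rewrite -(fineK ff) lee_fin; apply: outer_bigcup => k.
rewrite -lee_fin fineK // -sumEFin.
rewrite -(big_mkord xpredT (fun i => (outer (F i))%:E)).
exact: (@nneseries_lim_ge R (fun i => nu_outer (F i)) xpredT 0 k (fun i _ _ => p0 i)).
Qed.

Lemma nu_outer0 : nu_outer set0 = 0%E.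
Proof. by rewrite /nu_outer outer_set0. Qed.

Lemma nu_outer_ge0 A : (0 <= nu_outer A)%E.
Proof. by rewrite lee_fin outer_ge0. Qed.

Lemma nu_outer_mono : {homo nu_outer : A B / A `<=` B >-> (A <= B)%E}.
Proof. by move=> A B AB; rewrite lee_fin; exact: outer_mono. Qed.

HB.instance Definition _ := isOuterMeasure.Build R 'cV[R]_n nu_outer
  nu_outer0 nu_outer_ge0 nu_outer_mono nu_sigma_subadditive.

Lemma borel_caratheodory (E : set (borelV R n)) : measurable E -> nu_outer.-caratheodory E.
Proof.
move: E; apply: smallest_sub.
  split; first exact: caratheodory_measurable_set0.
    by move=> A mA; rewrite setTD; exact: caratheodory_measurable_setC.
  by move=> F mF; exact: caratheodory_measurable_bigcup.
move=> U oU; apply: (le_caratheodory_measurable (mu := nu_outer)) => A.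
by rewrite -EFinD lee_fin; exact: outer_open.
Qed.

Definition riesz_mu (E : set (borelV R n)) : \bar R := nu_outer E.

Lemma riesz_mu0 : riesz_mu set0 = 0%E. Proof. exact: nu_outer0. Qed.

Lemma riesz_mu_ge0 E : (0 <= riesz_mu E)%E. Proof. exact: nu_outer_ge0. Qed.

Lemma riesz_mu_additive : semi_sigma_additive riesz_mu.
Proof.
move=> F mF tF mU.
apply: (@caratheodory_measure_sigma_additive R 'cV[R]_n nu_outer F) => //.
  by move=> i; exact: borel_caratheodory.
exact: borel_caratheodory.
Qed.

HB.instance Definition _ := isMeasure.Build _ (borelV R n) R riesz_mu
  riesz_mu0 riesz_mu_ge0 riesz_mu_additive.

Lemma riesz_muT : riesz_mu setT = 1%E.
Proof.
congr (_%:E); apply/eqP; rewrite eq_le; apply/andP; split; first exact/outer_le/covers1.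
rewrite -{1}(mean_cst 1); apply: mean_le_outer => [|x|x]; first exact: cb_cst.
  by rewrite ler01 lexx.
by move=> h; case: h.
Qed.

HB.instance Definition _ := Measure_isProbability.Build _ (borelV R n) R riesz_mu riesz_muT.

Lemma cb_bmeas f : cb f -> bmeas (f : borelV R n -> R).
Proof. by move=> [cf [M hM]]; split; [exact: continuous_borel|exists M]. Qed.

Lemma cb_integrable (mu : probability (borelV R n) R) f : cb f -> mu.-integrable setT (EFin \o f).
Proof. by move=> cf; apply: bmeas_integrable; exact: cb_bmeas. Qed.

(** [N f] is cut into [N] layers, each vanishing off an open level set, where [mean_le_outer]
    applies. The indicators of these sets sum to at most [N f + 1], which leaves an error
    [1 / N]. *)
Lemma mean_le_Ex f : cb f -> (forall x, 0 <= f x <= 1) -> Lam f <= Ex riesz_mu f.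
Proof.
move=> cf f01; apply/ler_addgt0Pl => e e0.
have [k hk] := pow2_large (e^-1 : R); pose N := (2 ^ k)%N.
have N0 : 0 < N%:R :> R by rewrite ltr0n expn_gt0.
have NE : 1 <= e * N%:R by rewrite -ler_pdivrMl // mulr1 natrX; exact: hk.
pose fi (i : 'I_N) x : R := Num.min 1 (Num.max 0 (N%:R * f x - i%:R)).
have u0 x : 0 <= N%:R * f x by have := f01 x => /andP[? _]; rewrite mulr_ge0 // ltW.
have cNf : cb (fun x => N%:R * f x) by exact: cbZ.
have cfi i : cb (fi i).
  apply: cb_min; first exact: cb_cst.
  by apply: cb_max; [exact: cb_cst|apply: cbB => //; exact: cb_cst].
have fi01 i x : 0 <= fi i x <= 1 by rewrite le_min ler01 le_max lexx ge_min lexx.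
pose U (i : 'I_N) : set (borelV R n) := [set x | i%:R < N%:R * f x].
have mU i : measurable (U i).
  apply: open_borel; rewrite (_ : U i = (fun x => N%:R * f x) @^-1` [set r | i%:R < r]) //.
  by apply: open_comp; [move=> x _; exact: cNf.1|exact: open_gt].
have e1 : N%:R * Lam f = \sum_(i < N) Lam (fi i).
  rewrite -mean_sum // -(meanZ LamP) //; congr Lam; apply/funext => x.
  rewrite sum_layers //; apply/esym/min_idPl; by rewrite ler_piMr //; have /andP[] := f01 x.
have h1 : \sum_(i < N) Lam (fi i) <= \sum_(i < N) Ex riesz_mu (\1_(U i)).
  apply: ler_sum => i _; rewrite Ex_indic //; apply: mean_le_outer => // x Ux.
  rewrite /fi (max_idPl _) ?(min_idPr ler01) // subr_le0 leNgt; exact/negP.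
have bU i : riesz_mu.-integrable setT (EFin \o \1_(U i)) by exact/bmeas_integrable/bmeas_indic.
have cN1 : cb (fun x => N%:R * f x + 1) by apply: cbD => //; exact: cb_cst.
have h2 : \sum_(i < N) Ex riesz_mu (\1_(U i)) <= Ex riesz_mu (fun x => N%:R * f x + 1).
  rewrite -Ex_sum //; apply: Ex_le; [|exact: cb_integrable|].
    by apply/bmeas_integrable/bmeas_sum => i; exact: bmeas_indic.
  apply: aeW => x; apply: (@le_trans _ _ (Num.min (N%:R * f x + 1) N%:R)); last by rewrite ge_min lexx.
  rewrite -sum_layers; last by rewrite addr_ge0.
  apply: ler_sum => i _; rewrite indicE; case: (boolP (x \in U i)) => [|_].
    by rewrite inE /U /= => hx; rewrite le_min lexx le_max; apply/orP; right; lra.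
  by rewrite le_min ler01 le_max lexx.
have h3 : Ex riesz_mu (fun x => N%:R * f x + 1) = N%:R * Ex riesz_mu f + 1.
  rewrite ExD; [|exact: cb_integrable|exact/cb_integrable/cb_cst].
  by rewrite ExZ ?Ex_cst //; exact: cb_integrable.
have h4 : N%:R * Lam f <= N%:R * Ex riesz_mu f + 1 by rewrite e1 -h3; exact: le_trans h1 h2.
rewrite -(ler_pM2l N0); apply: (le_trans h4).
by rewrite mulrDr addrC lerD2r mulrC.
Qed.

(** The one-sided bound for both [f] and [1 - f] gives equality; other bounded functions are
    rescaled into [[0, 1]]. *)
Lemma riesz : exists mu : probability (borelV R n) R, forall f, cb f -> Ex mu f = Lam f.
Proof.
exists riesz_mu.
have h01 f : cb f -> (forall x, 0 <= f x <= 1) -> Ex riesz_mu f = Lam f.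
  move=> cf f01; apply/eqP; rewrite eq_le mean_le_Ex // andbT.
  have c1 : cb (fun x => 1 - f x) by apply: cbB => //; exact: cb_cst.
  have := mean_le_Ex c1; rewrite meanB ?mean_cst //; last exact: cb_cst.
  rewrite ExB ?Ex_cst; [|exact/cb_integrable/cb_cst|exact: cb_integrable].
  have g01 x : 0 <= 1 - f x <= 1 by have /andP[? ?] := f01 x; apply/andP; split; lra.
  by move=> /(_ g01); lra.
move=> f cf; have [_ [M hM]] := cf; pose M1 := `|M| + 1.
have M10 : 0 < M1 by rewrite ltr_wpDl.
have fM x : - M1 <= f x <= M1.
  have := hM x; rewrite ler_norml /M1 => /andP[? ?]; have := ler_norm M => ?; apply/andP; split; lra.
pose g x := (2 * M1)^-1 * (f x + M1).
have cfM : cb (fun x => f x + M1) by apply: cbD => //; exact: cb_cst.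
have cg : cb g by exact: cbZ.
have g01 x : 0 <= g x <= 1.
  have /andP[h1 h2] := fM x; apply/andP; split.
    by rewrite mulr_ge0 ?invr_ge0; lra.
  by rewrite ler_pdivrMl ?mulr1; lra.
have fE : f = fun x => 2 * M1 * g x - M1.
  by apply/funext => x; rewrite /g mulrA mulfV ?mul1r ?addrK // mulf_neq0 // gt_eqF.
have cg2 : cb (fun x => 2 * M1 * g x) by exact: cbZ.
rewrite fE meanB ?mean_cst //; last exact: cb_cst.
rewrite ExB ?Ex_cst; [|exact: cb_integrable|exact/cb_integrable/cb_cst].
by rewrite (meanZ LamP (2 * M1) cg) ExZ ?(h01 g) //; exact: cb_integrable.
Qed.

End Riesz.

(** * Stationarity and moments *)

Section Stationary.
Context {R : realType} {n : nat} d {T : measurableType d} (P : probability T R).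
Variables (B : {bilinear 'cV[R]_n -> 'cV[R]_n -> 'cV[R]_n}) (A sigma : 'M[R]_n).
Variables (W : R -> T -> 'cV[R]_n) (X : 'cV[R]_n -> R -> T -> 'cV[R]_n).
Hypothesis W_bm : brownian_motion P W.
Hypothesis X_sol : forall x, sde_solution P B A sigma W x (X x).
Variable mu : probability (borelV R n) R.
Implicit Types (x y : 'cV[R]_n) (f g : 'cV[R]_n -> R).
Local Notation Pt := (Pt P X).
Hypothesis mu_grid : forall (m a : nat) f, cb f -> Ex mu (Pt (4^-1 ^+ m * a%:R) f) = Ex mu f.

Lemma grid_approx (t : R) : 0 <= t ->
  exists a : nat -> nat, (4^-1 ^+ m * (a m)%:R) @[m --> \oo] --> t.
Proof.
move=> t0; exists (fun m => Num.truncn (4 ^+ m * t)).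
apply/cvgrPdist_lt => e e0; have [k0 hk] := pow2_large e^-1.
near=> m; have m0 : (k0 <= m)%N by near: m; exists k0.
have p0 : (0 : R) < 4 ^+ m by rewrite exprn_gt0.
have /andP[h1 h2] := truncn_itv (mulr_ge0 (ltW p0) t0).
have h3 : (0 : R) < 4^-1 ^+ m by rewrite exprn_gt0 // invr_gt0.
have h4 : 4^-1 ^+ m * 4 ^+ m = 1 :> R by rewrite -exprMn mulVf ?expr1n.
have h5 : 4^-1 ^+ m <= e.
  rewrite exprVn invf_ple ?posrE //; apply: (le_trans (hk m m0)).
  by apply: lerXn2r; rewrite ?nnegrE //; lra.
move: (ler_wpM2l (ltW h3) h1); rewrite mulrA h4 mul1r => h6.
move: h2; rewrite -(ltr_pM2l h3) mulrA h4 mul1r -[X in _ < _ * X]natr1 mulrDr mulr1 => h7.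
by rewrite ltr_norml; apply/andP; split; lra.
Unshelve. all: by end_near. Qed.

(** Dyadic times are dense, and paths are continuous, so bounded convergence applies under both
    expectations. *)
Lemma mu_invariant f (t : R) : 0 <= t -> cb f -> Ex mu (Pt t f) = Ex mu f.
Proof.
move=> t0 cf; have [a ha] := grid_approx t0; have [cf1 [M hM]] := cf.
have g0 m : 0 <= (4^-1 : R) ^+ m * (a m)%:R by exact: grid_ge0.
have cP (s : R) : 0 <= s -> cb (Pt s f) by move=> s0; exact: (cb_Pt W_bm X_sol).
have PM (s : R) y : 0 <= s -> `|Pt s f y| <= M by move=> s0; exact: (Pt_bounded X_sol).
have h1 : Ex mu (Pt (4^-1 ^+ m * (a m)%:R) f) @[m --> \oo] --> Ex mu (Pt t f).
  apply: (Ex_cvg (P := mu) (M := M)).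
  - by move=> m; exact: (cb_bmeas (cP _ (g0 m))).1.
  - exact: (cb_bmeas (cP _ t0)).1.
  - by move=> m y; exact: PM.
  apply: aeW => y; apply: (Ex_cvg (P := P) (M := M)).
  - by move=> m; exact: (measurable_flow X_sol).
  - exact: (measurable_flow X_sol).
  - by move=> m w; exact: hM.
  apply: filterS (ae_flow_path W_bm X_sol y) => w [[xc _ _ _] _].
  have hx : X y (Num.max 0 (4^-1 ^+ m * (a m)%:R)) w @[m --> \oo] --> X y (Num.max 0 t) w.
    exact: (cvg_comp _ _ ha (xc t)).
  have := cvg_comp _ _ hx (cf1 _).
  rewrite (max_idPr t0); apply: cvg_trans; apply: near_eq_cvg; apply: nearW => m /=.
  by rewrite (max_idPr (g0 m)).
have h2 : Ex mu (Pt (4^-1 ^+ m * (a m)%:R) f) @[m --> \oo] --> Ex mu f.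
  under eq_fun do rewrite mu_grid //; exact: cvg_cst.
exact: (cvg_unique _ h1 h2).
Qed.

Definition kernel_at (t : R) (E : set (borelV R n)) (x : borelV R n) : R := Pr P [set w | E (X x t w)].

Lemma flow_measurable (t : R) x (E : set (borelV R n)) : 0 <= t -> measurable E ->
  measurable [set w | E (X x t w)].
Proof.
move=> t0 mE; have [mX _] := X_sol x.
by rewrite -[X in measurable X]setTI; exact: mX.
Qed.

Lemma kernel_bounded x (E : set (borelV R n)) (t : R) : 0 <= t -> measurable E -> `|kernel_at t E x| <= 1.
Proof.
move=> t0 mE; rewrite ger0_norm; last exact: Pr_ge0.
rewrite -lee_fin -PrE; last exact: flow_measurable.
by apply: probability_le1; exact: flow_measurable.
Qed.

Lemma Pr_cvg_bigcup d' (T' : measurableType d') (Q : probability T' R) (F : nat -> set T') :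
  (forall k, measurable (F k)) -> trivIset setT F ->
  \sum_(i < k) Pr Q (F i) @[k --> \oo] --> Pr Q (\bigcup_k F k).
Proof.
move=> mF tF; have mU : measurable (\bigcup_k F k) by exact: bigcup_measurable.
have h := @measure_sigma_additive _ _ _ Q F mF tF.
suff h' : (\sum_(i < k) Pr Q (F i))%:E @[k --> \oo] --> (Pr Q (\bigcup_k F k))%:E by exact: (fine_cvg h').
rewrite -PrE //; move: h; apply: cvg_trans; apply: near_eq_cvg; apply: nearW => k /=.
by rewrite big_mkord -sumEFin; apply: eq_bigr => i _; exact: PrE.
Qed.

(** Dynkin's argument, starting from open sets, which are reached by increasing cutoffs.
    Measurability in the starting point is carried through the same induction. *)
Lemma kernel_invariant (t : R) (E : set (borelV R n)) : 0 <= t -> measurable E ->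
  measurable_fun setT (kernel_at t E) /\ Ex mu (kernel_at t E) = Pr mu E.
Proof.
move=> t0.
suff : forall F : set (borelV R n), (<<s (@open 'cV[R]_n) >> : set_system (borelV R n)) F -> measurable F ->
    measurable_fun setT (kernel_at t F) /\ Ex mu (kernel_at t F) = Pr mu F.
  by move=> h mE; exact: (h E mE mE).
apply: (@dynkin_induction _ (borelV R n) (@open 'cV[R]_n)) => //.
- by move=> U V oU oV; exact: openI.
- move=> _; have -> : kernel_at t setT = fun=> 1.
    by apply/funext => x; rewrite /kernel_at /Pr; have -> : [set w | setT (X x t w)] = setT; rewrite ?probability_setT.
  by split; [exact: measurable_cst|rewrite Ex_cst /Pr probability_setT].
- move=> U oU mU; have c01 k x := cutoff_bound U k x.
  have cc k : cb (cutoff U k) := cb_cutoff U k.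
  have cM k x : `|cutoff U k x| <= 1 by have /andP[h1 h2] := c01 k x; rewrite ger0_norm.
  have ccv x : cutoff U k x @[k --> \oo] --> (\1_U x : R).
    have [Ux|Ux] := pselect (U x).
      have [k0 hk0] := cutoff_in oU Ux; rewrite indicE mem_set //.
      apply: cvg_near_cst; exists k0 => // k /= kk; apply/eqP; rewrite eq_le.
      have /andP[_ ->] := c01 k x; rewrite -[leLHS]hk0.
      by apply: (chain_le (g := cutoff U)) => //; move=> j y; exact: cutoff_mono.
    rewrite indicE memNset //; apply: cvg_near_cst; apply: nearW => k; exact: cutoff_out.
  have kc x : Pt t (cutoff U k) x @[k --> \oo] --> kernel_at t U x.
    rewrite /kernel_at -Ex_indic; last exact: flow_measurable.
    apply: (Ex_cvg (P := P) (M := 1)).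
    - by move=> k; apply: (measurable_flow X_sol) => //; exact: (cc k).1.
    - by apply: (bmeas_indic _).1; exact: flow_measurable.
    - by move=> k w; exact: cM.
    by apply: aeW => w; exact: ccv.
  have mPt k : measurable_fun setT (Pt t (cutoff U k) : borelV R n -> R).
    exact: (cb_bmeas (cb_Pt W_bm X_sol t0 (cc k))).1.
  have mK : measurable_fun setT (kernel_at t U).
    apply: (measurable_fun_cvg (h := fun k => Pt t (cutoff U k) : borelV R n -> R)) => // x _; exact: kc.
  split=> //.
  have h1 : Ex mu (Pt t (cutoff U k)) @[k --> \oo] --> Ex mu (kernel_at t U).
    apply: (Ex_cvg (P := mu) (M := 1)) => //; last by apply: aeW.
    by move=> k y; apply: (Pt_bounded X_sol) => //; exact: (cc k).1.
  have h2 : Ex mu (cutoff U k) @[k --> \oo] --> Pr mu U.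
    rewrite -Ex_indic //; apply: (Ex_cvg (P := mu) (M := 1)) => //; last by apply: aeW.
    by move=> k; exact: (cb_bmeas (cc k)).1.
  have h3 : Ex mu (Pt t (cutoff U k)) @[k --> \oo] --> Pr mu U.
    by under eq_fun do rewrite mu_invariant //.
  exact: (cvg_unique _ h1 h3).
- move=> S mS hS mCS; have [mK eK] := hS mS.
  have kE : kernel_at t (~` S) = fun x => 1 - kernel_at t S x.
    by apply/funext => x; rewrite /kernel_at -Pr_setC //; exact: flow_measurable.
  split; first by rewrite kE; exact: measurable_funB.
  rewrite kE ExB ?Ex_cst ?eK ?Pr_setC //; apply: bmeas_integrable; first exact: bmeas_cst.
  by split=> //; exists 1 => x; exact: kernel_bounded.
move=> F mF tF hF mUF.
have kc x : \sum_(i < k) kernel_at t (F i) x @[k --> \oo] --> kernel_at t (\bigcup_k F k) x.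
  have -> : kernel_at t (\bigcup_k F k) x = Pr P (\bigcup_k [set w | F k (X x t w)]).
    by congr (Pr P _); apply/seteqP; split => w [k _ hk]; exists k.
  apply: Pr_cvg_bigcup; first by move=> k; exact: flow_measurable.
  by apply/trivIsetP => i j _ _ ij; move/trivIsetP : tF => /(_ i j I I ij) h;
    apply/seteqP; split => // w /= [h1 h2]; have : (F i `&` F j) (X x t w) by []; rewrite h.
have mS k : measurable_fun setT (fun x : borelV R n => \sum_(i < k) kernel_at t (F i) x).
  by apply: measurable_sum => i; exact: (hF i (mF i)).1.
have sM k x : `|\sum_(i < k) kernel_at t (F i) x| <= 1.
  have nd : nondecreasing_seq (fun k => \sum_(i < k) kernel_at t (F i) x).
    apply/nondecreasing_seqP => j; rewrite big_ord_recr /= lerDl; exact: Pr_ge0.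
  rewrite ger0_norm; last by apply: sumr_ge0 => i _; exact: Pr_ge0.
  have := nondecreasing_cvgn_le nd (cvgP _ (kc x)) k; rewrite (cvg_lim _ (kc x)) // => h.
  by apply: (le_trans h); apply: (le_trans (ler_norm _)); exact: kernel_bounded.
have mK : measurable_fun setT (kernel_at t (\bigcup_k F k)).
  by apply: (measurable_fun_cvg (h := fun k (x : borelV R n) => \sum_(i < k) kernel_at t (F i) x)) => // x _; exact: kc.
split=> //.
have h1 : Ex mu (fun x : borelV R n => \sum_(i < k) kernel_at t (F i) x) @[k --> \oo] --> Ex mu (kernel_at t (\bigcup_k F k)).
  by apply: (Ex_cvg (P := mu) (M := 1)) => //; apply: aeW.
have h2 := Pr_cvg_bigcup (Q := mu) mF tF.
have h3 : Ex mu (fun x : borelV R n => \sum_(i < k) kernel_at t (F i) x) @[k --> \oo] --> Pr mu (\bigcup_k F k).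
  move: h2; apply: cvg_trans; apply: near_eq_cvg; apply: nearW => k /=.
  rewrite Ex_sum; last first.
    by move=> i; apply: bmeas_integrable; split; [exact: (hF i (mF i)).1|exists 1 => x; exact: kernel_bounded].
  by apply: eq_bigr => i _; rewrite (hF i (mF i)).2.
exact: (cvg_unique _ h1 h3).
Qed.

Lemma invariant_stationary : stationary P X mu.
Proof.
move=> t t0 E mE; have [mK eK] := kernel_invariant t0 mE.
rewrite /dual_semigroup (eq_integral (fun x : borelV R n => (kernel_at t E x)%:E)) => [|x _]; last first.
  rewrite /semigroup unlock /kernel_at -PrE; last exact: flow_measurable.
  have mF := flow_measurable x t0 mE.
  by have := integral_indic P measurableT mF; rewrite setIT.
rewrite ExE ?eK ?PrE //; apply: bmeas_integrable; split=> //; exists 1 => x.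
exact: kernel_bounded.
Qed.

End Stationary.

(** * Moments from the decay over annuli *)

Section Moments.
Context {R : realType} {n : nat}.
Implicit Types (x : 'cV[R]_n).

Lemma bernoulli_ineq (u : R) (k : nat) : 0 <= u -> 1 + k%:R * u <= (1 + u) ^+ k.
Proof.
move=> u0; elim: k => [|k IH]; first by rewrite mul0r addr0 expr0.
rewrite exprS -natr1; have h := ler_wpM2l (_ : 0 <= 1 + u) IH.
apply: le_trans (h _); last by lra.
have : 0 <= k%:R * (u * u) by rewrite !mulr_ge0 ?ler0n.
lra.
Qed.

(** By Bernoulli's inequality the factor [k + 1] is at most a constant times [(1 + u) ^ k], with [u]
    so small that [(1 + u) r < 1]. *)
Lemma arith_geometric_bound (r : R) : 0 <= r -> r < 1 -> exists C : R,
  forall m : nat, \sum_(k < m) k.+1%:R * r ^+ k <= C.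
Proof.
move=> r0 r1; pose u := (1 - r) / 2; have u0 : 0 < u by rewrite /u; lra.
have ur0 : 0 <= (1 + u) * r by rewrite mulr_ge0 //; lra.
have ur1 : (1 + u) * r < 1.
  have : u * r <= u * 1 by rewrite ler_pM2l // ltW.
  by rewrite /u; lra.
exists (u^-1 * (1 - (1 + u) * r)^-1) => m.
apply: (@le_trans _ _ (u^-1 * \sum_(k < m) ((1 + u) * r) ^+ k)); last first.
  by apply: ler_wpM2l; [rewrite invr_ge0 ltW|exact: geometric_bound].
rewrite mulr_sumr; apply: ler_sum => k _; rewrite exprMn mulrA; apply: ler_wpM2r; first exact: exprn_ge0.
rewrite ler_pdivlMl //; apply: le_trans (bernoulli_ineq k (ltW u0)); rewrite -natr1 /u.
have := ler0n R k; nra.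
Qed.

Lemma japanese_ge1 x : 1 <= japanese x.
Proof. by rewrite -[leLHS]sqrtr1 /japanese ler_sqrt ?lerDl ?sqr_ge0 //; have := sqr_ge0 (enorm x); lra. Qed.

Lemma japanese_le x : japanese x <= 1 + enorm x.
Proof.
have e0 := enorm_ge0 x; have p : 0 <= 1 + enorm x by lra.
rewrite -[leRHS]ger0_norm // -sqrtr_sqr ler_sqrt; last exact: sqr_ge0.
by rewrite sqrrD expr1n; lra.
Qed.

Lemma japanese_pow_continuous (q : R) : continuous (fun x => japanese x `^ q).
Proof.
have -> : (fun x => japanese x `^ q) = fun x => expR (q * ln (japanese x)).
  apply/funext => x; rewrite /powR gt_eqF //; exact: lt_le_trans ltr01 (japanese_ge1 x).
move=> x; apply: (@continuous_comp _ _ _ (fun x => q * ln (japanese x)) (@expR R)); last exact: continuous_expR.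
have j0 : 0 < japanese x by exact: lt_le_trans ltr01 (japanese_ge1 x).
have ej : enorm y @[y --> x] --> enorm x := @enorm_continuous R n x.
have e2 : 1 + enorm y ^+ 2 @[y --> x] --> 1 + enorm x ^+ 2.
  have e1 : enorm y ^+ 2 @[y --> x] --> enorm x ^+ 2 by exact: (cvgM ej ej).
  by apply: (cvgD _ e1); exact: cvg_cst.
have cj : japanese y @[y --> x] --> japanese x := cvg_comp _ _ e2 (@sqrt_continuous R _).
have cl : ln (japanese y) @[y --> x] --> ln (japanese x) := cvg_comp _ _ cj (continuous_ln j0).
exact: (cvgM (cvg_cst q) cl).
Qed.

Lemma powR_expn (a q : R) (k : nat) : 0 <= a -> (a ^+ k) `^ q = (a `^ q) ^+ k.
Proof.
move=> a0; elim: k => [|k IH]; first by rewrite !expr0 powR1.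
by rewrite !exprS powRM ?exprn_ge0 // IH.
Qed.

(** On the annulus of index [k] the weight is at most [c2 s ^ k] with [s = 4 ^ q], and the mean of
    [f k] is [O ((k + 1) / 4 ^ k)]: the series converges because [q < 1]. *)
Lemma mean_moment (Lam : ('cV[R]_n -> R) -> R) (C q : R) (k0 : nat) (f : nat -> 'cV[R]_n -> R) :
  mean_functional Lam -> (forall k, cb (f k) /\ forall x, 0 <= f k x <= 1) ->
  (forall k x, (k0 <= k)%N -> 4 ^+ k <= enorm x -> enorm x <= 4 * 4 ^+ k -> 1 <= f k x) ->
  (forall k, Lam (f k) <= C * (k.+1%:R * 4^-1 ^+ k)) -> 0 <= q -> q < 1 ->
  exists C' : R, forall M : nat, Lam (fun x => Num.min (japanese x `^ q) M%:R) <= C'.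
Proof.
move=> LamP cf hf hC q0 q1.
have C0 : 0 <= C.
  have := hC 0%N; rewrite expr0 !mulr1; apply: le_trans.
  by apply: (mean_ge0 LamP) => [|x]; [exact: (cf 0%N).1|have /andP[] := (cf 0%N).2 x].
pose s : R := 4 `^ q; have s0 : 0 <= s := powR_ge0 _ _.
have s4 : s < 4.
  have l4 : 0 < ln (4 : R) by rewrite ln_gt0 // ltr1n.
  rewrite -[ltRHS](@lnK R 4) ?posrE // /s /powR gt_eqF // ltr_expR.
  by rewrite -[ltRHS]mul1r ltr_pM2r.
have s40 : 0 <= s / 4 by rewrite divr_ge0.
have s41 : s / 4 < 1 by rewrite ltr_pdivrMr // mul1r.
have [D hD] := arith_geometric_bound s40 s41.
pose c1 : R := (2 * 4 ^+ k0) `^ q; pose c2 : R := 8 `^ q.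
have c10 : 0 <= c1 := powR_ge0 _ _; have c20 : 0 <= c2 := powR_ge0 _ _.
exists (c1 + c2 * C * D + 1) => M.
have e0 : 0 < (M.+1%:R)^-1 :> R by rewrite invr_gt0 ltr0n.
have [r hr] := mean_tight LamP e0.
pose chi x : R := Num.min 1 (Num.max 0 (enorm x - r)).
have cchi : cb chi.
  apply: (cb_bounded (a := 0) (b := 1)) => [x|x|x].
  - apply: (@continuous_min _ _ _ _ x); first exact: cst_continuous.
    apply: (@continuous_max _ _ _ _ x); first exact: cst_continuous.
    by apply: (cvgB (@enorm_continuous R n x)); exact: cvg_cst.
  - by rewrite le_min ler01 le_max lexx.
  - by rewrite ge_min lexx.
have chi01 x : 0 <= chi x <= 1 by rewrite le_min ler01 le_max lexx ge_min lexx.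
have hchi : Lam chi <= M.+1%:R^-1.
  by apply: hr => // x xr; rewrite /chi (max_idPl _) ?subr_le0 //; apply/min_idPr.
(* Finitely many annuli reach beyond [r + 1]. Further out the capped weight is at most [M], and
   tightness at level [1 / (M + 1)] keeps its contribution below [1], uniformly in [M]. *)
have [K hK] := pow2_large (r + 1).
pose S x := \sum_(k < K) c2 * s ^+ k * f k x.
have ct (k : 'I_K) : cb (fun x => c2 * s ^+ k * f k x) by apply: cbZ; exact: (cf k).1.
have cS : cb S by exact: cb_sum.
have f0 k x : 0 <= f k x by have /andP[] := (cf k).2 x.
have ck k : 0 <= c2 * s ^+ k by rewrite mulr_ge0 ?exprn_ge0.
have S0 x : 0 <= S x by apply: sumr_ge0 => k _; exact: mulr_ge0.
have cg : cb (fun x => Num.min (japanese x `^ q) M%:R).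
  apply: (cb_bounded (a := 0) (b := M%:R)) => [x|x|x].
  - by apply: (@continuous_min _ _ _ _ x); [exact: japanese_pow_continuous|exact: cst_continuous].
  - by rewrite le_min powR_ge0 ler0n.
  - by rewrite ge_min lexx orbT.
have cMchi : cb (fun x => M%:R * chi x) by exact: cbZ.
have ccS : cb (fun x => c1 + S x) by apply: cbD => //; exact: cb_cst.
have j0 x : japanese x \in Num.nneg by rewrite nnegrE (le_trans ler01) ?japanese_ge1.
have bound x : Num.min (japanese x `^ q) M%:R <= c1 + S x + M%:R * chi x.
  have /andP[h0 h1] := chi01 x; have hS := S0 x.
  have M0 : 0 <= M%:R * chi x by rewrite mulr_ge0 ?ler0n.
  case: (leP (r + 1) (enorm x)) => xr.
    have -> : chi x = 1 by rewrite /chi; apply/min_idPl; rewrite le_max; apply/orP; right; lra.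
    by rewrite ge_min; apply/orP; right; lra.
  rewrite ge_min; apply/orP; left.
  case: (leP (4 ^+ k0) (enorm x)) => xk; last first.
    suff : japanese x `^ q <= c1 by lra.
    have k1 : 1 <= (4 : R) ^+ k0 by rewrite exprn_ege1 // ler1n.
    apply: ge0_ler_powR => //; first by rewrite nnegrE mulr_ge0 ?exprn_ge0.
    by apply: (le_trans (japanese_le x)); lra.
  have [k /andP[k2 k3]] : exists k : nat, 4 ^+ k <= enorm x < 4 ^+ k.+1.
    by apply: pow4_bracket; apply: le_trans xk; rewrite exprn_ege1 // ler1n.
  have kk0 : (k0 <= k)%N by rewrite -ltnS -(@ltr_eXn2l R 4) ?ltr1n //; exact: le_lt_trans xk k3.
  have kK : (k < K)%N.
    rewrite -(@ltr_eXn2l R 4) ?ltr1n //; apply: (le_lt_trans k2); apply: (lt_le_trans xr).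
    by apply: (le_trans (hK K (leqnn K))); apply: lerXn2r; rewrite ?nnegrE //; lra.
  have fk : 1 <= f k x by apply: hf => //; rewrite -exprS ltW.
  have k1 : 1 <= (4 : R) ^+ k by rewrite exprn_ege1 // ler1n.
  have h2 : japanese x `^ q <= c2 * s ^+ k.
    have -> : c2 * s ^+ k = (8 * 4 ^+ k) `^ q.
      rewrite /c2 /s -powR_expn ?ler0n //; apply/esym; apply: powRM; first exact: ler0n.
      exact: le_trans ler01 k1.
    apply: ge0_ler_powR => //; first by rewrite nnegrE mulr_ge0 ?exprn_ge0.
    by apply: (le_trans (japanese_le x)); move: k3; rewrite exprS; lra.
  have h3 : c2 * s ^+ k <= S x.
    rewrite /S (bigD1 (Ordinal kK)) //=.
    have : 0 <= \sum_(i < K | i != Ordinal kK) c2 * s ^+ i * f i x.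
      by apply: sumr_ge0 => i _; exact: mulr_ge0.
    have : c2 * s ^+ k <= c2 * s ^+ k * f k x by rewrite ler_peMr.
    lra.
  lra.
apply: (le_trans (mean_le LamP cg (cbD ccS cMchi) bound)).
rewrite (meanD LamP) // (meanD LamP) //; last exact: cb_cst.
rewrite (mean_cst LamP) (meanZ LamP) //.
have h1 : Lam S <= c2 * C * D.
  rewrite /S (mean_sum LamP) //; apply: (@le_trans _ _ (c2 * C * \sum_(k < K) k.+1%:R * (s / 4) ^+ k)).
    rewrite mulr_sumr; apply: ler_sum => k _; rewrite (meanZ LamP); last exact: (cf k).1.
    apply: (le_trans (ler_wpM2l (ck k) (hC k))); rewrite exprMn; lra.
  by apply: ler_wpM2l => //; exact: mulr_ge0.
have h2 : M%:R * Lam chi <= 1.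
  apply: (le_trans (ler_wpM2l (ler0n R M) hchi)).
  by rewrite ler_pdivrMr ?ltr0n // mul1r ler_nat.
lra.
Qed.

(** Monotone convergence in the cap [M] treats the exponent [q]; smaller exponents, negative ones
    included, follow since [japanese x >= 1]. *)
Lemma moment_integrable (mu : probability (borelV R n) R) (C p q : R) : p <= q ->
  (forall M : nat, Ex mu (fun x => Num.min (japanese x `^ q) M%:R) <= C) ->
  mu.-integrable setT (fun x : borelV R n => (japanese x `^ p)%:E).
Proof.
move=> pq hC.
have mj (r : R) : measurable_fun setT (fun x : borelV R n => japanese x `^ r).
  exact: (continuous_borel (@japanese_pow_continuous r)).
suff iq : mu.-integrable setT (fun x : borelV R n => (japanese x `^ q)%:E).
  apply: (le_integrable measurableT _ _ iq) => [|x _].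
    by apply/measurable_EFinP; exact: mj.
  by rewrite lee_fin !ger0_norm ?powR_ge0 // ler_powR // japanese_ge1.
pose g (M : nat) (x : borelV R n) : R := Num.min (japanese x `^ q) M%:R.
have cg M : cb (g M).
  apply: (cb_bounded (a := 0) (b := M%:R)) => [x|x|x].
  - by apply: (@continuous_min _ _ _ _ x); [exact: japanese_pow_continuous|exact: cst_continuous].
  - by rewrite le_min powR_ge0 ler0n.
  - by rewrite ge_min lexx orbT.
apply/integrableP; split; first by apply/measurable_EFinP; exact: mj.
have gcv (x : borelV R n) : (g M x)%:E @[M --> \oo] --> (japanese x `^ q)%:E.
  apply: cvg_EFin; first exact: nearW.
  apply: cvg_near_cst; have [k hk] := pow2_large (japanese x `^ q).
  exists (2 ^ k)%N => // M /= kM; apply/min_idPl.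
  by apply: (le_trans (hk k (leqnn k))); rewrite -natrX ler_nat.
have mg M : measurable_fun setT (fun x : borelV R n => (g M x)%:E).
  by apply/measurable_EFinP; exact: (cb_bmeas (cg M)).1.
have g0 M (x : borelV R n) : setT x -> (0 <= (g M x)%:E)%E by move=> _; rewrite lee_fin le_min powR_ge0 ler0n.
have gnd (x : borelV R n) : setT x -> nondecreasing_seq (fun M => (g M x)%:E).
  by move=> _ M N MN; rewrite lee_fin le_min ge_min lexx /= ge_min ler_nat MN orbT.
have h := @cvg_monotone_convergence _ (borelV R n) R mu setT measurableT (fun M x => (g M x)%:E) mg g0 gnd.
have e : (\int[mu]_x `|(japanese x `^ q)%:E| = \int[mu]_x limn (fun M => (g M x)%:E))%E.
  apply: eq_integral => x _; rewrite (cvg_lim _ (gcv x)) //.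
  by rewrite gee0_abs // lee_fin powR_ge0.
rewrite e; apply: (@le_lt_trans _ _ C%:E); last exact: ltry.
rewrite -(cvg_lim _ h) //; apply: lime_le; first by apply/cvg_ex; eexists; exact: h.
by apply: nearW => M; rewrite (ExE (cb_integrable mu (cg M))) lee_fin; exact: hC.
Qed.

End Moments.

Unset Implicit Arguments.
Set Strict Implicit.
Set Printing Implicit Defensive.

Theorem theorem5p1 (R : realType) (n : nat)
  (B : {bilinear 'cV[R]_n -> 'cV[R]_n -> 'cV[R]_n}) (A sigma : 'M[R]_n)
  (d : measure_display) (T : measurableType d) (P : probability T R)
  (W : R -> T -> 'cV[R]_n) (X : 'cV[R]_n -> R -> T -> 'cV[R]_n)
  (V1 V2 : {vspace 'cV[R]_n})
  (B_energy : forall x, dotv x (B x x) = 0)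
  (A_psd : psd A)
  (W_bm : brownian_motion P W)
  (X_sol : forall x, sde_solution P B A sigma W x (X x))
  (sigma_rank : \rank sigma = n)
  (kerA : kerv A = (V1 + V2)%VS)
  (V_direct : directv (V1 + V2))
  (V_orth : (V1 <= orth V2)%VS)
  (hyp_i : forall x, x \in V1 \/ x \in V2 -> B x x = 0)
  (hyp_ii : exists2 C : R, 0 < C &
     forall V, V = V1 \/ V = V2 ->
     forall x, x \in V -> unit_sphere x ->
     exists Q J : 'M[R[i]]_n,
       jordan_decomposition (transverse_mx B V x) Q J /\
       opnorm Q + opnorm (invmx Q) <= C)
  (hyp_iii : exists2 lambda_min : R, 0 < lambda_min &
     forall V, V = V1 \/ V = V2 ->
     forall x, x \in V -> unit_sphere x ->
     exists2 lambda : R[i], eigenvalue (transverse_mx B V x) lambda &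
       lambda_min <= complex.Re lambda)
  (hyp_iv : exists2 c : R, 0 < c &
     forall v1 v2, v1 \in V1 -> v2 \in V2 ->
       orth_proj (kerv A) (B v1 v2) + orth_proj (kerv A) (B v2 v1) = 0 /\
       c * enorm v1 * enorm v2 <=
         enorm (orth_proj (orth (kerv A)) (B v1 v2)
                + orth_proj (orth (kerv A)) (B v2 v1))) :
  exists mu : probability (borelV R n) R,
    stationary P X mu /\
    forall p : R, p < 2 / 3 ->
      mu.-integrable setT (fun x : borelV R n => (japanese x `^ p)%:E).
Proof.
have sp := splitting_exists A_psd kerA V_orth hyp_i hyp_iii hyp_iv.
have su : sigma \in unitmx by rewrite -row_full_unit /row_full sigma_rank.
have [Lam [C [k0 [f [LamP Linv cf hf hC]]]]] := limit_functional W_bm X_sol B_energy su sp.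
have [mu hmu] := riesz LamP.
exists mu; split.
  apply: (invariant_stationary W_bm X_sol) => m a g cg.
  by rewrite !hmu ?Linv //; apply: (cb_Pt W_bm X_sol) => //; exact: grid_ge0.
(* The moment of order [2 / 3] is itself finite, and it dominates all smaller ones. *)
move=> p p23; have q0 : 0 <= 2 / 3 :> R by rewrite divr_ge0.
have q1 : 2 / 3 < 1 :> R by rewrite ltr_pdivrMr // mul1r ltr_nat.
have [C' hC'] := mean_moment LamP cf hf hC q0 q1.
apply: (moment_integrable (C := C') (ltW p23)) => M; rewrite hmu; first exact: hC'.
apply: (cb_bounded (a := 0) (b := M%:R)) => [x|x|x].
- by apply: (@continuous_min _ _ _ _ x); [exact: japanese_pow_continuous|exact: cst_continuous].
- by rewrite le_min powR_ge0 ler0n.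
- by rewrite ge_min lexx orbT.
Qed.
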